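(* Let $0<\alpha<1$, $x>0$, let $b:[0,T]\to\mathbb R^d$ be a deterministic, continuous, bounded function, $K\in\mathbb R^d$ with $K_i\ge0$, and $\varepsilon\in\mathbb R^d$ with $\varepsilon_i>0$. Let $(\hat\delta,\hat\gamma)$ be any pair of continuous functions $[0,T]\to\mathbb R^d$ such that for every $t\in[0,T]$ the pair $(\hat\delta_t,\hat\gamma_t)$ minimizes $\|b_t+\gamma-\delta\|^2$ over $\{(\delta,\gamma)\in\mathbb R^d\times\mathbb R^d:|\delta_i|\le\varepsilon_i,\ |\gamma_i|\le K_i,\ i=1,\dots,d\}$. Then $(\hat\delta,\hat\gamma)$ may not be unique, but the optimal terminal wealth $$\hat\xi=x\exp\Big(-\frac{\alpha}{2(1-\alpha)^2}\int_0^T\|b_r+\hat\gamma_r-\hat\delta_r\|^2dr\Big)\,(N_{0,T}^{0,b-\hat\delta})^{\frac1{\alpha-1}}\,(\Gamma_{0,T}^{0,\hat\gamma})^{\frac1{1-\alpha}}$$ is unique (it does not depend on the choice of $(\hat\delta,\hat\gamma)$). Furthermore, for $t\in[0,T]$ and $i=1,\dots,d$: (a) $\hat\delta_{it}=\varepsilon_i$ and $\hat\gamma_{it}=-K_i$ when $b_{it}>K_i+\varepsilon_i$; (b) $\hat\delta_{it}=-\varepsilon_i$ and $\hat\gamma_{it}=K_i$ when $b_{it}<-(K_i+\varepsilon_i)$; (c) $\hat\delta_{it}-\hat\gamma_{it}=b_{it}$ when $|b_{it}|\le K_i+\varepsilon_i$.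
   Context: $W$ is a standard $d$-dimensional Brownian motion on $[0,T]$; $\|\cdot\|$ is the Euclidean norm; prime denotes transpose. $N_{0,T}^{0,\nu}=\exp(-\frac12\int_0^T\|\nu_r\|^2dr-\int_0^T\nu_r'dW_r)$ and $\Gamma_{0,T}^{0,\gamma}=\exp(-\frac12\int_0^T\|\gamma_r\|^2dr+\int_0^T\gamma_r'dW_r)$. Here $\hat\xi$ is the optimal terminal wealth for the large-investor problem with wealth equation $dX_t=(b_t'\pi_t-\varepsilon'|\pi_t|)dt+\pi_t'dW_t$, $X_0=x$, $X\ge0$ (where $|\pi|$ is the vector of absolute values), maximizing $Y_0$ for the recursive utility $Y_t=\frac1\alpha X_T^\alpha-\int_t^TK'|Z_s|ds-\int_t^TZ_s'dW_s$. *)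

(* Defs.v *)
(* MathComp-Analysis *)
From HB Require Import structures.
From mathcomp Require Export all_boot all_order all_algebra.
From mathcomp Require Export all_classical all_reals all_analysis.
Export Order.TTheory GRing.Theory Num.Theory.
Export numFieldNormedType.Exports.

Set Implicit Arguments.
Unset Strict Implicit.
Unset Printing Implicit Defensive.

Local Open Scope classical_set_scope.
Local Open Scope ring_scope.

(* The library norm on row vectors is the sup norm, hence this explicit
   Euclidean structure. *)
Definition dotv (R : realType) (d : nat) (u v : 'rV[R]_d) : R :=
  \sum_(i < d) u ord0 i * v ord0 i.

Definition normsq (R : realType) (d : nat) (u : 'rV[R]_d) : R := dotv u u.

Definition absv (R : realType) (d : nat) (u : 'rV[R]_d) : 'rV[R]_d :=
  \row_(i < d) `|u ord0 i|.

Definition continuous_on (R : realType) (V : topologicalType) (T : R)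
    (f : R -> V) : Prop := {within `[0, T], continuous f}.

Definition bounded_on (R : realType) (d : nat) (T : R) (f : R -> 'rV[R]_d)
    : Prop :=
  exists M : R, forall (t : R) i, 0 <= t <= T -> `|f t ord0 i| <= M.

(* sigma(W_r : 0 <= r <= t) *)
Definition natural_filtration (R : realType) (disp : measure_display)
    (Omega : measurableType disp) (d : nat) (W : R -> Omega -> 'rV[R]_d)
    (t : R) : set (set Omega) :=
  <<s [set A | exists (r : R) i B, [/\ 0 <= r <= t, @measurable _ (measurableTypeR R) B
                               & A = [set w | B (W r w ord0 i)]]] >>.

(* Augmentation by the measurable null sets: on a complete probability space
   this is the usual one. *)
Definition filtration (R : realType) (disp : measure_display)
    (Omega : measurableType disp) (P : probability Omega R) (d : nat)
    (W : R -> Omega -> 'rV[R]_d) (t : R) : set (set Omega) :=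
  [set A | measurable A /\ exists2 B, natural_filtration W t B
                                    & P ((A `\` B) `|` (B `\` A)) = 0%E].

(* The third clause says that W_t - W_s is independent of sigma(W_r : r <= s)
   and has law N(0, (t - s) I_d); the second argument of normal_prob is the
   standard deviation. *)
Definition brownian_motion (R : realType) (disp : measure_display)
    (Omega : measurableType disp) (P : probability Omega R) (d : nat) (T : R)
    (W : R -> Omega -> 'rV[R]_d) : Prop :=
  [/\ forall (t : R) i, 0 <= t <= T ->
        measurable_fun [set: Omega] (fun w => W t w ord0 i : measurableTypeR R),
      {ae P, forall w, W 0 w = 0},
      forall s t : R, 0 <= s -> s < t -> t <= T ->
        forall A, natural_filtration W s A ->
        forall B : 'I_d -> set (measurableTypeR R), (forall i, measurable (B i)) ->
        P (A `&` [set w | forall i, B i ((W t w - W s w) ord0 i)]) =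
          (P A * \prod_(i < d) normal_prob 0 (Num.sqrt (t - s)) (B i))%E
    & {ae P, forall w, continuous_on T (W ^~ w)}].

Definition adapted (R : realType) (Omega : Type) (F : R -> set (set Omega))
    (T : R) (X : R -> Omega -> R) : Prop :=
  forall (t : R) (B : set (measurableTypeR R)), 0 <= t <= T -> measurable B ->
    F t (X t @^-1` B).

(* The restriction of H to [0, t] x Omega is B([0, t]) (x) F_t-measurable. *)
Definition progressive (R : realType) (Omega : Type)
    (F : R -> set (set Omega)) (T : R) (H : R -> Omega -> R) : Prop :=
  forall (t : R) (B : set (measurableTypeR R)), 0 <= t <= T -> measurable B ->
    <<s [set C | exists A D, [/\ @measurable _ (measurableTypeR R) A, F t D
                               & C = A `*` D]] >>
      [set u : R * Omega | 0 <= u.1 <= t /\ B (H u.1 u.2)].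

Definition continuous_paths (R : realType) (disp : measure_display)
    (Omega : measurableType disp) (P : probability Omega R) (T : R)
    (X : R -> Omega -> R) : Prop :=
  {ae P, forall w, continuous_on T (X ^~ w)}.

(* E int_0^T |H_t|^2 dt *)
Definition M2_normsq (R : realType) (disp : measure_display)
    (Omega : measurableType disp) (P : probability Omega R) (d : nat) (T : R)
    (H : R -> Omega -> 'rV[R]_d) : \bar R :=
  (\int[P]_w \int[lebesgue_measure]_(t in `[0%R, T]) (normsq (H t w))%:E)%E.

Definition M2 (R : realType) (disp : measure_display)
    (Omega : measurableType disp) (P : probability Omega R) (d : nat) (T : R)
    (W : R -> Omega -> 'rV[R]_d) (H : R -> Omega -> 'rV[R]_d) : Prop :=
  (forall i, progressive (filtration P W) T (fun t w => H t w ord0 i)) /\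
  (M2_normsq P T H < +oo)%E.

(* sum_(k < n) phi_k 1_(t_k, t_(k+1)] with phi_k bounded and F_(t_k)-measurable *)
Record simple_process (R : realType) (Omega : Type) (d : nat)
    (F : R -> set (set Omega)) (T : R) := SimpleProcess {
  sp_size : nat;
  sp_time : nat -> R;
  sp_val : nat -> Omega -> 'rV[R]_d;
  sp_time_start : sp_time 0%N = 0;
  sp_time_end : sp_time sp_size = T;
  sp_time_lt : forall k, (k < sp_size)%N -> sp_time k < sp_time k.+1;
  sp_val_measurable : forall k i (B : set (measurableTypeR R)),
    (k < sp_size)%N -> measurable B ->
    F (sp_time k) [set w | B (sp_val k w ord0 i)];
  sp_val_bounded : exists M : R, forall k w i,
    (k < sp_size)%N -> `|sp_val k w ord0 i| <= M }.

Definition sp_fun (R : realType) (Omega : Type) (d : nat)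
    (F : R -> set (set Omega)) (T : R) (S : simple_process d F T)
    (t : R) (w : Omega) : 'rV[R]_d :=
  \sum_(k < sp_size S)
    (if sp_time S k < t <= sp_time S k.+1 then sp_val S k w else 0).

Definition sp_integral (R : realType) (Omega : Type) (d : nat)
    (F : R -> set (set Omega)) (T : R) (W : R -> Omega -> 'rV[R]_d)
    (S : simple_process d F T) (t : R) (w : Omega) : R :=
  \sum_(k < sp_size S)
    dotv (sp_val S k w) (W (Num.min (sp_time S k.+1) t) w -
                         W (Num.min (sp_time S k) t) w).

(* I is (a continuous version of) the Ito integral (int_0^t H_s' dW_s)_t of
   H in M^2, i.e. the L^2 limit of the integrals of simple processes
   converging to H.  A relation, since I is only determined up to
   indistinguishability. *)
Definition ito_integral (R : realType) (disp : measure_display)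
    (Omega : measurableType disp) (P : probability Omega R) (d : nat) (T : R)
    (W : R -> Omega -> 'rV[R]_d) (H : R -> Omega -> 'rV[R]_d)
    (I : R -> Omega -> R) : Prop :=
  [/\ M2 P T W H, adapted (filtration P W) T I, continuous_paths P T I &
    exists S : nat -> simple_process d (filtration P W) T,
      M2_normsq P T (fun t w => sp_fun (S n) t w - H t w) @[n --> \oo] --> 0%E /\
      forall t : R, 0 <= t <= T ->
        (\int[P]_w ((sp_integral W (S n) t w - I t w) ^+ 2)%:E)%E
          @[n --> \oo] --> 0%E].

(* Wealth equation of the large investor. *)
Definition wealth (R : realType) (disp : measure_display)
    (Omega : measurableType disp) (P : probability Omega R) (d : nat) (T : R)
    (W : R -> Omega -> 'rV[R]_d) (b : R -> 'rV[R]_d) (eps : 'rV[R]_d) (x : R)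
    (pi_ : R -> Omega -> 'rV[R]_d) (X : R -> Omega -> R) : Prop :=
  [/\ adapted (filtration P W) T X, continuous_paths P T X &
    exists2 I, ito_integral P T W pi_ I &
      {ae P, forall w, forall t : R, 0 <= t <= T ->
        X t w = x + \int[lebesgue_measure]_(s in `[0, t])
                      (dotv (b s) (pi_ s w) - dotv eps (absv (pi_ s w)))
                + I t w}].

Definition admissible (R : realType) (disp : measure_display)
    (Omega : measurableType disp) (P : probability Omega R) (d : nat) (T : R)
    (W : R -> Omega -> 'rV[R]_d) (b : R -> 'rV[R]_d) (eps : 'rV[R]_d) (x : R)
    (pi_ : R -> Omega -> 'rV[R]_d) (X : R -> Omega -> R) : Prop :=
  wealth P T W b eps x pi_ X /\
  {ae P, forall w, forall t : R, 0 <= t <= T -> 0 <= X t w}.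

(* (Y, Z) solves the BSDE defining the recursive utility of the terminal
   wealth xi. *)
Definition recursive_utility (R : realType) (disp : measure_display)
    (Omega : measurableType disp) (P : probability Omega R) (d : nat) (T : R)
    (W : R -> Omega -> 'rV[R]_d) (K : 'rV[R]_d) (alpha : R) (xi : Omega -> R)
    (Y : R -> Omega -> R) (Z : R -> Omega -> 'rV[R]_d) : Prop :=
  [/\ adapted (filtration P W) T Y, continuous_paths P T Y &
    exists2 I, ito_integral P T W Z I &
      {ae P, forall w, forall t : R, 0 <= t <= T ->
        Y t w = alpha^-1 * xi w `^ alpha
                - \int[lebesgue_measure]_(s in `[t, T]) dotv K (absv (Z s w))
                - (I T w - I t w)}].

Definition optimal_terminal_wealth (R : realType) (disp : measure_display)
    (Omega : measurableType disp) (P : probability Omega R) (d : nat) (T : R)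
    (W : R -> Omega -> 'rV[R]_d) (b : R -> 'rV[R]_d) (eps K : 'rV[R]_d)
    (alpha x : R) (xi : Omega -> R) : Prop :=
  exists pi_ X Y Z,
    [/\ admissible P T W b eps x pi_ X,
        {ae P, forall w, xi w = X T w},
        recursive_utility P T W K alpha (X T) Y Z &
        forall pi' X' Y' Z',
          admissible P T W b eps x pi' X' ->
          recursive_utility P T W K alpha (X' T) Y' Z' ->
          {ae P, forall w, Y' 0 w <= Y 0 w}].

(* N is (a version of) N_{0,T}^{0,nu} *)
Definition N_version (R : realType) (disp : measure_display)
    (Omega : measurableType disp) (P : probability Omega R) (d : nat) (T : R)
    (W : R -> Omega -> 'rV[R]_d) (nu : R -> 'rV[R]_d) (N : Omega -> R) : Prop :=
  exists2 I, ito_integral P T W (fun t _ => nu t) I &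
    {ae P, forall w,
      N w = expR (- (2^-1 * \int[lebesgue_measure]_(r in `[0, T]) normsq (nu r))
                  - I T w)}.

(* G is (a version of) Gamma_{0,T}^{0,gamma} *)
Definition Gamma_version (R : realType) (disp : measure_display)
    (Omega : measurableType disp) (P : probability Omega R) (d : nat) (T : R)
    (W : R -> Omega -> 'rV[R]_d) (gamma : R -> 'rV[R]_d) (G : Omega -> R)
    : Prop :=
  exists2 I, ito_integral P T W (fun t _ => gamma t) I &
    {ae P, forall w,
      G w = expR (- (2^-1 * \int[lebesgue_measure]_(r in `[0, T]) normsq (gamma r))
                  + I T w)}.

Definition feasible (R : realType) (d : nat) (eps K : 'rV[R]_d)
    (delta gamma : 'rV[R]_d) : Prop :=
  forall i, `|delta ord0 i| <= eps ord0 i /\ `|gamma ord0 i| <= K ord0 i.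

Definition minimizer (R : realType) (d : nat) (T : R) (b : R -> 'rV[R]_d)
    (eps K : 'rV[R]_d) (delta gamma : R -> 'rV[R]_d) : Prop :=
  [/\ continuous_on T delta, continuous_on T gamma &
    forall t : R, 0 <= t <= T ->
      feasible eps K (delta t) (gamma t) /\
      forall delta' gamma', feasible eps K delta' gamma' ->
        normsq (b t + gamma t - delta t) <= normsq (b t + gamma' - delta')].

(* xi is given by the explicit formula built on (delta, gamma) *)
Definition wealth_formula (R : realType) (disp : measure_display)
    (Omega : measurableType disp) (P : probability Omega R) (d : nat) (T : R)
    (W : R -> Omega -> 'rV[R]_d) (b : R -> 'rV[R]_d) (alpha x : R)
    (delta gamma : R -> 'rV[R]_d) (xi : Omega -> R) : Prop :=
  exists N G,
    [/\ N_version P T W (fun t => b t - delta t) N,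
        Gamma_version P T W gamma G &
        {ae P, forall w,
          xi w = x * expR (- (alpha / (2 * (1 - alpha) ^+ 2) *
                              \int[lebesgue_measure]_(r in `[0, T])
                                normsq (b r + gamma r - delta r)))
                   * N w `^ (alpha - 1)^-1 * G w `^ (1 - alpha)^-1}].

Definition market_data (R : realType) (d : nat) (T : R) (b : R -> 'rV[R]_d)
    (eps K : 'rV[R]_d) : Prop :=
  [/\ continuous_on T b, bounded_on T b,
      forall i, 0 <= K ord0 i & forall i, 0 < eps ord0 i].

(* Main.v *)
(* Write theta = b + gamma - delta for a minimizer.  Componentwise minimization
   over the box gives delta'theta = eps'|theta| and gamma'theta = -K'|theta|,
   which turns the explicit exponentials
     X_t = x exp(...) with volatility theta / (1 - alpha),
     Y_t = c exp(...) with volatility alpha theta / (1 - alpha)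
   into a solution of the wealth equation and of the utility BSDE.
   Optimality is by duality.  Against N = N^{0,b-delta} every admissible wealth
   has E[N X_T] <= x, as delta'pi <= eps'|pi|; against G = Gamma^{0,gamma} every
   recursive utility satisfies Y_0 <= E[G X_T^alpha / alpha], as
   gamma'z >= -K'|z| and sigma(W_0) is trivial.  The candidate terminal wealth
   Xi satisfies G Xi^(alpha - 1) = kappa N and E[N Xi] = x, so the tangent line
   of the concave power at Xi bounds E[G X_T^alpha / alpha] by c, with equality
   only for X_T = Xi.  In particular Xi is characterized by optimality, which
   does not mention the minimizer.

   The two expectations are computed by showing E[M_T I_T] = E int M sigma'H
   for I the Ito integral of H and M the exponential martingale of a
   deterministic continuous sigma.  The underlying facts on Wiener integrals all
   come from one identity, the joint exponential moments
   E[f exp(lam (I_t - I_s) + c'(W_t - W_s))] for f measurable at time s. *)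

Require Import Defs.
From mathcomp Require Import lra ring measurable_realfun.

Set Implicit Arguments.
Unset Strict Implicit.
Unset Printing Implicit Defensive.

Local Open Scope classical_set_scope.
Local Open Scope ring_scope.

(** * Integration of real functions *)

(** Ito integrals are given only as L2 limits: one that is claimed must be exhibited with its
    approximating simple processes, and one that is given can be used only through them. Two devices
    replace Ito's formula. For given integrals, the squared distance between a simple integral and
    [k] times a reference variable J is computed for every [k]; comparing k = 1 with k = -1 yields
    the pairing with J, which passes to L2 limits. For claimed ones, the candidates have the form
    D_t M_t with D deterministic and M an exponential martingale; a discrete product rule leaves an
    L2 error of order h^(3/2) on each cell of width h, which still vanishes after summation over the
    cells. The normal law enters the computations only through its exponential moments. Convexity
    inequalities for exp squeeze the first and second moments out of them, so nothing is
    differentiated under an integral. The initial utility is a random variable measurable at time 0;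
    bounding it by a constant from an inequality between expectations is where the triviality of the
    initial sigma-algebra enters. *)

Section real_integrals.
Context d (T : measurableType d) (R : realType).
Implicit Types mu : {measure set T -> \bar R}.
Implicit Types (f g : T -> R) (M k c C : R).

Definition L1 mu f : Prop := mu.-integrable setT (EFin \o f).

Definition L2 mu f : Prop :=
  measurable_fun [set: T] f /\ L1 mu (fun x => f x ^+ 2).

Lemma L1_meas mu f : L1 mu f -> measurable_fun [set: T] f.
Proof. by move=> /(measurable_int mu) /measurable_EFinP. Qed.

Lemma L1_le mu f g : measurable_fun [set: T] f -> (forall x, `|f x| <= g x) ->
  L1 mu g -> L1 mu f.
Proof.
move=> mf fg ig; apply: (le_integrable measurableT _ _ ig).
  exact/measurable_EFinP.
move=> x _ /=; rewrite lee_fin (le_trans (fg x))// ler_norm//.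
Qed.

Lemma L1_norm mu f : L1 mu f -> L1 mu (fun x => `|f x|).
Proof.
move=> h; apply: (le_integrable measurableT _ _ h).
  by apply/measurable_EFinP; apply: measurableT_comp => //; exact: L1_meas h.
by move=> x _ /=; rewrite normr_id.
Qed.

Lemma L1D mu f g : L1 mu f -> L1 mu g -> L1 mu (fun x => f x + g x).
Proof.
move=> h1 h2; have := integrableD measurableT h1 h2.
by apply: eq_integrable => // x _.
Qed.

Lemma L1Z mu k f : L1 mu f -> L1 mu (fun x => k * f x).
Proof. by move=> h; have := integrableZl measurableT k h; apply: eq_integrable. Qed.

Lemma L1B mu f g : L1 mu f -> L1 mu g -> L1 mu (fun x => f x - g x).
Proof.
move=> h1 h2; have := integrableB measurableT h1 h2.
by apply: eq_integrable => // x _.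
Qed.

Lemma L1_eq mu f g : f =1 g -> L1 mu f -> L1 mu g.
Proof. by move=> /funext ->. Qed.

Lemma L1_0 mu : L1 mu (fun=> 0).
Proof. exact: integrable0. Qed.

Lemma L1_sum mu (I : Type) (s : seq I) (h : I -> T -> R) :
  (forall i, L1 mu (h i)) -> L1 mu (fun x => \sum_(i <- s) h i x).
Proof.
move=> H; elim: s => [|i s IH].
  by apply: L1_eq (L1_0 mu) => x; rewrite big_nil.
by apply: L1_eq (L1D (H i) IH) => x; rewrite big_cons.
Qed.

Lemma E_EFin mu f : L1 mu f -> (\int[mu]_x (f x)%:E)%E = (\int[mu]_x f x)%:E.
Proof. by move=> h; rewrite /Rintegral fineK//; exact: integrable_fin_num. Qed.

(** Turns a computation in the extended reals, as delivered by independence or monotone convergence,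
    into integrability plus a real expectation. *)
Lemma L1_fin mu f c : measurable_fun [set: T] f -> (forall x, 0 <= f x) ->
  (\int[mu]_x (f x)%:E)%E = c%:E -> L1 mu f /\ \int[mu]_x f x = c.
Proof.
move=> mf f0 h; split; last by rewrite /Rintegral h.
apply/integrableP; split; first exact/measurable_EFinP.
under eq_integral do rewrite /= ger0_norm//.
by rewrite h ltry.
Qed.

Lemma L1_lty mu f : measurable_fun [set: T] f -> (forall x, 0 <= f x) ->
  (\int[mu]_x (f x)%:E < +oo)%E -> L1 mu f.
Proof.
move=> mf f0 h; apply/integrableP; split; first exact/measurable_EFinP.
by under eq_integral do rewrite /= ger0_norm//.
Qed.

Lemma Eeq mu f g : (forall x, f x = g x) -> \int[mu]_x f x = \int[mu]_x g x.
Proof. by move=> /funext ->. Qed.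

Lemma ED mu f g : L1 mu f -> L1 mu g ->
  \int[mu]_x (f x + g x) = \int[mu]_x f x + \int[mu]_x g x.
Proof. by move=> *; rewrite RintegralD. Qed.

Lemma EB mu f g : L1 mu f -> L1 mu g ->
  \int[mu]_x (f x - g x) = \int[mu]_x f x - \int[mu]_x g x.
Proof. by move=> *; rewrite RintegralB. Qed.

Lemma EZ mu k f : L1 mu f -> \int[mu]_x (k * f x) = k * \int[mu]_x f x.
Proof. by move=> *; rewrite RintegralZl. Qed.

Lemma E0 mu : \int[mu]_x (0 : R) = 0.
Proof. by rewrite Rintegral_cst// mul0r. Qed.

Lemma Esum mu (I : Type) (s : seq I) (h : I -> T -> R) :
  (forall i, L1 mu (h i)) ->
  \int[mu]_x (\sum_(i <- s) h i x) = \sum_(i <- s) \int[mu]_x h i x.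
Proof.
move=> H; elim: s => [|i s IH].
  by under eq_Rintegral do rewrite big_nil; rewrite E0 big_nil.
under eq_Rintegral do rewrite big_cons.
by rewrite ED//; [rewrite IH big_cons|exact: L1_sum].
Qed.

Lemma Ele mu f g : L1 mu f -> L1 mu g -> (forall x, f x <= g x) ->
  \int[mu]_x f x <= \int[mu]_x g x.
Proof. by move=> *; apply: le_Rintegral. Qed.

Lemma Ege0 mu f : (forall x, 0 <= f x) -> 0 <= \int[mu]_x f x.
Proof. by move=> *; apply: Rintegral_ge0. Qed.

(** Negation moves the claim to a nonnegative integrand, where [fine] is nonnegative even if the
    integral is infinite. *)
Lemma Ele0 mu f : (forall x, f x <= 0) -> \int[mu]_x f x <= 0.
Proof.
move=> f0; have h : (\int[mu]_x (f x)%:E = - \int[mu]_x (- f x)%:E)%E.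
  rewrite -integral_ge0N; last by move=> x _; rewrite lee_fin oppr_ge0.
  by apply: eq_integral => x _; rewrite EFinN oppeK.
by rewrite /Rintegral h fineN oppr_le0; apply: Ege0 => x; rewrite oppr_ge0.
Qed.

Lemma Eabs mu f : L1 mu f -> `|\int[mu]_x f x| <= \int[mu]_x `|f x|.
Proof. by move=> *; apply: le_normr_Rintegral. Qed.

Lemma Eeq_ae mu f g : measurable_fun [set: T] f -> measurable_fun [set: T] g ->
  {ae mu, forall x, f x = g x} -> \int[mu]_x f x = \int[mu]_x g x.
Proof.
move=> mf mg h; rewrite /Rintegral; congr fine; apply: ae_eq_integral => //.
- exact/measurable_EFinP.
- exact/measurable_EFinP.
- by apply: filterS h => x -> _.
Qed.

Lemma L1_ae mu f g : measurable_fun [set: T] g ->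
  {ae mu, forall x, f x = g x} -> L1 mu f -> L1 mu g.
Proof.
move=> mg h hf; have mf := L1_meas hf.
move/integrableP: hf => [_ hf]; apply/integrableP; split.
  exact/measurable_EFinP.
apply: le_lt_trans hf; rewrite le_eqVlt; apply/orP; left; apply/eqP.
apply: ae_eq_integral => //.
- by do 2 apply: measurableT_comp => //.
- by do 2 apply: measurableT_comp => //.
- by apply: filterS h => x /= -> _.
Qed.

Lemma E0_ae mu f : (forall x, 0 <= f x) -> L1 mu f -> \int[mu]_x f x <= 0 ->
  {ae mu, forall x, f x = 0}.
Proof.
move=> f0 hf h0.
have e0 : \int[mu]_x f x = 0 by apply/eqP; rewrite eq_le h0 Ege0.
have mf := L1_meas hf.
have : ae_eq mu setT (EFin \o f) (cst 0%E).
  apply: (ae_eq_integral_abs mu measurableT _).1; first exact/measurable_EFinP.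
  rewrite (eq_integral (fun x => (f x)%:E)); first by rewrite E_EFin// e0.
  by move=> x _ /=; rewrite ger0_norm.
by apply: filterS => x /(_ I) /= [].
Qed.

Lemma sqr_mul_le (x y : R) : `|x * y| <= x ^+ 2 + y ^+ 2.
Proof. have := sqr_ge0 (x - y); have := sqr_ge0 (x + y).
by rewrite ler_norml !expr2 => *; apply/andP; split; nra. Qed.

Lemma sqrD_le (x y : R) : (x + y) ^+ 2 <= 2 * x ^+ 2 + 2 * y ^+ 2.
Proof. have := sqr_ge0 (x - y); rewrite !expr2; nra. Qed.

Lemma L2M mu f g : L2 mu f -> L2 mu g -> L1 mu (fun x => f x * g x).
Proof.
move=> [mf f2] [mg g2]; apply: L1_le (L1D f2 g2) => [|x].
  exact: measurable_funM.
exact: sqr_mul_le.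
Qed.

Lemma L2D mu f g : L2 mu f -> L2 mu g -> L2 mu (fun x => f x + g x).
Proof.
move=> [mf f2] [mg g2]; split; first exact: measurable_funD.
apply: L1_le (L1D (L1Z 2 f2) (L1Z 2 g2)) => [|x].
  by apply: measurable_funX; exact: measurable_funD.
by rewrite ger0_norm ?sqr_ge0 ?sqrD_le.
Qed.

Lemma L2Z mu k f : L2 mu f -> L2 mu (fun x => k * f x).
Proof.
move=> [mf f2]; split; first exact: measurable_funM.
by apply: L1_eq (L1Z (k ^+ 2) f2) => x; rewrite exprMn.
Qed.

Lemma L2_eq mu f g : f =1 g -> L2 mu f -> L2 mu g.
Proof. by move=> /funext ->. Qed.

Lemma L2B mu f g : L2 mu f -> L2 mu g -> L2 mu (fun x => f x - g x).
Proof.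
move=> hf hg; apply: L2_eq (L2D hf (L2Z (-1) hg)) => x; by rewrite mulN1r.
Qed.

Lemma L2_0 mu : L2 mu (fun=> 0).
Proof.
split; first exact: measurable_cst.
by apply: L1_eq (L1_0 mu) => x; rewrite expr0n.
Qed.

Lemma L2_sum mu (I : Type) (s : seq I) (h : I -> T -> R) :
  (forall i, L2 mu (h i)) -> L2 mu (fun x => \sum_(i <- s) h i x).
Proof.
move=> H; elim: s => [|i s IH].
  by apply: L2_eq (L2_0 mu) => x; rewrite big_nil.
by apply: L2_eq (L2D (H i) IH) => x; rewrite big_cons.
Qed.

Lemma L2_bound mu f g M : measurable_fun [set: T] f ->
  (forall x, `|f x| <= M) -> L2 mu g -> L2 mu (fun x => f x * g x).
Proof.
move=> mf fM [mg g2]; split; first exact: measurable_funM.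
apply: L1_le (L1Z (M ^+ 2) g2) => [|x].
  by apply: measurable_funX; exact: measurable_funM.
rewrite ger0_norm ?sqr_ge0// exprMn ler_wpM2r ?sqr_ge0//.
by rewrite -[f x ^+ 2]real_normK ?num_real// ler_sqr ?nnegrE// (le_trans _ (fM x)).
Qed.

Lemma L1_bound mu f g M : measurable_fun [set: T] f ->
  (forall x, `|f x| <= M) -> L1 mu g -> L1 mu (fun x => f x * g x).
Proof.
move=> mf fM g1; have mg := L1_meas g1.
apply: L1_le (L1Z M (L1_norm g1)) => [|x].
  exact: measurable_funM.
by rewrite normrM ler_wpM2r.
Qed.

End real_integrals.

(** * Limits of real sequences *)

Section real_sequences.
Variable R : realType.
Implicit Types (u v : nat -> R) (a b c : R).

Lemma seqD u v a b : u n @[n --> \oo] --> a -> v n @[n --> \oo] --> b ->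
  u n + v n @[n --> \oo] --> a + b.
Proof. exact: cvgD. Qed.

Lemma seqB u v a b : u n @[n --> \oo] --> a -> v n @[n --> \oo] --> b ->
  u n - v n @[n --> \oo] --> a - b.
Proof. exact: cvgB. Qed.

Lemma seqM u v a b : u n @[n --> \oo] --> a -> v n @[n --> \oo] --> b ->
  u n * v n @[n --> \oo] --> a * b.
Proof. exact: cvgM. Qed.

Lemma seqZ u k a : u n @[n --> \oo] --> a -> k * u n @[n --> \oo] --> k * a.
Proof. by move=> h; apply: seqM => //; exact: cvg_cst. Qed.

Lemma seq_eq u v a : (forall n, u n = v n) -> u n @[n --> \oo] --> a ->
  v n @[n --> \oo] --> a.
Proof. by move=> /funext ->. Qed.

Lemma seq_le u v a b : (forall n, u n <= v n) -> u n @[n --> \oo] --> a ->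
  v n @[n --> \oo] --> b -> a <= b.
Proof.
move=> uv ua vb; have /(_ _) := @ler_cvg_to _ _ _ _ u v a b ua vb; apply.
exact: nearW.
Qed.

Lemma seq_leC u a c : (forall n, u n <= c) -> u n @[n --> \oo] --> a -> a <= c.
Proof. by move=> uc ua; apply: seq_le ua (cvg_cst c). Qed.

Lemma seq_geC u a c : (forall n, c <= u n) -> u n @[n --> \oo] --> a -> c <= a.
Proof. by move=> uc ua; apply: seq_le (cvg_cst c) ua. Qed.

Lemma seq_squeeze0 u v : (forall n, 0 <= u n <= v n) -> v n @[n --> \oo] --> (0 : R) ->
  u n @[n --> \oo] --> (0 : R).
Proof.
move=> uv v0; apply: (@squeeze_cvgr _ _ _ _ (fun=> 0) v) => //; last exact: cvg_cst.
exact: nearW.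
Qed.

End real_sequences.

(** * Square-integrable functions and convergence of expectations *)

Section finite_measures.
Context d (T : measurableType d) (R : realType).
Variable mu : {finite_measure set T -> \bar R}.
Implicit Types (f g : T -> R) (M k c C : R).

Lemma L1_cst k : L1 mu (fun=> k).
Proof. exact: finite_measure_integrable_cst. Qed.

Lemma L1_bounded f M : measurable_fun [set: T] f -> (forall x, `|f x| <= M) ->
  L1 mu f.
Proof. by move=> mf fM; apply: L1_le (L1_cst M). Qed.

Lemma L2_bounded f M : measurable_fun [set: T] f -> (forall x, `|f x| <= M) ->
  L2 mu f.
Proof.
move=> mf fM; split => //; apply: (@L1_bounded _ (M ^+ 2)) => [|x].
  exact: measurable_funX.
by rewrite normrX ler_sqr ?nnegrE// (le_trans _ (fM x)).
Qed.

Lemma L2_L1 f : L2 mu f -> L1 mu f.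
Proof.
move=> [mf f2]; apply: L1_le (L1D (L1_cst 1) f2) => // x.
rewrite ler_norml; apply/andP; split; nra.
Qed.

(* Truncating at level [c] changes the integrals by at most [C / c]. *)
Lemma vitali (U_ : nat -> T -> R) (U : T -> R) (C : R) :
  (forall n, measurable_fun [set: T] (U_ n)) -> measurable_fun [set: T] U ->
  (forall n x, 0 <= U_ n x) -> (forall x, 0 <= U x) ->
  {ae mu, forall x, U_ n x @[n --> \oo] --> U x} ->
  (forall n, L1 mu (fun x => U_ n x ^+ 2)) ->
  (forall n, \int[mu]_x (U_ n x ^+ 2) <= C) ->
  [/\ L1 mu (fun x => U x ^+ 2), L1 mu U &
    \int[mu]_x U_ n x @[n --> \oo] --> \int[mu]_x U x].
Proof.
move=> mU_ mU U_0 U0 cU L2U_ UC.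
(* Fatou's lemma carries the uniform second-moment bound over to the limit. *)
have U2 : (\int[mu]_x (U x ^+ 2)%:E <= C%:E)%E.
  have mU2 n : measurable_fun [set: T] (fun x => (U_ n x ^+ 2)%:E).
    by apply/measurable_EFinP; exact: measurable_funX.
  have := @fatou _ _ _ mu setT measurableT _ mU2 _.
  move=> /(_ (fun n x _ => _)) H.
  have {H} : (\int[mu]_x limn_einf (fun n => (U_ n x ^+ 2)%:E)
     <= limn_einf (fun n => \int[mu]_x (U_ n x ^+ 2)%:E))%E.
    by apply: H => n x; rewrite lee_fin sqr_ge0.
  have -> : (\int[mu]_x limn_einf (fun n => (U_ n x ^+ 2)%:E) =
             \int[mu]_x (U x ^+ 2)%:E)%E.
    apply: ae_eq_integral => //.
    - apply: (emeasurable_fun_cvg (fun n x => einfs (fun m => (U_ m x ^+ 2)%:E) n)).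
        exact: measurable_fun_einfs.
      by move=> x _; rewrite limn_einf_lim; exact: is_cvg_einfs.
    - by apply/measurable_EFinP; exact: measurable_funX.
    - apply: filterS cU => x cx _.
      have : (U_ n x ^+ 2)%:E @[n --> \oo] --> (U x ^+ 2)%:E.
        by apply: cvg_EFin; [exact: nearW|exact: (cvgM cx cx)].
      move=> h; rewrite is_cvg_limn_einfE; [exact/cvg_lim|].
      by apply/cvg_ex; eexists; exact: h.
  move=> /le_trans; apply.
  rewrite limn_einf_lim; apply: lime_le.
    exact: is_cvg_einfs.
  apply: nearW => n; apply: (@le_trans _ _ (\int[mu]_x (U_ n x ^+ 2)%:E)%E).
    by apply: ereal_inf_lbound; exists n => //=.
  by rewrite E_EFin// lee_fin.
have L2U : L2 mu U.
  split => //; apply: L1_lty => [|x|].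
  - exact: measurable_funX.
  - exact: sqr_ge0.
  - by rewrite (le_lt_trans U2)// ltry.
have L1U := L2_L1 L2U.
have L1U_ n : L1 mu (U_ n) by apply: L2_L1; split.
split => //; first by case: L2U.
have EU2 : \int[mu]_x (U x ^+ 2) <= C.
  by have := U2; rewrite (E_EFin L2U.2) lee_fin.
have C0 : 0 <= C by apply: le_trans EU2; apply: Ege0 => x; exact: sqr_ge0.
pose V_ c n x := Num.min (U_ n x) c : R.
pose V c x := Num.min (U x) c : R.
have mmin c f : measurable_fun [set: T] f -> measurable_fun [set: T] (fun x => Num.min (f x) c).
  by move=> mf; apply: measurable_minr => //; exact: measurable_cst.
(* Above the level [c] the discarded part is at most [y], and there [y <= y ^+ 2 / c]. *)
have vb c (y : R) : 0 < c -> 0 <= y -> 0 <= y - Num.min y c <= y ^+ 2 / c.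
  move=> c0 y0; have [yc|cy] := leP y c.
    by rewrite subrr lexx divr_ge0 ?sqr_ge0 ?(ltW c0).
  rewrite subr_ge0 (ltW cy)/= ler_pdivlMr//; nra.
have L1m c f : 0 < c -> measurable_fun [set: T] f -> (forall x, 0 <= f x) ->
    L1 mu (fun x => Num.min (f x) c).
  move=> c0 mf f0; apply: (@L1_bounded _ c) => [|x]; first exact: mmin.
  rewrite ger0_norm ?le_min ?f0 ?(ltW c0)//.
  by rewrite ge_min lexx orbT.
have key c f : 0 < c -> measurable_fun [set: T] f -> (forall x, 0 <= f x) ->
   L1 mu f -> L1 mu (fun x => f x ^+ 2) -> \int[mu]_x (f x ^+ 2) <= C ->
   `|\int[mu]_x f x - \int[mu]_x Num.min (f x) c| <= C / c.
  move=> c0 mf f0 f1 f2 fC; rewrite -EB ?L1m//; last exact: L1m.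
  rewrite ger0_norm; last by apply: Ege0 => x; case/andP: (vb c (f x) c0 (f0 x)).
  apply: (@le_trans _ _ (\int[mu]_x (c^-1 * f x ^+ 2))).
    apply: Ele => [||x].
    - by apply: L1B => //; exact: L1m.
    - exact: L1Z.
    - by rewrite mulrC; case/andP: (vb c (f x) c0 (f0 x)).
  by rewrite EZ// mulrC ler_wpM2r// invr_ge0 ltW.
apply/cvgrPdist_le => e e0.
(* Makes each of the two truncation errors at most [e / 3]; [C + 1] keeps the level positive when
   [C = 0]. *)
pose c := 3 * (C + 1) / e.
have c0 : 0 < c by rewrite /c divr_gt0// mulr_gt0//; lra.
have Cc : C / c <= e / 3.
  rewrite /c invf_div mulrA ler_pdivrMr; last by lra.
  rewrite mulrAC -mulrA [in leRHS]mulrC; nra.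
have : \int[mu]_x V_ c n x @[n --> \oo] --> \int[mu]_x V c x.
  have := @dominated_convergence _ _ _ mu setT measurableT
    (fun n x => (V_ c n x)%:E) (fun x => (V c x)%:E) (fun=> c%:E).
  case.
  - by move=> n; apply/measurable_EFinP; exact: mmin.
  - by apply/measurable_EFinP; exact: mmin.
  - apply: filterS cU => x cx _; apply: cvg_EFin; first exact: nearW.
    rewrite /V_ /V minr_absE.
    under eq_fun do rewrite minr_absE.
    apply: cvgMr_tmp; apply: cvgB; first by apply: cvgD => //; exact: cvg_cst.
    by apply: cvg_norm; apply: cvgB => //; exact: cvg_cst.
  - exact: L1_cst.
  - apply: nearW => x n _; rewrite lee_fin ger0_norm.
      by rewrite ge_min lexx orbT.
    by rewrite le_min U_0 ltW.
  move=> _ _ H.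
  have Vc1 : L1 mu (V c) by exact: L1m.
  by move: H; rewrite (E_EFin Vc1) => /fine_cvg.
move/cvgrPdist_le => /(_ (e / 3)) /(_ ltac:(lra)).
apply: filterS => n hn.
have h1 := key c _ c0 mU U0 L1U L2U.2 EU2.
have h2 := key c _ c0 (mU_ n) (U_0 n) (L1U_ n) (L2U_ n) (UC n).
rewrite -/(V c) -/(V_ c n) in h1 h2.
move: h1 h2 hn; rewrite !ler_norml.
move: (\int[mu]_x U x) (\int[mu]_x U_ n x) (Rintegral _ _ _) (Rintegral _ _ _).
move=> a b k l; lra.
Qed.

End finite_measures.

(** * Gaussian moments and independence *)

Section expR_bounds.
Variable R : realType.
Implicit Types x y a p q c : R.

Lemma ndecr_ge0 (f f' : R -> R) y : (forall x, is_derive x 1 f (f' x)) ->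
  (forall x, 0 <= x -> 0 <= f' x) -> 0 <= y -> f 0 <= f y.
Proof.
move=> df f'0 y0.
have cf : {within `[0, y], continuous f}.
  apply: derivable_within_continuous => x _.
  exact: (@ex_derive _ _ _ _ _ _ _ (df x)).
have d1 x : x \in `]0, y[ -> derivable f x 1.
  by move=> _; exact: (@ex_derive _ _ _ _ _ _ _ (df x)).
have d2 x : x \in `]0, y[ -> 0 <= f^`()%classic x.
  rewrite in_itv/= => /andP[x0 _]; rewrite derive1E (@derive_val _ _ _ _ _ _ _ (df x)).
  exact: f'0 (ltW x0).
have := ger0_derive1_le_cc d1 d2 cf; apply => //; rewrite in_itv/= ?lexx ?y0//.
Qed.

Lemma sinh_ge y : 0 <= y -> 2 * y <= expR y - expR (- y).
Proof.
move=> y0; rewrite -subr_ge0.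
pose f x := expR x - expR (- x) - 2 * x : R.
have df x : is_derive x 1 f (expR x + expR (- x) - 2).
  rewrite /f; apply: is_derive_eq; rewrite /GRing.scale/=; ring.
have := ndecr_ge0 df _ y0; rewrite /f oppr0 expR0 !mulr0 !subr0 subrr.
apply=> x x0; have := expR_ge1Dx x; have := expR_ge1Dx (- x).
have := expRxMexpNx_1 x; have := expR_gt0 x; have := expR_gt0 (- x); nra.
Qed.

Lemma sinh_le y : 0 <= y -> expR y - expR (- y) <= y * (expR y + expR (- y)).
Proof.
move=> y0; rewrite -subr_ge0.
pose f x := x * (expR x + expR (- x)) - (expR x - expR (- x)) : R.
have df x : is_derive x 1 f (x * (expR x - expR (- x))).
  rewrite /f; apply: is_derive_eq; rewrite /GRing.scale/=; ring.
have := ndecr_ge0 df _ y0; rewrite /f oppr0 expR0 !mul0r !subrr.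
by apply=> x x0; rewrite mulr_ge0// (le_trans _ (sinh_ge x0))// mulr_ge0.
Qed.

(** The right side is the square of 2 sinh(x / 2). It dominates the square by exponentials, which
    gives both integrability and the upper bound of a second moment. *)
Lemma sqr_le_expR x : x ^+ 2 <= expR x + expR (- x) - 2.
Proof.
wlog x0 : x / 0 <= x => [hw|].
  have [/hw//|/ltW x0] := leP 0 x.
  by have := hw (- x); rewrite sqrrN opprK [expR (- x) + _]addrC; apply; rewrite oppr_ge0.
have y0 : 0 <= x / 2 by rewrite divr_ge0.
have := sinh_ge y0; set e := expR (x / 2); set e' := expR (- (x / 2)) => h.
have -> : expR x = e ^+ 2 by rewrite /e -expRM_natl; congr expR; lra.
have -> : expR (- x) = e' ^+ 2 by rewrite /e' -expRM_natl; congr expR; lra.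
have ee' : e * e' = 1 by exact: expRxMexpNx_1.
rewrite !expr2 in h *; nra.
Qed.

(** With H(x) = e^x + e^-x - 2 the left side is 4 H(x) - H(2x) / 2. It agrees with 2 x^2 to second
    order, and its fourth-order term is negative, so it is a minorant of the square made of
    exponentials. *)
Lemma expR_le_sqr x :
  4 * (expR x + expR (- x)) - 7 - (expR (2 * x) + expR (- (2 * x))) / 2 + 0 <= 2 * x ^+ 2 - 0.
Proof.
wlog x0 : x / 0 <= x => [hw|].
  have [/hw//|/ltW x0] := leP 0 x.
  have := hw (- x); rewrite sqrrN opprK mulrN opprK [expR (- x) + _]addrC.
  by rewrite [expR (- (2 * x)) + _]addrC; apply; rewrite oppr_ge0.
have y0 : 0 <= x / 2 by rewrite divr_ge0.
have := sinh_le y0; have := sinh_ge y0.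
set e := expR (x / 2); set e' := expR (- (x / 2)) => h1 h2.
have -> : expR (2 * x) = (e ^+ 2) ^+ 2.
  by rewrite /e -!expRM_natl; congr expR; lra.
have -> : expR (- (2 * x)) = (e' ^+ 2) ^+ 2.
  by rewrite /e' -!expRM_natl; congr expR; lra.
have -> : expR x = e ^+ 2 by rewrite /e -expRM_natl; congr expR; lra.
have -> : expR (- x) = e' ^+ 2 by rewrite /e' -expRM_natl; congr expR; lra.
have ee' : e * e' = 1 by exact: expRxMexpNx_1.
(* In terms of u = s^2 the left side is 2 u - u^2 / 2, while [sinh_le] gives u <= (x / 2)^2 (u +
   4). *)
pose s := e - e'.
have sE : e ^+ 2 + e' ^+ 2 = s ^+ 2 + 2 by rewrite /s; ring: ee'.
have sE2 : (e ^+ 2) ^+ 2 + (e' ^+ 2) ^+ 2 = (s ^+ 2 + 2) ^+ 2 - 2.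
  by rewrite /s; ring: ee'.
rewrite sE2 sE addr0 subr0.
have s0 : 0 <= s by apply: le_trans h1; lra.
have h3 : s ^+ 2 <= (x / 2) ^+ 2 * (s ^+ 2 + 4).
  have -> : s ^+ 2 + 4 = (e + e') ^+ 2 by rewrite /s; ring: ee'.
  by rewrite -exprMn ler_sqr ?nnegrE//; apply: le_trans h2.
set u := s ^+ 2 in h3 *; have u0 : 0 <= u by exact: sqr_ge0.
have -> : 2 * x ^+ 2 = 8 * (x / 2) ^+ 2 by field.
set v := (x / 2) ^+ 2 in h3 *.
nra.
Qed.

Lemma expR_lin_bound y : `|y| <= 2^-1 -> `|expR y - 1 - y| <= 2 * y ^+ 2.
Proof.
rewrite ler_norml => /andP[y1 y2].
have h1 := expR_ge1Dx y; have h2 := expR_ge1Dx (- y).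
have h3 := expRxMexpNx_1 y; have h4 := expR_gt0 y; have h5 := expR_gt0 (- y).
rewrite ger0_norm; last by lra.
rewrite expr2.
have : expR y * (1 - y) <= 1 by rewrite -[leRHS]h3 ler_pM2l.
move=> h6; have : (expR y - 1 - y) * (1 - y) <= y * y by nra.
nra.
Qed.

Lemma cvg_expR_slope (s : nat -> R) (a : R) : (forall n, s n != 0) ->
  s n @[n --> \oo] --> (0 : R) -> (expR (s n * a) - 1) / s n @[n --> \oo] --> a.
Proof.
move=> s0 cs.
have csa : s n * a @[n --> \oo] --> (0 : R).
  by rewrite -(mul0r a); apply: cvgM => //; exact: cvg_cst.
apply/cvgrPdist_le => e e0.
have A0 : 0 < 2 * (a ^+ 2 + 1) by rewrite mulr_gt0// ltr_wpDl// sqr_ge0.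
have H1 : \forall n \near \oo, `|s n| <= e / (2 * (a ^+ 2 + 1)).
  have /cvgrPdist_le /(_ (e / (2 * (a ^+ 2 + 1))) (divr_gt0 e0 A0)) := cs.
  by apply: filterS => n; rewrite sub0r normrN.
have H2 : \forall n \near \oo, `|s n * a| <= 2^-1.
  have /cvgrPdist_le /(_ 2^-1) := csa; rewrite invr_gt0 ltr0n => /(_ isT).
  by apply: filterS => n; rewrite sub0r normrN.
apply: filterS2 H1 H2 => n h1 h2.
have -> : a - (expR (s n * a) - 1) / s n = - ((expR (s n * a) - 1 - s n * a) / s n).
  by field; exact: s0.
have sn0 : 0 < `|s n| by rewrite normr_gt0.
rewrite normrN normrM normfV ler_pdivrMr//.
apply: (le_trans (expR_lin_bound h2)).
rewrite exprMn -[s n ^+ 2]real_normK ?num_real//.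
move: h1; rewrite ler_pdivlMr// => h1; have := sqr_ge0 a; nra.
Qed.

End expR_bounds.

(** * First and second moments from exponential moments *)

Section gaussian_moments.
Context d (T : measurableType d) (R : realType).
Variable mu : {finite_measure set T -> \bar R}.
Variables (g u : T -> R) (C p q : R).
Hypotheses (mg : measurable_fun [set: T] g) (mu_ : measurable_fun [set: T] u).
Hypothesis g0 : forall x, 0 <= g x.
(** Under the weight [g] the variable [u] has the exponential moments of [C] times a normal law with
    mean [p] and variance [2 * q]. *)
Hypothesis gu : forall k, L1 mu (fun x => g x * expR (k * u x)) /\
  \int[mu]_x (g x * expR (k * u x)) = C * expR (k * p + k ^+ 2 * q).

Let h k := expR (k * p + k ^+ 2 * q).

Let g1 : L1 mu g.
Proof.
have [+ _] := gu 0; apply: L1_eq => x; by rewrite mul0r expR0 mulr1.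
Qed.

Let gC : \int[mu]_x g x = C.
Proof.
have [_ +] := gu 0; rewrite !mul0r expr0n/= mul0r add0r expR0 mulr1 => <-.
by apply: eq_Rintegral => x _; rewrite mul0r expR0 mulr1.
Qed.

Lemma gauss_L1_sqr : L1 mu (fun x => g x * u x ^+ 2).
Proof.
have [h1 _] := gu 1; have [h2 _] := gu (-1).
apply: L1_le (L1D h1 h2) => [|x].
  by apply: measurable_funM => //; exact: measurable_funX.
rewrite ger0_norm; last by rewrite mulr_ge0// sqr_ge0.
rewrite mul1r mulN1r -mulrDr ler_wpM2l//.
by have := sqr_le_expR (u x); lra.
Qed.

Lemma gauss_L1 : L1 mu (fun x => g x * u x).
Proof.
apply: L1_le (L1D g1 gauss_L1_sqr) => [|x].
  exact: measurable_funM.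
rewrite normrM (ger0_norm (g0 x)) -{2}[g x]mulr1 -mulrDr ler_wpM2l//.
rewrite ler_norml; apply/andP; split; nra.
Qed.

Let s_ n : R := n.+1%:R^-1.
Let s0 n : s_ n != 0. Proof. by rewrite invr_eq0 pnatr_eq0. Qed.
Let sp n : 0 < s_ n. Proof. by rewrite invr_gt0 ltr0n. Qed.
Let cs : s_ n @[n --> \oo] --> (0 : R).
Proof. exact: cvg_harmonic. Qed.

Let ch k : h (k * s_ n) @[n --> \oo] --> (1 : R).
Proof.
rewrite /h -expR0; apply: continuous_cvg; first exact: continuous_expR.
have -> : (0 : R) = k * 0 * p + (k * 0) ^+ 2 * q by rewrite mulr0 expr2 !mul0r addr0.
have c1 : k * s_ n @[n --> \oo] --> k * 0 by apply: cvgM => //; exact: cvg_cst.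
apply: cvgD; first by apply: cvgM => //; exact: cvg_cst.
apply: cvgM => //; last exact: cvg_cst.
by rewrite expr2; under eq_fun do rewrite expr2; apply: cvgM.
Qed.

Let slope k : k != 0 -> (h (k * s_ n) - 1) / (k * s_ n) @[n --> \oo] --> p.
Proof.
move=> k0.
have s1 n : k * s_ n != 0 by rewrite mulf_neq0.
have cs1 : k * s_ n @[n --> \oo] --> (0 : R).
  by rewrite -(mulr0 k); apply: cvgM => //; exact: cvg_cst.
have s2 n : (k * s_ n) ^+ 2 != 0 by rewrite expf_neq0.
have cs2 : (k * s_ n) ^+ 2 @[n --> \oo] --> (0 : R).
  by rewrite -(mulr0 0); under eq_fun do rewrite expr2; apply: cvgM.
have e1 := cvg_expR_slope (a := p) s1 cs1; have e2 := cvg_expR_slope (a := q) s2 cs2.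
have e3 : expR ((k * s_ n) ^+ 2 * q) @[n --> \oo] --> (1 : R).
  rewrite -expR0; apply: continuous_cvg; first exact: continuous_expR.
  by rewrite -(mul0r q); apply: cvgM => //; exact: cvg_cst.
have := seqD (seqM e3 e1) (seqM cs1 e2); rewrite mul1r mul0r addr0; apply: seq_eq => n.
rewrite /h expRD; field; apply/andP; split.
  by move: (s1 n); rewrite mulf_eq0 negb_or => /andP[].
by move: (s1 n); rewrite mulf_eq0 negb_or => /andP[].
Qed.

(** Integrating 1 + k u <= e^(k u) against [g] gives C + k m <= C h(k) for every k. Small positive
    and small negative k pinch m between the one-sided slopes of [h] at 0. *)
Lemma gauss_mean : \int[mu]_x (g x * u x) = C * p.
Proof.
set m := LHS.
have key k : C + k * m <= C * h k.
  have [L _] := gu k; have G := gauss_L1.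
  have E1 : \int[mu]_x (g x + k * (g x * u x)) = C + k * m.
    by rewrite ED ?EZ ?gC//; exact: L1Z.
  rewrite -(gu k).2 -E1; apply: Ele => [|//|x]; first by apply: L1D => //; exact: L1Z.
   have := expR_ge1Dx (k * u x); have := g0 x; nra.
apply/eqP; rewrite eq_le; apply/andP; split.
- have c1 : C * ((h (1 * s_ n) - 1) / (1 * s_ n)) @[n --> \oo] --> C * p.
    by apply: cvgM; [exact: cvg_cst|apply: slope; exact: oner_neq0].
  apply: (seq_geC _ c1) => n.
  rewrite !mul1r mulrA ler_pdivlMr//; have := key (s_ n); lra.
- have c1 : C * ((h (-1 * s_ n) - 1) / (-1 * s_ n)) @[n --> \oo] --> C * p.
    by apply: cvgM; [exact: cvg_cst|apply: slope; rewrite oppr_eq0 oner_neq0].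
  apply: (seq_leC _ c1) => n.
  have := key (- s_ n); rewrite !mulN1r invrN mulrN mulrN lerNl mulrA => H.
  rewrite ler_pdivlMr//; lra.
Qed.

Let H k := h k + h (- k) - 2.

Let slope2 k : k != 0 -> H (k * s_ n) / (k * s_ n) ^+ 2 @[n --> \oo] --> 2 * q + p ^+ 2.
Proof.
move=> k0.
have s1 n : k * s_ n != 0 by rewrite mulf_neq0.
have cs1 : k * s_ n @[n --> \oo] --> (0 : R).
  by rewrite -(mulr0 k); apply: cvgM => //; exact: cvg_cst.
have s2 n : (k * s_ n) ^+ 2 != 0 by rewrite expf_neq0.
have cs2 : (k * s_ n) ^+ 2 @[n --> \oo] --> (0 : R).
  by rewrite -(mulr0 0); under eq_fun do rewrite expr2; apply: cvgM.
have e1 := cvg_expR_slope (a := p) s1 cs1; have e2 := cvg_expR_slope (a := q) s2 cs2.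
have e3 : expR ((k * s_ n) ^+ 2 * q) @[n --> \oo] --> (1 : R).
  rewrite -expR0; apply: continuous_cvg; first exact: continuous_expR.
  by rewrite -(mul0r q); apply: cvgM => //; exact: cvg_cst.
have e4 : expR (- (k * s_ n * p)) @[n --> \oo] --> (1 : R).
  rewrite -expR0; apply: continuous_cvg; first exact: continuous_expR.
  rewrite -oppr0; apply: cvgN.
  by rewrite -(mul0r p); apply: cvgM => //; exact: cvg_cst.
have c2 : (2 : R) @[n --> \oo] --> (2 : R) by exact: cvg_cst.
have := seqD (seqM c2 e2) (seqM (seqM e3 e4) (seqM e1 e1)).
rewrite !mul1r -expr2; apply: seq_eq => n.
rewrite /H /h sqrrN mulNr !expRD.
set E := expR (k * s_ n * p); set E' := expR (- _); set F := expR _.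
have EE : E * E' = 1 by exact: expRxMexpNx_1.
have k2 : k != 0 /\ s_ n != 0.
  by move: (s1 n); rewrite mulf_eq0 negb_or => /andP[].
have -> : E * F + E' * F - 2 = 2 * (F - 1) + F * E' * (E - 1) ^+ 2.
  ring: EE.
by field; apply/andP.
Qed.

(** The same pinching at second order: [sqr_le_expR] bounds k^2 m above by C H(k), [expR_le_sqr]
    bounds 2 k^2 m below by C (4 H(k) - H(2k) / 2), and after division by the power of k both bounds
    have the same limit. *)
Lemma gauss_sqr : \int[mu]_x (g x * u x ^+ 2) = C * (2 * q + p ^+ 2).
Proof.
set m := LHS.
have ub k : k ^+ 2 * m <= C * H k.
  have [L E] := gu k; have [L' E'] := gu (- k).
  rewrite /H (_ : C * _ = C * h k + C * h (- k) - 2 * C); last by ring.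
  have G := gauss_L1_sqr.
  have E1 : \int[mu]_x (g x * expR (k * u x) + g x * expR (- k * u x) - 2 * g x) =
            C * h k + C * h (- k) - 2 * C.
    by rewrite EB ?ED ?EZ ?gC ?E ?E'//; [exact: L1D|exact: L1Z].
  rewrite -E1 /m -EZ//; apply: Ele; [exact: L1Z|exact: (L1B (L1D L L') (L1Z 2 g1))|].
  move=> x; have := sqr_le_expR (k * u x); rewrite exprMn mulNr => hh.
  have := g0 x; nra.
have lb k : C * (4 * H k - H (2 * k) / 2) <= 2 * (k ^+ 2 * m).
  have [L E] := gu k; have [L' E'] := gu (- k).
  have [L2 E2] := gu (2 * k); have [L2' E2'] := gu (- (2 * k)).
  rewrite /H (_ : C * _ = 4 * (C * h k + C * h (- k)) - 7 * C - 2^-1 * (C * h (2 * k) + C * h (- (2 * k)))); last by field.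
  have G := gauss_L1_sqr.
  have LL := L1B (L1B (L1Z 4 (L1D L L')) (L1Z 7 g1)) (L1Z 2^-1 (L1D L2 L2')).
  have E1 : \int[mu]_x (4 * (g x * expR (k * u x) + g x * expR (- k * u x)) - 7 * g x -
      2^-1 * (g x * expR (2 * k * u x) + g x * expR (- (2 * k) * u x))) =
      4 * (C * h k + C * h (- k)) - 7 * C - 2^-1 * (C * h (2 * k) + C * h (- (2 * k))).
    rewrite EB; [|exact: (L1B (L1Z 4 (L1D L L')) (L1Z 7 g1))|exact: (L1Z 2^-1 (L1D L2 L2'))].
    rewrite EB; [|exact: (L1Z 4 (L1D L L'))|exact: (L1Z 7 g1)].
    rewrite EZ; last exact: L1D.
    rewrite ED// EZ// EZ; last exact: L1D.
    by rewrite ED// gC E E' E2 E2'.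
  have E3 : \int[mu]_x (2 * (k ^+ 2 * (g x * u x ^+ 2))) = 2 * (k ^+ 2 * m).
    by rewrite EZ ?EZ//; exact: L1Z.
  rewrite -E1 -E3; apply: Ele; [exact: LL|by do 2 apply: L1Z|].
  move=> x; have := expR_le_sqr (k * u x).
  rewrite exprMn !mulNr mulrA => hh.
  have := ler_wpM2l (g0 x) hh; lra.
have two0 : (2 : R) != 0 by rewrite pnatr_eq0.
apply/eqP; rewrite eq_le; apply/andP; split.
- have c1 : C * (H (1 * s_ n) / (1 * s_ n) ^+ 2) @[n --> \oo] --> C * (2 * q + p ^+ 2).
    by apply: cvgM; [exact: cvg_cst|apply: slope2; exact: oner_neq0].
  apply: (seq_geC _ c1) => n.
  rewrite !mul1r mulrA ler_pdivlMr ?exprn_gt0//; have := ub (s_ n); lra.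
- have c1 : C * (2 * (H (1 * s_ n) / (1 * s_ n) ^+ 2) - (H (2 * s_ n) / (2 * s_ n) ^+ 2)) @[n --> \oo] --> C * (2 * (2 * q + p ^+ 2) - (2 * q + p ^+ 2)).
    apply: cvgM; first exact: cvg_cst.
    apply: cvgB; last exact: slope2.
    by apply: cvgM; [exact: cvg_cst|apply: slope2; exact: oner_neq0].
  rewrite (_ : C * (2 * q + p ^+ 2) = C * (2 * (2 * q + p ^+ 2) - (2 * q + p ^+ 2))); last by ring.
  apply: (seq_leC _ c1) => n.
  rewrite !mul1r.
  have := lb (s_ n) => hh.
  have sn2 : 0 < s_ n ^+ 2 by rewrite exprn_gt0.
  rewrite (_ : C * _ = C * (4 * H (s_ n) - H (2 * s_ n) / 2) / (2 * s_ n ^+ 2)).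
    by rewrite ler_pdivrMr ?mulr_gt0//; lra.
  by field; rewrite s0.
Qed.

End gaussian_moments.

(** * Change of variables with a density *)

Section density.
Local Open Scope ereal_scope.
Context d (T : measurableType d) (R : realType) (mu : {measure set T -> \bar R}).
Context d' (T' : measurableType d') (nu : {measure set T' -> \bar R}).
Variables (F : T -> R) (Y : T -> T') (c : R).
Hypotheses (mF : measurable_fun [set: T] F) (F0 : forall x, (0 <= F x)%R).
Hypothesis mY : measurable_fun [set: T] Y.
Hypothesis FYE : forall B, measurable B ->
  \int[mu]_(x in Y @^-1` B) (F x)%:E = c%:E * nu B.

Import HBNNSimple.

(** By [FYE] the image under [Y] of the measure with density [F] is [c] times [nu]. This extends
    from sets to simple functions, then to [g] by monotone convergence. *)
Lemma ge0_integral_density (g : T' -> R) : measurable_fun [set: T'] g ->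
  (forall y, (0 <= g y)%R) ->
  \int[mu]_x (F x * g (Y x))%:E = c%:E * \int[nu]_y (g y)%:E.
Proof.
move=> mg g0.
have mg' : measurable_fun [set: T'] (EFin \o g) by exact/measurable_EFinP.
pose h := nnsfun_approx measurableT mg'.
have hg y : (h n y)%:E @[n --> \oo] --> (g y)%:E.
  by apply: cvg_nnsfun_approx => // z _; rewrite lee_fin.
have mhY n : measurable_fun [set: T] (fun x => h n (Y x)).
  by apply: measurableT_comp.
have mYh n k : measurable (Y @^-1` (h n @^-1` [set k])).
  by rewrite -[X in measurable X]setTI; exact: mY.
have step n : \int[mu]_x (F x * h n (Y x))%:E = c%:E * \int[nu]_y (h n y)%:E.
  rewrite integralT_nnsfun sintegralE ge0_mule_fsumr; last first.
    by move=> r; apply: (mulemu_ge0 (fun r => h n @^-1` [set r])) => r0; exact: preimage_nnfun0.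
  transitivity (\int[mu]_x (\sum_(k \in range (h n))
     ((F x)%:E * (k * \1_(h n @^-1` [set k]) (Y x))%:E))).
    apply: eq_integral => x _; rewrite [h n (Y x)]fimfunE EFinM -fsumEFin//.
    rewrite ge0_mule_fsumr// => k; exact: nnfun_muleindic_ge0.
  rewrite ge0_integral_fsum//; last 2 first.
  - move=> k; apply/measurable_EFinP; apply: measurable_funM => //.
    by apply: measurable_funM => //; apply: measurableT_comp.
  - by move=> k x _; rewrite mule_ge0 ?lee_fin ?F0//; exact: nnfun_muleindic_ge0.
  apply: eq_fsbigr => k; rewrite inE => -[y _ yk].
  have k0 : (0 <= k)%R by rewrite -yk.
  transitivity (k%:E * \int[mu]_(x in Y @^-1` (h n @^-1` [set k])) (F x)%:E).
    rewrite [in RHS]integral_mkcond -ge0_integralZl_EFin//.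
    - apply: eq_integral => x _; rewrite patchE -EFinM indicE.
      have -> : (Y x \in h n @^-1` [set k]) = (x \in Y @^-1` (h n @^-1` [set k])).
        by apply/idP/idP; rewrite !inE.
      by case: ifP => _ /=; rewrite ?mulr1 ?mulr0 ?mule0// -EFinM mulrC.
    - by move=> x _; rewrite patchE; case: ifP => // _; rewrite lee_fin.
    - apply/(measurable_restrictT _ _).1 => //.
      by apply/measurable_EFinP; apply: measurable_funTS.
  by rewrite FYE; [rewrite muleCA|rewrite -[X in measurable X]setTI; exact: measurable_funPT].
have mono n m x : (n <= m)%N -> (h n x <= h m x)%R.
  by move=> nm; exact/lefP/nd_nnsfun_approx.
have c1 : \int[mu]_x (F x * h n (Y x))%:E @[n --> \oo] --> \int[mu]_x (F x * g (Y x))%:E.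
  have E x : (F x * g (Y x))%:E = limn (fun n => (F x * h n (Y x))%:E).
    apply/esym/cvg_lim => //; under eq_fun do rewrite EFinM.
    by rewrite EFinM; apply: cvgeZl.
  under [X in _ --> X]eq_integral do rewrite E.
  apply: cvg_monotone_convergence => //.
  - by move=> n; apply/measurable_EFinP; exact: measurable_funM.
  - by move=> n x _; rewrite lee_fin mulr_ge0.
  - by move=> x _ n m nm; rewrite lee_fin ler_wpM2l// mono.
have c2 : \int[nu]_y (h n y)%:E @[n --> \oo] --> \int[nu]_y (g y)%:E.
  have E x : (g x)%:E = limn (fun n => (h n x)%:E) by apply/esym/cvg_lim.
  under [X in _ --> X]eq_integral do rewrite E.
  apply: cvg_monotone_convergence => //.
  - by move=> n; apply/measurable_EFinP.
  - by move=> n x _; rewrite lee_fin.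
  - by move=> x _ n m nm; rewrite lee_fin mono.
have c3 := cvgeZl (isT : c%:E \is a fin_num) c2.
apply/esym/(cvg_unique _ c3) => //.
by move: c1; under eq_fun do rewrite step.
Qed.

End density.

Section gaussian_law.
Variable R : realType.

Lemma integral_normal (s : R) (g : R -> R) : measurable_fun [set: R] g ->
  (forall y, 0 <= g y) ->
  (\int[normal_prob 0 s]_y (g y)%:E =
   \int[lebesgue_measure]_x (normal_pdf 0 s x * g x)%:E)%E.
Proof.
move=> mg g0.
rewrite (@ge0_integral_density _ _ _ lebesgue_measure _ _ (normal_prob 0 s) (normal_pdf 0 s) id 1)//.
- by rewrite mul1e.
- exact: measurable_normal_pdf.
- by move=> x; exact: normal_pdf_ge0.
- by move=> B mB; rewrite mul1e.
Qed.

(** Completing the square: tilting the centred density by e^(a y) shifts its mean to a s^2. *)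
Lemma normal_mgf (s a : R) : s != 0 ->
  (\int[normal_prob 0 s]_y (expR (a * y))%:E = (expR (a ^+ 2 * s ^+ 2 / 2))%:E)%E.
Proof.
move=> s0; rewrite integral_normal; last 2 first.
- by apply: measurableT_comp => //; exact: measurable_funM.
- by move=> y; exact: expR_ge0.
have E x : normal_pdf 0 s x * expR (a * x) = expR (a ^+ 2 * s ^+ 2 / 2) * normal_pdf (a * s ^+ 2) s x.
  rewrite /normal_pdf (negbTE s0) -[LHS]mulrA [RHS]mulrCA; congr (_ * _).
  by rewrite /normal_fun -!expRD; congr expR; field.
under eq_integral do rewrite E EFinM.
rewrite ge0_integralZl_EFin//.
- by rewrite integral_normal_pdf mule1.
- by move=> x _; rewrite lee_fin normal_pdf_ge0.
- by apply/measurable_EFinP; exact: measurable_normal_pdf.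
Qed.

End gaussian_law.

(** * Expectation of a product under independence *)

Section independence.
Context dd (T : measurableType dd) (R : realType) (P : probability T R).
Variables (d : nat) (f : T -> R) (Y : 'I_d -> T -> R).
Variable nu : {finite_measure set (measurableTypeR R) -> \bar R}.
Hypotheses (mf : measurable_fun [set: T] f) (f0 : forall x, 0 <= f x).
Hypothesis f1 : L1 P f.
Hypothesis mY : forall i, measurable_fun [set: T] (Y i).
Hypothesis indep : forall (A : set R) (B : 'I_d -> set R), measurable A ->
  (forall i, measurable (B i)) ->
  P ((f @^-1` A) `&` [set w | forall i, B i (Y i w)]) =
  (P (f @^-1` A) * \prod_(i < d) nu (B i))%E.

(** Induction on the number [k] of coordinates in which the indicator of [B i] has been replaced by
    [g i]; each replacement is one use of [ge0_integral_density], with the remaining factors as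
    density. *)
Lemma ge0_integral_indep (g : 'I_d -> R -> R) (m : 'I_d -> R) :
  (forall i, measurable_fun [set: R] (g i)) -> (forall i y, 0 <= g i y) ->
  (forall i, (\int[nu]_y (g i y)%:E = (m i)%:E)%E) ->
  (\int[P]_w (f w * \prod_(i < d) g i (Y i w))%:E =
   (\int[P]_w f w * \prod_(i < d) m i)%:E)%E.
Proof.
move=> mg g0 gm.
have m0 i : 0 <= m i.
  by rewrite -lee_fin -gm; apply: integral_ge0 => y _; rewrite lee_fin.
have nufin (B : set R) : measurable B -> (fine (nu B))%:E = nu B.
  by move=> mB; rewrite fineK// fin_num_measure.
have mprod (F : 'I_d -> T -> R) (Q : pred 'I_d) : (forall i, measurable_fun [set: T] (F i)) ->
   measurable_fun [set: T] (fun w => \prod_(i < d | Q i) F i w).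
  move=> mF; have -> : (fun w => \prod_(i < d | Q i) F i w) =
      (fun w => \prod_(i < d) (if Q i then F i w else 1)).
    by apply/funext => w; rewrite big_mkcond.
  by apply: measurable_prod => i _; case: (Q i).
pose h k (B : 'I_d -> set R) (i : 'I_d) y := if (i < k)%N then g i y else \1_(B i) y : R.
pose M k (B : 'I_d -> set R) (i : 'I_d) := if (i < k)%N then m i else fine (nu (B i)).
have mh k B i : (forall i, measurable (B i)) -> measurable_fun [set: R] (h k B i).
  by move=> mB; rewrite /h; case: (i < k)%N => //; exact: measurable_indic.
have mhY k B i : (forall i, measurable (B i)) -> measurable_fun [set: T] (fun w => h k B i (Y i w)).
  by move=> mB; apply: (measurableT_comp (mh k B i mB)).
have h0 k B i y : 0 <= h k B i y by rewrite /h; case: ifP.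
have M0 k B i : 0 <= M k B i by rewrite /M; case: ifP => // _; exact: fine_ge0.
have S k : (k <= d)%N -> forall B, (forall i, measurable (B i)) ->
  (\int[P]_w (f w * \prod_(i < d) h k B i (Y i w))%:E =
   (\int[P]_w f w * \prod_(i < d) M k B i)%:E)%E.
  elim: k => [_ B mB|k IH kd B mB].
    (* With no coordinate replaced the roles are exchanged: the indicator of the [Y] event is the
       density and [f] the variable. The positive part makes the integrand nonnegative on the whole
       line. *)
    pose F w := \prod_(i < d) h 0%N B i (Y i w).
    pose PF := pushforward P f.
    have mF : measurable_fun [set: T] F by apply: mprod => i; exact: mhY.
    have FE w : F w = \1_[set w | forall i, B i (Y i w)] w.
      rewrite /F /h/= indicE; case: (boolP (w \in _)) => [|/negP]; rewrite inE/=.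
        by move=> hB; rewrite big1// => i _; rewrite indicE mem_set.
      move=> hB; have [i hi] : exists i, ~ B i (Y i w) by apply/existsNP.
      by rewrite (bigD1 i)//= indicE memNset// mul0r.
    have mBY : measurable [set w | forall i, B i (Y i w)].
      have -> : [set w | forall i, B i (Y i w)] = \bigcap_(i in [set: 'I_d]) (Y i @^-1` B i).
        by apply/seteqP; split => [w hw i _|w hw i]; [exact: hw|exact: hw].
      apply: fin_bigcap_measurable; first exact: finite_finset.
      by move=> i _; rewrite -[X in measurable X]setTI; exact: mY.
    have c0 : 0 <= \prod_(i < d) M 0%N B i by apply: prodr_ge0.
    have cE : (\prod_(i < d) M 0%N B i)%:E = (\prod_(i < d) nu (B i))%E.
      rewrite (big_morph (@EFin R) (id1 := 1%E) (op1 := mule))//.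
      by apply: eq_bigr => i _; rewrite /M/= nufin.
    have mm : measurable_fun [set: R] (fun y : R => Num.max y 0).
      by apply: measurable_maxr.
    have FYE (A : set R) : measurable A -> (\int[P]_(x in f @^-1` A) (F x)%:E =
        (\prod_(i < d) M 0%N B i)%:E * pushforward P f A)%E.
      move=> mA; under eq_integral do rewrite FE.
      have mfA : measurable (f @^-1` A) by rewrite -[X in measurable X]setTI; exact: mf.
      have H := indep mA mB; rewrite cE muleC -H setIC.
      exact: integral_indic.
    have F0 x : 0 <= F x by apply: prodr_ge0.
    have := ge0_integral_density mF F0 mf FYE mm (fun y => ltac:(by rewrite le_max lexx orbT)).
    move=> /(_ mf); rewrite ge0_integral_pushforward//; last 2 first.
    - exact/measurable_EFinP.
    - by move=> y _; rewrite lee_fin le_max lexx orbT.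
    rewrite preimage_setT EFinM [RHS]muleC -(E_EFin f1) => H.
    transitivity (\int[P]_x (F x * Num.max (f x) 0)%:E)%E.
      by apply: eq_integral => w _; rewrite (max_idPl (f0 w)) mulrC.
    rewrite H; congr (_ * _)%E.
    by apply: eq_integral => w _ /=; rewrite (max_idPl (f0 w)).
  pose ik := Ordinal kd.
  pose F w := f w * \prod_(i < d | i != ik) h k.+1 B i (Y i w).
  have mF : measurable_fun [set: T] F.
    by apply: measurable_funM => //; apply: mprod => i; exact: mhY.
  have F0 w : 0 <= F w by rewrite mulr_ge0// prodr_ge0.
  have Ef0 : 0 <= \int[P]_w f w by exact: Ege0.
  pose c := \int[P]_w f w * \prod_(i < d | i != ik) M k.+1 B i.
  have c0 : 0 <= c by rewrite mulr_ge0// prodr_ge0.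
  have neq i : i != ik -> (i < k.+1)%N = (i < k)%N.
    by move=> ni; rewrite ltnS leq_eqVlt -[X in X == k]/(nat_of_ord i) (negbTE (ni : (i : nat) != k)).
  have FYE (A : set R) : measurable A ->
      (\int[P]_(x in Y ik @^-1` A) (F x)%:E = c%:E * nu A)%E.
    move=> mA.
    (* At stage [k] the coordinate [ik] is still an indicator, so the induction hypothesis applies
       with its set replaced by [A]. *)
    pose B' i := if i == ik then A else B i.
    have mB' i : measurable (B' i) by rewrite /B'; case: ifP.
    have := IH (ltnW kd) B' mB'.
    rewrite (bigD1 ik)//= [M _ _ _]/M ltnn /B' eqxx -/B' => H.
    transitivity (\int[P]_w (f w * \prod_(i < d) h k B' i (Y i w))%:E)%E.
      rewrite integral_mkcond; apply: eq_integral => w _.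
      rewrite patchE (bigD1 ik)//= [h k B' ik _]/h ltnn {1}/B' eqxx indicE.
      have -> : (Y ik w \in A) = (w \in Y ik @^-1` A) by apply/idP/idP; rewrite !inE.
      case: ifP => _ /=; last by rewrite mul0r mulr0.
      rewrite mul1r /F; congr (_ * _)%:E; apply: eq_bigr => i ni.
      by rewrite /h neq// /B' (negbTE ni).
    rewrite H EFinM EFinM (nufin _ mA) [in RHS]muleC muleCA -EFinM; congr (_ * (_ * _)%:E)%E.
    by apply: eq_bigr => i ni; rewrite /M neq// /B' (negbTE ni).
  have := @ge0_integral_density _ _ _ P _ (measurableTypeR R) nu F (Y ik) c mF F0 (mY ik) FYE (g ik) (mg ik) (g0 ik).
  rewrite gm -EFinM => H.
  transitivity (\int[P]_x (F x * g ik (Y ik x))%:E)%E.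
    apply: eq_integral => w _; rewrite (bigD1 ik)//= [h k.+1 B ik _]/h ltnSn.
    by rewrite /F; congr EFin; ring.
  by rewrite H (bigD1 ik)//= [M k.+1 B ik]/M ltnSn /c; congr EFin; ring.
have := S d (leqnn d) (fun=> setT) (fun=> measurableT).
by rewrite /h /M; under eq_integral do under eq_bigr do rewrite ltn_ord; under eq_bigr do rewrite ltn_ord.
Qed.

End independence.

(** * Algebra of the Euclidean inner product *)

Section dotv_theory.
Variables (R : realType) (d : nat).
Implicit Types (u v w : 'rV[R]_d) (k : R).

Lemma dotvDl u v w : dotv (u + v) w = dotv u w + dotv v w.
Proof. by rewrite /dotv -big_split; apply: eq_bigr => i _; rewrite mxE mulrDl. Qed.

Lemma dotvC u v : dotv u v = dotv v u.
Proof. by apply: eq_bigr => i _; rewrite mulrC. Qed.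

Lemma dotvDr u v w : dotv u (v + w) = dotv u v + dotv u w.
Proof. by rewrite dotvC dotvDl !(dotvC u). Qed.

Lemma dotvZl k u v : dotv (k *: u) v = k * dotv u v.
Proof. by rewrite /dotv mulr_sumr; apply: eq_bigr => i _; rewrite mxE mulrA. Qed.

Lemma dotvZr k u v : dotv u (k *: v) = k * dotv u v.
Proof. by rewrite dotvC dotvZl dotvC. Qed.

Lemma dotvNl u v : dotv (- u) v = - dotv u v.
Proof. by rewrite -scaleN1r dotvZl mulN1r. Qed.

Lemma dotvNr u v : dotv u (- v) = - dotv u v.
Proof. by rewrite dotvC dotvNl dotvC. Qed.

Lemma dotvBr u v w : dotv u (v - w) = dotv u v - dotv u w.
Proof. by rewrite dotvDr dotvNr. Qed.

Lemma dotvBl u v w : dotv (u - v) w = dotv u w - dotv v w.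
Proof. by rewrite dotvDl dotvNl. Qed.

Lemma dotv0 u : dotv u 0 = 0.
Proof. by rewrite /dotv big1// => i _; rewrite mxE mulr0. Qed.

Lemma dot0v u : dotv 0 u = 0.
Proof. by rewrite dotvC dotv0. Qed.

Lemma normsq_ge0 u : 0 <= normsq u.
Proof. by apply: sumr_ge0 => i _; rewrite -expr2 sqr_ge0. Qed.

Lemma normsqZ k u : normsq (k *: u) = k ^+ 2 * normsq u.
Proof. by rewrite /normsq dotvZl dotvZr mulrA expr2. Qed.

Lemma normsqD u v : normsq (u + v) = normsq u + 2 * dotv u v + normsq v.
Proof. by rewrite /normsq dotvDl !dotvDr (dotvC v u); ring. Qed.

Lemma normsqB u v : normsq (u - v) = normsq u - 2 * dotv u v + normsq v.
Proof. by rewrite /normsq dotvBl !dotvBr (dotvC v u); ring. Qed.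

Lemma normsqN u : normsq (- u) = normsq u.
Proof. by rewrite /normsq dotvNl dotvNr opprK. Qed.

Lemma normsq0 : normsq (0 : 'rV[R]_d) = 0.
Proof. exact: dotv0. Qed.

End dotv_theory.

(** * The Brownian filtration and sums of increments *)

Section filtration.
Context (R : realType) (disp : measure_display) (Omega : measurableType disp)
  (P : probability Omega R) (d : nat) (T : R) (W : R -> Omega -> 'rV[R]_d).
Hypothesis T0 : 0 < T.
Hypothesis bm : brownian_motion P T W.
Local Notation F := (filtration P W).
Local Notation E f := (\int[P]_w f w).

Lemma bm_meas t i : 0 <= t <= T -> measurable_fun [set: Omega] (fun w => W t w ord0 i).
Proof. by case: bm => + _ _ _; apply. Qed.

Lemma nat_meas t A : t <= T -> natural_filtration W t A -> measurable A.
Proof.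
move=> tT; apply: smallest_sub.
  split; first exact: measurable0.
  - by move=> B mB; rewrite setTD; exact: measurableC.
  - by move=> B mB; exact: bigcupT_measurable.
move=> _ [r [i [B [/andP[r0 rt] mB ->]]]].
have := bm_meas i (t := r); rewrite r0 (le_trans rt tT) => /(_ isT) mW.
by rewrite -[X in measurable X]setTI; exact: mW.
Qed.

(** Measurability for the augmented sigma-algebra, stated by preimages. [FmP] converts it to
    measurability on a generated space, whence the closure rules below. *)
Definition Fm (t : R) (f : Omega -> R) : Prop :=
  forall B : set R, measurable B -> F t (f @^-1` B).

Lemma symdiff_null (A B : set Omega) : measurable A -> measurable B ->
  P ((A `\` B) `|` (B `\` A)) = 0%E ->
  forall C, measurable C -> P (A `&` C) = P (B `&` C).
Proof.
move=> mA mB h C mC.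
have D0 (X Y : set Omega) : measurable X -> measurable Y -> 
  P ((X `\` Y) `|` (Y `\` X)) = 0%E -> (P (X `&` C) <= P (Y `&` C))%E.
  move=> mX mY h'.
  apply: (@le_trans _ _ (P ((Y `&` C) `|` ((X `\` Y) `|` (Y `\` X))))).
    rewrite le_measure ?inE//.
    - exact: measurableI.
    - by apply: measurableU; [exact: measurableI|apply: measurableU; exact: measurableD].
    - move=> w [Xw Cw]; have [Yw|nYw] := pselect (Y w); first by left.
      by right; left.
  have mI := measurableI _ _ mY mC.
  have mD : measurable ((X `\` Y) `|` (Y `\` X)) by apply: measurableU; exact: measurableD.
  apply: (le_trans (measureU2 P mI mD)); rewrite -[leRHS]adde0; apply: leeD => //.
  by rewrite le_eqVlt; apply/orP; left; apply/eqP; exact: h'.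
by apply/eqP; rewrite eq_le !D0//= setUC.
Qed.

Lemma F_meas t A : F t A -> measurable A. Proof. by case. Qed.

(** For countable unions, the symmetric difference is covered by the countably many null symmetric
    differences. *)
Lemma F_sigma t : t <= T -> sigma_algebra [set: Omega] (F t).
Proof.
move=> tT.
have [n0 nD nU] : sigma_algebra [set: Omega] (natural_filtration W t) by exact: smallest_sigma_algebra.
split.
- by split; [exact: measurable0|exists set0 => //; rewrite !setD0 setU0 measure0].
- move=> A [mA [B nB h]]; split; first by rewrite setTD; exact: measurableC.
  exists ([set: Omega] `\` B); first exact: nD.
  rewrite -h; congr (P _); rewrite !setTD; apply/seteqP; split => w /=.
    by move=> [[a b]|[a b]]; [right|left]; split => //; apply: contrapT.
  by move=> [[a b]|[a b]]; [right|left]; split => //; exact.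
- move=> A hA; split; first by apply: bigcupT_measurable => k; case: (hA k).
  have /choice[B hB] : forall k, exists B, natural_filtration W t B /\
      P ((A k `\` B) `|` (B `\` A k)) = 0%E.
    by move=> k; case: (hA k) => _ [B nB h]; exists B.
  exists (\bigcup_k B k); first by apply: nU => k; case: (hB k).
  have mA k : measurable (A k) by case: (hA k).
  have mB k : measurable (B k) by apply: (nat_meas tT); case: (hB k).
  have mAB k : measurable ((A k `\` B k) `|` (B k `\` A k)).
    by apply: measurableU; exact: measurableD.
  apply: (@subset_measure0 _ _ _ P _ (\bigcup_k ((A k `\` B k) `|` (B k `\` A k)))).
  - by apply: measurableU; apply: measurableD; exact: bigcupT_measurable.
  - exact: bigcupT_measurable.
  - move=> w [[[k _ Ak] nB]|[[k _ Bk] nA]]; exists k => //; [left|right]; split => //.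
      by move=> Bk; apply: nB; exists k.
    by move=> Ak; apply: nA; exists k.
  - apply/eqP; rewrite eq_le measure_ge0 andbT.
    apply: le_trans (measure_sigma_subadditive _ mAB _ (@subset_refl _ _)) _.
      exact: bigcupT_measurable.
    by rewrite eseries0// => k _ _; case: (hB k).
Qed.

Lemma FmP t f : t <= T ->
  Fm t f <-> measurable_fun [set: g_sigma_algebraType (F t)] (f : g_sigma_algebraType (F t) -> R).
Proof.
move=> tT; split => [h _ B mB|h B mB].
  by rewrite setTI; apply: sub_sigma_algebra; exact: h.
by have := h measurableT B mB; rewrite setTI (measurable_g_measurableTypeE (F_sigma tT)).
Qed.

Lemma Fm_meas t f : Fm t f -> measurable_fun [set: Omega] f.
Proof. by move=> h _ B mB; rewrite setTI; case: (h B mB). Qed.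

Lemma F_mono s t A : s <= t -> F s A -> F t A.
Proof.
move=> st [mA [B nB h]]; split => //; exists B => //; move: B nB {h}.
apply: sub_sigma_algebra2 => C [r [i [D [/andP[r0 rs] mD ->]]]].
by exists r, i, D; split => //; rewrite r0 (le_trans rs st).
Qed.

Lemma Fm_mono s t f : s <= t -> Fm s f -> Fm t f.
Proof. by move=> st h B mB; apply: F_mono st _; exact: h. Qed.

Lemma Fm_cst t k : t <= T -> Fm t (fun=> k).
Proof. by move=> tT; apply/(FmP _ tT); exact: measurable_cst. Qed.

Lemma FmD t f g : t <= T -> Fm t f -> Fm t g -> Fm t (fun w => f w + g w).
Proof.
by move=> tT /(FmP _ tT) hf /(FmP _ tT) hg; apply/(FmP _ tT); exact: measurable_funD.
Qed.

Lemma FmM t f g : t <= T -> Fm t f -> Fm t g -> Fm t (fun w => f w * g w).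
Proof.
by move=> tT /(FmP _ tT) hf /(FmP _ tT) hg; apply/(FmP _ tT); exact: measurable_funM.
Qed.

Lemma FmZ t k f : t <= T -> Fm t f -> Fm t (fun w => k * f w).
Proof. by move=> tT hf; apply: FmM => //; exact: Fm_cst. Qed.

Lemma FmB t f g : t <= T -> Fm t f -> Fm t g -> Fm t (fun w => f w - g w).
Proof.
by move=> tT /(FmP _ tT) hf /(FmP _ tT) hg; apply/(FmP _ tT); exact: measurable_funB.
Qed.

Lemma Fm_comp t (h : R -> R) f : measurable_fun [set: R] h -> Fm t f -> Fm t (fun w => h (f w)).
Proof.
by move=> mh hf B mB; apply: (hf (h @^-1` B)); rewrite -[X in measurable X]setTI; exact: mh.
Qed.

Lemma Fm_sum t (I : Type) (s : seq I) (h : I -> Omega -> R) : t <= T ->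
  (forall i, Fm t (h i)) -> Fm t (fun w => \sum_(i <- s) h i w).
Proof.
move=> tT hh; apply/(FmP _ tT); apply: measurable_sum => i.
exact/(FmP _ tT).
Qed.

Lemma Fm_expR t f : Fm t f -> Fm t (fun w => expR (f w)).
Proof. by apply: Fm_comp; exact: measurable_expR. Qed.

Lemma Fm_indic t A : t <= T -> F t A -> Fm t (\1_A).
Proof.
move=> tT FA; apply/(FmP _ tT); apply: measurable_indic.
by rewrite (measurable_g_measurableTypeE (F_sigma tT)).
Qed.

Lemma Fm_W t r i : 0 <= r <= t -> t <= T -> Fm t (fun w => W r w ord0 i).
Proof.
move=> rt tT B mB; have nB : natural_filtration W t ((fun w => W r w ord0 i) @^-1` B).
  by apply: sub_sigma_algebra; exists r, i, B.
split; first exact: nat_meas nB.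
by exists ((fun w => W r w ord0 i) @^-1` B) => //; rewrite setDv setU0 measure0.
Qed.

Lemma Fm_dotW t c r s : 0 <= r <= t -> 0 <= s <= t -> t <= T ->
  Fm t (fun w => dotv c (W r w - W s w)).
Proof.
move=> rt st tT; apply: Fm_sum => // i; apply: FmZ => //.
have -> : (fun w => (W r w - W s w) ord0 i) = (fun w => W r w ord0 i - W s w ord0 i).
  by apply/funext => w; rewrite !mxE.
by apply: FmB => //; exact: Fm_W.
Qed.

(** This is what the augmentation is for: a limit that exists off a null set may be redefined there
    and stays adapted. *)
Lemma Fm_ae t f g : t <= T -> Fm t f -> measurable_fun [set: Omega] g ->
  {ae P, forall w, f w = g w} -> Fm t g.
Proof.
move=> tT hf mg [N [mN N0 subN]] B mB.
have mgB : measurable (g @^-1` B) by rewrite -[X in measurable X]setTI; exact: mg.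
split => //; have [mfB [B0 nB0 h]] := hf B mB; exists B0 => //.
have mB0 := nat_meas tT nB0.
apply: (@subset_measure0 _ _ _ P _ (((f @^-1` B `\` B0) `|` (B0 `\` f @^-1` B)) `|` N)).
- by apply: measurableU; apply: measurableD.
- by apply: measurableU => //; apply: measurableU; apply: measurableD.
- move=> w hw; have [e|ne] := pselect (f w = g w); last by right; apply: subN.
  by left; move: hw => /=; rewrite e.
- apply/eqP; rewrite eq_le measure_ge0 andbT.
  apply: (le_trans (measureU2 P _ mN)).
    by apply: measurableU; apply: measurableD.
  rewrite -[leRHS]adde0; apply: leeD; rewrite le_eqVlt; apply/orP; left; apply/eqP.
    exact: h.
  exact: N0.
Qed.

Lemma Fm_lim t (f_ : nat -> Omega -> R) f : t <= T -> (forall n, Fm t (f_ n)) ->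
  (forall w, f_ n w @[n --> \oo] --> f w) -> Fm t f.
Proof.
move=> tT hf cf; apply/(FmP _ tT).
apply: (measurable_fun_cvg (h := f_ : nat -> g_sigma_algebraType (F t) -> R)).
  by move=> n; exact/(FmP _ tT).
by move=> w _; exact: cf.
Qed.

(** A set of the augmented sigma-algebra differs by a null set from one of the natural filtration,
    to which the independence clause applies. *)
Lemma bm_indep s t A (B : 'I_d -> set R) : 0 <= s -> s < t -> t <= T -> F s A ->
  (forall i, measurable (B i)) ->
  P (A `&` [set w | forall i, B i ((W t w - W s w) ord0 i)]) =
  (P A * \prod_(i < d) normal_prob 0 (Num.sqrt (t - s)) (B i))%E.
Proof.
move=> s0 st tT [mA [A0 nA0 h]] mB.
have sT : s <= T by apply: ltW; exact: lt_le_trans st tT.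
have mA0 := nat_meas sT nA0.
have mC : measurable [set w | forall i, B i ((W t w - W s w) ord0 i)].
  have -> : [set w | forall i, B i ((W t w - W s w) ord0 i)] =
     \bigcap_(i in [set: 'I_d]) ((fun w => W t w ord0 i - W s w ord0 i) @^-1` B i).
    apply/seteqP; split => [w hw i _|w hw i].
      by have := hw i; rewrite !mxE.
    by have := hw i I; rewrite /= !mxE.
  apply: fin_bigcap_measurable; first exact: finite_finset.
  move=> i _; rewrite -[X in measurable X]setTI; apply: measurable_funB => //.
    by apply: bm_meas; rewrite (le_trans s0 (ltW st)) tT.
  by apply: bm_meas; rewrite s0 sT.
rewrite (symdiff_null mA mA0 h mC).
have := symdiff_null mA mA0 h measurableT; rewrite !setIT => ->.
by case: bm => _ _ + _; apply.
Qed.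

(** All later Gaussian computations rest on this one. The case [s = t] is separate, since
    independence is given for [s < t]. *)
Lemma exp_incr s t (f : Omega -> R) (c : 'rV[R]_d) : 0 <= s -> s <= t -> t <= T ->
  Fm s f -> (forall w, 0 <= f w) -> L1 P f ->
  L1 P (fun w => f w * expR (dotv c (W t w - W s w))) /\
  E (fun w => f w * expR (dotv c (W t w - W s w))) = E f * expR (normsq c * (t - s) / 2).
Proof.
move=> s0; rewrite le_eqVlt => /predU1P[<- _ _ f0 f1|st tT hf f0 f1].
  have e w : f w * expR (dotv c (W s w - W s w)) = f w.
    by rewrite subrr dotv0 expR0 mulr1.
  rewrite subrr mulr0 mul0r expR0 mulr1; split.
    by apply: L1_eq f1 => w; rewrite e.
  by apply: eq_Rintegral => w _; rewrite e.
have sT : s <= T by apply: ltW; exact: lt_le_trans st tT.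
have ts : 0 < t - s by rewrite subr_gt0.
have sq0 : Num.sqrt (t - s) != 0 by rewrite sqrtr_eq0 -ltNge.
have mWi i : measurable_fun [set: Omega] (fun w => (W t w - W s w) ord0 i).
  have -> : (fun w => (W t w - W s w) ord0 i) = (fun w => W t w ord0 i - W s w ord0 i).
    by apply/funext => w; rewrite !mxE.
  apply: measurable_funB; apply: bm_meas; first by rewrite (le_trans s0 (ltW st)) tT.
  by rewrite s0 sT.
have := @ge0_integral_indep _ _ _ P d f (fun i w => (W t w - W s w) ord0 i)
  (normal_prob 0 (Num.sqrt (t - s))) (Fm_meas hf) f0 f1 mWi _
  (fun i y => expR (c ord0 i * y)) (fun i => expR (c ord0 i ^+ 2 * (t - s) / 2)).
have -> : (fun w => (f w * \prod_(i < d) expR (c ord0 i * (W t w - W s w) ord0 i))%:E)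
  = (fun w => (f w * expR (dotv c (W t w - W s w)))%:E).
  by apply/funext => w; rewrite -expR_sum.
have -> : \prod_(i < d) expR (c ord0 i ^+ 2 * (t - s) / 2) = expR (normsq c * (t - s) / 2).
  by rewrite -expR_sum /normsq /dotv !mulr_suml.
move=> H; apply: L1_fin.
- apply: measurable_funM; first exact: Fm_meas hf.
  by apply: (@Fm_meas t); apply: Fm_expR; apply: Fm_dotW => //; rewrite ?s0 ?lexx ?(ltW st) ?(le_trans s0 (ltW st)).
- by move=> w; rewrite mulr_ge0// expR_ge0.
- apply: H.
  + by move=> A B mA mB; apply: bm_indep => //; exact: hf.
  + by move=> i; apply: measurableT_comp => //; exact: measurable_funM.
  + by move=> i y; exact: expR_ge0.
  + by move=> i; rewrite normal_mgf// sqr_sqrtr// ltW.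
Qed.

(** * Sums of Brownian increments along a grid *)

Section grid.
Variables (u : nat -> R) (c : nat -> 'rV[R]_d).
Hypotheses (u0 : 0 <= u 0%N) (uT : forall k, u k <= T) (ule : forall k, u k <= u k.+1).

Lemma grid_le i j : (i <= j)%N -> u i <= u j.
Proof. by move=> ij; apply: (homo_leq (r := fun x y : R => x <= y)) ij => //; apply: le_trans. Qed.

Lemma grid_ge0 k : 0 <= u k.
Proof. exact: le_trans u0 (grid_le _). Qed.

(** The grid is only nondecreasing, so that grids clamped to a subinterval, with repeated points,
    qualify. The coefficients are deterministic. *)
Definition gsum N w := \sum_(k < N) dotv (c k) (W (u k.+1) w - W (u k) w).
Definition gvar N := \sum_(k < N) normsq (c k) * (u k.+1 - u k).

Lemma gsumS N w : gsum N.+1 w = gsum N w + dotv (c N) (W (u N.+1) w - W (u N) w).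
Proof. by rewrite /gsum big_ord_recr. Qed.

Lemma gvarS N : gvar N.+1 = gvar N + normsq (c N) * (u N.+1 - u N).
Proof. by rewrite /gvar big_ord_recr. Qed.

Lemma gvar_le i j : (i <= j)%N -> gvar i <= gvar j.
Proof.
move=> ij; apply: (homo_leq (r := fun x y : R => x <= y)) ij => //; first exact: le_trans.
by move=> k; rewrite gvarS lerDl mulr_ge0 ?normsq_ge0// subr_ge0.
Qed.

Lemma Fm_gsum N : Fm (u N) (gsum N).
Proof.
elim: N => [|N IH].
  rewrite /gsum; have -> : (fun w => \sum_(k < 0) dotv (c k) (W (u k.+1) w - W (u k) w)) = (fun=> 0).
    by apply/funext => w; rewrite big_ord0.
  exact: Fm_cst.
have -> : gsum N.+1 = (fun w => gsum N w + dotv (c N) (W (u N.+1) w - W (u N) w)).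
  by apply/funext => w; rewrite gsumS.
apply: FmD => //; first exact: Fm_mono (ule N) IH.
by apply: Fm_dotW => //; rewrite grid_ge0 ?lexx ?ule.
Qed.

Lemma exp_gsum N (f : Omega -> R) : Fm (u 0%N) f -> (forall w, 0 <= f w) -> L1 P f ->
  L1 P (fun w => f w * expR (gsum N w)) /\
  E (fun w => f w * expR (gsum N w)) = E f * expR (gvar N / 2).
Proof.
move=> hf f0 f1; elim: N => [|N [IH1 IH2]].
  have e w : f w * expR (gsum 0 w) = f w by rewrite /gsum big_ord0 expR0 mulr1.
  rewrite /gvar big_ord0 mul0r expR0 mulr1; split.
    by apply: L1_eq f1 => w; rewrite e.
  by apply: eq_Rintegral => w _; rewrite e.
have hg : Fm (u N) (fun w => f w * expR (gsum N w)).
  by apply: FmM => //; [exact: Fm_mono (grid_le (leq0n N)) hf|exact/Fm_expR/Fm_gsum].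
have g0 w : 0 <= f w * expR (gsum N w) by rewrite mulr_ge0// expR_ge0.
have := exp_incr (c N) (grid_ge0 N) (ule N) (uT N.+1) hg g0 IH1.
have -> : (fun w => f w * expR (gsum N w) * expR (dotv (c N) (W (u N.+1) w - W (u N) w))) =
  (fun w => f w * expR (gsum N.+1 w)).
  by apply/funext => w; rewrite -mulrA -expRD gsumS.
by rewrite IH2 -mulrA -expRD gvarS mulrDl.
Qed.

(* Ville's inequality for the exponential martingale. *)
Lemma maximal_ineq N (l k : R) : 0 < k ->
  (P [set w | exists2 j, (j <= N)%N & (l <= gsum j w)%R] <=
   (expR (k ^+ 2 * gvar N / 2 - k * l))%:E)%E.
Proof.
move=> k0.
pose B j := [set w | exists2 i, (i <= j)%N & l <= gsum i w].
pose Z j w := expR (k * gsum j w - k ^+ 2 * gvar j / 2).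
(* A lower bound for [Z j] wherever [gsum j] has reached [l], uniform in [j <= N] because [gvar] is
   nondecreasing. *)
pose L := expR (k * l - k ^+ 2 * gvar N / 2).
have FU j A A' : F (u j) A -> F (u j) A' -> F (u j) (A `|` A').
  rewrite -(measurable_g_measurableTypeE (F_sigma (uT j))); exact: measurableU.
have FG j : F (u j) [set w | l <= gsum j w].
  have := Fm_gsum j (measurable_itv `[l, +oo[); congr (F _ _).
  by apply/seteqP; split => w; rewrite /= in_itv/= andbT.
have FB j : F (u j) (B j).
  elim: j => [|j IH].
    have -> : B 0%N = [set w | l <= gsum 0 w] by apply/seteqP; split => [w [[]//]|w]; exists 0%N.
    exact: FG.
  have -> : B j.+1 = B j `|` [set w | l <= gsum j.+1 w].
    apply/seteqP; split => [w [i]|w [[i ij h]|h]].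
    - by rewrite leq_eqVlt => /predU1P[-> |ij]; [right|left; exists i].
    - by exists i => //; exact: leqW.
    - by exists j.+1.
  by apply: FU => //; exact: F_mono (ule j) (IH).
have mZ j : Fm (u j) (Z j).
  by apply: Fm_expR; apply: FmB; [exact: uT|apply: FmZ; [exact: uT|exact: Fm_gsum]|exact: Fm_cst].
have Zstep j A : F (u j) A -> L1 P (Z j) ->
    L1 P (fun w => \1_A w * Z j.+1 w) /\ E (fun w => \1_A w * Z j.+1 w) = E (fun w => \1_A w * Z j w).
  move=> FA LZ.
  have mA := F_meas FA.
  have LAZ : L1 P (fun w => \1_A w * Z j w).
    by apply: (L1_bound (M := 1)) => // w; rewrite indicE; case: (_ \in _); rewrite /= ?normr1 ?normr0.
  have hf : Fm (u j) (fun w => \1_A w * Z j w) by apply: FmM => //; exact: Fm_indic.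
  have f0 w : 0 <= \1_A w * Z j w by rewrite mulr_ge0// expR_ge0.
  have [LL E1] := exp_incr (k *: c j) (grid_ge0 j) (ule j) (uT j.+1) hf f0 LAZ.
  pose q := normsq (k *: c j) * (u j.+1 - u j) / 2.
  have e w : expR (- q) * (\1_A w * Z j w * expR (dotv (k *: c j) (W (u j.+1) w - W (u j) w))) =
      \1_A w * Z j.+1 w.
    rewrite -mulrA mulrCA; congr (_ * _); rewrite /Z -!expRD; congr expR.
    by rewrite gsumS gvarS dotvZl /q normsqZ; ring.
  split; first by apply: L1_eq e _; exact: L1Z.
  transitivity (E (fun w => expR (- q) * (\1_A w * Z j w * expR (dotv (k *: c j) (W (u j.+1) w - W (u j) w))))).
    by apply: eq_Rintegral => w _; rewrite e.
  by rewrite EZ// E1 mulrCA -/q -expRD addrC subrr expR0 mulr1.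
have LZ j : L1 P (Z j) /\ E (Z j) = 1.
  elim: j => [|j [IH1 IH2]].
    have e w : 1 = Z 0%N w by rewrite /Z /gsum /gvar !big_ord0 !mulr0 mul0r subrr expR0.
    split; first by apply: L1_eq e _; exact: L1_cst.
    under eq_Rintegral do rewrite -e.
    by rewrite Rintegral_cst// mul1r -[RHS]/(fine 1%E); congr fine; exact: probability_setT.
  have FT : F (u j) setT.
    rewrite -(measurable_g_measurableTypeE (F_sigma (uT j))); exact: measurableT.
  have e i w : \1_setT w * Z i w = Z i w by rewrite indicT mul1r.
  have [h1 h2] := Zstep j setT FT IH1; split; first exact: L1_eq (e j.+1) h1.
  rewrite -IH2; under eq_Rintegral do rewrite -e; rewrite h2.
  by apply: eq_Rintegral => w _; rewrite e.
have indb (A : set Omega) w : `|\1_A w : R| <= 1.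
  by rewrite indicE; case: (_ \in _); rewrite /= ?normr1 ?normr0.
have Lind A i : measurable A -> L1 P (fun w => \1_A w * Z i w).
  by move=> mA; apply: (L1_bound (M := 1)) => //; exact: (LZ i).1.
have mB j := F_meas (FB j).
have L1i (A : set Omega) : measurable A -> L1 P (\1_A : Omega -> R).
  by move=> mA; apply: L1_bounded (indb A).
(* Decomposition at the first passage: on paths that have crossed before, [Zstep] advances the
   martingale by one step; on those that cross at [j.+1] it is at least [L]. *)
have LB j : (j <= N)%N -> E (fun w => L * \1_(B j) w) <= E (fun w => \1_(B j) w * Z j w).
  have LZw i w : (i <= N)%N -> l <= gsum i w -> L <= Z i w.
    move=> iN h; rewrite ler_expR lerB// ?ler_pM2l//.
    by rewrite ler_pM2r ?invr_gt0// ler_wpM2l ?sqr_ge0// gvar_le.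
  elim: j => [_|j IH jN].
    apply: Ele; [exact/L1Z/L1i|exact: Lind|move=> w].
    rewrite mulrC indicE; case: (boolP (w \in B 0%N)) => hw; rewrite ?mul1r ?mul0r//.
    by move: hw; rewrite inE => -[[|//] _]; exact: LZw.
  pose D := B j.+1 `\` B j.
  have mD : measurable D by apply: measurableD.
  have BD w : \1_(B j.+1) w = \1_(B j) w + \1_D w :> R.
    rewrite !indicE /D in_setD.
    have [h|h] := boolP (w \in B j); last by rewrite andbT add0r.
    rewrite andbF addr0; congr (_%:R); rewrite mem_set//.
    by move: h; rewrite inE => -[i ij h]; exists i => //; exact: leqW.
  have [_ e1] := Zstep j _ (FB j) (LZ j).1.
  apply: (@le_trans _ _ (E (fun w => L * \1_(B j) w) + E (fun w => \1_D w * Z j.+1 w))).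
    rewrite -ED; [|exact/L1Z/L1i|exact: Lind].
    apply: Ele; [exact/L1Z/L1i|apply: L1D; [exact/L1Z/L1i|exact: Lind]|move=> w].
    rewrite BD mulrDr lerD2l mulrC [\1_D w]indicE.
    case: (boolP (w \in D)) => hw; rewrite ?mul0r// !mul1r.
    move: hw; rewrite inE => -[[i ij h] nB]; move: ij; rewrite leq_eqVlt => /predU1P[e|ij].
      by move: h; rewrite e; exact: LZw.
    by exfalso; apply: nB; exists i.
  apply: (@le_trans _ _ (E (fun w => \1_(B j) w * Z j.+1 w) + E (fun w => \1_D w * Z j.+1 w))).
    by rewrite lerD2r e1; apply: IH; exact: ltnW.
  rewrite -ED; [|exact: Lind|exact: Lind].
  by apply: Ele; [apply: L1D; exact: Lind|exact: Lind|move=> w; rewrite BD mulrDl].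
have L0 : 0 < L by exact: expR_gt0.
have := LB N (leqnn N); rewrite EZ; last exact: L1i.
move=> h.
have : L * E (\1_(B N)) <= 1.
  apply: (le_trans h); rewrite -(LZ N).2; apply: Ele; [exact: Lind|exact: (LZ N).1|move=> w].
  have Z0 : 0 <= Z N w by exact: expR_ge0.
  by rewrite indicE; case: (_ \in _); rewrite ?mul1r ?mul0r.
rewrite -ler_pdivlMl// mulr1 => h2.
have -> : P [set w | exists2 j, (j <= N)%N & l <= gsum j w] = (E (\1_(B N)))%:E.
  by rewrite -E_EFin; [rewrite integral_indic// setIT|exact: L1i].
by rewrite lee_fin (le_trans h2)// /L -expRN ler_expR opprB.
Qed.

End grid.
End filtration.

(** * Grids and Riemann sums *)

Section continuous_functions.
Variable R : realType.
Implicit Types (f g : R -> R) (a b c k e t T : R).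
Local Notation mu := (@lebesgue_measure R).
Local Notation Rint f a b := (\int[mu]_(x in `[a, b]) f x).

(** Compactness is used in its near-covering form. Only [x] is confined to the interval, which
    spares the users a check on [y]. *)
Lemma unif_mod f T e : continuous f -> 0 < e ->
  exists2 r, 0 < r & forall x y, 0 <= x <= T -> `|x - y| <= r -> `|f x - f y| <= e.
Proof.
move=> cf e0.
have K : compact `[0, T]%classic by exact: segment_compact.
pose Q (r x : R) := forall y, `|x - y| <= r -> `|f x - f y| <= e.
have H : \forall r \near 0^'+, `[0, T]%classic `<=` Q r.
  apply: ((compact_near_coveringP _).1 K R (0^'+) Q) => x _.
  have /cvgrPdist_le /(_ (e / 2)) := cf x; rewrite divr_gt0// => /(_ isT) /nbhs_ballP[r/= r0 hr].
  exists (ball x (r / 2), [set s : R | s < r / 2]) => /=.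
    split; first by apply: nbhsx_ballx; rewrite divr_gt0.
    by apply: nbhs_right_lt; rewrite divr_gt0.
  move=> [x' s] /= [bx' sr] y xy.
  have h1 : `|f x - f x'| <= e / 2.
    by apply: hr; apply: le_ball bx'; lra.
  have h2 : `|f x - f y| <= e / 2.
    apply: hr; rewrite /ball/=; move: bx'; rewrite /ball/= => bx'.
    have := ler_distD x' x y; lra.
  apply: (le_trans (ler_distD (f x) _ _)); rewrite (distrC (f x')); lra.
have H2 : \forall r \near 0^'+, `[0, T]%classic `<=` Q r /\ 0 < r.
  by apply: filterS2 H (nbhs_right_gt 0) => r.
have [r [hr r0]] : exists r, `[0, T]%classic `<=` Q r /\ 0 < r.
  exact: (@filter_ex _ (0^'+) _ _ H2).
by exists r => // x y xT; apply: hr; rewrite /= in_itv.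
Qed.

Lemma Rint_int f a b : continuous f -> mu.-integrable `[a, b] (EFin \o f).
Proof.
move=> cf; apply: continuous_compact_integrable; first exact: segment_compact.
exact: continuous_subspaceT.
Qed.

Lemma Rint_cst k a b : a <= b -> Rint (fun=> k) a b = k * (b - a).
Proof.
move=> ab; rewrite Rintegral_cst//= lebesgue_measure_itv/= lte_fin.
move: ab; rewrite le_eqVlt => /predU1P[->|->//]; by rewrite ltxx subrr mulr0.
Qed.

Lemma Rint_add f a b c : continuous f -> a <= b -> b <= c ->
  Rint f a c = Rint f a b + Rint f b c.
Proof.
move=> cf ab bc; have := @Rintegral_itvB R f (BLeft a) (BRight c) b (Rint_int a c cf).
rewrite !bnd_simp => /(_ ab bc) /eqP; rewrite subr_eq addrC => /eqP ->.
congr (_ + _); rewrite Rintegral_itv_obnd_cbnd//.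
apply: integrableS (Rint_int b c cf) => //.
by apply: subset_itvr; rewrite bnd_simp.
Qed.

Lemma Rint_point f a : Rint f a a = 0.
Proof. by rewrite set_itv1 Rintegral_set1. Qed.

Lemma Rint_le f g a b : continuous f -> continuous g ->
  (forall x, a <= x <= b -> f x <= g x) -> Rint f a b <= Rint g a b.
Proof.
move=> cf cg h; apply: le_Rintegral => //; [exact: Rint_int|exact: Rint_int].
Qed.

Lemma Rint_ge0 f a b : (forall x, a <= x <= b -> 0 <= f x) -> 0 <= Rint f a b.
Proof. by move=> h; apply: Rintegral_ge0 => x /=; rewrite in_itv/=; exact: h. Qed.

Lemma RintD f g a b : continuous f -> continuous g ->
  Rint (fun x => f x + g x) a b = Rint f a b + Rint g a b.
Proof. by move=> cf cg; rewrite RintegralD//; exact: Rint_int. Qed.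

Lemma RintB f g a b : continuous f -> continuous g ->
  Rint (fun x => f x - g x) a b = Rint f a b - Rint g a b.
Proof. by move=> cf cg; rewrite RintegralB//; exact: Rint_int. Qed.

Lemma RintZ f k a b : continuous f ->
  Rint (fun x => k * f x) a b = k * Rint f a b.
Proof. by move=> cf; rewrite RintegralZl//; exact: Rint_int. Qed.

Lemma Rint_eq f g a b : (forall x, a <= x <= b -> f x = g x) -> Rint f a b = Rint g a b.
Proof. by move=> h; apply: eq_Rintegral => x; rewrite inE/= in_itv/=; exact: h. Qed.

Lemma Rint_dist f k e a b : continuous f -> a <= b ->
  (forall x, a <= x <= b -> `|k - f x| <= e) -> `|k * (b - a) - Rint f a b| <= e * (b - a).
Proof.
move=> cf ab h; rewrite -!Rint_cst// -RintB//; last by move=> x; exact: cvg_cst.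
apply: (le_trans (le_normr_Rintegral _ _)) => //.
  by apply: Rint_int => x; apply: cvgB; [exact: cvg_cst|exact: cf].
apply: Rint_le => // x.
  by apply: cvg_norm; apply: cvgB; [exact: cvg_cst|exact: cf].
exact: cvg_cst.
Qed.

Lemma continuous_bounded f a b : continuous f ->
  exists2 M, 0 <= M & forall x, a <= x <= b -> `|f x| <= M.
Proof.
move=> cf; have [ab|ba] := leP a b; last first.
  by exists 0 => // x /andP[h1 h2]; have := lt_le_trans ba (le_trans h1 h2); rewrite ltxx.
have cn : {within `[a, b], continuous (fun x => `|f x|)}.
  by apply: continuous_subspaceT => x; apply: cvg_norm; exact: cf.
have [c _ hc] := EVT_max ab cn.
by exists `|f c| => // x xab; apply: hc; rewrite in_itv.
Qed.

(** The retraction onto [0, T]. Composition with it makes a function continuous on [0, T] continuous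
    on the line, without changing its values there. *)
Definition clamp T t : R := Num.max 0 (Num.min t T).

Lemma clamp_itv T t : 0 <= T -> 0 <= clamp T t <= T.
Proof. by move=> T0; rewrite /clamp le_max lexx ge_max T0 ge_min lexx orbT. Qed.

Lemma clampE T t : 0 <= t <= T -> clamp T t = t.
Proof. by move=> /andP[t0 tT]; rewrite /clamp (min_idPl tT) (max_idPr t0). Qed.

Lemma continuous_clamp T : continuous (clamp T).
Proof.
move=> t; rewrite /clamp.
have -> : (fun t => Num.max 0 (Num.min t T)) = (fun t => (0 + (t + T - `|t - T|) / 2 + `|0 - (t + T - `|t - T|) / 2|) / 2) :> (R -> R).
  by apply/funext => s; rewrite minr_absE maxr_absE.
have c1 : {for t, continuous (fun t => (t + T - `|t - T|) / 2)}.
  apply: cvgM; last exact: cvg_cst.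
  apply: cvgB; first by apply: cvgD; [exact: cvg_id|exact: cvg_cst].
  by apply: cvg_norm; apply: cvgB; [exact: cvg_id|exact: cvg_cst].
apply: cvgM; last exact: cvg_cst.
apply: cvgD; first by apply: cvgD; [exact: cvg_cst|exact: c1].
by apply: cvg_norm; apply: cvgB; [exact: cvg_cst|exact: c1].
Qed.

Lemma continuous_on_clamp T (V : topologicalType) (f : R -> V) : 0 <= T ->
  continuous_on T f -> continuous (f \o clamp T).
Proof.
move=> T0 cf t.
have cft := (subspace_continuousP _ _).1 cf (clamp T t).
have ct : `[0, T]%classic (clamp T t) by rewrite /= in_itv/=; exact: clamp_itv.
have {}cft := cft ct; move=> B /cft hB.
have h2 : nbhs (clamp T t) [set x | `[0, T]%classic x -> B (f x)] by exact: hB.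
have := @continuous_clamp T t _ h2.
move=> h3; have h4 : \forall s \near t, `[0, T]%classic (clamp T s) -> B (f (clamp T s)) by exact: h3.
suff : \forall s \near t, B (f (clamp T s)) by [].
by apply: filterS h4 => s; apply; rewrite /= in_itv/=; exact: clamp_itv.
Qed.

(* The level-[n] dyadic grid, constant equal to [T] from index [2 ^ n] on. *)
Definition tn T (n k : nat) : R := Num.min T (T * k%:R / 2 ^+ n).

Lemma tn0 T n : 0 <= T -> tn T n 0 = 0.
Proof. by move=> T0; rewrite /tn mulr0 mul0r (min_idPr T0). Qed.

Lemma tnE T (n k : nat) : 0 <= T -> (k <= 2 ^ n)%N -> tn T n k = T * k%:R / 2 ^+ n.
Proof.
move=> T0 k2; apply/min_idPr; rewrite -mulrA ler_piMr// ler_pdivrMr ?exprn_gt0//.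
by rewrite mul1r -natrX ler_nat.
Qed.

Lemma tn_end T n : 0 <= T -> tn T n (2 ^ n) = T.
Proof. by move=> T0; rewrite tnE// natrX mulfK// expf_neq0. Qed.

Lemma tn_le T (n k : nat) : tn T n k <= T.
Proof. by rewrite /tn ge_min lexx. Qed.

Lemma tn_ge0 T (n k : nat) : 0 <= T -> 0 <= tn T n k.
Proof. by move=> T0; rewrite /tn le_min T0 divr_ge0 ?exprn_ge0// mulr_ge0. Qed.

Lemma tnS T (n k : nat) : 0 <= T -> tn T n k <= tn T n k.+1.
Proof.
move=> T0; rewrite /tn le_min ge_min lexx/= ge_min; apply/orP; right.
by rewrite ler_wpM2r ?invr_ge0 ?exprn_ge0// ler_wpM2l// ler_nat.
Qed.

Lemma tn_homo T n i j : 0 <= T -> (i <= j)%N -> tn T n i <= tn T n j.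
Proof. by move=> T0 ij; apply: (homo_leq (r := fun x y : R => x <= y)) ij => //; [exact: le_trans|move=> k; exact: tnS]. Qed.

Lemma tn_step T (n k : nat) : 0 <= T -> tn T n k.+1 - tn T n k <= T / 2 ^+ n.
Proof.
move=> T0; have [k2|k2] := leqP (2 ^ n) k.
  have h i : (2 ^ n <= i)%N -> tn T n i = T.
    by move=> hi; apply/eqP; rewrite eq_le tn_le -{1}(tn_end n T0) tn_homo.
  by rewrite !h ?leqW// subrr divr_ge0 ?exprn_ge0.
by rewrite !tnE// 1?ltnW// -mulrBl -mulrBr -natrB// subSnn mulr1.
Qed.

Lemma tn_refine T (n m k : nat) : tn T (n + m) (k * 2 ^ m) = tn T n k.
Proof.
rewrite /tn natrM natrX exprD; congr Num.min; field.
by rewrite !expf_neq0.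
Qed.

(* Index of the level-[n] interval containing the [k]-th level-[p] interval. *)
Definition pidx (p n k : nat) : nat := (k %/ 2 ^ (p - n))%N.

Lemma pidxP T (p n k : nat) : 0 <= T -> (n <= p)%N ->
  tn T n (pidx p n k) <= tn T p k /\ tn T p k.+1 <= tn T n (pidx p n k).+1.
Proof.
move=> T0 np; have hp : p = (n + (p - n))%N by rewrite subnKC.
have q0 : (0 < 2 ^ (p - n))%N by rewrite expn_gt0.
split.
  rewrite -(tn_refine T n (p - n)) -hp; apply: tn_homo => //; exact: leq_trunc_div.
rewrite -(tn_refine T n (p - n)) -hp; apply: tn_homo => //; exact: ltn_ceil.
Qed.

(** Clamping a grid of [0, T] to [s, t] collapses the cells outside, so that sums over the full
    dyadic grid produce increments over [s, t]. *)
Definition cl s t x : R := Num.max s (Num.min x t).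

Lemma cl_itv s t x : s <= t -> s <= cl s t x <= t.
Proof. by move=> st; rewrite /cl le_max lexx ge_max st ge_min lexx orbT. Qed.

Lemma cl_homo s t x y : x <= y -> cl s t x <= cl s t y.
Proof.
move=> xy; rewrite /cl ge_max le_max lexx/= le_max; apply/orP; right.
by rewrite le_min ge_min xy/= ge_min lexx orbT.
Qed.

Lemma cl_sub s t x y z : cl s t x <= z <= cl s t y -> cl s t x < cl s t y -> x <= z <= y.
Proof.
move=> /andP[h1 h2] h3; apply/andP; split.
  apply: le_trans h1; have [xt|tx] := leP x t.
    by rewrite /cl (min_idPl xt) le_max lexx orbT.
  move: h3; rewrite ltNge /cl (min_idPr (ltW tx)) => /negP[].
  rewrite ge_max; apply/andP; split; first by rewrite le_max lexx.
  by rewrite le_max; apply/orP; right; rewrite ge_min lexx orbT.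
apply: (le_trans h2); have [sy|ys] := leP s (Num.min y t).
  by rewrite /cl (max_idPr sy) ge_min lexx.
move: h3; rewrite ltNge {1}/cl (max_idPl (ltW ys)) => /negP[].
by rewrite /cl le_max lexx.
Qed.

Lemma cl_id s t x : s <= x <= t -> cl s t x = x.
Proof. by move=> /andP[sx xt]; rewrite /cl (min_idPl xt) (max_idPr sx). Qed.

Lemma cl_ge s t x : s <= t -> t <= x -> cl s t x = t.
Proof. by move=> st tx; rewrite /cl (min_idPr tx) (max_idPr st). Qed.

Lemma cl_le s t x : x <= s -> cl s t x = s.
Proof. by move=> xs; rewrite /cl; apply/max_idPl; rewrite ge_min xs. Qed.

Lemma Rint_sum f (u : nat -> R) (N : nat) : continuous f -> (forall k : nat, u k <= u k.+1) ->
  Rint f (u 0%N) (u N) = \sum_(k < N) Rint f (u k) (u k.+1).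
Proof.
move=> cf uS; elim: N => [|N IH]; first by rewrite big_ord0 Rint_point.
rewrite big_ord_recr/= -IH -Rint_add//.
by apply: (homo_leq (r := fun x y : R => x <= y)) (leq0n N) => //; exact: le_trans.
Qed.

(** The sample point may lie outside [s, t], but every point of a clamped cell that is not collapsed
    lies in the original cell, hence within one mesh of the sample point. *)
Lemma riemann_bound f T s t e (n : nat) : continuous f -> 0 <= T -> 0 <= s -> s <= t -> t <= T ->
  (forall x y, 0 <= x <= T -> `|x - y| <= T / 2 ^+ n -> `|f x - f y| <= e) ->
  `|\sum_(k < 2 ^ n) f (tn T n k) * (cl s t (tn T n k.+1) - cl s t (tn T n k)) - Rint f s t| <= e * (t - s).
Proof.
move=> cf T0 s0 st tT he.
pose u (k : nat) := cl s t (tn T n k).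
have uS (k : nat) : u k <= u k.+1 by apply: cl_homo; exact: tnS.
have u0 : u 0%N = s by rewrite /u tn0// cl_le.
have uN : u (2 ^ n)%N = t by rewrite /u tn_end// cl_ge.
have e0 : 0 <= e by apply: le_trans (he 0 0 _ _); rewrite ?subrr ?normr0 ?lexx ?divr_ge0 ?exprn_ge0.
have -> : Rint f s t = \sum_(k < 2 ^ n) Rint f (u k) (u k.+1).
  by rewrite -(Rint_sum (2 ^ n) cf uS) u0 uN.
rewrite -sumrB.
apply: (le_trans (ler_norm_sum _ _ _)).
have -> : e * (t - s) = \sum_(k < 2 ^ n) e * (u k.+1 - u k).
  rewrite -mulr_sumr; congr (_ * _).
  by rewrite -(big_mkord xpredT (fun k : nat => u k.+1 - u k)) telescope_sumr// uN u0.
apply: ler_sum => k _; have := uS k; rewrite le_eqVlt => /predU1P[ue|ul].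
  by rewrite -/(u k) -/(u k.+1) -ue subrr !mulr0 Rint_point subrr normr0.
apply: Rint_dist => //; first exact: uS.
move=> x xu; apply: he.
  by rewrite tn_ge0// tn_le.
have /andP[h1 h2] := cl_sub xu ul.
rewrite distrC ger0_norm; last by rewrite subr_ge0.
by apply: le_trans (tn_step n k T0); rewrite lerB.
Qed.

Lemma grid_mesh T r : 0 <= T -> 0 < r -> \forall n \near \oo, T / 2 ^+ n <= r.
Proof.
move=> T0 r0; have : T / 2 ^+ n @[n --> \oo] --> (0 : R).
  rewrite -(mulr0 T); apply: seqZ.
  have := @cvg_geometric R 1 (2^-1) _; rewrite ger0_norm ?invr_ge0// invf_lt1// => /(_ (ltr1n _ 2)).
  by apply: seq_eq => n; rewrite /geometric/= mul1r exprVn.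
move=> /cvgrPdist_le /(_ _ r0); apply: filterS => n; rewrite sub0r normrN.
by rewrite ger0_norm// divr_ge0// exprn_ge0.
Qed.

Lemma riemann f T s t : continuous f -> 0 <= T -> 0 <= s -> s <= t -> t <= T ->
  \sum_(k < 2 ^ n) f (tn T n k) * (cl s t (tn T n k.+1) - cl s t (tn T n k))
    @[n --> \oo] --> Rint f s t.
Proof.
move=> cf T0 s0 st tT; apply/cvgrPdist_le => e e0.
have ts0 : 0 < t - s + 1 by rewrite ltr_wpDl// subr_ge0.
have [r r0 hr] := unif_mod T cf (divr_gt0 e0 ts0).
apply: filterS (grid_mesh T0 r0) => n hn.
rewrite distrC; apply: (le_trans (riemann_bound (e := e / (t - s + 1)) cf T0 s0 st tT _)).
  by move=> x y xT xy; apply: hr => //; exact: le_trans hn.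
rewrite mulrAC ler_pdivrMr// ler_pM2l//; lra.
Qed.

End continuous_functions.

(** * Wiener integrals *)

Section continuous_vectors.
Variables (R : realType) (d : nat).
Implicit Types (sigma eta : R -> 'rV[R]_d).

Definition contv sigma := forall i, continuous (fun t => sigma t ord0 i).

Lemma continuous_sum (I : Type) (s : seq I) (h : I -> R -> R) :
  (forall i, continuous (h i)) -> continuous (fun t => \sum_(i <- s) h i t).
Proof.
move=> ch; elim: s => [|i s IH] t.
  rewrite (_ : (fun t => _) = (fun=> 0)); first exact: cvg_cst.
  by apply/funext => r; rewrite big_nil.
rewrite (_ : (fun t => _) = (fun t => h i t + \sum_(i <- s) h i t)); last first.
  by apply/funext => r; rewrite big_cons.
by apply: cvgD; [exact: ch|exact: IH].
Qed.

Lemma contv_dotv sigma eta : contv sigma -> contv eta -> continuous (fun t => dotv (sigma t) (eta t)).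
Proof. by move=> c1 c2; apply: continuous_sum => i t; apply: cvgM; [exact: c1|exact: c2]. Qed.

Lemma contv_normsq sigma : contv sigma -> continuous (fun t => normsq (sigma t)).
Proof. by move=> c1; apply: contv_dotv. Qed.

Lemma contvD sigma eta : contv sigma -> contv eta -> contv (fun t => sigma t + eta t).
Proof.
move=> c1 c2 i; rewrite (_ : (fun t => _) = (fun t => sigma t ord0 i + eta t ord0 i)); last first.
  by apply/funext => t; rewrite mxE.
by move=> t; apply: cvgD; [exact: c1|exact: c2].
Qed.

Lemma contvZ k sigma : contv sigma -> contv (fun t => k *: sigma t).
Proof.
move=> c1 i; rewrite (_ : (fun t => _) = (fun t => k * sigma t ord0 i)); last first.
  by apply/funext => t; rewrite mxE.
by move=> t; apply: cvgM; [exact: cvg_cst|exact: c1].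
Qed.

Lemma contvN sigma : contv sigma -> contv (fun t => - sigma t).
Proof.
move=> c1; rewrite (_ : (fun t => _) = (fun t => (-1) *: sigma t)); first exact: contvZ.
by apply/funext => t; rewrite scaleN1r.
Qed.

Lemma contv_cst c : contv (fun=> c).
Proof. by move=> i t; exact: cvg_cst. Qed.

Lemma contv_mod sigma T e : contv sigma -> 0 < e ->
  exists2 r, 0 < r & forall x y, 0 <= x <= T -> `|x - y| <= r -> normsq (sigma x - sigma y) <= e.
Proof.
(* Since [e' <= 1], squares are again bounded by [e']; [d.+1] avoids a division by zero. *)
move=> cs e0; pose e' := Num.min 1 (e / d.+1%:R).
have e'0 : 0 < e' by rewrite lt_min ltr01 divr_gt0.
have /choice[r hr] : forall i, exists r, 0 < r /\ forall x y, 0 <= x <= T -> `|x - y| <= r ->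
    `|sigma x ord0 i - sigma y ord0 i| <= e'.
  by move=> i; have [r r0 h] := unif_mod T (cs i) e'0; exists r.
exists (\big[Num.min/1]_i r i).
  by apply: lt_bigmin => // i _; case: (hr i).
move=> x y xT xy; rewrite /normsq /dotv.
apply: (@le_trans _ _ (\sum_(i < d) e')).
  apply: ler_sum => i _; rewrite !mxE -expr2.
  have h : `|sigma x ord0 i - sigma y ord0 i| <= e'.
    by apply: (hr i).2 => //; apply: (le_trans xy); exact: bigmin_le.
  have h1 : e' <= 1 by rewrite ge_min lexx.
  rewrite -real_normK ?num_real//; apply: (@le_trans _ _ (e' ^+ 2)).
    by rewrite ler_sqr ?nnegrE// ltW.
  by rewrite expr2 ger_pMr.
rewrite sumr_const card_ord -[e' *+ d]mulr_natr.
apply: (@le_trans _ _ (e / d.+1%:R * d%:R)).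
  by rewrite ler_wpM2r// ge_min lexx orbT.
by rewrite mulrAC ler_pdivrMr// ler_pM2l// ler_nat.
Qed.

Lemma seq_sub (u : nat -> R) (nj : nat -> nat) (l : R) : (forall j, (j <= nj j)%N) ->
  u n @[n --> \oo] --> l -> u (nj j) @[j --> \oo] --> l.
Proof.
move=> hn hu; apply: (cvg_comp nj u _ hu).
move=> A [N _ hA]; exists N => // j /= Nj; apply: hA => /=; exact: leq_trans (hn j).
Qed.

(** Subtracting and adding the geometric tail [q] gives an increasing and a decreasing sequence
    around [u], which provide both the limit and the explicit rate. *)
Lemma geom_cauchy (u : nat -> R) (J : nat) :
  (forall j, (J <= j)%N -> `|u j.+1 - u j| <= 2^-1 ^+ j) ->
  u j @[j --> \oo] --> lim (u @ \oo) /\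
  (forall j, (J <= j)%N -> `|u j - lim (u @ \oo)| <= 2 * 2^-1 ^+ j).
Proof.
move=> hu; pose q j : R := 2 * 2^-1 ^+ j.
have qS j : q j = q j.+1 + 2^-1 ^+ j 
  by rewrite /q exprS [2 * (_ * _)]mulrA mulfV ?mul1r ?pnatr_eq0// mulr_natl mulr2n.
have q0 j : 0 <= q j by rewrite mulr_ge0// exprn_ge0// invr_ge0.
pose a j := u (J + j)%N - q (J + j)%N.
pose b j := u (J + j)%N + q (J + j)%N.
have aS j : a j <= a j.+1.
  have := hu (J + j)%N (leq_addr _ _); rewrite /a addnS ler_norml (qS (J + j)%N); lra.
have bS j : b j.+1 <= b j.
  have := hu (J + j)%N (leq_addr _ _); rewrite /b addnS ler_norml (qS (J + j)%N); lra.
have ab j : a j <= b j by rewrite /a /b; have := q0 (J + j)%N; lra.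
have amono i j : (i <= j)%N -> a i <= a j.
  by move=> ij; apply: (homo_leq (r := fun x y : R => x <= y)) ij => //; exact: le_trans.
have bmono i j : (i <= j)%N -> b j <= b i.
  by move=> ij; apply: (homo_leq (r := fun x y : R => y <= x)) ij => // ? ? ? h1 h2; exact: le_trans h2 h1.
have ca : cvgn a.
  apply: nondecreasing_is_cvgn; first by move=> i j; exact: amono.
  exists (b 0%N) => _ [j _ <-]; exact: le_trans (ab j) (bmono _ _ (leq0n j)).
have cq : q j @[j --> \oo] --> (0 : R).
  rewrite -(mulr0 2); apply: seqZ.
  have := @cvg_geometric R 1 (2^-1) _; rewrite ger0_norm ?invr_ge0// invf_lt1// => /(_ (ltr1n _ 2)).
  by apply: seq_eq => n; rewrite /geometric/= mul1r.
have cu : u j @[j --> \oo] --> lim (a @ \oo).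
  rewrite -(cvg_shiftn J).
  have cq' : q (J + j)%N @[j --> \oo] --> (0 : R) by apply: (seq_sub (u := q)) => // j; exact: leq_addl.
  have := seqD ca cq'; rewrite addr0; apply: seq_eq => n.
  by rewrite /a addnC subrK.
have -> : lim (u @ \oo) = lim (a @ \oo) by exact/cvg_lim.
split => // j Jj; have hj : (J + (j - J) = j)%N by rewrite subnKC.
have h1 : a (j - J)%N <= lim (a @ \oo).
  by apply: nondecreasing_cvgn_le => //; move=> i k; exact: amono.
have h2 : lim (a @ \oo) <= b (j - J)%N.
  apply: (seq_leC (u := fun i => a ((j - J) + i)%N)); last first.
    by apply: (seq_sub (u := a)) => // i; exact: leq_addl.
  by move=> i; apply: (le_trans (ab _)); apply: bmono; exact: leq_addr.
by move: h1 h2; rewrite /a /b hj ler_norml /q => h1 h2; apply/andP; split; lra.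
Qed.

Lemma uniform_lim_continuous (u : nat -> R -> R) (f : R -> R) (J : nat) :
  (forall j, continuous (u j)) ->
  (forall j t, (J <= j)%N -> `|u j t - f t| <= 2 * 2^-1 ^+ j) -> continuous f.
Proof.
move=> cu hu t; apply/cvgrPdist_le => e e0.
have cq : 2 * 2^-1 ^+ j @[j --> \oo] --> (0 : R).
  rewrite -(mulr0 2); apply: seqZ.
  have := @cvg_geometric R 1 (2^-1) _; rewrite ger0_norm ?invr_ge0// invf_lt1// => /(_ (ltr1n _ 2)).
  by apply: seq_eq => n; rewrite /geometric/= mul1r.
have e30 : 0 < e / 3 by rewrite divr_gt0.
have /cvgrPdist_le/(_ _ e30) [N _ hN] := cq.
pose j := maxn J N.
have qj : 2 * 2^-1 ^+ j <= e / 3.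
  have := hN j (leq_maxr _ _); rewrite sub0r normrN ger0_norm//.
have /cvgrPdist_le/(_ _ e30) := cu j t; apply: filterS => s hs.
have h1 := hu j t (leq_maxl _ _); have h2 := hu j s (leq_maxl _ _).
apply: (le_trans (ler_distD (u j t) _ _)); rewrite distrC.
have := ler_distD (u j s) (u j t) (f s); lra.
Qed.

End continuous_vectors.

(** * Ito sums of a deterministic integrand and their limit *)

Section step_integrals.
Context (R : realType) (disp : measure_display) (Omega : measurableType disp)
  (P : probability Omega R) (d : nat) (T : R) (W : R -> Omega -> 'rV[R]_d).
Hypothesis T0 : 0 < T.
Hypothesis bm : brownian_motion P T W.
Local Notation E f := (\int[P]_w f w).
Local Notation Fm := (Fm P W).
Variable sigma : R -> 'rV[R]_d.
Hypothesis cs : contv sigma.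
Local Notation mu := (@lebesgue_measure R).
Let T0' : 0 <= T := ltW T0.

Definition Sint (n : nat) t w := \sum_(k < 2 ^ n) dotv (sigma (tn T n k))
  (W (Num.min (tn T n k.+1) t) w - W (Num.min (tn T n k) t) w).

Lemma min_cl s t x w : s <= t ->
  W (Num.min x t) w - W (Num.min x s) w = W (cl s t x) w - W s w.
Proof.
move=> st; have [xs|sx] := leP x s.
  by rewrite (min_idPl (le_trans xs st)) cl_le// !subrr.
have [xt|tx] := leP x t; first by rewrite cl_id// (ltW sx).
by rewrite cl_ge// ltW.
Qed.

Lemma Sint_incr n s t w : s <= t -> Sint n t w - Sint n s w =
  gsum W (fun k => cl s t (tn T n k)) (fun k => sigma (tn T n k)) (2 ^ n) w.
Proof.
move=> st; rewrite /Sint /gsum -sumrB; apply: eq_bigr => k _.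
rewrite -dotvBr; congr dotv.
have := min_cl (tn T n k.+1) w st; have := min_cl (tn T n k) w st.
set A := W (Num.min _ t) w; set B := W (Num.min _ s) w; set A' := W (Num.min _ t) w.
set B' := W (Num.min _ s) w => e1 e2.
by rewrite opprB [B - B']addrC addrACA [- A + B]addrC -[B - A]opprB e1 e2 opprB addrA subrK.
Qed.

Lemma Sint0 n w : Sint n 0 w = 0.
Proof.
rewrite /Sint big1// => k _.
by rewrite !(min_idPr _) ?tn_ge0// subrr dotv0.
Qed.

Lemma Sint_local n k s t w : (k < 2 ^ n)%N -> tn T n k <= s -> s <= t -> t <= tn T n k.+1 ->
  Sint n t w - Sint n s w = dotv (sigma (tn T n k)) (W t w - W s w).
Proof.
move=> kn ks st tk; rewrite Sint_incr// /gsum (bigD1 (Ordinal kn))//=.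
rewrite cl_ge// cl_le// big1 ?addr0// => i ni.
have [ik|ki|e] := ltngtP i k.
- have h : tn T n i.+1 <= s by apply: le_trans ks; exact: tn_homo.
  by rewrite !cl_le// ?subrr ?dotv0// (le_trans _ h)// tnS.
- have h : t <= tn T n i by apply: (le_trans tk); exact: tn_homo.
  by rewrite !cl_ge// ?subrr ?dotv0// (le_trans h)// tnS.
- by move: ni; rewrite -val_eqE/= e eqxx.
Qed.

(** On a common refinement both step integrands are constant on each cell, so at grid points the
    difference is again a sum of increments with deterministic coefficients. *)
Lemma Sint_diff n m p j w : (n <= p)%N -> (m <= p)%N -> (j <= 2 ^ p)%N ->
  Sint n (tn T p j) w - Sint m (tn T p j) w =
  gsum W (tn T p) (fun k => sigma (tn T n (pidx p n k)) - sigma (tn T m (pidx p m k))) j w.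
Proof.
move=> np mp; elim: j => [|j IH] jp.
  by rewrite tn0// !Sint0 subrr /gsum big_ord0.
have idx q : (q <= p)%N -> (pidx p q j < 2 ^ q)%N.
  by move=> qp; rewrite /pidx ltn_divLR ?expn_gt0// -expnD subnKC.
have loc q : (q <= p)%N -> Sint q (tn T p j.+1) w - Sint q (tn T p j) w =
    dotv (sigma (tn T q (pidx p q j))) (W (tn T p j.+1) w - W (tn T p j) w).
  move=> qp; have [h1 h2] := pidxP j T0' qp.
  by apply: Sint_local => //; [exact: idx|exact: tnS].
rewrite gsumS -IH; last exact: ltnW.
by rewrite dotvBl -(loc n np) -(loc m mp); ring.
Qed.

Lemma Fm_Sint n t : 0 <= t <= T -> Fm t (Sint n t).
Proof.
move=> /andP[t0 tT]; apply: (Fm_sum bm) => // k; apply: (Fm_dotW bm) => //.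
  by rewrite le_min tn_ge0// t0/= ge_min lexx orbT.
by rewrite le_min tn_ge0// t0/= ge_min lexx orbT.
Qed.

Definition contW w := forall i, continuous (fun t => W (clamp T t) w ord0 i).

Lemma contW_ae : {ae P, forall w, contW w}.
Proof.
case: bm => _ _ _; apply: filterS => w hw i t.
have := @continuous_on_clamp R T _ (W ^~ w) T0' hw t => h.
exact: (continuous_comp h (@coord_continuous _ _ _ ord0 i _)).
Qed.

Lemma Sint_continuous n w : contW w -> continuous (fun t => Sint n (clamp T t) w).
Proof.
move=> cW; apply: continuous_sum => k; apply: continuous_sum => i t.
apply: cvgM; first exact: cvg_cst.
have h x : 0 <= x <= T -> continuous (fun t => W (Num.min x (clamp T t)) w ord0 i).
  move=> xT; have -> : (fun t => W (Num.min x (clamp T t)) w ord0 i) =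
     (fun t => W (clamp T (Num.min x (clamp T t))) w ord0 i).
    apply/funext => s; rewrite (clampE (t := Num.min _ _))//.
    have /andP[c0 cT] := clamp_itv s T0'; have /andP[x0 xT'] := xT.
    by rewrite le_min x0 c0 ge_min xT'.
  have c : continuous (fun t => Num.min x (clamp T t)).
    have -> : (fun t => Num.min x (clamp T t)) = (fun t => (x + clamp T t - `|x - clamp T t|) / 2).
      by apply/funext => r; rewrite minr_absE.
    move=> s; apply: cvgM; last exact: cvg_cst.
    apply: cvgB; first by apply: cvgD; [exact: cvg_cst|exact: continuous_clamp].
    by apply: cvg_norm; apply: cvgB; [exact: cvg_cst|exact: continuous_clamp].
  by move=> s; exact: (continuous_comp (c s) (cW i _)).
rewrite (_ : (fun t => _) = (fun t => W (Num.min (tn T n k.+1) (clamp T t)) w ord0 i -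
    W (Num.min (tn T n k) (clamp T t)) w ord0 i)); last by apply/funext => s; rewrite !mxE.
rewrite !mxE.
by apply: cvgB; apply: h; rewrite tn_ge0// tn_le.
Qed.

Lemma grid_dense t p : 0 <= t <= T -> exists2 i, (i <= 2 ^ p)%N & `|t - tn T p i| <= T / 2 ^+ p.
Proof.
move=> /andP[t0 tT].
have h : exists i, (i <= 2 ^ p)%N && (t <= tn T p i).
  by exists (2 ^ p)%N; rewrite leqnn tn_end.
case: (ex_minnP h) => -[|i] /andP[ip ti] hmin.
  exists 0%N => //; move: ti; rewrite tn0// => ti.
  have -> : t = 0 by apply/eqP; rewrite eq_le ti.
  by rewrite subrr normr0 divr_ge0 ?exprn_ge0.
exists i.+1 => //; rewrite distrC ger0_norm ?subr_ge0//.
apply: le_trans (tn_step p i T0'); rewrite lerB// leNgt; apply/negP => hi.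
by have := hmin i; rewrite (ltnW ip) (ltW hi) ltnn => /(_ isT).
Qed.

(* On the grid events the difference of two step integrals is a sum of
   Brownian increments, so Ville's inequality applies. *)
Lemma Sint_maximal n m p e l (k : R) : (n <= m)%N -> (m <= p)%N -> 0 < k ->
  (forall x y, 0 <= x <= T -> `|x - y| <= T / 2 ^+ n -> normsq (sigma x - sigma y) <= e) ->
  (P [set w | exists2 i, (i <= 2 ^ p)%N & (l <= `|Sint n (tn T p i) w - Sint m (tn T p i) w|)%R] <=
   (2 * expR (k ^+ 2 * (e * T) / 2 - k * l))%:E)%E.
Proof.
move=> nm mp k0 he; have np := leq_trans nm mp.
(* The left endpoints of the two cells around one fine cell are at most the coarser mesh apart,
   which bounds each coefficient by [e] and the total variance by [e * T]. *)
pose c (j : nat) := sigma (tn T n (pidx p n j)) - sigma (tn T m (pidx p m j)).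
have cb j : (j < 2 ^ p)%N -> normsq (c j) <= e.
  move=> jp; apply: he; first by rewrite tn_ge0// tn_le.
  have [a1 a2] := pidxP j T0' np; have [b1 b2] := pidxP j T0' mp.
  have := tn_step n (pidx p n j) T0'; have := tn_step m (pidx p m j) T0'.
  have h : T / 2 ^+ m <= T / 2 ^+ n.
    by rewrite ler_wpM2l// lef_pV2 ?posrE ?exprn_gt0// ler_weXn2l// ler1n.
  have := tnS p j T0'.
  rewrite ler_norml => h1 h2 h3; apply/andP; split; lra.
have hv : gvar (tn T p) c (2 ^ p) <= e * T.
  have e0 : 0 <= e by apply: le_trans (he 0 0 _ _); rewrite ?normsq_ge0 ?subrr ?normr0 ?lexx ?divr_ge0 ?exprn_ge0.
  apply: (@le_trans _ _ (\sum_(k < 2 ^ p) e * (tn T p k.+1 - tn T p k))).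
    by apply: ler_sum => j _; rewrite ler_wpM2r ?cb// subr_ge0 tnS.
  rewrite -mulr_sumr ler_wpM2l// -(big_mkord xpredT (fun k : nat => tn T p k.+1 - tn T p k)).
  by rewrite telescope_sumr// tn_end// tn0// subr0.
have u0 : 0 <= tn T p 0 by rewrite tn0.
have mx cc := maximal_ineq bm cc u0 (tn_le T p) (fun k => tnS p k T0') (2 ^ p) l k0.
have gN (j : nat) w : gsum W (tn T p) (fun k => - c k) j w = - gsum W (tn T p) c j w.
  by rewrite /gsum -sumrN; apply: eq_bigr => i _; rewrite dotvNl.
have vN : gvar (tn T p) (fun k => - c k) (2 ^ p) = gvar (tn T p) c (2 ^ p).
  by apply: eq_bigr => i _; rewrite normsqN.
pose A cc := [set w | exists2 j, (j <= 2 ^ p)%N & l <= gsum W (tn T p) cc j w].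
have mA cc : measurable (A cc).
  have -> : A cc = \bigcup_(j in [set j | (j <= 2 ^ p)%N]) [set w | l <= gsum W (tn T p) cc j w].
    by apply/seteqP; split => [w [j jp h]|w [j jp h]]; exists j.
  apply: bigcup_measurable => j _.
  have := Fm_meas (Fm_gsum bm cc u0 (tn_le T p) (fun k => tnS p k T0') j) => hm.
  have := hm measurableT _ (measurable_itv `[l, +oo[); rewrite setTI; congr measurable.
  by apply/seteqP; split => w; rewrite /= in_itv/= andbT.
have sub : [set w | exists2 i, (i <= 2 ^ p)%N & (l <= `|Sint n (tn T p i) w - Sint m (tn T p i) w|)%R]
   = A c `|` A (fun k => - c k).
  apply/seteqP; split => [w [i ip]|w [[i ip]|[i ip]]] h.
  - move: h; rewrite Sint_diff// -/c => h; have := h; rewrite ler_normr => /orP[h1|h1].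
      by left; exists i.
    by right; exists i => //; rewrite gN.
  - by exists i => //; rewrite Sint_diff// (le_trans h)// ler_norm.
  - by exists i => //; rewrite Sint_diff// (le_trans h)// gN -normrN ler_norm.
rewrite sub; apply: (le_trans (measureU2 P (mA _) (mA _))).
have bd cc : gvar (tn T p) cc (2 ^ p) <= e * T ->
    (P (A cc) <= (expR (k ^+ 2 * (e * T) / 2 - k * l))%:E)%E.
  move=> hcc; apply: (le_trans (mx cc)).
  rewrite lee_fin ler_expR lerB// ler_pM2r ?invr_gt0// ler_pM2l// exprn_gt0//.
rewrite mulr_natl mulr2n EFinD; apply: leeD; apply: bd => //.
by rewrite vN.
Qed.

(** The levels [nj] grow so fast that consecutive step integrals differ by at most 2^-j uniformly in
    time, off an event of summable probability. Borel-Cantelli then gives uniform convergence of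
    almost all paths, and the value 0 on the remaining null set makes every path continuous. *)
Lemma wiener_limit : exists (I : R -> Omega -> R) (nj : nat -> nat),
  [/\ forall j, (j <= nj j)%N, forall t, 0 <= t <= T -> Fm t (I t),
      forall w, continuous (I ^~ w), forall w, I 0 w = 0 &
      {ae P, forall w, forall t, 0 <= t <= T -> Sint (nj j) t w @[j --> \oo] --> I t w}].
Proof.
(* With threshold 2^-j and parameter 4^j in [Sint_maximal] the exponent becomes 1/2 - 2^j, whose
   exponentials are summable. *)
pose e j : R := 16^-1 ^+ j / T.
have e0 j : 0 < e j by rewrite divr_gt0// exprn_gt0.
have /choice[n0 hn0] : forall j, exists n0, forall n, (n0 <= n)%N -> forall x y, 0 <= x <= T ->
    `|x - y| <= T / 2 ^+ n -> normsq (sigma x - sigma y) <= e j.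
  move=> j; have [r r0 hr] := contv_mod T cs (e0 j).
  have [N _ hN] := grid_mesh T0' r0; exists N => n Nn x y xT xy.
  by apply: hr => //; apply: (le_trans xy); exact: hN.
(* Summing makes the levels nondecreasing and at least [j], so that they define a passage to the
   limit. *)
pose nj j := (\sum_(i < j.+1) (n0 i).+1)%N.
have njS j : nj j.+1 = (nj j + (n0 j.+1).+1)%N by rewrite /nj big_ord_recr.
have nj_le j : (nj j <= nj j.+1)%N by rewrite njS leq_addr.
have nj_ge j : (j <= nj j)%N.
  by elim: j => // j IH; rewrite njS addnS ltnS (leq_trans IH)// leq_addr.
have nj_n0 j : (n0 j <= nj j)%N.
  case: j => [|j]; first by rewrite /nj big_ord_recl big_ord0 addn0.
  by rewrite njS addnS (leq_trans _ (leqnSn _))// leq_addl.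
pose D j t w := Sint (nj j) t w - Sint (nj j.+1) t w.
(* The crossing is tested on grids refined by [q] further levels. These events increase with [q],
   and their bound does not depend on [q]. *)
pose A j q := [set w | exists2 i, (i <= 2 ^ (nj j.+1 + q))%N &
   2^-1 ^+ j <= `|D j (tn T (nj j.+1 + q) i) w|].
have mA j q : measurable (A j q).
  have -> : A j q = \bigcup_(i in [set i | (i <= 2 ^ (nj j.+1 + q))%N])
      [set w | 2^-1 ^+ j <= `|D j (tn T (nj j.+1 + q) i) w|].
    by apply/seteqP; split => [w [i ip h]|w [i ip h]]; exists i.
  apply: bigcup_measurable => i _.
  have ht : 0 <= tn T (nj j.+1 + q) i <= T by rewrite tn_ge0// tn_le.
  have hm : measurable_fun [set: Omega] (fun w => `|D j (tn T (nj j.+1 + q) i) w|).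
    apply: measurableT_comp => //; apply: measurable_funB; exact: Fm_meas (Fm_Sint _ ht).
  have := hm measurableT _ (measurable_itv `[(2^-1 ^+ j : R), +oo[); rewrite setTI; congr measurable.
  by apply/seteqP; split => w; rewrite /= in_itv/= andbT.
(* The bound is put in the form of the geometric series that is summed below. *)
have PA j q : (P (A j q) <= (8 / (2 ^ (j + 1))%:R)%:E)%E.
  have k0 : 0 < (4 ^+ j : R) by rewrite exprn_gt0.
  have := @Sint_maximal (nj j) (nj j.+1) (nj j.+1 + q) (e j) (2^-1 ^+ j) (4 ^+ j) (nj_le j) (leq_addr _ _) k0
    (hn0 j _ (nj_n0 j)).
  move=> /le_trans; apply; rewrite lee_fin.
  have -> : (4 ^+ j) ^+ 2 * (e j * T) / 2 - 4 ^+ j * 2^-1 ^+ j = 2^-1 - 2 ^+ j :> R.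
    rewrite /e divfK ?gt_eqF// -exprM mulnC exprM -[4 ^+ j * _]exprMn -exprMn.
    have -> : (4 ^+ 2 * 16^-1 : R) = 1 by field.
    have -> : (4 * 2^-1 : R) = 2 by field.
    by rewrite expr1n mul1r.
  have y1 : 0 < (2 ^+ j : R) by rewrite exprn_gt0.
  rewrite expRD natrX exprD expr1.
  have h1 : expR (2^-1 : R) <= 2.
    have := expR_ge1Dx (- (2^-1) : R); have := expRxMexpNx_1 (2^-1 : R); have := expR_gt0 (2^-1 : R).
    nra.
  have h2 : expR (- (2 ^+ j)) <= (2 ^+ j)^-1 :> R.
    rewrite expRN lef_pV2 ?posrE ?expR_gt0//.
    by apply: le_trans (expR_ge1Dx _); rewrite ler_wpDl.
  have -> : 8 / (2 ^+ j * 2) = 2 * (2 * (2 ^+ j)^-1) :> R by field; rewrite gt_eqF.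
  by rewrite ler_pM2l// ler_pM ?expR_ge0.
have Amono j q : A j q `<=` A j q.+1.
  move=> w [i ip h]; exists (i * 2 ^ 1)%N.
    by rewrite addnS expn1 expnSr leq_mul2r ip orbT.
  have -> : (nj j.+1 + q.+1 = nj j.+1 + q + 1)%N by rewrite addnS addn1.
  by rewrite tn_refine.
pose EE j := \bigcup_q A j q.
have mE j : measurable (EE j) by exact: bigcupT_measurable.
have PE j : (P (EE j) <= (8 / (2 ^ (j + 1))%:R)%:E)%E.
  have cP := @nondecreasing_cvg_mu _ _ _ P (A j) (mA j) (mE j) _.
  have {}cP : (P \o A j) q @[q --> \oo] --> P (EE j).
    apply: cP; apply/nondecreasing_seqP => q; apply/subsetPset; exact: Amono.
  rewrite -(cvg_lim _ cP)//; apply: lime_le; first by apply/cvg_ex; eexists; exact: cP.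
  by apply: nearW => q; exact: PA.
have PL : P (lim_sup_set EE) = 0%E.
  apply: lim_sup_set_cvg0 => //.
  apply: (@le_lt_trans _ _ (\sum_(j <oo) (8 / (2 ^ (j + 1))%:R)%:E)%E).
    by apply: lee_nneseries => // j _; exact: PE.
  have := @cvg_geometric_eseries_half R 8 0 => /cvg_lim ->//.
  by rewrite ltry.
have mL : measurable (lim_sup_set EE).
  by apply: bigcap_measurable => // k _; apply: bigcup_measurable.
have [N1 [mN1 N10 sN1]] := contW_ae.
pose Bad := N1 `|` lim_sup_set EE.
have mBad : measurable Bad by exact: measurableU.
have PBad : P Bad = 0%E.
  apply/eqP; rewrite eq_le measure_ge0 andbT.
  by apply: (le_trans (measureU2 P mN1 mL)); rewrite -[leRHS]adde0; apply: leeD;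
    rewrite le_eqVlt; apply/orP; left; apply/eqP; [exact: N10|exact: PL].
have good w : ~ Bad w -> contW w /\ exists J, forall j t, (J <= j)%N ->
    `|Sint (nj j.+1) (clamp T t) w - Sint (nj j) (clamp T t) w| <= 2^-1 ^+ j.
  move=> nB; have cW : contW w by apply: contrapT => h; apply: nB; left; exact: sN1.
  split => //.
  have : ~ lim_sup_set EE w by move=> h; apply: nB; right.
  rewrite /lim_sup_set => /existsNP[J /not_implyP[_ hJ]]; exists J => j t Jj.
  have nE q : ~ A j q w by move=> h; apply: hJ; exists j => //; exists q.
  pose p q := (nj j.+1 + q)%N; set s := clamp T t.
  have sT : 0 <= s <= T by exact: clamp_itv.
  have /choice[i hi] : forall q, exists i, (i <= 2 ^ p q)%N /\ `|s - tn T (p q) i| <= T / 2 ^+ p q.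
    by move=> q; have [i i1 i2] := grid_dense (p q) sT; exists i.
  have cx : tn T (p q) (i q) @[q --> \oo] --> s.
    apply/cvgrPdist_le => r r0; have [N _ hN] := grid_mesh T0' r0; exists N => // q /= Nq.
    apply: (le_trans (hi q).2); apply: hN => /=; apply: (leq_trans Nq); exact: leq_addl.
  (* Grid points approximating [s] transfer the bound from the grids to [s], by continuity of the
     path. *)
  pose g x := `|D j (clamp T x) w|.
  have cg : continuous g.
    by move=> x; apply: cvg_norm; apply: cvgB; exact: Sint_continuous.
  have c2 : g (tn T (p q) (i q)) @[q --> \oo] --> g s by apply: continuous_cvg => //; exact: cg.
  have := seq_leC (c := 2^-1 ^+ j) _ c2; rewrite /g (clampE sT) distrC; apply => q.
  rewrite leNgt; apply/negP => h; apply: (nE q); exists (i q); first exact: (hi q).1.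
  by move: h; rewrite clampE; [exact: ltW|rewrite tn_ge0// tn_le].
pose I t w := if w \in Bad then 0 else lim (Sint (nj j) (clamp T t) w @[j --> \oo]).
have Igood w t : ~ Bad w -> Sint (nj j) (clamp T t) w @[j --> \oo] --> I t w.
  move=> nB; have [cW [J hJ]] := good w nB.
  rewrite /I memNset//; have [h _] := geom_cauchy (fun j => hJ j t).
  exact: h.
exists I, nj; split => //.
- move=> t tT; have tT' : t <= T by case/andP: tT.
  apply: (@Fm_lim _ _ _ _ _ _ _ bm t (fun j w => Sint (nj j) t w * \1_(~` Bad) w)) => //.
    move=> j; apply: (Fm_ae bm tT' (Fm_Sint (nj j) tT)).
      apply: measurable_funM; first exact: Fm_meas (Fm_Sint (nj j) tT).
      by apply: measurable_indic; exact: measurableC.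
    exists Bad; split => // w /= h; apply: contrapT => nB; apply: h.
    by rewrite indicE mem_set// mulr1.
  move=> w; have [B|nB] := pselect (Bad w).
    rewrite /I mem_set//; apply: (seq_eq (u := fun=> 0)); last exact: cvg_cst.
    by move=> n; rewrite indicE memNset ?mulr0//= => h; exact: h.
  have := Igood w t nB; rewrite (clampE tT); apply: seq_eq => j.
  by rewrite indicE mem_set// mulr1.
- move=> w; have [B|nB] := pselect (Bad w).
    have -> : I ^~ w = (fun=> 0) by apply/funext => t; rewrite /I mem_set.
    by move=> t; exact: cvg_cst.
  have [cW [J hJ]] := good w nB.
  apply: (@uniform_lim_continuous _ (fun j t => Sint (nj j) (clamp T t) w) _ J).
    by move=> j; exact: Sint_continuous.
  move=> j t Jj; rewrite /I memNset//.
  by have [_ h] := geom_cauchy (fun j => hJ j t); exact: h.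
- move=> w; rewrite /I; case: ifP => // _.
  rewrite clampE ?lexx//; apply/cvg_lim => //.
  by apply: (seq_eq (u := fun=> 0)); [move=> n; rewrite Sint0|exact: cvg_cst].
- exists Bad; split => // w /= h; apply: contrapT => nB; apply: h => t tT.
  by have := Igood w t nB; rewrite clampE.
Qed.

Lemma gsum_cst (u : nat -> R) c N w : gsum W u (fun=> c) N w = dotv c (W (u N) w - W (u 0%N) w).
Proof.
elim: N => [|N IH]; first by rewrite /gsum big_ord0 subrr dotv0.
by rewrite gsumS IH -dotvDr [X in dotv _ X]addrC addrA subrK.
Qed.

(** The exponential moments of the Ito sums along the clamped grids are explicit. Those with doubled
    coefficients bound the second moments, so that [vitali] applies. *)
Lemma wiener_exp I nj lam (c : 'rV[R]_d) s t (f : Omega -> R) M :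
  (forall j, (j <= nj j)%N) -> (forall t, 0 <= t <= T -> Fm t (I t)) ->
  {ae P, forall w, forall t, 0 <= t <= T -> Sint (nj j) t w @[j --> \oo] --> I t w} ->
  0 <= s -> s <= t -> t <= T -> Fm s f -> (forall w, 0 <= f w <= M) ->
  L1 P (fun w => f w * expR (lam * (I t w - I s w) + dotv c (W t w - W s w))) /\
  E (fun w => f w * expR (lam * (I t w - I s w) + dotv c (W t w - W s w))) =
  E f * expR (\int[mu]_(r in `[s, t]) normsq (lam *: sigma r + c) / 2).
Proof.
move=> hnj hI cI s0 st tT hf fM.
have sT := le_trans st tT; have t0 := le_trans s0 st.
pose h r := normsq (lam *: sigma r + c).
have ch : continuous h by apply: contv_normsq; apply: contvD; [exact: contvZ|exact: contv_cst].
pose u n k := cl s t (tn T n k).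
have uS n k : u n k <= u n k.+1 by apply: cl_homo; exact: tnS.
have u0 n : u n 0%N = s by rewrite /u tn0// cl_le.
have uN n : u n (2 ^ n)%N = t by rewrite /u tn_end// cl_ge.
have uT n k : u n k <= T by have /andP[_ h2] := cl_itv (tn T n k) st; exact: le_trans h2 tT.
have u00 n : 0 <= u n 0%N by rewrite u0.
pose V a n := gvar (u n) (fun k => a *: (lam *: sigma (tn T n k) + c)) (2 ^ n).
have VE a n : V a n = a ^+ 2 * \sum_(k < 2 ^ n) h (tn T n k) * (u n k.+1 - u n k).
  by rewrite /V /gvar mulr_sumr; apply: eq_bigr => k _; rewrite normsqZ mulrA.
pose X n w := lam * (Sint n t w - Sint n s w) + dotv c (W t w - W s w).
have XE a n w : gsum W (u n) (fun k => a *: (lam *: sigma (tn T n k) + c)) (2 ^ n) w = a * X n w.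
  rewrite /X Sint_incr// -{2}(uN n) -{2}(u0 n) -gsum_cst /gsum mulrDr !mulr_sumr -big_split/=.
  by apply: eq_bigr => k _; rewrite dotvZl dotvDl dotvZl; ring.
have f0 w : 0 <= f w by case/andP: (fM w).
have mf := Fm_meas hf.
have fb w : `|f w| <= M by rewrite ger0_norm//; case/andP: (fM w).
have f1 : L1 P f by apply: L1_bounded fb.
have f2 : L1 P (fun w => f w ^+ 2).
  apply: (@L1_bounded _ _ _ _ _ (M ^+ 2)) => [|w]; first exact: measurable_funX.
  by rewrite normrX ler_sqr ?nnegrE// (le_trans _ (fb w)).
have hfu n : Fm (u n 0%N) f by rewrite u0.
have hf2u n : Fm (u n 0%N) (fun w => f w ^+ 2).
  by rewrite u0; apply: (Fm_comp (h := fun y => y ^+ 2)) => //; exact: measurable_funX.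
have e1 n := @exp_gsum _ _ _ _ _ _ _ bm (u n) (fun k => 1 *: (lam *: sigma (tn T n k) + c)) (u00 n) (uT n) (uS n) (2 ^ n) f (hfu n) f0 f1.
have e2 n := @exp_gsum _ _ _ _ _ _ _ bm (u n) (fun k => 2 *: (lam *: sigma (tn T n k) + c)) (u00 n) (uT n) (uS n) (2 ^ n) _ (hf2u n) (fun w => sqr_ge0 (f w)) f2.
pose U j w := f w * expR (X (nj j) w).
pose UU w := f w * expR (lam * (I t w - I s w) + dotv c (W t w - W s w)).
have [B B0 hB] := continuous_bounded 0 T ch.
have Vb n : V 2 n / 2 <= 2 * (B * (t - s)).
  rewrite VE; have : \sum_(k < 2 ^ n) h (tn T n k) * (u n k.+1 - u n k) <= B * (t - s).
    apply: (@le_trans _ _ (\sum_(k < 2 ^ n) B * (u n k.+1 - u n k))).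
      apply: ler_sum => k _; rewrite ler_wpM2r ?subr_ge0//.
      by rewrite (le_trans (ler_norm _))// hB// tn_ge0// tn_le.
    by rewrite -mulr_sumr -(big_mkord xpredT (fun k : nat => u n k.+1 - u n k)) telescope_sumr// uN u0.
  lra.
have mW i : measurable_fun [set: Omega] (fun w => dotv c (W t w - W s w)).
  by apply: (@Fm_meas _ _ _ _ _ _ t); apply: (Fm_dotW bm) => //; rewrite ?s0 ?t0 ?lexx.
have mS n r : 0 <= r <= T -> measurable_fun [set: Omega] (Sint n r) by move=> hr; exact: Fm_meas (Fm_Sint n hr).
have sT' : 0 <= s <= T by rewrite s0 sT.
have tT' : 0 <= t <= T by rewrite t0 tT.
have mXX (S : R -> Omega -> R) : (forall r, 0 <= r <= T -> measurable_fun [set: Omega] (S r)) ->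
   measurable_fun [set: Omega] (fun w => f w * expR (lam * (S t w - S s w) + dotv c (W t w - W s w))).
  move=> hS; apply: measurable_funM => //; apply: measurableT_comp => //.
  apply: measurable_funD; last exact: mW.
  by apply: measurable_funM => //; apply: measurable_funB; apply: hS.
have UE2 n w : f w ^+ 2 * expR (gsum W (u n) (fun k => 2 *: (lam *: sigma (tn T n k) + c)) (2 ^ n) w) =
    (f w * expR (X n w)) ^+ 2.
  by rewrite XE exprMn expRM_natl.
have UE1 n w : f w * expR (gsum W (u n) (fun k => 1 *: (lam *: sigma (tn T n k) + c)) (2 ^ n) w) =
    f w * expR (X n w).
  by rewrite XE mul1r.
have [_ L cE] : [/\ L1 P (fun x => UU x ^+ 2), L1 P UU & E (U n) @[n --> \oo] --> E UU].
  apply: (@vitali _ _ _ P U UU (E (fun w => f w ^+ 2) * expR (2 * (B * (t - s))))).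
  - by move=> n; apply: (mXX (fun r => Sint (nj n) r)) => r hr; exact: mS.
  - by apply: mXX => r hr; exact: Fm_meas (hI r hr).
  - by move=> n w; rewrite mulr_ge0// expR_ge0.
  - by move=> w; rewrite mulr_ge0// expR_ge0.
  - apply: filterS cI => w hw; apply: seqZ; apply: continuous_cvg; first exact: continuous_expR.
    apply: seqD; last exact: cvg_cst.
    by apply: seqZ; apply: seqB; exact: hw.
  - by move=> n; apply: L1_eq (e2 (nj n)).1 => w; rewrite UE2.
  - move=> n; under eq_Rintegral do rewrite -UE2.
    rewrite (e2 (nj n)).2 ler_wpM2l ?ler_expR ?Vb//.
    by apply: Ege0 => w; exact: sqr_ge0.
split => //.
have cV : V 1 (nj j) @[j --> \oo] --> \int[mu]_(r in `[s, t]) h r.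
  apply: (seq_sub (u := V 1)) => //.
  by apply: seq_eq (riemann ch T0' s0 st tT) => n; rewrite VE expr1n mul1r.
have c2 : E f * expR (V 1 (nj j) / 2) @[j --> \oo] --> E f * expR (\int[mu]_(r in `[s, t]) h r / 2).
  apply: seqZ; apply: continuous_cvg; first exact: continuous_expR.
  by apply: seqM => //; exact: cvg_cst.
apply: (cvg_unique _ cE) => //.
apply: seq_eq c2 => j; rewrite -(e1 (nj j)).2.
by apply: eq_Rintegral => w _; rewrite UE1.
Qed.

End step_integrals.

(** * The Wiener integral and its moments given the past *)

Section wiener_integrals.
Context (R : realType) (disp : measure_display) (Omega : measurableType disp)
  (P : probability Omega R) (d : nat) (T : R) (W : R -> Omega -> 'rV[R]_d).
Hypothesis T0 : 0 < T.
Hypothesis bm : brownian_motion P T W.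
Local Notation E f := (\int[P]_w f w).
Local Notation Fm := (Fm P W).
Local Notation mu := (@lebesgue_measure R).
Local Notation Rint f a b := (\int[mu]_(x in `[a, b]) f x).
Let T0' : 0 <= T := ltW T0.

(* A continuous version of the Wiener integral, characterized by its joint
   exponential moments with the Brownian increments. *)
Definition wiener (sigma : R -> 'rV[R]_d) (I : R -> Omega -> R) : Prop :=
  [/\ contv sigma, forall t, 0 <= t <= T -> Fm t (I t), forall w, continuous (I ^~ w),
      forall w, I 0 w = 0 &
      forall lam (c : 'rV[R]_d) s t (f : Omega -> R) M,
        0 <= s -> s <= t -> t <= T -> Fm s f -> (forall w, 0 <= f w <= M) ->
        L1 P (fun w => f w * expR (lam * (I t w - I s w) + dotv c (W t w - W s w))) /\
        E (fun w => f w * expR (lam * (I t w - I s w) + dotv c (W t w - W s w))) =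
        E f * expR (\int[mu]_(r in `[s, t]) normsq (lam *: sigma r + c) / 2)].

Lemma wiener_exists sigma : contv sigma -> exists I, wiener sigma I.
Proof.
move=> cs; have [I [nj [h1 h2 h3 h4 h5]]] := wiener_limit T0 bm cs.
exists I; split => // lam c s t f M s0 st tT hf fM.
exact: (wiener_exp T0 bm cs lam c h1 h2 h5 s0 st tT hf fM).
Qed.

Lemma wienerZ k sigma I : wiener sigma I -> wiener (fun t => k *: sigma t) (fun t w => k * I t w).
Proof.
move=> [h1 h2 h3 h4 h5]; split.
- exact: contvZ.
- by move=> t tT; apply: (FmZ bm); [case/andP: tT|exact: h2].
- by move=> w t; apply: cvgM; [exact: cvg_cst|exact: h3].
- by move=> w; rewrite h4 mulr0.
move=> lam c s t f M s0 st tT hf fM.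
have [e1 e2] := h5 (lam * k) c s t f M s0 st tT hf fM.
have e w : f w * expR (lam * k * (I t w - I s w) + dotv c (W t w - W s w)) =
    f w * expR (lam * (k * I t w - k * I s w) + dotv c (W t w - W s w)).
  by rewrite -mulrBr mulrA.
split; first exact: L1_eq e e1.
rewrite -(Eeq _ e) e2.
by congr (_ * expR (_ / 2)); apply: eq_Rintegral => r _; rewrite scalerA.
Qed.

Lemma Fm_max0 t f : Fm t f -> Fm t (fun w => Num.max (f w) 0).
Proof. by apply: (Fm_comp (h := fun y : R => Num.max y 0)); exact: measurable_maxr. Qed.

Lemma L1_max0 f : L1 P f -> L1 P (fun w => Num.max (f w) 0).
Proof.
move=> f1; apply: L1_le (L1_norm f1) => [|w].
  by apply: measurable_maxr => //; exact: L1_meas f1.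
rewrite ger0_norm ?le_max ?lexx ?orbT//.
by have [|_] := leP (f w) 0; rewrite ?normr_ge0 ?ler_norm.
Qed.

Lemma max0_sub (x : R) : Num.max x 0 - Num.max (- x) 0 = x.
Proof. by rewrite !maxr_absE !subr0 normrN; field. Qed.

(** Reduces a moment identity to nonnegative weights by splitting [f] into positive and negative
    parts. *)
Lemma signed_ext t (h : Omega -> R) k : t <= T ->
  (forall f, Fm t f -> (forall w, 0 <= f w) -> L1 P f ->
     L1 P (fun w => f w * h w) /\ E (fun w => f w * h w) = E f * k) ->
  forall f, Fm t f -> L1 P f -> L1 P (fun w => f w * h w) /\ E (fun w => f w * h w) = E f * k.
Proof.
move=> tT H f hf f1.
have hN : Fm t (fun w => - f w).
  rewrite (_ : (fun w => _) = (fun w => -1 * f w)); last by apply/funext => w; rewrite mulN1r.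
  exact: (FmZ bm).
have LN : L1 P (fun w => - f w) by apply: L1_eq (L1Z (-1) f1) => w; rewrite mulN1r.
have p0 (g : Omega -> R) w : 0 <= Num.max (g w) 0 by rewrite le_max lexx orbT.
have [a1 a2] := H _ (Fm_max0 hf) (p0 f) (L1_max0 f1).
have [b1 b2] := H _ (Fm_max0 hN) (p0 _) (L1_max0 LN).
have e w : Num.max (f w) 0 * h w - Num.max (- f w) 0 * h w = f w * h w.
  by rewrite -mulrBl max0_sub.
split; first by apply: L1_eq (L1B a1 b1) => w; rewrite e.
rewrite -(Eeq _ e) EB// a2 b2 -mulrBl -EB; [|exact: L1_max0..].
by congr (_ * _); apply: Eeq => w; rewrite max0_sub.
Qed.

(** Removes the boundedness of the weight in [wiener], by truncation and monotone convergence. *)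
Lemma L1_mono_limit (f h : Omega -> R) k : measurable_fun [set: Omega] f ->
  measurable_fun [set: Omega] h -> (forall w, 0 <= f w) -> (forall w, 0 <= h w) -> L1 P f ->
  (forall n : nat, L1 P (fun w => Num.min (f w) n%:R * h w) /\
     E (fun w => Num.min (f w) n%:R * h w) = E (fun w => Num.min (f w) n%:R) * k) ->
  L1 P (fun w => f w * h w) /\ E (fun w => f w * h w) = E f * k.
Proof.
move=> mf mh f0 h0 f1 H.
have cf w : Num.min (f w) n%:R @[n --> \oo] --> f w.
  apply: cvg_near_cst; exists (Num.truncn (f w)).+1 => // n /= nf; apply/min_idPl.
  by apply: (le_trans (ltW (truncnS_gt _))); rewrite ler_nat.
have mn n : measurable_fun [set: Omega] (fun w => Num.min (f w) n%:R) by exact: measurable_minr.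
have n0 n w : 0 <= Num.min (f w) n%:R by rewrite le_min f0 ler0n.
have nmono m n w : (m <= n)%N -> Num.min (f w) m%:R <= Num.min (f w) n%:R.
  move=> mn'; rewrite le_min ge_min lexx/= ge_min; apply/orP; right.
  by rewrite ler_nat.
have Ln n : L1 P (fun w => Num.min (f w) n%:R).
  apply: L1_le f1 => // w; rewrite ger0_norm// ge_min lexx//.
have conv (g : Omega -> R) : measurable_fun [set: Omega] g -> (forall w, 0 <= g w) ->
  (\int[P]_w (Num.min (f w) n%:R * g w)%:E @[n --> \oo] --> \int[P]_w (f w * g w)%:E)%E.
  move=> mg g0.
  have e w : (f w * g w)%:E = limn (fun n => (Num.min (f w) n%:R * g w)%:E).
    apply/esym/cvg_lim => //; apply: cvg_EFin; first exact: nearW.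
    by apply: seqM => //; exact: cvg_cst.
  under [X in _ --> X]eq_integral do rewrite e.
  apply: cvg_monotone_convergence => //.
  - by move=> n; apply/measurable_EFinP; exact: measurable_funM.
  - by move=> n w _; rewrite lee_fin mulr_ge0.
  - by move=> w _ m n mn'; rewrite lee_fin ler_wpM2r// nmono.
have c1 := conv h mh h0.
have c2 := conv (fun=> 1) (measurable_cst _) (fun=> ler01).
have e2 n : (\int[P]_w (Num.min (f w) n%:R * h w)%:E = (E (fun w => Num.min (f w) n%:R) * k)%:E)%E.
  by rewrite (E_EFin (H n).1) (H n).2.
have c3 : E (fun w => Num.min (f w) n%:R) @[n --> \oo] --> E f.
  have -> : E f = fine (\int[P]_w (f w * 1)%:E)%E.
    by rewrite /Rintegral; congr fine; apply: eq_integral => w _; rewrite mulr1.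
  have f1' : L1 P (fun w => f w * 1) by apply: L1_eq f1 => w; rewrite mulr1.
  move: c2; rewrite (E_EFin f1') => /fine_cvg; apply: cvg_trans.
  apply: near_eq_cvg; apply: nearW => n /=; congr fine; apply: eq_integral => w _.
  by rewrite mulr1.
have e3 : (\int[P]_w (f w * h w)%:E = (E f * k)%:E)%E.
  have c4 : (\int[P]_w (Num.min (f w) n%:R * h w)%:E @[n --> \oo] --> (E f * k)%:E)%E.
    under eq_fun do rewrite e2; apply: cvg_EFin; first exact: nearW.
    by apply: seqM => //; exact: cvg_cst.
  exact: (cvg_unique _ c1 c4).
apply: L1_fin e3; first exact: measurable_funM.
by move=> w; rewrite mulr_ge0.
Qed.

Section moments.
Variables (sigma : R -> 'rV[R]_d) (I : R -> Omega -> R).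
Hypothesis wI : wiener sigma I.
Variables (s t : R).
Hypotheses (s0 : 0 <= s) (st : s <= t) (tT : t <= T).
Let sT : s <= T := le_trans st tT.
Let t0 : 0 <= t := le_trans s0 st.
Let cs : contv sigma. Proof. by case: wI. Qed.

Definition lin lam (c : 'rV[R]_d) w := lam * (I t w - I s w) + dotv c (W t w - W s w).
Definition quad lam (c : 'rV[R]_d) := Rint (fun r => normsq (lam *: sigma r + c)) s t.

Lemma Fm_lin lam c : Fm t (lin lam c).
Proof.
apply: (FmD bm) => //; last by apply: (Fm_dotW bm) => //; rewrite ?s0 ?t0 ?lexx.
case: wI => _ hI _ _ _; apply: (FmZ bm) => //; apply: (FmB bm) => //.
  by apply: hI; rewrite t0.
by apply: (Fm_mono st); apply: hI; rewrite s0.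
Qed.

Lemma linZ k lam c w : lin (k * lam) (k *: c) w = k * lin lam c w.
Proof. by rewrite /lin dotvZl [RHS]mulrDr mulrA. Qed.

Lemma linD lam c lam' c' w : lin (lam + lam') (c + c') w = lin lam c w + lin lam' c' w.
Proof. by rewrite /lin dotvDl mulrDl addrACA. Qed.

Lemma continuous_quad lam c : continuous (fun r => normsq (lam *: sigma r + c)).
Proof. by apply: contv_normsq; apply: contvD; [exact: contvZ|exact: contv_cst]. Qed.

Lemma quadZ k lam c : quad (k * lam) (k *: c) = k ^+ 2 * quad lam c.
Proof.
rewrite /quad -RintZ; last exact: continuous_quad.
by apply: Rint_eq => r _; rewrite -scalerA -scalerDr normsqZ.
Qed.

Lemma wiener_expL1 lam c (f : Omega -> R) : Fm s f -> L1 P f ->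
  L1 P (fun w => f w * expR (lin lam c w)) /\
  E (fun w => f w * expR (lin lam c w)) = E f * expR (quad lam c / 2).
Proof.
move: f; apply: (signed_ext sT) => f hf f0 f1.
apply: L1_mono_limit => //.
- exact: Fm_meas hf.
- exact: Fm_meas (Fm_expR (Fm_lin lam c)).
move=> n; case: wI => _ _ _ _ /(_ lam c s t (fun w => Num.min (f w) n%:R) n%:R s0 st tT); apply.
  apply: (Fm_comp (h := fun y : R => Num.min y n%:R)) => //.
  exact: measurable_minr.
by move=> w; rewrite le_min f0 ler0n ge_min lexx orbT.
Qed.

(** Given the past, [lin] is centred normal with variance [quad]: in the moment lemmas p = 0 and q =
    quad / 2. *)
Lemma wiener_exp_lin lam c (f : Omega -> R) : Fm s f -> (forall w, 0 <= f w) -> L1 P f ->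
  forall k, L1 P (fun w => f w * expR (k * lin lam c w)) /\
    E (fun w => f w * expR (k * lin lam c w)) = E f * expR (k * 0 + k ^+ 2 * (quad lam c / 2)).
Proof.
move=> hf f0 f1 k; have [h1 h2] := wiener_expL1 (k * lam) (k *: c) hf f1.
have e w : f w * expR (lin (k * lam) (k *: c) w) = f w * expR (k * lin lam c w) by rewrite linZ.
split; first exact: L1_eq e h1.
by rewrite -(Eeq _ e) h2 quadZ mulr0 add0r mulrA.
Qed.

Lemma wiener_mean lam c (f : Omega -> R) : Fm s f -> L1 P f ->
  L1 P (fun w => f w * lin lam c w) /\ E (fun w => f w * lin lam c w) = E f * 0.
Proof.
move: f; apply: (signed_ext sT) => f hf f0 f1.
have gu := wiener_exp_lin lam c hf f0 f1.
have mu' := Fm_meas (Fm_lin lam c).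
by split; [exact: (gauss_L1 (Fm_meas hf) mu' f0 gu)|exact: (gauss_mean (Fm_meas hf) mu' f0 gu)].
Qed.

Lemma wiener_sqr lam c (f : Omega -> R) : Fm s f -> L1 P f ->
  L1 P (fun w => f w * lin lam c w ^+ 2) /\ E (fun w => f w * lin lam c w ^+ 2) = E f * quad lam c.
Proof.
move: f; apply: (signed_ext sT) => f hf f0 f1.
have gu := wiener_exp_lin lam c hf f0 f1.
have mu' := Fm_meas (Fm_lin lam c).
split; first exact: (gauss_L1_sqr (Fm_meas hf) mu' f0 gu).
by rewrite (gauss_sqr (Fm_meas hf) mu' f0 gu); congr (_ * _); field.
Qed.

(** Polarization of [wiener_sqr]. *)
Lemma wiener_cov lam c lam' c' (f : Omega -> R) : Fm s f -> L1 P f ->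
  L1 P (fun w => f w * (lin lam c w * lin lam' c' w)) /\
  E (fun w => f w * (lin lam c w * lin lam' c' w)) =
  E f * Rint (fun r => dotv (lam *: sigma r + c) (lam' *: sigma r + c')) s t.
Proof.
move=> hf f1.
have [a1 a2] := wiener_sqr (lam + lam') (c + c') hf f1.
have [b1 b2] := wiener_sqr (lam + -1 * lam') (c + -1 *: c') hf f1.
have e w : 4^-1 * (f w * lin (lam + lam') (c + c') w ^+ 2 - f w * lin (lam + -1 * lam') (c + -1 *: c') w ^+ 2)
  = f w * (lin lam c w * lin lam' c' w).
  rewrite !linD linZ; by move: (lin lam c w) (lin lam' c' w) (f w) => x y z; field.
split; first by apply: (L1_eq e); exact/L1Z/L1B.
rewrite -(Eeq _ e) EZ ?EB//; last exact: L1B.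
rewrite a2 b2 -mulrBr mulrCA; congr (_ * _).
rewrite /quad -RintB; [|exact: continuous_quad..].
rewrite -RintZ; last by move=> r; apply: cvgB; exact: continuous_quad.
apply: Rint_eq => r _.
have -> : (lam + lam') *: sigma r + (c + c') = (lam *: sigma r + c) + (lam' *: sigma r + c').
  by rewrite scalerDl addrACA.
have -> : (lam + -1 * lam') *: sigma r + (c + -1 *: c') = (lam *: sigma r + c) - (lam' *: sigma r + c').
  by rewrite scalerDl addrACA -scalerA -scalerDr scaleN1r.
by rewrite normsqD normsqB; move: (normsq _) (normsq _) (dotv _ _) => x y z; field.
Qed.

Definition qvar := Rint (fun r => normsq (sigma r)) s t.

(** A Girsanov shift: under the exponential weight the increment of W in the direction [c] has mean
    int sigma'c. This integral is the linear coefficient [p] of the weighted exponential moments,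
    and [gauss_mean] reads it off. *)
Lemma wiener_exp_mean c (f : Omega -> R) : Fm s f -> L1 P f ->
  let h w := expR (I t w - I s w - qvar / 2) * dotv c (W t w - W s w) in
  L1 P (fun w => f w * h w) /\
  E (fun w => f w * h w) = E f * Rint (fun r => dotv (sigma r) c) s t.
Proof.
move=> + + h; move: f; apply: (signed_ext sT) => f hf f0 f1.
pose g w := f w * expR (lin 1 0 w).
pose p := Rint (fun r => dotv (sigma r) c) s t.
pose q := normsq c * (t - s) / 2.
have [g1 g2] := wiener_expL1 1 0 hf f1.
have q0 : quad 1 0 = qvar by apply: Rint_eq => r _; rewrite scale1r addr0.
have ge0 w : 0 <= g w by rewrite mulr_ge0// expR_ge0.
have mg : measurable_fun [set: Omega] g by exact: L1_meas g1.
have mu' := Fm_meas (Fm_lin 0 c).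
have quadE k : quad 1 (k *: c) / 2 = qvar / 2 + (k * p + k ^+ 2 * q).
  rewrite /quad /qvar /p /q.
  have ct1 := contv_normsq cs; have ct2 : continuous (fun r => dotv (sigma r) c) by apply: contv_dotv => //; exact: contv_cst.
  have -> : Rint (fun r => normsq (1 *: sigma r + k *: c)) s t =
     Rint (fun r => (normsq (sigma r) + (2 * k) * dotv (sigma r) c) + k ^+ 2 * normsq c) s t.
    by apply: Rint_eq => r _; rewrite scale1r normsqD dotvZr normsqZ mulrA.
  rewrite RintD; last 2 first.
  - by move=> r; apply: cvgD; [exact: ct1|apply: cvgM; [exact: cvg_cst|exact: ct2]].
  - by move=> r; exact: cvg_cst.
  rewrite RintD; last 2 first.
  - exact: ct1.
  - by move=> r; apply: cvgM; [exact: cvg_cst|exact: ct2].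
  rewrite (RintZ _ _ _ ct2) Rint_cst//; by move: (\int[mu]_(x in _) _) (\int[mu]_(x in _) _) => x y; field.
have gu k : L1 P (fun w => g w * expR (k * lin 0 c w)) /\
   E (fun w => g w * expR (k * lin 0 c w)) = (E f * expR (qvar / 2)) * expR (k * p + k ^+ 2 * q).
  have [h1 h2] := wiener_expL1 1 (k *: c) hf f1.
  have e w : f w * expR (lin 1 (k *: c) w) = g w * expR (k * lin 0 c w).
    by rewrite /g -mulrA -expRD -linZ -linD mulr0 addr0 add0r.
  split; first exact: L1_eq e h1.
  by rewrite -(Eeq _ e) h2 quadE expRD mulrA.
have L := gauss_L1 mg mu' ge0 gu; have G := gauss_mean mg mu' ge0 gu.
have e w : expR (- (qvar / 2)) * (g w * lin 0 c w) = f w * h w.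
  rewrite /g /h /lin dot0v mul0r add0r addr0 mul1r [_ - qvar / 2]addrC (expRD (- _)).
  by move: (expR _) (expR _) (dotv _ _) (f w) => x y z v; ring.
split; first by apply: (L1_eq e); exact: L1Z.
rewrite -(Eeq _ e) EZ// G -!mulrA mulrCA; congr (_ * _).
by rewrite mulrA [expR _ * expR _]mulrC expRxMexpNx_1 mul1r.
Qed.

End moments.
End wiener_integrals.

(** * Exponential martingales *)

Section expectation_algebra.
Context (disp : measure_display) (T : measurableType disp) (R : realType)
  (mu : {measure set T -> \bar R}).
Implicit Types f g X Y : T -> R.

Lemma L1_scaled k f g a : (forall w, k * f w = g w) -> L1 mu f -> \int[mu]_w f w = a ->
  L1 mu g /\ \int[mu]_w g w = k * a.
Proof.
move=> e f1 <-; split; first by apply: (L1_eq e); exact: L1Z.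
by rewrite -(Eeq _ e) EZ.
Qed.

Lemma E_sqrB X Y : L2 mu X -> L2 mu Y -> \int[mu]_w (X w - Y w) ^+ 2 =
  \int[mu]_w X w ^+ 2 - 2 * \int[mu]_w (X w * Y w) + \int[mu]_w Y w ^+ 2.
Proof.
move=> hX hY; have [_ X2] := hX; have [_ Y2] := hY; have XY := L2M hX hY.
have e w : (X w ^+ 2 - 2 * (X w * Y w)) + Y w ^+ 2 = (X w - Y w) ^+ 2.
  by move: (X w) (Y w) => x y; ring.
by rewrite -(Eeq _ e) ED// ?EB// ?EZ//; [exact: L1Z|apply: L1B => //; exact: L1Z].
Qed.

End expectation_algebra.

(** * Primitives and the fundamental theorem of calculus *)

Section primitive.
Context (R : realType) (T : R).
Hypothesis T0 : 0 < T.
Local Notation mu := (@lebesgue_measure R).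
Local Notation Rint f a b := (\int[mu]_(x in `[a, b]) f x).
Let T0' : 0 <= T := ltW T0.
Variable g : R -> R.
Hypothesis cg : continuous g.

Definition Prim t := Rint g 0 (clamp T t).

Lemma PrimE t : 0 <= t <= T -> Prim t = Rint g 0 t.
Proof. by move=> tT; rewrite /Prim clampE. Qed.

Lemma Prim0 : Prim 0 = 0.
Proof. by rewrite PrimE ?lexx// Rint_point. Qed.

Lemma Prim_diff s t : 0 <= s -> s <= t -> t <= T -> Prim t - Prim s = Rint g s t.
Proof.
move=> s0 st tT; rewrite !PrimE ?s0 ?(le_trans s0 st) ?(le_trans st tT)//.
by rewrite (Rint_add cg s0 st) addrC addKr.
Qed.

Lemma Prim_continuous : continuous Prim.
Proof.
apply: (continuous_on_clamp T0' (f := fun t => Rint g 0 t)).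
exact: (parameterized_integral_continuous T0' (@Rint_int _ g 0 T cg)).
Qed.

Lemma Prim_ftc s t : 0 <= s -> s <= t -> t <= T ->
  expR (Prim t) - expR (Prim s) = Rint (fun x => g x * expR (Prim x)) s t.
Proof.
move=> s0; rewrite le_eqVlt => /predU1P[<- _|st tT]; first by rewrite Rint_point subrr.
(* Integrating from -1 makes 0 an interior point, so that the derivative is two-sided on all of
   [0, T]. *)
pose G (x : R) := Rint g (-1) x; pose c := Rint g (-1) 0.
have m10 : -1 <= 0 :> R by rewrite lerN10.
have GP (x : R) : 0 <= x <= T -> G x - c = Prim x.
  move=> /andP[x0 xT]; rewrite PrimE ?x0// /G /c.
  by rewrite (Rint_add cg m10 x0) addrC addKr.
have dG (x : R) : -1 < x -> is_derive x (1 : R) G (g x).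
  move=> x1; have xu : x < x + 1 by rewrite ltrDl.
  have cgx : {for x, continuous g} by exact: cg.
  have [dx ex] := continuous_FTC1_closed xu (@Rint_int _ g (-1) (x + 1) cg) x1 cgx.
  by split; [exact: dx|rewrite -derive1E; exact: ex].
pose H (x : R) := expR (G x - c).
have dH (x : R) : -1 < x -> is_derive x (1 : R) H (g x * expR (G x - c)).
  move=> x1; rewrite mulrC.
  have dGc : is_derive x (1 : R) (G - cst c) (g x - 0) by apply: is_deriveB; exact: dG.
  by have := @is_derive1_comp _ _ (G - cst c) _ _ _ (is_derive_expR (G x - c)) dGc; rewrite subr0.
have dHx (x : R) : -1 < x -> derivable H x 1 by move=> x1; have [] := dH x x1.
have cH (x : R) : -1 < x -> {for x, continuous H}.
  by move=> x1; apply: differentiable_continuous; apply/derivable1_diffP; exact: dHx.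
have st1 x : s <= x -> -1 < x by move=> sx; apply: lt_le_trans sx; apply: lt_le_trans s0; rewrite ltrN10.
have cf : continuous (fun x => g x * expR (Prim x)).
  move=> x; apply: cvgM; first exact: cg.
  by apply: continuous_comp; [exact: Prim_continuous|exact: continuous_expR].
have sT := le_trans (ltW st) tT.
have := @continuous_FTC2 R (fun x => g x * expR (Prim x)) H s t st.
rewrite /Rintegral => ->.
- by rewrite /= /H !GP// ?s0 ?sT ?tT ?(le_trans s0 (ltW st)).
- exact: continuous_subspaceT.
- split.
  + by move=> x; rewrite in_itv/= => /andP[sx _]; apply: dHx; apply: st1; exact: ltW.
  + by apply: cvg_at_right_filter; apply: cH; exact: st1.
  + by apply: cvg_at_left_filter; apply: cH; apply: st1; exact: ltW.
- move=> x; rewrite in_itv/= => /andP[sx xt]; rewrite derive1E.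
  have [_ ->] := dH x (st1 _ (ltW sx)).
  by rewrite GP// (le_trans s0 (ltW sx)) (le_trans (ltW xt) tT).
Qed.

End primitive.

(** * The exponential martingale of a deterministic volatility *)

Section exponential_martingale.
Context (R : realType) (disp : measure_display) (Omega : measurableType disp)
  (P : probability Omega R) (d : nat) (T : R) (W : R -> Omega -> 'rV[R]_d).
Hypothesis T0 : 0 < T.
Hypothesis bm : brownian_motion P T W.
Local Notation E f := (\int[P]_w f w).
Local Notation Fm := (Fm P W).
Local Notation mu := (@lebesgue_measure R).
Local Notation Rint f a b := (\int[mu]_(x in `[a, b]) f x).
Let T0' : 0 <= T := ltW T0.
Variables (sigma : R -> 'rV[R]_d) (I : R -> Omega -> R).
Hypothesis wI : wiener P T W sigma I.
Let cs : contv sigma. Proof. by case: wI. Qed.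
Let cns : continuous (fun t => normsq (sigma t)). Proof. exact: contv_normsq. Qed.

Definition Avar := Prim T (fun t => normsq (sigma t)).
(* Locked, since comparing exponentials at different times by conversion
   diverges. *)
Definition Mexp := locked (fun t w => expR (I t w - Avar t / 2)).

Lemma MexpE t w : Mexp t w = expR (I t w - Avar t / 2).
Proof. by rewrite /Mexp -lock. Qed.

Lemma Mexp_ge0 t w : 0 <= Mexp t w. Proof. by rewrite MexpE expR_ge0. Qed.

Lemma Mexp0 w : Mexp 0 w = 1.
Proof. by case: wI => _ _ _ h0 _; rewrite MexpE h0 /Avar Prim0// mul0r subrr expR0. Qed.

Lemma Mexp_continuous w : continuous (Mexp ^~ w).
Proof.
rewrite (_ : Mexp ^~ w = fun t => expR (I t w - Avar t / 2)); last first.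
  by apply/funext => t; exact: MexpE.
move=> t; apply: (continuous_comp (f := fun t => I t w - Avar t / 2) (g := expR)).
  apply: cvgB; first by case: wI => _ _ h _ _; exact: h.
  by apply: cvgM; [exact: (Prim_continuous T0 cns)|exact: cvg_cst].
exact: continuous_expR.
Qed.

Lemma Fm_I t : 0 <= t <= T -> Fm t (I t). Proof. by case: wI => _ h _ _ _; exact: h. Qed.

Lemma Fm_Mexp t : 0 <= t <= T -> Fm t (Mexp t).
Proof.
move=> tT; have [_ t1] := andP tT.
rewrite (_ : Mexp t = fun w => expR (I t w - Avar t / 2)); last first.
  by apply/funext => w; exact: MexpE.
apply: Fm_expR; apply: (FmB bm) => //.
  exact: Fm_I.
exact: (Fm_cst bm).
Qed.

Lemma Avar_diff s t : 0 <= s -> s <= t -> t <= T -> Avar t - Avar s = qvar sigma s t.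
Proof. exact: Prim_diff. Qed.

Lemma Avar_homo s t : 0 <= s -> s <= t -> t <= T -> Avar s <= Avar t.
Proof.
move=> s0 st tT; rewrite -subr_ge0 Avar_diff//; apply: Rint_ge0 => x _; exact: normsq_ge0.
Qed.

Lemma Mexp_step s t w : 0 <= s -> s <= t -> t <= T ->
  Mexp t w = Mexp s w * expR (I t w - I s w - qvar sigma s t / 2).
Proof.
move=> s0 st tT; rewrite -Avar_diff// !MexpE -expRD; congr expR.
by move: (I t w) (I s w) (Avar t) (Avar s) => a b c e; field.
Qed.

Lemma Mexp_mart s t f : 0 <= s -> s <= t -> t <= T -> Fm s f ->
  L1 P (fun w => f w * Mexp s w) ->
  L1 P (fun w => f w * Mexp t w) /\ E (fun w => f w * Mexp t w) = E (fun w => f w * Mexp s w).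
Proof.
move=> s0 st tT hf f1; have sT := le_trans st tT.
have hfM : Fm s (fun w => f w * Mexp s w).
  by apply: (FmM bm) => //; apply: Fm_Mexp; rewrite s0.
have [a1 a2] := wiener_expL1 bm wI s0 st tT 1 0 hfM f1.
have q0 : quad sigma s t 1 0 = qvar sigma s t by apply: Rint_eq => r _; rewrite scale1r addr0.
have e w : expR (- (qvar sigma s t / 2)) * (f w * Mexp s w * expR (lin W I s t 1 0 w)) = f w * Mexp t w.
  rewrite (Mexp_step w s0 st tT) /lin dot0v addr0 mul1r [_ - qvar sigma s t / 2]addrC (expRD (- _)).
  by move: (expR _) (expR _) (Mexp _ _) (f w) => x y z v; ring.
have [b1 ->] := L1_scaled e a1 a2; split; first exact: b1.
by rewrite q0 mulrCA [expR (- _) * _]mulrC expRxMexpNx_1 mulr1.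
Qed.

(** The power is the exponential of k I_t up to a deterministic factor. The exponents 1, 2 and 4
    will serve for the mean, the second moment and the truncation error. *)
Lemma Mexp_pow k t : 0 <= t <= T ->
  L1 P (fun w => Mexp t w ^+ k) /\ E (fun w => Mexp t w ^+ k) = expR ((k%:R ^+ 2 - k%:R) / 2 * Avar t).
Proof.
move=> /andP[t0 tT].
have [a1 a2] := wiener_expL1 bm wI (lexx 0) t0 tT k%:R 0 (Fm_cst bm 1 T0') (L1_cst P 1).
have q0 : quad sigma 0 t k%:R 0 = k%:R ^+ 2 * Avar t.
  rewrite /quad /Avar PrimE ?t0// -RintZ//; apply: Rint_eq => r _.
  by rewrite addr0 normsqZ.
have I0 w : I 0 w = 0 by case: wI.
have e w : expR (- (k%:R * Avar t / 2)) * (1 * expR (lin W I 0 t k%:R 0 w)) = Mexp t w ^+ k.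
  rewrite MexpE -expRM_natl mul1r -expRD /lin I0 dot0v subr0 addr0; congr expR.
  by move: (I t w) (Avar t) k%:R => x y z; ring.
split; first by apply: (L1_eq e); exact: L1Z.
rewrite -(Eeq _ e) EZ// a2 q0 Rintegral_cst//=.
have -> : fine (P [set: Omega]) = 1 by rewrite probability_setT.
rewrite !mul1r -expRD; congr expR.
by move: (Avar t) k%:R => y z; field.
Qed.

Lemma Mexp_L2 t : 0 <= t <= T -> L2 P (Mexp t).
Proof. by move=> tT; split; [exact: Fm_meas (Fm_Mexp tT)|exact: (Mexp_pow 2 tT).1]. Qed.

Lemma Mexp_sqr t : 0 <= t <= T -> E (fun w => Mexp t w ^+ 2) = expR (Avar t).
Proof.
move=> tT; rewrite (Mexp_pow 2 tT).2; congr expR.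
by move: (Avar t) => y; field.
Qed.

(** By the martingale property the left side is exp(A_t) - exp(A_s), which [Prim_ftc] writes as a
    time integral. It is the isometry of int M sigma'dW in disguise. *)
Lemma Mexp_incr s t : 0 <= s -> s <= t -> t <= T ->
  E (fun w => (Mexp t w - Mexp s w) ^+ 2) =
  Rint (fun r => normsq (sigma r) * expR (Avar r)) s t.
Proof.
move=> s0 st tT; rewrite -Prim_ftc//.
have sT : 0 <= s <= T by rewrite s0 (le_trans st tT).
have tT' : 0 <= t <= T by rewrite tT (le_trans s0 st).
have [a1 a2] := Mexp_mart s0 st tT (Fm_Mexp sT) (L2M (Mexp_L2 sT) (Mexp_L2 sT)).
have e : E (fun w => Mexp t w * Mexp s w) = expR (Avar s).
  rewrite -(Mexp_sqr sT); etransitivity; last exact: a2.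
  by apply: Eeq => w; exact: mulrC.
rewrite (E_sqrB (Mexp_L2 tT') (Mexp_L2 sT)) e (Mexp_sqr sT) (Mexp_sqr tT').
by rewrite /Avar; move: (expR _) (expR _) => x y; ring.
Qed.

End exponential_martingale.

(** * The isometry against simple processes *)

Section isometry.
Context (R : realType) (disp : measure_display) (Omega : measurableType disp)
  (P : probability Omega R) (d : nat) (T : R) (W : R -> Omega -> 'rV[R]_d).
Hypothesis T0 : 0 < T.
Hypothesis bm : brownian_motion P T W.
Local Notation F := (filtration P W).
Local Notation E f := (\int[P]_w f w).
Local Notation Fm := (Fm P W).
Local Notation mu := (@lebesgue_measure R).
Local Notation Rint f a b := (\int[mu]_(x in `[a, b]) f x).
Let T0' : 0 <= T := ltW T0.

Lemma Rint_bigsum (I : Type) (r : seq I) (h : I -> R -> R) a b : (forall i, continuous (h i)) ->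
  Rint (fun x => \sum_(i <- r) h i x) a b = \sum_(i <- r) Rint (h i) a b.
Proof.
move=> ch; elim: r => [|i r IH].
  rewrite big_nil (Rint_eq (g := fun=> 0 * 0)) => [|x _]; last by rewrite big_nil mulr0.
  by rewrite RintZ ?mul0r//; exact: cst_continuous.
rewrite big_cons -IH -RintD//; last exact: continuous_sum.
by apply: Rint_eq => x _; rewrite big_cons.
Qed.

Lemma dotv_delta i (v : 'rV[R]_d) : dotv (delta_mx ord0 i) v = v ord0 i.
Proof.
rewrite /dotv (bigD1 i)//= big1 ?addr0 => [|j ji]; rewrite mxE eqxx/=.
  by rewrite eqxx mul1r.
by rewrite (negbTE ji) mul0r.
Qed.

Lemma dotv_deltaC i (v : 'rV[R]_d) : dotv v (delta_mx ord0 i) = v ord0 i.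
Proof. by rewrite dotvC dotv_delta. Qed.

Section one_increment.
Variables s t : R.
Hypotheses (s0 : 0 <= s) (st : s <= t) (tT : t <= T).
Let sT : s <= T := le_trans st tT.
Let s0T : 0 <= s <= T. Proof. by rewrite s0. Qed.
Let t0T : 0 <= t <= T. Proof. by rewrite tT (le_trans s0 st). Qed.

Definition dW i w := (W t w - W s w) ord0 i.

(** Brownian increments are the case [lam = 0] of [lin]; the Wiener integral of 0 serves to
    instantiate it. *)
Lemma bm_mean f i : Fm s f -> L1 P f ->
  L1 P (fun w => f w * dW i w) /\ E (fun w => f w * dW i w) = 0.
Proof.
move=> hf f1; have c0 : contv (fun _ : R => 0 : 'rV[R]_d) by exact: contv_cst.
have [I wI] := wiener_exists T0 bm c0.
have [a1 a2] := wiener_mean bm wI s0 st tT 0 (delta_mx ord0 i) hf f1.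
have e w : f w * lin W I s t 0 (delta_mx ord0 i) w = f w * dW i w.
  by rewrite /lin mul0r add0r dotv_delta.
by split; [exact: (L1_eq e)|rewrite -(Eeq _ e) a2 mulr0].
Qed.

Lemma bm_cov f i j : Fm s f -> L1 P f ->
  L1 P (fun w => f w * (dW i w * dW j w)) /\
  E (fun w => f w * (dW i w * dW j w)) = E f * ((i == j)%:R * (t - s)).
Proof.
move=> hf f1; have c0 : contv (fun _ : R => 0 : 'rV[R]_d) by exact: contv_cst.
have [I wI] := wiener_exists T0 bm c0.
have [a1 a2] := wiener_cov bm wI s0 st tT 0 (delta_mx ord0 i) 0 (delta_mx ord0 j) hf f1.
have e w : f w * (lin W I s t 0 (delta_mx ord0 i) w * lin W I s t 0 (delta_mx ord0 j) w) =
    f w * (dW i w * dW j w).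
  by rewrite /lin !mul0r !add0r !dotv_delta.
split; first exact: (L1_eq e).
rewrite -(Eeq _ e) a2; congr (_ * _).
rewrite -(Rint_cst _ st); apply: Rint_eq => r _.
by rewrite !scale0r !add0r dotv_delta mxE eqxx.
Qed.

Lemma dW_L2 i : L2 P (dW i).
Proof.
have [a1 _] := bm_cov i i (Fm_cst bm 1 sT) (L1_cst P 1).
split; last by apply: L1_eq a1 => w; rewrite mul1r expr2.
have := L1_meas (bm_mean i (Fm_cst bm 1 sT) (L1_cst P 1)).1.
by congr (measurable_fun _ _); apply/funext => w; rewrite mul1r.
Qed.

End one_increment.

(* [J] plays the part of int U sigma' dW; both [U = 1] and the exponential
   martingale qualify. *)
Record repr (sigma : R -> 'rV[R]_d) (U J : R -> Omega -> R) (u2 : R -> R) (C L : R) : Prop := Repr {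
  repr_contv : contv sigma;
  repr_Fm : forall t, 0 <= t <= T -> Fm t (U t);
  repr_cont : forall w, continuous (U ^~ w);
  repr_ge0 : forall t w, 0 <= U t w;
  repr_L4 : forall t, 0 <= t <= T ->
    L1 P (fun w => U t w ^+ 4) /\ E (fun w => U t w ^+ 4) <= C;
  repr_L2 : forall t, 0 <= t <= T -> L2 P (U t);
  repr_u2 : forall t, 0 <= t <= T -> E (fun w => U t w ^+ 2) = u2 t;
  repr_u2c : continuous u2;
  repr_mart : forall s t f M, 0 <= s -> s <= t -> t <= T -> Fm s f ->
    (forall w, `|f w| <= M) -> E (fun w => f w * U t w) = E (fun w => f w * U s w);
  repr_lip : forall s t, 0 <= s -> s <= t -> t <= T ->
    E (fun w => (U t w - U s w) ^+ 2) <= L * (t - s);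
  repr_FmJ : forall t, 0 <= t <= T -> Fm t (J t);
  repr_J0 : forall w, J 0 w = 0;
  repr_L2J : forall t, 0 <= t <= T -> L2 P (J t);
  repr_mean : forall s t f, 0 <= s -> s <= t -> t <= T -> Fm s f -> L2 P f ->
    E (fun w => f w * (J t w - J s w)) = 0;
  repr_cov : forall s t f M i, 0 <= s -> s <= t -> t <= T -> Fm s f ->
    (forall w, `|f w| <= M) ->
    E (fun w => f w * (dW s t i w * (J t w - J s w))) =
    E (fun w => f w * U s w) * Rint (fun r => sigma r ord0 i) s t;
  repr_var : forall s t, 0 <= s -> s <= t -> t <= T ->
    E (fun w => (J t w - J s w) ^+ 2) = Rint (fun r => normsq (sigma r) * u2 r) s t }.

(** * Distance between simple integrals and multiples of a represented variable *)

Section represented.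
Variables (sigma : R -> 'rV[R]_d) (U J : R -> Omega -> R) (u2 : R -> R) (C L : R).
Hypothesis rp : repr sigma U J u2 C L.

Section one_step.
Variables (s t : R) (phi : Omega -> 'rV[R]_d) (B k : R).
Hypotheses (s0 : 0 <= s) (st : s <= t) (tT : t <= T).
Hypothesis phiF : forall i, Fm s (fun w => phi w ord0 i).
Hypothesis phiB : forall i w, `|phi w ord0 i| <= B.
Let sT : s <= T := le_trans st tT.
Let s0T : 0 <= s <= T. Proof. by rewrite s0. Qed.
Let t0T : 0 <= t <= T. Proof. by rewrite tT (le_trans s0 st). Qed.

(** The error on one cell when the increment of [k * J] is approximated by a constant integrand. *)
Definition step w := dotv (phi w) (W t w - W s w) - k * (J t w - J s w).
Definition stepvar r := E (fun w => normsq (phi w - (k * U r w) *: sigma r)).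

Let mphi i : measurable_fun [set: Omega] (fun w => phi w ord0 i).
Proof. exact: Fm_meas (phiF i). Qed.

Let phi2F i j : Fm s (fun w => phi w ord0 i * phi w ord0 j).
Proof. exact: (FmM bm). Qed.

Let phi2L i j : L1 P (fun w => phi w ord0 i * phi w ord0 j).
Proof. by apply: L2M; exact: L2_bounded. Qed.

Let dWL2 i : L2 P (dW s t i). Proof. exact: dW_L2. Qed.
Let dJL2 : L2 P (fun w => J t w - J s w).
Proof. by apply: L2B; exact: (repr_L2J rp). Qed.

Lemma dotvW_L2 : L2 P (fun w => dotv (phi w) (W t w - W s w)).
Proof. by apply: L2_sum => i; exact: L2_bound (mphi i) (phiB i) (dWL2 i). Qed.

Lemma step_L2 : L2 P step.
Proof. by apply: L2B; [exact: dotvW_L2|exact: L2Z]. Qed.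

Lemma step_Fm : Fm t step.
Proof.
apply: (FmB bm) => //.
  apply: (Fm_sum bm) => // i; apply: (FmM bm) => //; first exact: Fm_mono st _.
  have -> : (fun w => (W t w - W s w) ord0 i) = (fun w => W t w ord0 i - W s w ord0 i).
    by apply/funext => w; rewrite !mxE.
  by apply: (FmB bm) => //; apply: (Fm_W bm) => //; rewrite ?s0 ?st ?lexx ?(le_trans s0 st).
apply: (FmZ bm) => //; apply: (FmB bm) => //; first exact: (repr_FmJ rp).
by apply: Fm_mono st _; exact: (repr_FmJ rp).
Qed.

Lemma step_orth f : Fm s f -> L2 P f -> E (fun w => f w * step w) = 0.
Proof.
move=> hf f2.
have e w : f w * step w = \sum_i f w * phi w ord0 i * dW s t i w - k * (f w * (J t w - J s w)).
  rewrite /step mulrBr mulrCA; congr (_ - _); rewrite /dotv mulr_sumr.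
  by apply: eq_bigr => i _; rewrite mulrA.
have h i : L1 P (fun w => f w * phi w ord0 i * dW s t i w) /\
    E (fun w => f w * phi w ord0 i * dW s t i w) = 0.
  apply: (bm_mean s0 st tT); first exact: (FmM bm).
  by apply: L2M => //; exact: L2_bounded (phiB i).
rewrite (Eeq _ e) EB; last 2 first.
- by apply: L1_sum => i; have [] := h i.
- by apply: L1Z; exact: L2M.
rewrite Esum => [|i]; last by have [] := h i.
rewrite big1 => [|i _]; last by have [] := h i.
by rewrite EZ; [rewrite (repr_mean rp)// mulr0 subr0|exact: L2M].
Qed.

Lemma dotvW_sqr : E (fun w => dotv (phi w) (W t w - W s w) ^+ 2) =
  \sum_i E (fun w => phi w ord0 i ^+ 2) * (t - s).
Proof.
have e w : dotv (phi w) (W t w - W s w) ^+ 2 =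
    \sum_i \sum_j (phi w ord0 i * phi w ord0 j) * (dW s t i w * dW s t j w).
  rewrite expr2 /dotv mulr_suml; apply: eq_bigr => i _; rewrite mulr_sumr.
  by apply: eq_bigr => j _; rewrite mulrACA.
have h i j := bm_cov s0 st tT i j (phi2F i j) (phi2L i j).
rewrite (Eeq _ e) Esum => [|i]; last by apply: L1_sum => j; have [] := h i j.
apply: eq_bigr => i _; rewrite Esum => [|j]; last by have [] := h i j.
rewrite (bigD1 i)//= (h i i).2 eqxx mul1r big1 ?addr0 => [|j ji]; first by congr (_ * _).
by rewrite (h i j).2 eq_sym (negbTE ji) mul0r mulr0.
Qed.

Lemma dotvW_cov : E (fun w => dotv (phi w) (W t w - W s w) * (J t w - J s w)) =
  \sum_i E (fun w => phi w ord0 i * U s w) * Rint (fun r => sigma r ord0 i) s t.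
Proof.
have e w : dotv (phi w) (W t w - W s w) * (J t w - J s w) =
    \sum_i phi w ord0 i * (dW s t i w * (J t w - J s w)).
  by rewrite /dotv mulr_suml; apply: eq_bigr => i _; rewrite mulrA.
rewrite (Eeq _ e) Esum => [|i].
  by apply: eq_bigr => i _; exact: (repr_cov rp i s0 st tT (phiF i) (phiB i)).
apply: L1_bound (mphi i) (phiB i) _; exact: L2M.
Qed.

(** The share of coordinate [i] in [stepvar], with [U] frozen at time [s] in the mixed term. In this
    form continuity in [r] is visible. *)
Definition stepvar_comp i r := E (fun w => phi w ord0 i ^+ 2) -
  2 * k * E (fun w => phi w ord0 i * U s w) * sigma r ord0 i + k ^+ 2 * (sigma r ord0 i ^+ 2 * u2 r).

Lemma stepvarE r : s <= r <= t -> stepvar r = \sum_i stepvar_comp i r.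
Proof.
move=> /andP[sr rt]; have r0T : 0 <= r <= T by rewrite (le_trans s0 sr) (le_trans rt tT).
have UL := repr_L2 rp r0T.
have e w : normsq (phi w - (k * U r w) *: sigma r) = \sum_i (phi w ord0 i ^+ 2
    - (2 * k * sigma r ord0 i) * (phi w ord0 i * U r w) + (k ^+ 2 * sigma r ord0 i ^+ 2) * U r w ^+ 2).
  apply: eq_bigr => i _; rewrite !mxE.
  by move: (phi w ord0 i) (sigma r ord0 i) (U r w) => x y z; ring.
have l1 i : L1 P (fun w => phi w ord0 i ^+ 2) by apply: L1_eq (phi2L i i) => w; rewrite expr2.
have l2 i : L1 P (fun w => phi w ord0 i * U r w) by apply: L2M => //; exact: L2_bounded (phiB i).
have [_ l3] := UL.
have l4 i : L1 P (fun w => phi w ord0 i ^+ 2 - (2 * k * sigma r ord0 i) * (phi w ord0 i * U r w)).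
  by apply: L1B => //; exact: L1Z.
rewrite /stepvar (Eeq _ e) Esum => [|i]; last by apply: L1D => //; exact: L1Z.
apply: eq_bigr => i _; rewrite ED//; last exact: L1Z.
rewrite EB//; last exact: L1Z.
rewrite !EZ// (repr_u2 rp)// (repr_mart rp s0 sr (le_trans rt tT) (phiF i) (phiB i)).
by rewrite /stepvar_comp -!mulrA; congr (_ - _ * (_ * _) + _); exact: mulrC.
Qed.

Lemma stepvar_comp_continuous i : continuous (stepvar_comp i).
Proof.
move=> r; have cs : contv sigma := repr_contv rp; have cu := repr_u2c rp.
apply: cvgD; last first.
  apply: cvgM; [exact: cvg_cst|apply: cvgM; last exact: cu].
  by rewrite expr2; apply: cvgM; exact: cs.
by apply: cvgB; [exact: cvg_cst|apply: cvgM; [exact: cvg_cst|exact: cs]].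
Qed.

(** The three terms of the expanded square come from [dotvW_sqr], [dotvW_cov] and [repr_var]; the
    martingale property of [U], used in [stepvarE], puts them under one time integral. *)
Lemma step_sqr : E (fun w => step w ^+ 2) = Rint stepvar s t.
Proof.
have cs := repr_contv rp; have cu := repr_u2c rp.
rewrite (E_sqrB dotvW_L2 (L2Z k dJL2)) dotvW_sqr.
have -> : E (fun w => dotv (phi w) (W t w - W s w) * (k * (J t w - J s w))) = k *
    \sum_i E (fun w => phi w ord0 i * U s w) * Rint (fun r => sigma r ord0 i) s t.
  rewrite -dotvW_cov -EZ; first by apply: Eeq => w; rewrite mulrCA.
  exact: L2M dotvW_L2 dJL2.
have -> : E (fun w => (k * (J t w - J s w)) ^+ 2) =
    k ^+ 2 * \sum_i Rint (fun r => sigma r ord0 i ^+ 2 * u2 r) s t.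
  rewrite -(@Rint_bigsum _ _ (fun i r => sigma r ord0 i ^+ 2 * u2 r)); last first.
    by move=> i r; apply: cvgM; [rewrite expr2; apply: cvgM; exact: cs|exact: cu].
  have -> : Rint (fun r => \sum_i sigma r ord0 i ^+ 2 * u2 r) s t =
      E (fun w => (J t w - J s w) ^+ 2).
    rewrite (repr_var rp)//; apply: Rint_eq => r _; rewrite /normsq /dotv mulr_suml.
    by apply: eq_bigr => i _; rewrite expr2.
  rewrite -EZ; first by apply: Eeq => w; rewrite exprMn.
  by have [] := dJL2.
rewrite (Rint_eq (g := fun r => \sum_i stepvar_comp i r)); last exact: stepvarE.
rewrite Rint_bigsum; last exact: stepvar_comp_continuous.
rewrite mulrA !mulr_sumr -sumrB -big_split/=; apply: eq_bigr => i _.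
have ci : continuous (fun r => sigma r ord0 i) := cs i.
have cq : continuous (fun r => sigma r ord0 i ^+ 2 * u2 r).
  by move=> r; apply: cvgM; [rewrite expr2; apply: cvgM; exact: cs|exact: cu].
rewrite /stepvar_comp RintD; last 2 first.
- by move=> r; apply: cvgB; [exact: cvg_cst|apply: cvgM; [exact: cvg_cst|exact: ci]].
- by move=> r; apply: cvgM; [exact: cvg_cst|exact: cq].
rewrite RintB; last 2 first.
- exact: cst_continuous.
- by move=> r; apply: cvgM; [exact: cvg_cst|exact: ci].
by rewrite Rint_cst// !RintZ// !mulrA.
Qed.

End one_step.

Section many_steps.
Variables (u : nat -> R) (phi : nat -> Omega -> 'rV[R]_d) (B : R) (dd : nat -> R).
Hypotheses (u0 : 0 <= u 0%N) (uT : forall k, u k <= T) (ule : forall k, u k <= u k.+1).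
Hypothesis phiF : forall k i, Fm (u k) (fun w => phi k w ord0 i).
Hypothesis phiB : forall k i w, `|phi k w ord0 i| <= B.

Let stepk k := step (u k) (u k.+1) (phi k) (dd k).

(** Each step is orthogonal to the past by [step_orth], so the second moments add up. The factor
    [dd] may vary with the cell, as the weights D(t_k) will. *)
Lemma steps_iso N :
  [/\ Fm (u N) (fun w => \sum_(k < N) stepk k w), L2 P (fun w => \sum_(k < N) stepk k w) &
  E (fun w => (\sum_(k < N) stepk k w) ^+ 2) =
  \sum_(k < N) Rint (stepvar (phi k) (dd k)) (u k) (u k.+1)].
Proof.
have uge k : 0 <= u k by exact: (grid_ge0 u0 ule).
elim: N => [|N [IH1 IH2 IH3]].
  have e : (fun w : Omega => \sum_(k < 0) stepk k w) = fun=> 0.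
    by apply/funext => w; rewrite big_ord0.
  rewrite e; split; [exact: (Fm_cst bm)|exact: L2_0|].
  by rewrite big_ord0 -[RHS](E0 P); apply: Eeq => w; rewrite big_ord0 expr2 mulr0.
have e : (fun w : Omega => \sum_(k < N.+1) stepk k w) =
    (fun w => (\sum_(k < N) stepk k w) + stepk N w).
  by apply/funext => w; rewrite big_ord_recr.
have LN : L2 P (stepk N) := step_L2 (dd N) (uge N) (ule N) (uT N.+1) (phiF N) (phiB N).
have FN : Fm (u N.+1) (stepk N) := step_Fm (dd N) (uge N) (ule N) (uT N.+1) (phiF N).
rewrite e; split.
- by apply: (FmD bm) => //; exact: Fm_mono (ule N) IH1.
- exact: L2D.
have e2 w : (\sum_(k < N.+1) stepk k w) ^+ 2 = ((\sum_(k < N) stepk k w) - (-1 * stepk N w)) ^+ 2.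
  by rewrite big_ord_recr/= mulN1r opprK.
rewrite (Eeq _ e2) (E_sqrB IH2 (L2Z (-1) LN)) IH3 big_ord_recr/=.
have -> : E (fun w => (\sum_(k < N) stepk k w) * (-1 * stepk N w)) = 0.
  have e3 w : (\sum_(k < N) stepk k w) * (-1 * stepk N w) = -1 * ((\sum_(k < N) stepk k w) * stepk N w).
    by rewrite mulrCA.
  rewrite (Eeq _ e3) EZ; last exact: L2M.
  by rewrite (step_orth (dd N) (uge N) (ule N) (uT N.+1) (phiF N) (phiB N) IH1 IH2) mulr0.
rewrite mulr0 subr0; congr (_ + _).
rewrite -(step_sqr (dd N) (uge N) (ule N) (uT N.+1) (phiF N) (phiB N)).
by apply: Eeq => w; rewrite mulN1r sqrrN.
Qed.

End many_steps.

Section simple.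
Variable S : simple_process d F T.
Local Notation N := (sp_size S).
Local Notation ts := (sp_time S).

Lemma sp_time_homo i j : (i <= j)%N -> (j <= N)%N -> ts i <= ts j.
Proof.
move=> ij; rewrite -(subnKC ij); elim: (j - i)%N => [|m IH]; first by rewrite addn0.
rewrite addnS => h; apply: le_trans (IH (ltnW h)) _; apply: ltW; exact: sp_time_lt.
Qed.

Lemma sp_time_itv k : (k <= N)%N -> 0 <= ts k <= T.
Proof.
move=> kN; have := sp_time_homo (leq0n k) kN; rewrite sp_time_start => ->.
by have := sp_time_homo kN (leqnn N); rewrite sp_time_end.
Qed.

Lemma simple_iso t (dd : nat -> R) : 0 <= t <= T ->
  let X w := sp_integral W S t w -
    \sum_(k < N) dd k * (J (Num.min (ts k.+1) t) w - J (Num.min (ts k) t) w) in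
  L2 P X /\ E (fun w => X w ^+ 2) = \sum_(k < N)
    Rint (stepvar (sp_val S k) (dd k)) (Num.min (ts k) t) (Num.min (ts k.+1) t).
Proof.
move=> /andP[t0 tT] X.
(* [minn] freezes the times after the last one, so that the grid is nondecreasing for all
   indices. *)
pose u k := Num.min (ts (minn k N)) t.
(* A cell that starts after [t] collapses to the point [t], where its value need not be measurable
   yet; the value is replaced by 0. *)
pose phi k w : 'rV[R]_d := if (k < N)%N && (ts k <= t) then sp_val S k w else 0.
have u0 : 0 <= u 0%N by rewrite /u min0n sp_time_start le_min lexx.
have uT k : u k <= T by rewrite /u ge_min tT orbT.
have ule k : u k <= u k.+1.
  rewrite /u le_min !ge_min lexx orbT andbT sp_time_homo ?geq_minr//.
  by rewrite leq_min geq_minr andbT (leq_trans (geq_minl _ _)).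
have phiF k i : Fm (u k) (fun w => phi k w ord0 i).
  rewrite /phi; case: (boolP ((k < N)%N && (ts k <= t))) => [/andP[kN kt]|_]; last first.
    by under eq_fun do rewrite mxE; exact: (Fm_cst bm).
  rewrite /u (minn_idPl (ltnW kN)) (min_idPl kt) => A mA.
  exact: (sp_val_measurable i kN mA).
have [B hB] := sp_val_bounded S.
have phiB k i w : `|phi k w ord0 i| <= Num.max B 0.
  rewrite /phi le_max; case: ifP => [/andP[kN _]|_]; first by rewrite hB.
  by rewrite mxE normr0 lexx orbT.
have [_ a1 a2] := steps_iso dd u0 uT ule phiF phiB N.
have uE k : (k <= N)%N -> u k = Num.min (ts k) t by move=> kN; rewrite /u (minn_idPl kN).
have late k : (k < N)%N -> ~~ (ts k <= t) -> u k = u k.+1.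
  move=> kN; rewrite -ltNge => tk; rewrite !uE//; last exact: ltnW.
  have tk1 : t <= ts k.+1 by rewrite ltW// (lt_trans tk)// sp_time_lt.
  by rewrite (min_idPr (ltW tk)) (min_idPr tk1).
have e w : \sum_(k < N) step (u k) (u k.+1) (phi k) (dd k) w = X w.
  rewrite /X /sp_integral -sumrB; apply: eq_bigr => k _; rewrite /step /phi ltn_ord/=.
  have kN := ltn_ord k; case: (boolP (ts k <= t)) => [kt|kt].
    by rewrite !uE// ltnW.
  by rewrite -(uE _ (ltnW kN)) -(uE _ kN) -(late _ kN kt) !subrr !dotv0.
split; first exact: L2_eq e a1.
rewrite -(Eeq _ (fun w => congr1 (fun x => x ^+ 2) (e w))) a2.
apply: eq_bigr => k _; have kN := ltn_ord k.
rewrite -(uE _ (ltnW kN)) -(uE _ kN) /phi kN/=.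
by case: (boolP (ts k <= t)) => [kt//|kt]; rewrite -(late _ kN kt) !Rint_point.
Qed.

End simple.
End represented.
End isometry.

(** * The two instances of the representation *)

Section representations.
Context (R : realType) (disp : measure_display) (Omega : measurableType disp)
  (P : probability Omega R) (d : nat) (T : R) (W : R -> Omega -> 'rV[R]_d).
Hypothesis T0 : 0 < T.
Hypothesis bm : brownian_motion P T W.
Local Notation E f := (\int[P]_w f w).
Local Notation Fm := (Fm P W).
Local Notation mu := (@lebesgue_measure R).
Local Notation Rint f a b := (\int[mu]_(x in `[a, b]) f x).
Let T0' : 0 <= T := ltW T0.
Variables (sigma : R -> 'rV[R]_d) (I : R -> Omega -> R).
Hypothesis wI : wiener P T W sigma I.
Let cs : contv sigma. Proof. by case: wI. Qed.

Lemma E_cst k : E (fun=> k) = k.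
Proof.
rewrite Rintegral_cst//=.
have -> : fine (P [set: Omega]) = 1 by rewrite probability_setT.
exact: mulr1.
Qed.

Lemma E_eq_cst f k : (forall w, f w = k) -> E f = k.
Proof. by move=> e; rewrite -[RHS]E_cst; apply: Eeq => w; exact: e. Qed.

Lemma lin10 s t w : lin W I s t 1 0 w = I t w - I s w.
Proof. by rewrite /lin mul1r dot0v addr0. Qed.

Lemma lin0d s t i w : lin W I s t 0 (delta_mx ord0 i) w = dW W s t i w.
Proof. by rewrite /lin mul0r add0r dotv_delta. Qed.

Lemma I_L2 t : 0 <= t <= T -> L2 P (I t).
Proof.
move=> tT; have [t0 t1] := andP tT; split; first by apply: (Fm_meas (Fm_I wI tT)).
have [a1 _] := wiener_sqr bm wI (lexx 0) t0 t1 1 0 (Fm_cst bm 1 T0') (L1_cst P 1).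
have I0 w : I 0 w = 0 by case: wI.
by apply: L1_eq a1 => w; rewrite lin10 I0 subr0 mul1r.
Qed.

Lemma repr_one : repr P T W sigma (fun _ _ => 1) I (fun=> 1) 1 0.
Proof.
have I0 w : I 0 w = 0 by case: wI.
split => //.
- by move=> t /andP[_ tT]; exact: (Fm_cst bm).
- by move=> w; exact: cst_continuous.
- by move=> t _; split; [exact: L1_cst|rewrite (@E_eq_cst _ 1)// => w; rewrite expr1n].
- by move=> t _; apply: (L2_bounded P (M := 1)) => // w; rewrite normr1.
- by move=> t _; rewrite (@E_eq_cst _ 1)// => w; rewrite expr1n.
- exact: cst_continuous.
- move=> s t s0 st tT; rewrite mul0r (@E_eq_cst _ 0)// => w.
  by rewrite subrr expr0n.
- by move=> t tT; exact: (Fm_I wI).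
- exact: I_L2.
- move=> s t f s0 st tT hf f2.
  have [_ <-] : L1 P (fun w => f w * lin W I s t 1 0 w) /\ E (fun w => f w * lin W I s t 1 0 w) = 0.
    by have [b1 b2] := wiener_mean bm wI s0 st tT 1 0 hf (L2_L1 f2); rewrite b2 mulr0.
  by apply: Eeq => w; rewrite lin10.
- move=> s t f M i s0 st tT hf fM.
  have f1 : L1 P f by apply: L1_bounded (fM); exact: Fm_meas hf.
  have [_ b2] := wiener_cov bm wI s0 st tT 0 (delta_mx ord0 i) 1 0 hf f1.
  transitivity (E f * Rint (fun r => dotv (0 *: sigma r + delta_mx ord0 i) (1 *: sigma r + 0)) s t).
    by rewrite -b2; apply: Eeq => w; rewrite lin0d lin10.
  congr (_ * _); first by apply: Eeq => w; rewrite mulr1.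
  by apply: Rint_eq => r _; rewrite scale0r add0r scale1r addr0 dotv_delta.
- move=> s t s0 st tT; have sT := le_trans st tT.
  have [_ b2] := wiener_sqr bm wI s0 st tT 1 0 (Fm_cst bm 1 sT) (L1_cst P 1).
  transitivity (E (fun=> 1) * quad sigma s t 1 0).
    by rewrite -b2; apply: Eeq => w; rewrite lin10 mul1r.
  by rewrite E_cst mul1r; apply: Rint_eq => r _; rewrite scale1r addr0 mulr1.
Qed.

Local Notation M := (Mexp T sigma I).
Local Notation A := (Avar T sigma).

Lemma Avar_continuous : continuous A.
Proof. by apply: Prim_continuous => //; exact: contv_normsq. Qed.

Lemma expA_continuous : continuous (fun r => expR (A r)).
Proof.
move=> r; apply: (continuous_comp (f := A) (g := expR)); first exact: Avar_continuous.
exact: continuous_expR.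
Qed.

Lemma repr_exp : exists C L, repr P T W sigma M (fun t w => M t w - 1) (fun r => expR (A r)) C L.
Proof.
have cq : continuous (fun r => normsq (sigma r) * expR (A r)).
  by move=> r; apply: cvgM; [exact: contv_normsq|exact: expA_continuous].
have [L L0 hL] := @continuous_bounded _ _ 0 T cq.
have ML t (tT : 0 <= t <= T) := Mexp_L2 T0 bm wI tT.
have dJ s t w : M t w - 1 - (M s w - 1) = M t w - M s w by rewrite opprB addrA subrK.
(* 6 = (4^2 - 4) / 2 is the exponent of the fourth moment in [Mexp_pow]; [L] bounds the integrand in
   [Mexp_incr]. *)
exists (expR (6 * A T)), L; split => //.
- by move=> t tT; exact: Fm_Mexp.
- by move=> w; exact: (@Mexp_continuous _ _ _ _ _ _ _ T0 _ _ wI w).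
- by move=> t w; exact: Mexp_ge0.
- move=> t tT; have [b1 b2] := Mexp_pow T0 bm wI 4 tT; split; first exact: b1.
  rewrite b2 ler_expR.
  have -> : (4%:R ^+ 2 - 4%:R) / 2 = 6 :> R by field.
  by rewrite ler_wpM2l// (Avar_homo wI)//; case/andP: tT.
- by move=> t tT; exact: (Mexp_sqr T0 bm wI).
- exact: expA_continuous.
- move=> s t f B s0 st tT hf fB; have sT : 0 <= s <= T by rewrite s0 (le_trans st tT).
  have [_ ] := Mexp_mart bm wI s0 st tT hf (L1_bound (Fm_meas hf) fB (L2_L1 (ML _ sT))).
  by [].
- move=> s t s0 st tT; rewrite (Mexp_incr T0 bm wI s0 st tT) -(Rint_cst _ st).
  apply: Rint_le => //; first exact: cst_continuous.
  move=> x /andP[sx xt]; apply: le_trans (ler_norm _) _; apply: hL.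
  by rewrite (le_trans s0 sx) (le_trans xt tT).
- move=> t tT; have [_ t1] := andP tT; apply: (FmB bm) => //; first exact: Fm_Mexp.
  exact: (Fm_cst bm).
- by move=> w; rewrite (Mexp0 T0 wI) subrr.
- move=> t tT; apply: L2B => //; first exact: ML.
  by apply: (L2_bounded P (M := 1)) => // w; rewrite normr1.
- move=> s t f s0 st tT hf f2; have sT : 0 <= s <= T by rewrite s0 (le_trans st tT).
  have f1 := L2M f2 (ML _ sT).
  have [b1 b2] := Mexp_mart bm wI s0 st tT hf f1.
  have e w : f w * M t w - f w * M s w = f w * (M t w - 1 - (M s w - 1)) by rewrite dJ mulrBr.
  by rewrite -(Eeq _ e) (EB b1 f1) b2 subrr.
- move=> s t f B i s0 st tT hf fB; have sT : 0 <= s <= T by rewrite s0 (le_trans st tT).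
  have f1 := L1_bound (Fm_meas hf) fB (L2_L1 (ML _ sT)).
  have hfM : Fm s (fun w => f w * M s w) by apply: (FmM bm); [case/andP: sT|exact: hf|exact: Fm_Mexp].
  have [b1 b2] := wiener_exp_mean bm wI s0 st tT (delta_mx ord0 i) hfM f1.
  have [c1 c2] := bm_mean T0 bm s0 st tT i hfM f1.
  (* M_t - M_s is M_s times an exponential minus one. The exponential is handled by
     [wiener_exp_mean], and the remaining part has mean zero. *)
  have e w : f w * M s w * (expR (I t w - I s w - qvar sigma s t / 2) *
      dotv (delta_mx ord0 i) (W t w - W s w)) - f w * M s w * dW W s t i w =
      f w * (dW W s t i w * (M t w - 1 - (M s w - 1))).
    rewrite dJ (Mexp_step wI w s0 st tT) dotv_delta -/(dW W s t i w).
    by move: (f w) (M s w) (expR _) (dW _ _ _ _ _) => x y z v; ring.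
  rewrite -(Eeq _ e) (EB b1 c1) b2 c2 subr0; congr (_ * _).
  by apply: Rint_eq => r _; rewrite dotv_deltaC.
- move=> s t s0 st tT; rewrite -(Mexp_incr T0 bm wI s0 st tT).
  by apply: Eeq => w; rewrite dJ.
Qed.

End representations.

(** * Joint measurability and Ito integrals *)

Section partition.
Variables (R : realType) (u : nat -> R) (N : nat).

Lemma part_ex r : u 0%N < r -> r <= u N -> exists2 k, (k < N)%N & u k < r <= u k.+1.
Proof.
move=> r0 rN; have h : exists i, r <= u i by exists N.
case: (ex_minnP h) => -[|k] rk hmin; first by rewrite leNgt r0 in rk.
exists k; first exact: hmin.
by rewrite rk andbT ltNge; apply/negP => /hmin; rewrite ltnn.
Qed.

Hypothesis uh : forall i j, (i <= j)%N -> (j <= N)%N -> u i <= u j.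

Lemma part_sum (V : zmodType) (f : nat -> V) k r : (k < N)%N -> u k < r <= u k.+1 ->
  \sum_(j < N) (if u j < r <= u j.+1 then f j else 0) = f k.
Proof.
move=> kN /andP[kr rk]; rewrite (bigD1 (Ordinal kN))//= kr rk/= big1 ?addr0// => j jk.
case: ifP => // /andP[jr rj]; exfalso; move/eqP: jk; apply; apply/val_inj => /=.
apply/eqP; rewrite eqn_leq; apply/andP; split; rewrite leqNgt; apply/negP => h.
- have := lt_le_trans jr rk; rewrite ltNge => /negP; apply; exact: uh (ltnW (ltn_ord j)).
- have := lt_le_trans kr rj; rewrite ltNge => /negP; apply; exact: uh (ltnW kN).
Qed.

Lemma part_sum0 (V : zmodType) (f : nat -> V) r : ~~ (u 0%N < r <= u N) ->
  \sum_(j < N) (if u j < r <= u j.+1 then f j else 0) = 0.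
Proof.
move=> h; rewrite big1// => j _; case: ifP => // /andP[jr rj]; exfalso; move/negP: h; apply.
have jN := ltn_ord j.
by rewrite (le_lt_trans (uh (leq0n j) (ltnW jN)) jr) (le_trans rj)// uh.
Qed.

End partition.

(** * Progressive and jointly measurable processes *)

Section joint_measurability.
Context (R : realType) (disp : measure_display) (Omega : measurableType disp)
  (P : probability Omega R) (d : nat) (T : R) (W : R -> Omega -> 'rV[R]_d).
Hypothesis T0 : 0 < T.
Hypothesis bm : brownian_motion P T W.
Local Notation F := (filtration P W).
Local Notation Fm := (Fm P W).
Local Notation mu := (@lebesgue_measure R).
Let T0' : 0 <= T := ltW T0.
Local Notation RO := (measurableTypeR R * Omega)%type.

(** Extension by 0 outside [0, T] puts all processes on the full product space, where Fubini's
    theorem is applied. *)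
Definition tl (H : R -> Omega -> R) (u : RO) : R := \1_(`[0, T]%classic) u.1 * H u.1 u.2.

Definition jm H := measurable_fun [set: RO] (tl H).

Lemma tl_in H u : 0 <= u.1 <= T -> tl H u = H u.1 u.2.
Proof. by move=> h; rewrite /tl indicE mem_set ?mul1r//= in_itv. Qed.

Lemma tl_out H u : ~~ (0 <= u.1 <= T) -> tl H u = 0.
Proof.
by move=> h; rewrite /tl indicE memNset ?mul0r//= in_itv/=; exact/negP.
Qed.

Lemma tl_case (Q : R -> Prop) H u : (0 <= u.1 <= T -> Q (H u.1 u.2)) -> Q 0 -> Q (tl H u).
Proof.
by move=> h q; case: (boolP (0 <= u.1 <= T)) => c; [rewrite tl_in//; exact: h|rewrite tl_out].
Qed.

Lemma m01 : measurable_fun [set: RO] (fun u : RO => \1_(`[0, T]%classic) u.1 : R).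
Proof. by apply: measurableT_comp => //; exact: measurable_indic. Qed.

Lemma jm_det h : continuous h -> jm (fun t _ => h t).
Proof.
move=> ch; apply: measurable_funM; first exact: m01.
by apply: measurableT_comp => //; exact: continuous_measurable_fun.
Qed.

Lemma jm_rv f : measurable_fun [set: Omega] f -> jm (fun _ w => f w).
Proof.
by move=> mf; apply: measurable_funM; [exact: m01|exact: measurableT_comp].
Qed.

Lemma jm_eq H H' : (forall t w, 0 <= t <= T -> H t w = H' t w) -> jm H -> jm H'.
Proof.
move=> e; rewrite /jm; congr (measurable_fun _ _); apply/funext => u.
by case: (boolP (0 <= u.1 <= T)) => c; [rewrite !tl_in// e|rewrite !tl_out].
Qed.

Lemma jmD H H' : jm H -> jm H' -> jm (fun t w => H t w + H' t w).
Proof.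
move=> h h'; have := measurable_funD h h'; congr (measurable_fun _ _); apply/funext => u.
by rewrite /= /tl mulrDr.
Qed.

Lemma jmM H H' : jm H -> jm H' -> jm (fun t w => H t w * H' t w).
Proof.
move=> h h'; have := measurable_funM h h'; congr (measurable_fun _ _); apply/funext => u.
by case: (boolP (0 <= u.1 <= T)) => c; rewrite /=; [rewrite !tl_in|rewrite !tl_out// mul0r].
Qed.

Lemma jmZ k H : jm H -> jm (fun t w => k * H t w).
Proof.
move=> h; have := measurable_funM (measurable_cst k) h; congr (measurable_fun _ _).
by apply/funext => u; rewrite /tl mulrCA.
Qed.

Lemma jmB H H' : jm H -> jm H' -> jm (fun t w => H t w - H' t w).
Proof.
by move=> h /(jmZ (-1)) h'; apply: jm_eq (jmD h h') => t w _; rewrite mulN1r.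
Qed.

Lemma jm_sum (I : Type) (s : seq I) (h : I -> R -> Omega -> R) : (forall i, jm (h i)) ->
  jm (fun t w => \sum_(i <- s) h i t w).
Proof.
move=> hh; elim: s => [|i s IH].
  apply: (@jm_eq (fun _ _ => 0)); last exact: (jm_det (@cst_continuous _ _ (0 : R))).
  by move=> t w _; rewrite big_nil.
by apply: jm_eq (jmD (hh i) IH) => t w _; rewrite big_cons.
Qed.

Lemma jm_dotv (H H' : R -> Omega -> 'rV[R]_d) : (forall i, jm (fun t w => H t w ord0 i)) ->
  (forall i, jm (fun t w => H' t w ord0 i)) -> jm (fun t w => dotv (H t w) (H' t w)).
Proof. by move=> h h'; apply: jm_sum => i; exact: jmM. Qed.

Local Notation rects t := [set C : set (R * Omega) | exists A D,
  [/\ @measurable _ (measurableTypeR R) A, F t D & C = A `*` D]].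

Lemma progressive_jm H : progressive F T H -> jm H.
Proof.
move=> pH _ B mB; rewrite setTI.
have mD : measurable ([set u | 0 <= u.1 <= T /\ B (H u.1 u.2)] : set RO).
  have TT : 0 <= T <= T by rewrite T0' lexx.
  have := pH T B TT mB; apply: smallest_sub; first exact: sigma_algebra_measurable.
  by move=> _ [A [D [mA /F_meas mD ->]]]; exact: measurableX.
have m0 : measurable ((fun u : RO => \1_(`[0, T]%classic) u.1 : R) @^-1` [set 0]).
  by rewrite -[X in measurable X]setTI; exact: m01.
have -> : tl H @^-1` B = [set u | 0 <= u.1 <= T /\ B (H u.1 u.2)] `|`
    ((fun u : RO => \1_(`[0, T]%classic) u.1 : R) @^-1` [set 0] `&` [set _ | B 0]).
  apply/seteqP; split => u /=; case: (boolP (0 <= u.1 <= T)) => c.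
  - by rewrite tl_in//; left.
  - by rewrite tl_out// => B0; right; rewrite indicE memNset//= in_itv/=; exact/negP.
  - rewrite tl_in// indicE mem_set ?in_itv//= => -[[]//|[/eqP]].
    by rewrite oner_eq0.
  - by rewrite tl_out// => -[[]//|[]].
apply: measurableU => //; have [B0|nB0] := pselect (B 0).
  have -> : [set _ : RO | B 0] = setT by apply/seteqP; split.
  by rewrite setIT.
have -> : [set _ : RO | B 0] = set0 by apply/seteqP; split.
by rewrite setI0; exact: measurable0.
Qed.

(** The sets whose section at [t] lies in F_t form a sigma-algebra containing the rectangles. *)
Lemma progressive_section H t : 0 <= t <= T -> progressive F T H -> Fm t (H t).
Proof.
move=> tT pH B mB; have [t0 t1] := andP tT.
suff : F t [set w | [set u : R * Omega | 0 <= u.1 <= t /\ B (H u.1 u.2)] (t, w)].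
  by congr (F t _); apply/seteqP; split => w /=; rewrite t0 lexx => //; case.
have := pH t B tT mB.
pose Gs := [set C : set (R * Omega) | F t [set w | C (t, w)]].
suff hs : <<s rects t >> `<=` Gs by move/hs.
apply: smallest_sub.
  have [n0 nD nU] := F_sigma bm t1; split; first exact: n0.
    by move=> A hA; have := nD _ hA; rewrite /Gs/=; congr (F t _).
  by move=> A hA; exact: nU.
move=> _ [A [D [mA FD ->]]]; rewrite /Gs/=.
have [At|nAt] := pselect (A t).
  by have -> : [set w | (A `*` D) (t, w)] = D by apply/seteqP; split => w //= [].
have -> : [set w | (A `*` D) (t, w)] = set0 by apply/seteqP; split => w //= [].
by have [] := F_sigma bm t1.
Qed.

(** Left-endpoint approximations along the dyadic grid of [0, t] use only values up to time [t], and
    they converge by continuity of the paths. *)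
Lemma progressive_cont X : (forall t, 0 <= t <= T -> Fm t (X t)) ->
  (forall w, continuous (X ^~ w)) -> progressive F T X.
Proof.
move=> FX cX t B /andP[t0 t1] mB.
have [n0 nD nU] := F_sigma bm t1.
have FT : F t setT by rewrite -(setD0 setT); exact: nD.
pose G := g_sigma_algebraType (rects t).
have mrect (A : set (measurableTypeR R)) (D : set Omega) : measurable A -> F t D ->
    measurable ((A `*` D : set (R * Omega)) : set G).
  by move=> mA FD; apply: sub_sigma_algebra; exists A, D.
have m1 (A : set (measurableTypeR R)) : measurable A ->
    measurable_fun [set: G] (fun u : G => \1_A u.1 : R).
  move=> mA; have m1 : measurable_fun [set: G] (fun u : G => u.1 : measurableTypeR R).
    move=> _ B' mB'; rewrite setTI.
    have -> : (fun u : G => u.1) @^-1` B' = (B' `*` setT : set (R * Omega)).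
      by apply/seteqP; split => // u [].
    exact: mrect.
  by apply: measurableT_comp m1; exact: measurable_indic.
have m2 s : 0 <= s <= t -> measurable_fun [set: G] (fun u : G => X s u.2).
  move=> /andP[s0 st] _ B' mB'; rewrite setTI.
  have -> : (fun u : G => X s u.2) @^-1` B' = (setT `*` (X s @^-1` B') : set (R * Omega)).
    by apply/seteqP; split => // u [].
  apply: mrect => //; apply: (F_mono st); apply: FX => //.
  by rewrite s0 (le_trans st t1).
(* The cells are open on the left, so time 0 needs a term of its own. *)
pose Xn n (u : G) := \sum_(k < 2 ^ n) \1_(`]tn t n k, tn t n k.+1]%classic) u.1 * X (tn t n k) u.2 +
  \1_([set 0]) u.1 * X 0 u.2.
pose Xl (u : G) := \1_(`[0, t]%classic) u.1 * X u.1 u.2.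
have mXn n : measurable_fun [set: G] (Xn n).
  apply: measurable_funD; last by apply: measurable_funM; [exact: m1|apply: m2; rewrite lexx].
  apply: measurable_sum => k; apply: measurable_funM; first exact: m1.
  by apply: m2; rewrite tn_ge0// tn_le.
have th n i j : (i <= j)%N -> (j <= 2 ^ n)%N -> tn t n i <= tn t n j by move=> ij _; exact: tn_homo.
have XnE n u : Xn n u = \sum_(k < 2 ^ n) (if tn t n k < u.1 <= tn t n k.+1 then X (tn t n k) u.2 else 0)
    + (if u.1 == 0 then X 0 u.2 else 0).
  congr (_ + _).
    apply: eq_bigr => k _; rewrite indicE; case: ifP => h.
      by rewrite mem_set ?mul1r//= in_itv.
    by rewrite memNset ?mul0r//= in_itv/= h.
  by rewrite indicE; case: eqP => h; [rewrite mem_set// mul1r|rewrite memNset// mul0r].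
have Xn0 n u : ~~ (0 < u.1 <= t) -> Xn n u = if u.1 == 0 then X 0 u.2 else 0.
  move=> h; rewrite XnE (part_sum0 (@th n) (fun k => X (tn t n k) u.2)) ?add0r//.
  by rewrite tn0// tn_end.
have cXl u : Xn n u @[n --> \oo] --> Xl u.
  have [u0|u0] := eqVneq u.1 0.
    apply: (seq_eq (u := fun=> X 0 u.2)) => [n|].
      by rewrite Xn0 u0 ?ltxx// eqxx.
    rewrite /Xl u0 indicE mem_set ?mul1r//= ?in_itv/= ?lexx//; exact: cvg_cst.
  have [ut|ut] := boolP (0 <= u.1 <= t); last first.
    apply: (seq_eq (u := fun=> 0)) => [n|].
      rewrite Xn0 ?(negbTE u0)//.
      by apply: contra ut => /andP[a ->]; rewrite ltW.
    rewrite /Xl indicE memNset ?mul0r//= ?in_itv/=; [exact: cvg_cst|exact/negP].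
  have ut0 : 0 < u.1 by rewrite lt_neqAle eq_sym u0; case/andP: ut.
  have [_ ut1] := andP ut.
  have /choice[r hr] : forall n, exists r, Xn n u = X r u.2 /\ `|u.1 - r| <= t / 2 ^+ n.
    move=> n; have [||k kN ku] := @part_ex _ (tn t n) (2 ^ n)%N u.1.
    - by rewrite tn0.
    - by rewrite tn_end.
    exists (tn t n k); split.
      by rewrite XnE (part_sum (@th n) (fun k => X (tn t n k) u.2) kN ku) (negbTE u0) addr0.
    have [k1 k2] := andP ku; rewrite gtr0_norm ?subr_gt0//.
    by apply: le_trans (tn_step n k t0); rewrite lerD2r.
  apply: (seq_eq (u := fun n => X (r n) u.2)) => [n|]; first by have [] := hr n.
  rewrite /Xl indicE mem_set ?mul1r//= ?in_itv//.
  have cr : r n @[n --> \oo] --> u.1.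
    have : u.1 - r n @[n --> \oo] --> (0 : R).
      apply/norm_cvg0P; apply: (@seq_squeeze0 _ _ (fun n => t / 2 ^+ n)) => [n|].
        by rewrite normr_ge0/=; have [] := hr n.
      apply/cvgrPdist_le => e e0; have := grid_mesh t0 e0; apply: filterS => n.
      by rewrite sub0r normrN ger0_norm// divr_ge0// exprn_ge0.
    move=> h; rewrite -[X in _ --> X]subr0.
    apply: (seq_eq (u := fun n => (u.1 : R) - (u.1 - r n))) => [n|]; first by rewrite opprB addrCA subrr addr0.
    by apply: seqB h; exact: cvg_cst.
  by apply: (cvg_comp r (X ^~ u.2) cr); exact: cX.
have mXl : measurable_fun [set: G] Xl.
  by apply: (measurable_fun_cvg (h := Xn)) => // u _; exact: cXl.
have : measurable (((`[0, t]%classic `*` setT : set (R * Omega)) : set G) `&` (Xl @^-1` B)).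
  apply: measurableI; first exact: mrect.
  by rewrite -[X in measurable X]setTI; exact: mXl.
rewrite /measurable/=; congr (<<s _ >> _); apply/seteqP; split => u /=; rewrite in_itv/= /Xl indicE.
  by move=> [[h _]]; rewrite mem_set ?mul1r//= in_itv.
by move=> [h hB]; rewrite mem_set ?mul1r//= in_itv.
Qed.

End joint_measurability.

(** Young's inequality with a free weight [k] takes the place of Cauchy-Schwarz. *)
Lemma L2_pair_cvg (disp : measure_display) (T : measurableType disp) (R : realType)
    (mu : {measure set T -> \bar R}) (f_ : nat -> T -> R) f g :
  (forall n, L2 mu (f_ n)) -> L2 mu f -> L2 mu g ->
  \int[mu]_x (f_ n x - f x) ^+ 2 @[n --> \oo] --> (0 : R) ->
  \int[mu]_x (f_ n x * g x) @[n --> \oo] --> \int[mu]_x (f x * g x).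
Proof.
move=> h_ h hg c0; pose B := \int[mu]_x (g x ^+ 2).
have B0 : 0 <= B by apply: Ege0 => x; exact: sqr_ge0.
apply/cvgrPdist_le => e e0.
(* Both halves of Young's bound are then at most [e / 2], once the squared distance is below
   [k * e]. *)
pose k := e / (B + 1); have B1 : 0 < B + 1 by rewrite ltr_wpDl.
have k0 : 0 < k by rewrite divr_gt0.
have ke0 : 0 < k * e by rewrite mulr_gt0.
move/cvgrPdist_le : c0 => /(_ _ ke0); apply: filterS => n; rewrite sub0r normrN => hn.
have d2 : L2 mu (fun x => f_ n x - f x) := L2B (h_ n) h.
have -> : \int[mu]_x (f x * g x) - \int[mu]_x (f_ n x * g x) = - \int[mu]_x ((f_ n x - f x) * g x).
  rewrite -opprB -EB; [|exact: L2M..]; congr (- _).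
  by apply: Eeq => x; rewrite mulrBl.
rewrite normrN; apply: le_trans (Eabs (L2M d2 hg)) _.
have [_ d1] := d2; have [_ g1] := hg.
apply: (@le_trans _ _ (\int[mu]_x ((2 * k)^-1 * (f_ n x - f x) ^+ 2 + k / 2 * g x ^+ 2))).
  apply: Ele.
  - by apply: L1_norm; exact: L2M.
  - by apply: L1D; exact: L1Z.
  - move=> x; rewrite normrM -(real_normK (num_real (f_ n x - f x))) -(real_normK (num_real (g x))).
    move: (`|f_ n x - f x|) (`|g x|) => a b.
    have -> : (2 * k)^-1 * a ^+ 2 + k / 2 * b ^+ 2 = a * b + (2 * k)^-1 * (a - k * b) ^+ 2.
      by field; rewrite gt_eqF.
    by rewrite lerDl mulr_ge0 ?sqr_ge0// invr_ge0 mulr_ge0// ltW.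
rewrite ED; [|exact: L1Z..]; rewrite !EZ// -/B.
have h1 : (2 * k)^-1 * \int[mu]_x (f_ n x - f x) ^+ 2 <= e / 2.
  have <- : (2 * k)^-1 * (k * e) = e / 2 by field; rewrite gt_eqF.
  apply: ler_wpM2l; first by rewrite invr_ge0 ltW// mulr_gt0.
  exact: le_trans (ler_norm _) hn.
have h2 : k / 2 * B <= e / 2.
  rewrite /k -!mulrA ler_wpM2l ?(ltW e0)// mulrCA ler_piMr//.
  by rewrite mulrC ler_pdivrMr// mul1r lerDl.
by apply: le_trans (lerD h1 h2) _; rewrite -splitr.
Qed.

(** * The M^2 norm as an integral over the product space *)

Section joint_integrals.
Context (R : realType) (disp : measure_display) (Omega : measurableType disp)
  (P : probability Omega R) (d : nat) (T : R) (W : R -> Omega -> 'rV[R]_d).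
Hypothesis T0 : 0 < T.
Hypothesis bm : brownian_motion P T W.
Local Notation F := (filtration P W).
Local Notation E f := (\int[P]_w f w).
Local Notation Fm := (Fm P W).
Local Notation mu := (@lebesgue_measure R).
Local Notation Rint f a b := (\int[mu]_(x in `[a, b]) f x).
Let T0' : 0 <= T := ltW T0.
Local Notation tl := (tl T).
Local Notation jm := (jm T).
Local Notation Q := (@lebesgue_measure R \x P)%E.

Lemma RintE f (a b : R) : continuous f -> (\int[mu]_(x in `[a, b]) (f x)%:E)%E = (Rint f a b)%:E.
Proof. by move=> cf; rewrite /Rintegral fineK// integrable_fin_num//; exact: Rint_int. Qed.

Lemma tl_restrict (g : R -> \bar R) (H : R -> Omega -> R) w :
  (forall t, 0 <= t <= T -> g t = (H t w)%:E) ->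
  (\int[mu]_(t in `[0%R, T]) g t = \int[mu]_t (tl H (t, w))%:E)%E.
Proof.
move=> e; rewrite integral_mkcond; apply: eq_integral => t _; rewrite patchE.
case: ifPn => [|] h.
  by move: h; rewrite inE/= in_itv/= => h; rewrite e// tl_in.
by rewrite tl_out//; apply: contra h => h; rewrite mem_set//= in_itv.
Qed.

Lemma jm_normsq (H : R -> Omega -> 'rV[R]_d) : (forall i, jm (fun t w => H t w ord0 i)) ->
  jm (fun t w => normsq (H t w)).
Proof. by move=> h; exact: jm_dotv. Qed.

Lemma tl_ge0 (H : R -> Omega -> R) u : (forall t w, 0 <= t <= T -> 0 <= H t w) -> 0 <= tl H u.
Proof. by move=> h; apply: (tl_case (Q := fun x => 0 <= x)) => // c; exact: h. Qed.

Lemma M2_normsq_Q (H : R -> Omega -> 'rV[R]_d) : (forall i, jm (fun t w => H t w ord0 i)) ->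
  (M2_normsq P T H = \int[Q]_u (tl (fun t w => normsq (H t w)) u)%:E)%E.
Proof.
move=> jH; rewrite fubini_tonelli2; last 2 first.
- by apply/measurable_EFinP; exact: jm_normsq.
- by move=> u; rewrite lee_fin; apply: tl_ge0 => *; exact: normsq_ge0.
by apply: eq_integral => w _; exact: tl_restrict.
Qed.

Lemma M2_normsq_swap (H : R -> Omega -> 'rV[R]_d) : (forall i, jm (fun t w => H t w ord0 i)) ->
  (M2_normsq P T H = \int[mu]_(t in `[0%R, T]) \int[P]_w (normsq (H t w))%:E)%E.
Proof.
move=> jH; rewrite M2_normsq_Q// fubini_tonelli1; last 2 first.
- by apply/measurable_EFinP; exact: jm_normsq.
- by move=> u; rewrite lee_fin; apply: tl_ge0 => *; exact: normsq_ge0.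
rewrite [RHS]integral_mkcond; apply: eq_integral => t _; rewrite patchE /fubini_F.
case: ifPn => h.
  move: h; rewrite inE/= in_itv/= => h.
  by apply: eq_integral => w _; rewrite tl_in.
rewrite -[RHS](integral0 P setT); apply: eq_integral => w _.
by rewrite tl_out//; apply: contra h => h; rewrite mem_set//= in_itv.
Qed.

Lemma tl_normsq (H : R -> Omega -> 'rV[R]_d) u :
  tl (fun t w => normsq (H t w)) u = \sum_i tl (fun t w => H t w ord0 i) u ^+ 2.
Proof.
case: (boolP (0 <= u.1 <= T)) => c.
  by rewrite tl_in//; apply: eq_bigr => i _; rewrite tl_in// expr2.
by rewrite tl_out// big1// => i _; rewrite tl_out// expr2 mul0r.
Qed.

Lemma M2_normsq_fin (H : R -> Omega -> 'rV[R]_d) : (forall i, L2 Q (tl (fun t w => H t w ord0 i))) ->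
  M2_normsq P T H = (\sum_i \int[Q]_u (tl (fun t w => H t w ord0 i) u ^+ 2))%:E.
Proof.
move=> h; rewrite M2_normsq_Q; last by move=> i; case: (h i).
rewrite E_EFin; last first.
  apply: (L1_eq (fun u => esym (tl_normsq H u))).
  by apply: L1_sum => i; case: (h i).
congr (_%:E); rewrite -Esum; last by move=> i; case: (h i).
by apply: Eeq => u; exact: tl_normsq.
Qed.

Lemma M2_L2 (H : R -> Omega -> 'rV[R]_d) i : (forall i, jm (fun t w => H t w ord0 i)) ->
  (M2_normsq P T H < +oo)%E -> L2 Q (tl (fun t w => H t w ord0 i)).
Proof.
move=> jH; rewrite M2_normsq_Q// => fin; split; first exact: jH.
have n0 u : 0 <= tl (fun t w => normsq (H t w)) u by apply: tl_ge0 => *; exact: normsq_ge0.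
apply: (L1_le (g := tl (fun t w => normsq (H t w)))).
- by apply: measurable_funX; exact: jH.
- move=> u; rewrite ger0_norm ?sqr_ge0// tl_normsq (bigD1 i)//= lerDl.
  by apply: sumr_ge0 => j _; exact: sqr_ge0.
- by apply: L1_lty fin => //; exact: jm_normsq.
Qed.

Lemma M2_comp_le (H : R -> Omega -> 'rV[R]_d) i : (forall i, L2 Q (tl (fun t w => H t w ord0 i))) ->
  \int[Q]_u (tl (fun t w => H t w ord0 i) u ^+ 2) <= fine (M2_normsq P T H).
Proof.
move=> h; rewrite M2_normsq_fin//= (bigD1 i)//= lerDl.
by apply: sumr_ge0 => j _; apply: Ege0 => u; exact: sqr_ge0.
Qed.

Section simple_processes.
Variables (sigma : R -> 'rV[R]_d) (U J : R -> Omega -> R) (u2 : R -> R) (C L : R).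
Hypothesis rp : repr P T W sigma U J u2 C L.
Variable S : simple_process d F T.
Local Notation N := (sp_size S).
Local Notation ts := (sp_time S).

Lemma jm_U : jm U.
Proof.
apply: (progressive_jm (P := P) (W := W)) => //.
by apply: progressive_cont => //; [exact: (repr_Fm rp)|exact: (repr_cont rp)].
Qed.

Lemma jm_sp i : jm (fun t w => sp_fun S t w ord0 i).
Proof.
apply: (jm_eq (H := fun t w => \sum_(k < N) \1_(`]ts k, ts k.+1]%classic) t * sp_val S k w ord0 i)).
  move=> t w _; rewrite /sp_fun summxE; apply: eq_bigr => k _; rewrite indicE.
  case: ifP => h; first by rewrite mem_set ?mul1r//= in_itv.
  by rewrite memNset ?mul0r ?mxE//= in_itv/= h.
apply: jm_sum => k; apply: jmM.
  apply: measurable_funM; first exact: m01.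
  by apply: measurableT_comp => //; exact: measurable_indic.
apply: jm_rv; apply: Fm_meas => B mB.
exact: (sp_val_measurable i (ltn_ord k) mB).
Qed.

Lemma jm_diff (k : R) i : jm (fun t w => (sp_fun S t w - (k * U t w) *: sigma t) ord0 i).
Proof.
apply: (jm_eq (H := fun t w => sp_fun S t w ord0 i - k * (U t w * sigma t ord0 i))).
  by move=> t w _; rewrite !mxE mulrA.
apply: jmB; first exact: jm_sp.
by apply: jmZ; apply: jmM; [exact: jm_U|apply: jm_det; exact: (repr_contv rp)].
Qed.

Lemma sp_funE k t w : (k < N)%N -> ts k < t <= ts k.+1 -> sp_fun S t w = sp_val S k w.
Proof.
move=> kN kt; rewrite /sp_fun.
exact: (part_sum (u := ts) (fun i j => @sp_time_homo _ _ _ _ _ _ _ S i j) (fun k => sp_val S k w) kN kt).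
Qed.

(** On its left-open cell the simple process equals its k-th value, so the inner expectation is
    [stepvar]; the time integral is then added up cell by cell. *)
Lemma sp_M2 (dd : R) : M2_normsq P T (fun t w => sp_fun S t w - (dd * U t w) *: sigma t) =
  (\sum_(k < N) Rint (stepvar P sigma U (sp_val S k) dd) (ts k) (ts k.+1))%:E.
Proof.
set H := fun t w => _; have jH i : jm (fun t w => H t w ord0 i) by exact: jm_diff.
rewrite M2_normsq_Q// fubini_tonelli1; last 2 first.
- by apply/measurable_EFinP; exact: jm_normsq.
- by move=> u; rewrite lee_fin; apply: tl_ge0 => *; exact: normsq_ge0.
set g := fubini_F _ _.
have mg : measurable_fun [set: measurableTypeR R] g.
  apply: measurable_fun_fubini_tonelli_F; first by apply/measurable_EFinP; exact: jm_normsq.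
  by move=> u; rewrite lee_fin; apply: tl_ge0 => *; exact: normsq_ge0.
have g0 t : (0 <= g t)%E.
  apply: integral_ge0 => w _; rewrite lee_fin; apply: tl_ge0 => *; exact: normsq_ge0.
have gE k t : (k < N)%N -> ts k < t <= ts k.+1 -> g t = (stepvar P sigma U (sp_val S k) dd t)%:E.
  move=> kN /andP[kt tk]; have tT : 0 <= t <= T.
    have /andP[k0 _] := @sp_time_itv _ _ _ _ _ _ _ S _ (ltnW kN); have /andP[_ k1] := @sp_time_itv _ _ _ _ _ _ _ S _ kN.
    by rewrite (le_trans k0 (ltW kt)) (le_trans tk k1).
  have [B hB] := sp_val_bounded S.
  rewrite /g /fubini_F /stepvar -E_EFin; first last.
    apply: L1_sum => i; have h : L2 P (fun w => (sp_val S k w - (dd * U t w) *: sigma t) ord0 i).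
      apply: (L2_eq (f := fun w => sp_val S k w ord0 i - dd * sigma t ord0 i * U t w)).
        by move=> w; rewrite !mxE mulrAC.
      apply: L2B; last by apply: L2Z; exact: (repr_L2 rp).
      apply: L2_bounded (fun w => hB k w i kN); apply: (Fm_meas (t := ts k) (P := P) (W := W)) => A mA.
      exact: (sp_val_measurable i kN mA).
    exact: L2M.
  by apply: eq_integral => w _; rewrite tl_in// /H (sp_funE w kN)// kt.
have piece k : (k < N)%N -> (\int[mu]_(t in `]ts k, ts k.+1]) g t =
    (Rint (stepvar P sigma U (sp_val S k) dd) (ts k) (ts k.+1))%:E)%E.
  move=> kN; have [B hB] := sp_val_bounded S.
  have /andP[k0 _] := @sp_time_itv _ _ _ _ _ _ _ S _ (ltnW kN); have /andP[_ k1] := @sp_time_itv _ _ _ _ _ _ _ S _ kN.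
  have kk := ltW (sp_time_lt kN).
  pose q r := \sum_i stepvar_comp P sigma U u2 (ts k) (sp_val S k) dd i r.
  have cq : continuous q by apply: continuous_sum => i; exact: (stepvar_comp_continuous rp).
  have e r : ts k <= r <= ts k.+1 -> stepvar P sigma U (sp_val S k) dd r = q r.
    have pF i : Fm (ts k) (fun w => sp_val S k w ord0 i) by move=> A mA; exact: (sp_val_measurable i kN mA).
    have pB i w : `|sp_val S k w ord0 i| <= B by exact: hB.
    by move=> h; exact: (stepvarE rp dd k0 k1 pF pB h).
  rewrite (Rint_eq (g := q))// -RintE// -[RHS]integral_itv_obnd_cbnd; last first.
    by apply/measurable_EFinP; apply: measurable_funTS; exact: continuous_measurable_fun.
  apply: eq_integral => t; rewrite inE/= in_itv/= => h.
  by rewrite (gE _ _ kN h) e//; case/andP: h => /ltW -> ->.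
have main n : (n <= N)%N -> (\int[mu]_(t in `]ts 0%N, ts n]) g t =
    (\sum_(k < n) Rint (stepvar P sigma U (sp_val S k) dd) (ts k) (ts k.+1))%:E)%E.
  elim: n => [_|n IH nN]; first by rewrite big_ord0 set_itv_ge ?integral_set0// bnd_simp ltxx.
  rewrite (@itv_bndbnd_setU _ _ (BRight (ts 0%N)) (BRight (ts n)) (BRight (ts n.+1))); last 2 first.
  - by rewrite bnd_simp sp_time_homo// ltnW.
  - by rewrite bnd_simp sp_time_homo.
  rewrite ge0_integral_setU//=.
  - by rewrite big_ord_recr/= EFinD; congr (_ + _)%E; [exact: (IH (ltnW nN))|exact: (piece _ nN)].
  - exact: measurable_funTS.
  - by apply/disj_setPS => t /=; rewrite !in_itv/= => -[/andP[_ a] /andP[b _]]; have := lt_le_trans b a; rewrite ltxx.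
rewrite -main// sp_time_start sp_time_end integral_itv_obnd_cbnd; last exact: measurable_funTS.
rewrite [RHS]integral_mkcond; apply: eq_integral => t _; rewrite patchE; case: ifPn => // h.
rewrite /g /fubini_F -[RHS](integral0 P setT); apply: eq_integral => w _.
by rewrite tl_out//; apply: contra h => h; rewrite mem_set//= in_itv.
Qed.

(** With a constant factor the increments of [J] telescope, and the isometry becomes an equality of
    two squared L2 norms. *)
Lemma simple_iso_T (dd : R) :
  L2 P (fun w => sp_integral W S T w - dd * J T w) /\
  (E (fun w => (sp_integral W S T w - dd * J T w) ^+ 2))%:E =
  M2_normsq P T (fun t w => sp_fun S t w - (dd * U t w) *: sigma t).
Proof.
have TT : 0 <= T <= T by rewrite T0' lexx.
have [a1 a2] := simple_iso T0 bm rp S (fun=> dd) TT.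
have mT k : (k <= N)%N -> Num.min (ts k) T = ts k.
  by move=> kN; apply/min_idPl; case/andP: (@sp_time_itv _ _ _ _ _ _ _ S _ kN).
have e w : \sum_(k < N) dd * (J (Num.min (ts k.+1) T) w - J (Num.min (ts k) T) w) = dd * J T w.
  rewrite -mulr_sumr; congr (_ * _).
  transitivity (\sum_(k < N) (J (ts k.+1) w - J (ts k) w)).
    by apply: eq_bigr => k _; rewrite !mT// ltnW.
  rewrite -(big_mkord xpredT (fun k => J (ts k.+1) w - J (ts k) w)) telescope_sumr//.
  by rewrite sp_time_end sp_time_start (repr_J0 rp) subr0.
split; first by apply: L2_eq a1 => w; rewrite e.
rewrite sp_M2; congr (_%:E).
transitivity (\sum_(k < N) Rint (stepvar P sigma U (sp_val S k) dd) (Num.min (ts k) T) (Num.min (ts k.+1) T)).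
  by rewrite -a2; apply: Eeq => w; rewrite e.
by apply: eq_bigr => k _; rewrite !mT// ltnW.
Qed.

End simple_processes.
End joint_integrals.

Lemma seq_sum (R : realType) (I : Type) (r : seq I) (f : I -> nat -> R) (a : I -> R) :
  (forall i, f i n @[n --> \oo] --> a i) ->
  \sum_(i <- r) f i n @[n --> \oo] --> \sum_(i <- r) a i.
Proof.
move=> h; elim: r => [|i r IH].
  by rewrite big_nil; apply: (seq_eq (u := fun=> 0)) => [n|]; [rewrite big_nil|exact: cvg_cst].
rewrite big_cons; apply: (seq_eq (u := fun n => f i n + \sum_(j <- r) f j n)) => [n|].
  by rewrite big_cons.
exact: seqD.
Qed.

(** * Pairing Ito integrals with a represented variable *)

Section duality.
Context (R : realType) (disp : measure_display) (Omega : measurableType disp)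
  (P : probability Omega R) (d : nat) (T : R) (W : R -> Omega -> 'rV[R]_d).
Hypothesis T0 : 0 < T.
Hypothesis bm : brownian_motion P T W.
Local Notation F := (filtration P W).
Local Notation E f := (\int[P]_w f w).
Local Notation Fm := (Fm P W).
Local Notation mu := (@lebesgue_measure R).
Let T0' : 0 <= T := ltW T0.
Let TT : 0 <= T <= T. Proof. by rewrite T0' lexx. Qed.
Local Notation RO := (measurableTypeR R * Omega)%type.
Local Notation tl := (tl T).
Local Notation jm := (jm T).
Local Notation Q := (@lebesgue_measure R \x P)%E.

Lemma L2_tl X C : jm X -> 0 <= C ->
  (forall t, 0 <= t <= T -> L2 P (X t) /\ E (fun w => X t w ^+ 2) <= C) -> L2 Q (tl X).
Proof.
move=> jX C0 h; split; first exact: jX.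
have mX2 : measurable_fun [set: RO] (fun u => (tl X u ^+ 2)%:E).
  by apply/measurable_EFinP; apply: measurable_funX; exact: jX.
apply: L1_lty => [|u|]; [exact/measurable_EFinP|exact: sqr_ge0|].
rewrite fubini_tonelli1//; last by move=> u; rewrite lee_fin sqr_ge0.
have le : (\int[mu]_x fubini_F P (fun z : RO => (tl X z ^+ 2)%:E) x <=
   \int[mu]_x (C * \1_(`[0%R, T]%classic) x)%:E)%E.
  apply: ge0_le_integral => //.
  - by move=> t _; apply: integral_ge0 => w _; rewrite lee_fin sqr_ge0.
  - by apply: measurable_fun_fubini_tonelli_F => // u; rewrite lee_fin sqr_ge0.
  - by apply/measurable_EFinP; apply: measurable_funM => //; exact: measurable_indic.
  - move=> t _; rewrite /fubini_F; case: (boolP (0 <= t <= T)) => tT.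
      have [[_ h1] h2] := h t tT.
      rewrite indicE mem_set ?in_itv//= mulr1.
      rewrite (eq_integral (fun w => (X t w ^+ 2)%:E)) => [|w _]; last by rewrite tl_in.
      by rewrite E_EFin// lee_fin.
    rewrite (eq_integral (fun=> 0%E)) => [|w _]; last by rewrite tl_out// expr2 mul0r.
    by rewrite integral0 lee_fin mulr_ge0// indicE ler0n.
apply: le_lt_trans le _.
have -> : (\int[mu]_x (C * \1_(`[0%R, T]%classic) x)%:E = \int[mu]_(x in `[0%R, T]) C%:E)%E.
  rewrite [RHS]integral_mkcond; apply: eq_integral => t _; rewrite patchE indicE.
  by case: (_ \in _); rewrite ?mulr1 ?mulr0.
rewrite (RintE _ _ (f := fun=> C)); last exact: cst_continuous.
exact: ltry.
Qed.

Section with_repr.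
Variables (sigma : R -> 'rV[R]_d) (U J : R -> Omega -> R) (u2 : R -> R) (C L : R).
Hypothesis rp : repr P T W sigma U J u2 C L.

Definition Usig i t w := U t w * sigma t ord0 i.

Lemma Usig_L2 i : L2 Q (tl (Usig i)).
Proof.
have cs : continuous (fun t => sigma t ord0 i) by exact: (repr_contv rp).
have cq : continuous (fun t => sigma t ord0 i ^+ 2 * u2 t).
  by move=> r; apply: cvgM; [rewrite expr2; apply: cvgM; exact: cs|exact: (repr_u2c rp)].
have [M M0 hM] := @continuous_bounded _ _ 0 T cq.
have jU := jm_U T0 bm rp.
apply: (L2_tl (C := M)) => //; first by apply: jmM => //; exact: jm_det.
move=> t tT; have [mU UL] := repr_L2 rp tT.
have e w : sigma t ord0 i * U t w = Usig i t w by rewrite mulrC.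
split; first by apply: (L2_eq e); exact: L2Z.
have e2 w : sigma t ord0 i ^+ 2 * U t w ^+ 2 = Usig i t w ^+ 2 by rewrite -exprMn e.
by rewrite -(Eeq _ e2) EZ// (repr_u2 rp)//; apply: le_trans (ler_norm _) (hM _ tT).
Qed.

Lemma sp_L2 (S : simple_process d F T) i : L2 Q (tl (fun t w => sp_fun S t w ord0 i)).
Proof.
have h : L2 Q (tl (fun t w => (sp_fun S t w - (0 * U t w) *: sigma t) ord0 i)).
  apply: (M2_L2 (P := P) i (fun i => jm_diff T0 bm rp S 0 i)).
  by rewrite (sp_M2 T0 bm rp) ltry.
by apply: L2_eq h => u; rewrite /tl !mxE mul0r mul0r subr0.
Qed.

Lemma sp_integral_L2 (S : simple_process d F T) : L2 P (sp_integral W S T).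
Proof.
have [h _] := simple_iso_T T0 bm rp S 0.
by apply: L2_eq h => w; rewrite mul0r subr0.
Qed.

(** Both sides of [simple_iso_T] are quadratic in [k]; the case [k = -1] minus the case [k = 1]
    leaves four times the pairing. *)
Lemma simple_dual (S : simple_process d F T) :
  E (fun w => sp_integral W S T w * J T w) =
  \sum_i \int[Q]_u (tl (fun t w => sp_fun S t w ord0 i) u * tl (Usig i) u).
Proof.
have JL := repr_L2J rp TT; have XL := sp_integral_L2 S.
have key k : E (fun w => sp_integral W S T w ^+ 2) - 2 * (k * E (fun w => sp_integral W S T w * J T w)) +
    E (fun w => (k * J T w) ^+ 2) = \sum_i (\int[Q]_u tl (fun t w => sp_fun S t w ord0 i) u ^+ 2 -
    2 * (k * \int[Q]_u (tl (fun t w => sp_fun S t w ord0 i) u * tl (Usig i) u)) +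
    \int[Q]_u (k * tl (Usig i) u) ^+ 2).
  have [_ h] := simple_iso_T T0 bm rp S k.
  have e i u : tl (fun t w => sp_fun S t w ord0 i) u - k * tl (Usig i) u =
      tl (fun t w => (sp_fun S t w - (k * U t w) *: sigma t) ord0 i) u.
    by rewrite /tl /Usig mulrCA -mulrBr !mxE mulrA.
  have eL i : L2 Q (tl (fun t w => (sp_fun S t w - (k * U t w) *: sigma t) ord0 i)).
    apply: (L2_eq (e i)); apply: L2B; first exact: sp_L2.
    by apply: L2Z; exact: Usig_L2.
  rewrite (M2_normsq_fin eL) in h; case: h => h.
  rewrite (E_sqrB XL (L2Z k JL)) in h.
  have -> : k * E (fun w => sp_integral W S T w * J T w) = E (fun w => sp_integral W S T w * (k * J T w)).
    by rewrite -EZ; [apply: Eeq => w; rewrite mulrCA|exact: L2M].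
  rewrite h; apply: eq_bigr => i _.
  have -> : k * \int[Q]_u (tl (fun t w => sp_fun S t w ord0 i) u * tl (Usig i) u) =
      \int[Q]_u (tl (fun t w => sp_fun S t w ord0 i) u * (k * tl (Usig i) u)).
    by rewrite -EZ; [apply: Eeq => u; rewrite mulrCA|apply: L2M; [exact: sp_L2|exact: Usig_L2]].
  rewrite -E_sqrB; [|exact: sp_L2|by apply: L2Z; exact: Usig_L2].
  by apply: Eeq => u; rewrite e.
have e1 : E (fun w => (-1 * J T w) ^+ 2) = E (fun w => (1 * J T w) ^+ 2).
  by apply: Eeq => w; rewrite mulN1r sqrrN mul1r.
have e2 i : \int[Q]_u (-1 * tl (Usig i) u) ^+ 2 = \int[Q]_u (1 * tl (Usig i) u) ^+ 2.
  by apply: Eeq => w; rewrite mulN1r sqrrN mul1r.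
have k1 := key 1; have k2 := key (-1); rewrite e1 in k2.
rewrite (eq_bigr _ (fun i _ => congr1 (fun z => _ + z) (e2 i))) in k2.
have := congr2 (fun x y => (y - x) / 4) k1 k2.
rewrite -sumrB => h; transitivity ((E (fun w => sp_integral W S T w ^+ 2) - 2 * (-1 * E (fun w => sp_integral W S T w * J T w)) +
    E (fun w => (1 * J T w) ^+ 2) - (E (fun w => sp_integral W S T w ^+ 2) - 2 * (1 * E (fun w => sp_integral W S T w * J T w)) +
    E (fun w => (1 * J T w) ^+ 2))) / 4).
  by move: (Rintegral _ _ _) (Rintegral _ _ _) (Rintegral _ _ _) => x y z; field.
rewrite h mulr_suml; apply: eq_bigr => i _.
by move: (Rintegral _ _ _) (Rintegral _ _ _) (Rintegral _ _ _) => x y z; field.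
Qed.

Lemma simple_mean (S : simple_process d F T) : E (sp_integral W S T) = 0.
Proof.
have h (k : 'I_(sp_size S)) (g := fun w => dotv (sp_val S k w) (W (sp_time S k.+1) w - W (sp_time S k) w)) :
    L1 P g /\ E g = 0.
  have kN := ltn_ord k; have /andP[k0 _] := sp_time_itv (ltnW kN); have /andP[_ k1] := sp_time_itv kN.
  have kk := ltW (sp_time_lt kN); have [B hB] := sp_val_bounded S.
  have pF i : Fm (sp_time S k) (fun w => sp_val S k w ord0 i) by move=> A mA; exact: (sp_val_measurable i kN mA).
  have pB i w : `|sp_val S k w ord0 i| <= B by exact: hB.
  have hi i := bm_mean T0 bm k0 kk k1 i (pF i) (L1_bounded P (Fm_meas (pF i)) (pB i)).
  split; first by apply: L1_sum => i; have [] := hi i.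
  by rewrite Esum => [|i]; [rewrite big1// => i _; have [] := hi i|have [] := hi i].
have e w : sp_integral W S T w = \sum_(k < sp_size S) dotv (sp_val S k w) (W (sp_time S k.+1) w - W (sp_time S k) w).
  apply: eq_bigr => k _; have kN := ltn_ord k.
  have /andP[_ k0] := sp_time_itv (ltnW kN); have /andP[_ k1] := sp_time_itv kN.
  by rewrite (min_idPl k0) (min_idPl k1).
rewrite (Eeq _ e) Esum => [|k]; last by have [] := h k.
by rewrite big1// => k _; have [] := h k.
Qed.

Section ito.
Variables (H : R -> Omega -> 'rV[R]_d) (I : R -> Omega -> R).
Hypothesis itoH : ito_integral P T W H I.

Lemma ito_jm i : jm (fun t w => H t w ord0 i).
Proof. by case: itoH => -[h _] _ _ _; apply: (progressive_jm (P := P) (W := W)). Qed.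

Lemma ito_L2H i : L2 Q (tl (fun t w => H t w ord0 i)).
Proof. by apply: M2_L2; [exact: ito_jm|case: itoH => -[]]. Qed.

Lemma ito_approx : exists S : nat -> simple_process d F T,
  [/\ L2 P (I T),
   E (fun w => (sp_integral W (S n) T w - I T w) ^+ 2) @[n --> \oo] --> (0 : R),
   M2_normsq P T (fun t w => sp_fun (S n) t w - H t w) @[n --> \oo] --> 0%E &
   forall i, \int[Q]_u (tl (fun t w => sp_fun (S n) t w ord0 i) u - tl (fun t w => H t w ord0 i) u) ^+ 2
     @[n --> \oo] --> (0 : R)].
Proof.
case: itoH => _ adI _ [S [S1 S2]]; exists S; have S2T := S2 T TT.
have mI : measurable_fun [set: Omega] (I T) by apply: (@Fm_meas _ _ _ P d W T) => B mB; exact: adI.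
(* One finite approximation error already places the limit in L2. *)
have IL : L2 P (I T).
  have /fine_cvgP[+ _] := S2T.
  move=> [n _ /(_ n (leqnn n)) /= hn]; have [mX XL] := sp_integral_L2 (S n).
  have D : L2 P (fun w => sp_integral W (S n) T w - I T w).
    split; first exact: measurable_funB.
    apply: L1_lty => [|w|]; [by apply: measurable_funX; exact: measurable_funB|exact: sqr_ge0|].
    by rewrite -ge0_fin_numE//; apply: integral_ge0 => w _; rewrite lee_fin sqr_ge0.
  by apply: L2_eq (L2B (sp_integral_L2 (S n)) D) => w; rewrite opprB addrC subrK.
have DL n : L2 P (fun w => sp_integral W (S n) T w - I T w) by apply: L2B => //; exact: sp_integral_L2.
have Di n i : L2 Q (tl (fun t w => (sp_fun (S n) t w - H t w) ord0 i)).
  apply: (L2_eq (f := fun u => tl (fun t w => sp_fun (S n) t w ord0 i) u - tl (fun t w => H t w ord0 i) u)).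
    by move=> u; rewrite /tl !mxE mulrBr.
  by apply: L2B; [exact: sp_L2|exact: ito_L2H].
split => //.
  have := S2T; rewrite (eq_cvg _ _ (g := fun n => (E (fun w => (sp_integral W (S n) T w - I T w) ^+ 2))%:E)); last first.
    by move=> n; rewrite E_EFin//; case: (DL n).
  by move/fine_cvg.
move=> i; apply: (@seq_squeeze0 _ _ (fun n => fine (M2_normsq P T (fun t w => sp_fun (S n) t w - H t w)))) => [n|].
  apply/andP; split; first by apply: Ege0 => u; exact: sqr_ge0.
  apply: le_trans (M2_comp_le i (Di n)); rewrite le_eqVlt; apply/orP; left; apply/eqP; apply: Eeq => u.
  by rewrite /tl !mxE mulrBr.
by move/fine_cvg: S1.
Qed.

Lemma ito_L2 : L2 P (I T).
Proof. by have [S []] := ito_approx. Qed.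

Lemma ito_dual : E (fun w => I T w * J T w) =
  \sum_i \int[Q]_u (tl (fun t w => H t w ord0 i) u * tl (Usig i) u).
Proof.
have [S [IL S1 _ S2]] := ito_approx.
have c1 := L2_pair_cvg (fun n => sp_integral_L2 (S n)) IL (repr_L2J rp TT) S1.
have c2 i := L2_pair_cvg (fun n => sp_L2 (S n) i) (ito_L2H i) (Usig_L2 i) (S2 i).
have c3 : \sum_i \int[Q]_u (tl (fun t w => sp_fun (S n) t w ord0 i) u * tl (Usig i) u) @[n --> \oo] -->
    \sum_i \int[Q]_u (tl (fun t w => H t w ord0 i) u * tl (Usig i) u).
  exact: seq_sum.
apply: (cvg_unique _ c1); first exact: norm_hausdorff.
by apply: seq_eq c3 => n; rewrite simple_dual.
Qed.

Lemma ito_mean : E (I T) = 0.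
Proof.
have [S [IL S1 _ _]] := ito_approx.
have L2_1 : L2 P (fun=> 1) by apply: (L2_bounded P (M := 1)) => // w; rewrite normr1.
have c1 := L2_pair_cvg (fun n => sp_integral_L2 (S n)) IL L2_1 S1.
have -> : E (I T) = E (fun w => I T w * 1) by apply: Eeq => w; rewrite mulr1.
apply: (cvg_unique _ c1); first exact: norm_hausdorff.
apply: (seq_eq (u := fun=> 0)) => [n|]; last exact: cvg_cst.
by rewrite -(simple_mean (S n)); apply: Eeq => w; rewrite mulr1.
Qed.

End ito.
End with_repr.

Lemma M2_normsq_eq (H H' : R -> Omega -> 'rV[R]_d) :
  (forall t w, 0 <= t <= T -> H t w = H' t w) -> M2_normsq P T H = M2_normsq P T H'.
Proof.
move=> e; apply: eq_integral => w _; apply: eq_integral => t; rewrite inE/= in_itv/= => h.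
by rewrite e.
Qed.

(** The given Ito integral and the Wiener integral are L2 limits of the same simple integrals; for
    the latter this is the isometry with [U = 1]. *)
Lemma ito_unique sigma I0 (H : R -> Omega -> 'rV[R]_d) I : wiener P T W sigma I0 ->
  (forall t w, 0 <= t <= T -> H t w = sigma t) -> ito_integral P T W H I ->
  {ae P, forall w, I T w = I0 T w}.
Proof.
move=> wI eH itoH; have rp := repr_one T0 bm wI.
have [S [IL S1 S3 _]] := ito_approx rp itoH.
have I0L : L2 P (I0 T) := repr_L2J rp TT.
have XL n := sp_integral_L2 rp (S n).
have S2 : E (fun w => (sp_integral W (S n) T w - I0 T w) ^+ 2) @[n --> \oo] --> (0 : R).
  have : M2_normsq P T (fun t w => sp_fun (S n) t w - (1 * 1) *: sigma t) @[n --> \oo] --> 0%E.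
    move: S3; apply: cvg_trans; apply: near_eq_cvg; apply: nearW => n.
    by apply: M2_normsq_eq => t w tT; rewrite eH// mulr1 scale1r.
  rewrite (eq_cvg _ _ (g := fun n => (E (fun w => (sp_integral W (S n) T w - 1 * I0 T w) ^+ 2))%:E)); last first.
    by move=> n; have [_ ->] := simple_iso_T T0 bm rp (S n) 1.
  move/fine_cvg; apply: seq_eq => n /=; apply: Eeq => w; by rewrite mul1r.
have D1 n := L2B (XL n) IL; have D2 n := L2B (XL n) I0L; have D3 := L2B IL I0L.
have le n : E (fun w => (I T w - I0 T w) ^+ 2) <= 2 * E (fun w => (sp_integral W (S n) T w - I T w) ^+ 2)
    + 2 * E (fun w => (sp_integral W (S n) T w - I0 T w) ^+ 2).
  have [_ d1] := D1 n; have [_ d2] := D2 n; have [_ d3] := D3.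
  rewrite -!EZ// -ED; [|exact: L1Z..].
  apply: Ele => //; first by apply: L1D; exact: L1Z.
  move=> w; move: (sp_integral W (S n) T w) (I T w) (I0 T w) => x y z.
  have := sqrD_le (x - z) (- (x - y)); rewrite sqrrN.
  have -> : x - z + - (x - y) = y - z by ring.
  by rewrite [leRHS]addrC.
have z : E (fun w => (I T w - I0 T w) ^+ 2) <= 0.
  apply: (seq_geC (u := fun n => 2 * E (fun w => (sp_integral W (S n) T w - I T w) ^+ 2)
    + 2 * E (fun w => (sp_integral W (S n) T w - I0 T w) ^+ 2))) => //.
  by rewrite -[X in _ --> X](addr0 (0 : R)) -{1 2}(mulr0 2); apply: seqD; exact: seqZ.
have [_ d3] := D3.
have := E0_ae (fun w => sqr_ge0 _) d3 z; apply: filterS => w /eqP.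
by rewrite sqrf_eq0 subr_eq0 => /eqP.
Qed.

End duality.

(** * Expectations against an exponential density *)

Section verification.
Context (R : realType) (disp : measure_display) (Omega : measurableType disp)
  (P : probability Omega R) (d : nat) (T : R) (W : R -> Omega -> 'rV[R]_d).
Hypothesis T0 : 0 < T.
Hypothesis bm : brownian_motion P T W.
Local Notation E f := (\int[P]_w f w).
Local Notation Fm := (Fm P W).
Local Notation mu := (@lebesgue_measure R).
Local Notation Rint f a b := (\int[mu]_(x in `[a, b]) f x).
Let T0' : 0 <= T := ltW T0.
Let TT : 0 <= T <= T. Proof. by rewrite T0' lexx. Qed.
Local Notation RO := (measurableTypeR R * Omega)%type.
Local Notation tl := (tl T).
Local Notation jm := (jm T).
Local Notation Q := (@lebesgue_measure R \x P)%E.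
Variables (sigma : R -> 'rV[R]_d) (I0 : R -> Omega -> R).
Hypothesis wI : wiener P T W sigma I0.
Local Notation M := (Mexp T sigma I0).

Lemma jm_M : jm M.
Proof. by have [C [L rp]] := repr_exp T0 bm wI; exact: (@jm_U R disp Omega P d T W T0 bm _ _ _ _ _ _ rp). Qed.

Lemma M_L2Q : L2 Q (tl M).
Proof.
apply: (L2_tl (C := expR (Avar T sigma T))); [exact: jm_M|exact: expR_ge0|].
move=> t tT; split; first exact: (Mexp_L2 T0 bm wI tT).
rewrite (Mexp_sqr T0 bm wI tT) ler_expR (Avar_homo wI)//; by case/andP: tT.
Qed.

Lemma MT_L2Q : L2 Q (tl (fun _ w => M T w)).
Proof.
have ML := Mexp_L2 T0 bm wI TT.
apply: (L2_tl (C := E (fun w => M T w ^+ 2))) => //.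
- by apply: jm_rv; case: ML.
- by apply: Ege0 => w; exact: sqr_ge0.
Qed.

Section drift.
Variable a : R -> Omega -> R.
Hypothesis aF : forall t, 0 <= t <= T -> Fm t (a t).
Hypothesis aL2 : L2 Q (tl a).

Let h (u : RO) := tl (fun _ w => M T w) u * tl a u.
Let h' (u : RO) := tl M u * tl a u.

Let hL : L1 Q h. Proof. exact: L2M MT_L2Q aL2. Qed.
Let hL' : L1 Q h'. Proof. exact: L2M M_L2Q aL2. Qed.

(* The martingale property moves the density from the terminal time to the
   current one. *)
Lemma drift_exchange : \int[Q]_u h u = \int[Q]_u h' u.
Proof.
rewrite /Rintegral; congr fine.
rewrite -(integral12_prod_meas1 hL) -(integral12_prod_meas1 hL').
have m1 := measurable_int _ (integrable_fubini_F hL).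
have m2 := measurable_int _ (integrable_fubini_F hL').
apply: ae_eq_integral => //.
have [_ a2] := aL2; have := ae_integrable1 a2; apply: filterS => t ht _.
rewrite /fubini_F; case: (boolP (0 <= t <= T)) => tT; last first.
  by apply: eq_integral => w _; rewrite /= /h /h' !(tl_out _ (u := (t, w))) ?mulr0.
have [t0 t1] := andP tT.
have aL : L2 P (a t).
  split; first exact: Fm_meas (aF tT).
  by apply: L1_eq ht => w /=; rewrite tl_in.
have ML := Mexp_L2 T0 bm wI tT.
have [b1 b2] := Mexp_mart bm wI t0 t1 (lexx T) (aF tT) (L2M aL ML).
transitivity (\int[P]_w (a t w * M T w)%:E)%E.
  by apply: eq_integral => w _; rewrite /= /h !tl_in// mulrC.
rewrite (E_EFin b1) b2 -E_EFin; last exact: L2M.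
by apply: eq_integral => w _; rewrite /= /h' !tl_in// mulrC.
Qed.

(** Integrability of [a] in time is known for almost every path only. [fine] of the partial integral
    provides a measurable version, hence the equality almost everywhere. *)
Lemma drift_fubini : exists2 g : Omega -> R, L1 P g & E g = \int[Q]_u h u /\
  {ae P, forall w, g w = M T w * Rint (fun s => a s w) 0 T}.
Proof.
have mh := L1_meas hL.
pose hs (v : Omega * measurableTypeR R) := (h (v.2, v.1))%:E.
have mhs : measurable_fun [set: Omega * measurableTypeR R] hs.
  by apply/measurable_EFinP; apply: (measurableT_comp mh); exact: measurable_swap.
have ihs : (P \x mu)%E.-integrable setT hs.
  apply/(integrable12ltyP P mu mhs).
  have -> : (\int[P]_w \int[mu]_t `|hs (w, t)| = \int[Q]_u (`|h u|)%:E)%E.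
    rewrite fubini_tonelli2//; apply/measurable_EFinP; exact: measurableT_comp.
  rewrite E_EFin ?ltry//; exact: L1_norm.
have iF := integrable_fubini_F ihs.
set f := fubini_F _ _ in iF; have mf := measurable_int _ iF.
have aefin := integrable_ae measurableT iF.
have mg : measurable_fun [set: Omega] (fun w => fine (f w)).
  exact: (measurableT_comp (fine_measurable measurableT) mf).
have gL : L1 P (fun w => fine (f w)).
  apply: (le_integrable measurableT _ _ iF); first exact/measurable_EFinP.
  by move=> w _ /=; case: (f w) => [r| |] /=; rewrite ?leey ?lexx.
exists (fun w => fine (f w)) => //; split.
  rewrite /Rintegral; congr fine; rewrite -(integral21_prod_meas1 hL).
  apply: ae_eq_integral => //; first exact/measurable_EFinP.
  by move: aefin; apply: filterS => w hw _; rewrite fineK//; exact: hw.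
have aL1 : L1 Q (tl a).
  have one : L2 Q (tl (fun _ _ => 1)).
    apply: (L2_tl (C := 1)) => //; first by apply: jm_rv; exact: measurable_cst.
    move=> t _; split; first by apply: (L2_bounded P (M := 1)) => // w; rewrite normr1.
    by rewrite (@E_eq_cst _ _ _ _ _ 1)// => w; rewrite expr1n.
  apply: L1_eq (L2M aL2 one) => u.
  by case: (boolP (0 <= u.1 <= T)) => c; [rewrite !tl_in// mulr1|rewrite !tl_out// mulr0].
have := ae_integrable2 aL1; apply: filterS => w hw.
have tE : Rint (fun s => a s w) 0 T = \int[mu]_t tl a (t, w).
  by rewrite /Rintegral; congr fine; exact: tl_restrict.
rewrite tE -(EZ (M T w) (mu := mu) hw) /Rintegral; congr fine.
apply: eq_integral => t _; congr (_%:E); rewrite /h /=.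
by case: (boolP (0 <= t <= T)) => ct; [rewrite !(tl_in _ (u := (t, w)) ct)|rewrite !(tl_out _ (u := (t, w)) ct) !mulr0].
Qed.

End drift.
Section dual_expectation.
Variables (H : R -> Omega -> 'rV[R]_d) (I : R -> Omega -> R) (a : R -> Omega -> R).
Hypothesis itoH : ito_integral P T W H I.
Hypothesis aF : forall t, 0 <= t <= T -> Fm t (a t).
Hypothesis aL2 : L2 Q (tl a).
Variables (V : Omega -> R) (c : R).
Hypothesis mV : measurable_fun [set: Omega] V.
Hypothesis VE : {ae P, forall w, V w = c + Rint (fun s => a s w) 0 T + I T w}.

(** The product rule for M V in expectation. The constant is settled by E[M_T] = 1, the drift by
    [drift_exchange], and the Ito part by E[M_T I_T] = E[(M_T - 1) I_T], where M_T - 1 is the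
    represented variable. *)
Lemma verification : L1 P (fun w => M T w * V w) /\
  E (fun w => M T w * V w) =
  c + \int[Q]_u tl (fun t w => M t w * (a t w + dotv (sigma t) (H t w))) u.
Proof.
have [C [L rp]] := repr_exp T0 bm wI.
have ML := Mexp_L2 T0 bm wI TT; have IL := ito_L2 T0 bm rp itoH.
have [g gL [gE gae]] := drift_fubini aL2.
have hl i : L1 Q (fun u => tl (fun t w => H t w ord0 i) u * tl (Usig sigma M i) u).
  by apply: L2M; [exact: (ito_L2H T0 itoH)|exact: (Usig_L2 T0 bm rp)].
have ML1 := L2_L1 ML; have MI := L2M ML IL.
have EM : E (M T) = 1.
  have [_] := Mexp_pow T0 bm wI 1 TT.
  by rewrite expr1n subrr !mul0r expR0; under eq_Rintegral do rewrite expr1.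
pose K w := c * M T w + g w + M T w * I T w.
have KL : L1 P K by apply: L1D => //; apply: L1D => //; exact: L1Z.
have KV : {ae P, forall w, K w = M T w * V w}.
  apply: filterS2 VE gae => w -> gw; rewrite /K gw !mulrDr [c * _]mulrC; by [].
have mMV : measurable_fun [set: Omega] (fun w => M T w * V w).
  by apply: measurable_funM => //; case: ML.
split; first exact: L1_ae mMV KV KL.
rewrite -(Eeq_ae (L1_meas KL) mMV KV).
have cL : L1 P (fun w => c * M T w) by exact: L1Z.
have -> : E K = c * E (M T) + E g + E (fun w => M T w * I T w).
  by rewrite /K ED//; [rewrite ED// EZ|exact: L1D].
have -> : E (fun w => M T w * I T w) = E (fun w => I T w * (M T w - 1)).
  have e w : I T w * (M T w - 1) = M T w * I T w - I T w by rewrite mulrBr mulr1 mulrC.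
  by rewrite (Eeq _ e) EB ?(ito_mean T0 bm rp itoH) ?subr0//; exact: L2_L1.
rewrite (ito_dual T0 bm rp itoH) EM mulr1 gE (drift_exchange aF aL2) -addrA; congr (_ + _).
have hL' : L1 Q (fun u => tl M u * tl a u) by exact: L2M M_L2Q aL2.
rewrite -Esum// -ED//; last exact: L1_sum.
apply: Eeq => u; case: (boolP (0 <= u.1 <= T)) => cu.
  rewrite !tl_in// mulrDr; congr (_ + _); rewrite /dotv mulr_sumr; apply: eq_bigr => i _.
  by rewrite !tl_in// /Usig mulrC -mulrA.
by rewrite !tl_out// mul0r add0r big1// => i _; rewrite !tl_out// mul0r.
Qed.

End dual_expectation.
End verification.

Lemma tn_lt (R : realType) (T : R) n k : 0 < T -> (k < 2 ^ n)%N -> tn T n k < tn T n k.+1.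
Proof.
move=> T0 kn; rewrite !tnE ?ltW//; last exact: ltnW.
by rewrite ltr_pM2r ?invr_gt0 ?exprn_gt0// ltr_pM2l// ltr_nat.
Qed.

Lemma sqr_comp_le (R : realType) (d : nat) (v : 'rV[R]_d) i : v ord0 i ^+ 2 <= normsq v.
Proof.
rewrite /normsq /dotv (bigD1 i)//= -expr2 lerDl.
by apply: sumr_ge0 => j _; rewrite -expr2 sqr_ge0.
Qed.

Lemma normsq3_le (R : realType) (d : nat) (a b c : 'rV[R]_d) :
  normsq (a + b + c) <= 3 * (normsq a + normsq b + normsq c).
Proof.
have h1 := normsq_ge0 (a - b); have h2 := normsq_ge0 (b - c); have h3 := normsq_ge0 (a - c).
rewrite !normsqD dotvDl; rewrite !normsqB in h1 h2 h3.
move: (normsq a) (normsq b) (normsq c) (dotv a b) (dotv b c) (dotv a c) h1 h2 h3.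
by move=> x y z p q r h1 h2 h3; lra.
Qed.

(** * Existence of Ito integrals *)

Section grid_processes.
Context (R : realType) (disp : measure_display) (Omega : measurableType disp)
  (P : probability Omega R) (d : nat) (T : R) (W : R -> Omega -> 'rV[R]_d).
Hypothesis T0 : 0 < T.
Hypothesis bm : brownian_motion P T W.
Local Notation F := (filtration P W).
Local Notation E f := (\int[P]_w f w).
Local Notation Fm := (Fm P W).
Local Notation mu := (@lebesgue_measure R).
Let T0' : 0 <= T := ltW T0.
Let TT : 0 <= T <= T. Proof. by rewrite T0' lexx. Qed.

Let tn_itv n k : 0 <= tn T n k <= T. Proof. by rewrite tn_ge0// tn_le. Qed.

Section construction.
Variables (U : R -> Omega -> R) (eta : R -> 'rV[R]_d).
Hypothesis FU : forall t, 0 <= t <= T -> Fm t (U t).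
Hypothesis U0 : forall t w, 0 <= U t w.
Hypothesis ceta : contv eta.

(** Truncation at [n], tied to the grid level, makes the values bounded as a simple process
    requires. *)
Definition gval n k w := Num.min (U (tn T n k) w) n%:R *: eta (tn T n k).

Lemma gval_measurable n k i (B : set (measurableTypeR R)) : (k < 2 ^ n)%N -> measurable B ->
  F (tn T n k) [set w | B (gval n k w ord0 i)].
Proof.
move=> _ mB; have h : Fm (tn T n k) (fun w => gval n k w ord0 i).
  have -> : (fun w => gval n k w ord0 i) = (fun w => eta (tn T n k) ord0 i * Num.min (U (tn T n k) w) n%:R).
    by apply/funext => w; rewrite !mxE mulrC.
  apply: (FmZ bm); first exact: tn_le.
  by apply: (Fm_comp (h := fun y : R => Num.min y n%:R)); [exact: measurable_minr|exact: FU].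
exact: h.
Qed.

Lemma eta_bounded : exists2 B, 0 <= B & forall t, 0 <= t <= T -> normsq (eta t) <= B.
Proof.
have [B B0 hB] := @continuous_bounded _ _ 0 T (contv_normsq ceta).
by exists B => // t tT; apply: le_trans (ler_norm _) (hB _ tT).
Qed.

Lemma gval_bounded n : exists B : R, forall k w i, (k < 2 ^ n)%N -> `|gval n k w ord0 i| <= B.
Proof.
have [B B0 hB] := eta_bounded; exists (n%:R * (1 + B)) => k w i _.
rewrite mxE normrM; apply: ler_pM => //.
  by rewrite ger0_norm ?le_min ?U0 ?ler0n// ge_min lexx orbT.
have h := le_trans (sqr_comp_le (eta (tn T n k)) i) (hB _ (tn_itv n k)).
move: (eta _ _ _) h => y h; rewrite -(real_normK (num_real y)) in h.
move: `|y| h => a h; have := sqr_ge0 (a - 1); nra.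
Qed.

Definition gsp n : simple_process d F T := SimpleProcess (tn0 n T0') (tn_end n T0')
  (fun k => @tn_lt R T n k T0) (@gval_measurable n) (gval_bounded n).

End construction.

Section estimates.
Variables (sigma : R -> 'rV[R]_d) (U J : R -> Omega -> R) (u2 : R -> R) (C L : R).
Hypothesis rp : repr P T W sigma U J u2 C L.
Let U0 := repr_ge0 rp.

(** Where U exceeds n the error U - n is at most U, and n is at most U; hence n^2 (U - n)^2 <= U^4,
    and the fourth moment gives the rate. *)
Lemma trunc_sqr (n : nat) t : 0 <= t <= T -> (0 < n)%N ->
  L2 P (fun w => Num.min (U t w) n%:R - U t w) /\
  E (fun w => (Num.min (U t w) n%:R - U t w) ^+ 2) <= C / n%:R ^+ 2.
Proof.
move=> tT n0; have [mU U2] := repr_L2 rp tT; have [U4 C4] := repr_L4 rp tT.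
have n0' : 0 < n%:R :> R by rewrite ltr0n.
have le2 w : (Num.min (U t w) n%:R - U t w) ^+ 2 <= (n%:R ^+ 2)^-1 * U t w ^+ 4.
  rewrite -ler_pdivrMl ?invr_gt0 ?exprn_gt0// invrK.
  have := U0 t w; move: (U t w) => y y0; have [yn|ny] := leP y n%:R.
    by rewrite subrr expr0n/= mulr0 exprn_ge0.
  rewrite -exprMn (_ : y ^+ 4 = (y ^+ 2) ^+ 2); last by ring.
  rewrite -sqrrN; apply: lerXn2r; rewrite ?nnegrE ?sqr_ge0//.
    by rewrite -mulrN opprB mulr_ge0 ?ler0n// subr_ge0 ltW.
  rewrite -mulrN opprB expr2; apply: ler_pM; rewrite ?ler0n ?subr_ge0 ?(ltW ny)//.
  by rewrite gerBl ler0n.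
have mm : measurable_fun [set: Omega] (fun w => Num.min (U t w) n%:R - U t w).
  by apply: measurable_funB => //; exact: measurable_minr.
have L2' : L2 P (fun w => Num.min (U t w) n%:R - U t w).
  split => //; apply: (L1_le (g := fun w => (n%:R ^+ 2)^-1 * U t w ^+ 4)).
  - exact: measurable_funX.
  - by move=> w; rewrite ger0_norm ?sqr_ge0.
  - exact: L1Z.
split => //; apply: (le_trans (Ele L2'.2 (L1Z _ U4) le2)).
by rewrite EZ// mulrC ler_wpM2r// invr_ge0 exprn_ge0// ltW.
Qed.

Lemma C_ge0 : 0 <= C.
Proof.
by have [_ h] := repr_L4 rp TT; apply: le_trans h; apply: Ege0 => w; rewrite exprn_ge0.
Qed.

Lemma lip_L2 s t : 0 <= s <= T -> 0 <= t <= T -> L2 P (fun w => U s w - U t w).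
Proof. by move=> sT tT; apply: L2B; exact: (repr_L2 rp). Qed.

Section fixed_eta.
Variable eta : R -> 'rV[R]_d.
Hypothesis ceta : contv eta.
Local Notation gval := (gval U eta).

Lemma normsq_L2 (v : Omega -> R) (y : 'rV[R]_d) : L2 P v ->
  L1 P (fun w => normsq (v w *: y)) /\ E (fun w => normsq (v w *: y)) = normsq y * E (fun w => v w ^+ 2).
Proof.
move=> [mv v2]; have e w : normsq y * v w ^+ 2 = normsq (v w *: y) by rewrite normsqZ mulrC.
by have := L1_scaled e v2 erefl.
Qed.

Lemma gval_L2 n k r i : 0 <= r <= T -> L2 P (fun w => (gval n k w - U r w *: eta r) ord0 i).
Proof.
move=> rT; have [mk _] := repr_L2 rp (tn_itv n k).
apply: (L2_eq (f := fun w => eta (tn T n k) ord0 i * Num.min (U (tn T n k) w) n%:R - eta r ord0 i * U r w)).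
  by move=> w; rewrite !mxE mulrC [eta r _ _ * _]mulrC.
apply: L2B; apply: L2Z; last exact: (repr_L2 rp).
apply: (L2_bounded P (M := n%:R)); first exact: measurable_minr.
by move=> w; rewrite ger0_norm ?le_min ?U0 ?ler0n// ge_min lexx orbT.
Qed.

Lemma gval_L1 n k r : 0 <= r <= T -> L1 P (fun w => normsq (gval n k w - U r w *: eta r)).
Proof. by move=> rT; apply: L1_sum => i; apply: L2M; exact: gval_L2. Qed.

(** The error splits into the variation of [eta], the truncation and the increment of [U]. Each is
    brought below e / 9: a factor 3 for the number of terms and a factor 3 from [normsq3_le]. *)
Lemma grid_close e : 0 < e -> \forall n \near \oo, forall k r, (k < 2 ^ n)%N ->
  tn T n k <= r <= tn T n k.+1 -> E (fun w => normsq (gval n k w - U r w *: eta r)) <= e.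
Proof.
move=> e0; have [B B0 hB] := eta_bounded ceta.
have [G G0 hG] := @continuous_bounded _ _ 0 T (repr_u2c rp).
have C0 := C_ge0.
have e1 : 0 < e / (9 * (G + 1)) by rewrite divr_gt0// mulr_gt0// ltr_wpDl.
have [rho rho0 hrho] := contv_mod T ceta e1.
pose h := e / (9 * (B + 1) * (`|L| + 1)).
have B1 : 0 < B + 1 by rewrite ltr_wpDl.
have L1' : 0 < `|L| + 1 by rewrite ltr_wpDl.
have h0 : 0 < h by rewrite divr_gt0// !mulr_gt0.
pose N := (Num.truncn (9 * (B + 1) * (C + 1) / e)).+1.
have m1 := grid_mesh T0' rho0; have m2 := grid_mesh T0' h0.
have m3 : \forall n \near \oo, (N <= n)%N by exists N.
near=> n; move=> k r kn /andP[kr rk].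
have hn1 : T / 2 ^+ n <= rho by near: n.
have hn2 : T / 2 ^+ n <= h by near: n.
have hn3 : (N <= n)%N by near: n.
have n0 : (0 < n)%N by exact: leq_trans hn3.
have rT : 0 <= r <= T by case/andP: (tn_itv n k) (tn_itv n k.+1) => a _ /andP[_ b]; rewrite (le_trans a kr) (le_trans rk b).
have kT := tn_itv n k; have step := tn_step n k T0'.
have rk' : r - tn T n k <= T / 2 ^+ n by apply: le_trans step; rewrite lerD2r.
have kL := repr_L2 rp kT.
have [mk k2] := kL.
have tL : L2 P (fun w => Num.min (U (tn T n k) w) n%:R).
  apply: (L2_bounded P (M := n%:R)); first exact: measurable_minr.
  by move=> w; rewrite ger0_norm ?le_min ?U0 ?ler0n// ge_min lexx orbT.
have [a1 a2] := normsq_L2 (eta (tn T n k) - eta r) tL.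
have [trL trE] := trunc_sqr kT n0.
have [b1 b2] := normsq_L2 (eta r) trL.
have [c1 c2] := normsq_L2 (eta r) (lip_L2 kT rT).
have dec w : gval n k w - U r w *: eta r = Num.min (U (tn T n k) w) n%:R *: (eta (tn T n k) - eta r)
   + (Num.min (U (tn T n k) w) n%:R - U (tn T n k) w) *: eta r + (U (tn T n k) w - U r w) *: eta r.
  rewrite /gval scalerBr !scalerBl; apply/rowP => i; rewrite !mxE.
  by move: (eta _ _ _) (eta _ _ _) (U _ _) (U _ _) (Num.min _ _) => x y z v u; ring.
have s1 : E (fun w => Num.min (U (tn T n k) w) n%:R ^+ 2) <= G.
  have : E (fun w => U (tn T n k) w ^+ 2) <= G.
    by rewrite (repr_u2 rp kT); apply: le_trans (ler_norm _) (hG _ kT).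
  apply: le_trans; apply: Ele => //; first by case: tL.
  by move=> w; apply: lerXn2r; rewrite ?nnegrE ?le_min ?U0 ?ler0n// ge_min lexx.
have s3 : E (fun w => (U (tn T n k) w - U r w) ^+ 2) <= `|L| * (T / 2 ^+ n).
  have e3 w : (U (tn T n k) w - U r w) ^+ 2 = (U r w - U (tn T n k) w) ^+ 2 by rewrite -sqrrN opprB.
  rewrite (Eeq _ e3); apply: (le_trans (repr_lip rp _ kr _)); [by case/andP: kT|by case/andP: rT|].
  apply: (@le_trans _ _ (`|L| * (r - tn T n k))); last by rewrite ler_wpM2l.
  by rewrite ler_wpM2r ?ler_norm// subr_ge0.
have t1 : E (fun w => normsq (Num.min (U (tn T n k) w) n%:R *: (eta (tn T n k) - eta r))) <= e / 9.
  rewrite a2; apply: (@le_trans _ _ (e / (9 * (G + 1)) * G)).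
    apply: ler_pM => //; [exact: normsq_ge0|by apply: Ege0 => w; exact: sqr_ge0|].
    by apply: hrho => //; rewrite distrC ger0_norm ?subr_ge0// (le_trans rk').
  have G1 : 0 < G + 1 by rewrite ltr_wpDl.
  have -> : e / (9 * (G + 1)) * G = e / 9 * (G / (G + 1)) by field; rewrite gt_eqF.
  apply: ler_piMr; first by rewrite divr_ge0// ltW.
  by rewrite ler_pdivrMr// mul1r lerDl.
have t2 : E (fun w => normsq ((Num.min (U (tn T n k) w) n%:R - U (tn T n k) w) *: eta r)) <= e / 9.
  rewrite b2; apply: (@le_trans _ _ ((B + 1) * (C / n%:R ^+ 2))).
    apply: ler_pM => //; [exact: normsq_ge0|by apply: Ege0 => w; exact: sqr_ge0|].
    by apply: le_trans (hB _ rT) _; rewrite lerDl.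
  have nN : 9 * (B + 1) * (C + 1) / e <= n%:R.
    by apply: (le_trans (ltW (truncnS_gt _))); rewrite ler_nat.
  have n1 : 1 <= n%:R :> R by rewrite ler1n.
  have nn : n%:R <= n%:R ^+ 2 :> R by rewrite expr2 ler_peMl// ler0n.
  rewrite mulrA ler_pdivrMr ?exprn_gt0 ?ltr0n//.
  have q : 9 * (B + 1) * (C + 1) <= n%:R ^+ 2 * e by rewrite -ler_pdivrMr// (le_trans nN).
  move: (n%:R ^+ 2) q => z q; have := mulr_ge0 (ltW B1) C0; lra.
have t3 : E (fun w => normsq ((U (tn T n k) w - U r w) *: eta r)) <= e / 9.
  rewrite c2; apply: (@le_trans _ _ ((B + 1) * ((`|L| + 1) * h))).
    apply: ler_pM => //; [exact: normsq_ge0|by apply: Ege0 => w; exact: sqr_ge0| |].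
      by apply: le_trans (hB _ rT) _; rewrite lerDl.
    apply: (le_trans s3); apply: ler_pM => //; first by rewrite divr_ge0// exprn_ge0.
    by rewrite lerDl.
  have -> : (B + 1) * ((`|L| + 1) * h) = e / 9 by rewrite /h; field; rewrite !gt_eqF.
  by [].
have l12 := L1D (L1D a1 b1) c1.
apply: (@le_trans _ _ (3 * (e / 9 + e / 9 + e / 9))); last by lra.
apply: (@le_trans _ _ (E (fun w => 3 * (normsq (Num.min (U (tn T n k) w) n%:R *: (eta (tn T n k) - eta r))
   + normsq ((Num.min (U (tn T n k) w) n%:R - U (tn T n k) w) *: eta r)
   + normsq ((U (tn T n k) w - U r w) *: eta r))))).
  apply: Ele; [exact: gval_L1|exact: L1Z|move=> w; rewrite dec; exact: normsq3_le].
rewrite EZ// ler_wpM2l// (ED (L1D a1 b1) c1) (ED a1 b1).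
by apply: lerD => //; exact: lerD.
Unshelve. all: by end_near.
Qed.

End fixed_eta.
End estimates.
End grid_processes.

Lemma squeeze0_near (R : realType) (u : nat -> R) : (forall n, 0 <= u n) ->
  (forall e, 0 < e -> \forall n \near \oo, u n <= e) -> u n @[n --> \oo] --> (0 : R).
Proof.
move=> u0 h; apply/cvgrPdist_le => e e0; have := h e e0; apply: filterS => n hn.
by rewrite sub0r normrN ger0_norm.
Qed.

(** * Convergence along the dyadic grids *)

Section grid_limits.
Context (R : realType) (disp : measure_display) (Omega : measurableType disp)
  (P : probability Omega R) (d : nat) (T : R) (W : R -> Omega -> 'rV[R]_d).
Hypothesis T0 : 0 < T.
Hypothesis bm : brownian_motion P T W.
Local Notation E f := (\int[P]_w f w).
Local Notation Fm := (Fm P W).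
Local Notation mu := (@lebesgue_measure R).
Let T0' : 0 <= T := ltW T0.
Let TT : 0 <= T <= T. Proof. by rewrite T0' lexx. Qed.
Local Notation tl := (tl T).
Local Notation jm := (jm T).

Let tn_itv n k : 0 <= tn T n k <= T. Proof. by rewrite tn_ge0// tn_le. Qed.

(** The bound is asked for positive times: simple processes live on left-open cells and vanish at 0,
    and a single time is a null set. *)
Lemma M2_le (H : R -> Omega -> 'rV[R]_d) C : (forall i, jm (fun t w => H t w ord0 i)) -> 0 <= C ->
  (forall t, 0 < t <= T -> L1 P (fun w => normsq (H t w)) /\ E (fun w => normsq (H t w)) <= C) ->
  (M2_normsq P T H <= (C * T)%:E)%E.
Proof.
move=> jH C0 h; rewrite M2_normsq_swap//.
have eqF t : ((fun t => \int[P]_w (normsq (H t w))%:E)%E \_ `[0%R, T]) t =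
    fubini_F P (fun u => (tl (fun t w => normsq (H t w)) u)%:E) t.
  rewrite patchE /fubini_F; case: ifPn => c.
    by move: c; rewrite inE/= in_itv/= => c; apply: eq_integral => w _; rewrite tl_in.
  rewrite [RHS](eq_integral (fun=> 0%E)) => [|w _]; first by rewrite integral0.
  by rewrite tl_out//; apply: contra c => c; rewrite mem_set//= in_itv.
have -> : (\int[mu]_(t in `[0%R, T]) \int[P]_w (normsq (H t w))%:E =
    \int[mu]_t fubini_F P (fun u => (tl (fun t w => normsq (H t w)) u)%:E) t)%E.
  by rewrite integral_mkcond; apply: eq_integral => t _; exact: eqF.
have -> : (C * T)%:E = (\int[mu]_t (C * \1_(`[0%R, T]%classic) t)%:E)%E.
  transitivity (\int[mu]_(t in `[0%R, T]) C%:E)%E.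
    by rewrite (RintE _ _ (f := fun=> C)) ?Rint_cst// ?subr0//; exact: cst_continuous.
  rewrite integral_mkcond; apply: eq_integral => t _; rewrite patchE indicE.
  by case: (_ \in _); rewrite ?mulr1 ?mulr0.
apply: ae_ge0_le_integral => //.
- by move=> t _; apply: integral_ge0 => w _; rewrite lee_fin; apply: tl_ge0 => *; exact: normsq_ge0.
- apply: measurable_fun_fubini_tonelli_F; first by apply/measurable_EFinP; exact: jm_normsq.
  by move=> u; rewrite lee_fin; apply: tl_ge0 => *; exact: normsq_ge0.
- by move=> t _; rewrite lee_fin mulr_ge0// indicE ler0n.
- by apply/measurable_EFinP; apply: measurable_funM => //; exact: measurable_indic.
have z : (mu : set (measurableTypeR R) -> \bar R).-negligible [set (0 : R)].
  by exists [set 0]; split => //; exact: lebesgue_measure_set1.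
apply: negligibleS z => t /= ht; apply: contrapT => t0; apply: ht => _.
rewrite -eqF patchE indicE; case: ifPn => // c; last by rewrite mulr0.
rewrite mulr1; move: c; rewrite inE/= in_itv/= => /andP[c0 c1].
have [a1 a2] : L1 P (fun w => normsq (H t w)) /\ E (fun w => normsq (H t w)) <= C.
  by apply: h; rewrite c1 andbT lt_neqAle c0 andbT eq_sym; apply/eqP.
by rewrite E_EFin.
Qed.

Section grid.
Variables (sigma : R -> 'rV[R]_d) (U J : R -> Omega -> R) (u2 : R -> R) (C L : R).
Hypothesis rp : repr P T W sigma U J u2 C L.
Let FU := repr_Fm rp.
Let U0 := repr_ge0 rp.
Let cs := repr_contv rp.

Section any_eta.
Variable eta : R -> 'rV[R]_d.
Hypothesis ceta : contv eta.
Local Notation S n := (gsp T0 bm FU U0 ceta n).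

Lemma gsp_M2 : M2_normsq P T (fun t w => sp_fun (S n) t w - U t w *: eta t) @[n --> \oo] --> 0%E.
Proof.
have jS n i : jm (fun t w => (sp_fun (S n) t w - U t w *: eta t) ord0 i).
  apply: (jm_eq (H := fun t w => sp_fun (S n) t w ord0 i - U t w * eta t ord0 i)).
    by move=> t w _; rewrite !mxE.
  apply: jmB; first exact: jm_sp.
  apply: jmM; first exact: (@jm_U R disp Omega P d T W T0 bm _ _ _ _ _ _ rp).
  exact: jm_det.
have key e : 0 < e -> \forall n \near \oo,
    (M2_normsq P T (fun t w => sp_fun (S n) t w - U t w *: eta t)%R <= e%:E)%E.
  move=> e0; have eT : 0 < e / T by rewrite divr_gt0.
  have := grid_close T0 rp ceta eT; apply: filterS => n hn.
  have -> : e = e / T * T by rewrite divfK// gt_eqF.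
  apply: M2_le => //; first exact: ltW.
  move=> t /andP[t0 tT]; have t0T : 0 <= t <= T by rewrite ltW.
  have [||k kn kt] := @part_ex _ (tn T n) (2 ^ n)%N t.
  - by rewrite tn0.
  - by rewrite tn_end.
  have e1 w : normsq (gval T U eta n k w - U t w *: eta t) = normsq (sp_fun (S n) t w - U t w *: eta t).
    by rewrite (@sp_funE R disp Omega P d T W (S n) k t w kn kt).
  split; first by apply: (L1_eq e1); exact: (gval_L1 T0 rp eta n k t0T).
  by rewrite -(Eeq _ e1); apply: hn => //; case/andP: kt => /ltW -> ->.
have ge0 n : (0 <= M2_normsq P T (fun t w => sp_fun (S n) t w - U t w *: eta t)%R)%E.
  by apply: integral_ge0 => w _; apply: integral_ge0 => t _; rewrite lee_fin normsq_ge0.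
apply/fine_cvgP; split.
  have := key 1 ltr01; apply: filterS => n hn; rewrite ge0_fin_numE//.
  by apply: le_lt_trans hn _; exact: ltry.
apply: squeeze0_near => [n|e e0]; first exact: fine_ge0.
have := key e e0; apply: filterS => n hn; rewrite -lee_fin fineK// ge0_fin_numE//.
by apply: le_lt_trans hn _; exact: ltry.
Qed.

End any_eta.

Variable D : R -> R.
Hypothesis cD : continuous D.

Let cDs : contv (fun t => D t *: sigma t).
Proof.
move=> i; have -> : (fun t => (D t *: sigma t) ord0 i) = (fun t => D t * sigma t ord0 i).
  by apply/funext => t; rewrite mxE.
by move=> t; apply: cvgM; [exact: cD|exact: cs].
Qed.

Definition wsp n := gsp T0 bm FU U0 cDs n.
(** Riemann sums of int D dJ. They stand in for the simple integrals of D U sigma, from which they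
    differ by a null sequence in L2. *)
Definition wsum n t w := \sum_(k < 2 ^ n)
  D (tn T n k) * (J (Num.min (tn T n k.+1) t) w - J (Num.min (tn T n k) t) w).

Lemma wsp_L2 n t : 0 <= t <= T -> L2 P (fun w => sp_integral W (wsp n) t w - wsum n t w).
Proof. by move=> tT; have [] := simple_iso T0 bm rp (wsp n) (fun k => D (tn T n k)) tT. Qed.

(** Applied with the weights D(t_k), the isometry leaves D(t_k)^2 times the error for [sigma] alone,
    which [grid_close] makes small. *)
Lemma wsp_iso t : 0 <= t <= T ->
  E (fun w => (sp_integral W (wsp n) t w - wsum n t w) ^+ 2) @[n --> \oo] --> (0 : R).
Proof.
move=> tT; have [t0 t1] := andP tT.
apply: squeeze0_near => [n|e e0]; first by apply: Ege0 => w; exact: sqr_ge0.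
have cDD : continuous (fun t => D t * D t) by move=> r; apply: cvgM; exact: cD.
have [B B0 hB] := @continuous_bounded _ _ 0 T cDD.
have B1 : 0 < B + 1 by rewrite ltr_wpDl.
have e' : 0 < e / ((B + 1) * T) by rewrite divr_gt0// mulr_gt0.
have := grid_close T0 rp cs e'; apply: filterS => n hn.
have [_ ->] := simple_iso T0 bm rp (wsp n) (fun k => D (tn T n k)) tT.
have mn k : 0 <= Num.min (tn T n k) t <= T by rewrite le_min tn_ge0// t0 ge_min tn_le.
have mh k : Num.min (tn T n k) t <= Num.min (tn T n k.+1) t.
  by rewrite le_min; apply/andP; split; rewrite ge_min ?(tnS n k T0') ?lexx ?orbT.
have tE j : sp_time (wsp n) j = tn T n j by [].
apply: (@le_trans _ _ (\sum_(k < 2 ^ n) e / T * (Num.min (tn T n k.+1) t - Num.min (tn T n k) t))).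
  apply: ler_sum => k _; have kn := ltn_ord k; rewrite !tE.
  case: (boolP (tn T n k <= t)) => [kt|]; last first.
    rewrite -ltNge => tk; have tk1 : t <= tn T n k.+1 by apply: (le_trans (ltW tk)); exact: tnS.
    by rewrite (min_idPr (ltW tk)) (min_idPr tk1) Rint_point subrr mulr0.
  have mk : Num.min (tn T n k) t = tn T n k by apply/min_idPl.
  have pB : exists B', forall i w, `|sp_val (wsp n) k w ord0 i| <= B'.
    by have [B' hB'] := sp_val_bounded (wsp n); exists B' => i w; exact: hB'.
  have [B' hB'] := pB.
  have pF i : Fm (tn T n k) (fun w => sp_val (wsp n) k w ord0 i).
    by move=> A mA; exact: (@sp_val_measurable _ _ _ _ _ (wsp n) k i A kn mA).
  have k0 := tn_ge0 n k T0'; have [_ kT] := andP (mn k.+1).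
  have SE r : tn T n k <= r <= Num.min (tn T n k.+1) t -> stepvar P sigma U (sp_val (wsp n) k) (D (tn T n k)) r <= e / T
    /\ stepvar P sigma U (sp_val (wsp n) k) (D (tn T n k)) r =
     \sum_i stepvar_comp P sigma U u2 (tn T n k) (sp_val (wsp n) k) (D (tn T n k)) i r.
    move=> kr; split; last exact: (stepvarE rp (D (tn T n k)) k0 kT pF hB' kr).
    have [kr1 kr2] := andP kr; have kr3 : r <= tn T n k.+1 by move: kr2; rewrite le_min => /andP[].
    have rT : 0 <= r <= T by rewrite (le_trans k0 kr1) (le_trans kr2 kT).
    have e1 w : D (tn T n k) ^+ 2 * normsq (gval T U sigma n k w - U r w *: sigma r) =
       normsq (sp_val (wsp n) k w - (D (tn T n k) * U r w) *: sigma r).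
      rewrite -normsqZ; congr normsq; rewrite /= /gval scalerBr !scalerA; congr (_ *: _ - _).
      exact: mulrC.
    rewrite /stepvar -(Eeq _ e1) EZ; last exact: (gval_L1 T0 rp sigma n k rT).
    have b1 : D (tn T n k) ^+ 2 <= B + 1.
      by rewrite expr2; apply: (le_trans (ler_norm _)); apply: (le_trans (hB _ (tn_itv n k))); rewrite lerDl.
    have b2 : E (fun w => normsq (gval T U sigma n k w - U r w *: sigma r)) <= e / ((B + 1) * T).
      by apply: hn => //; rewrite kr1.
    have -> : e / T = (B + 1) * (e / ((B + 1) * T)) by field; rewrite !gt_eqF.
    apply: ler_pM => //; [exact: sqr_ge0|by apply: Ege0 => w; exact: normsq_ge0].
  rewrite mk.
  have mk1 : tn T n k <= Num.min (tn T n k.+1) t by rewrite -{1}mk; exact: mh.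
  rewrite -(Rint_cst (e / T) mk1).
  rewrite [leLHS](Rint_eq (g := fun r => \sum_i stepvar_comp P sigma U u2 (tn T n k) (sp_val (wsp n) k) (D (tn T n k)) i r)); last first.
    by move=> r kr; have [_ ->] := SE r kr.
  apply: Rint_le; first by apply: continuous_sum => i; exact: (stepvar_comp_continuous rp).
    exact: cst_continuous.
  by move=> r kr; have [h1 <-] := SE r kr.
rewrite -mulr_sumr -(big_mkord xpredT (fun k => Num.min (tn T n k.+1) t - Num.min (tn T n k) t)).
rewrite telescope_sumr// tn_end// tn0// (min_idPr t1) (min_idPl t0) subr0.
by rewrite mulrAC ler_pdivrMr// ler_wpM2l// ltW.
Qed.

End grid.

(* Linearity, only needed at the terminal time. *)
Lemma wiener_linear s1 s2 I1 I2 I3 : wiener P T W s1 I1 -> wiener P T W s2 I2 ->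
  wiener P T W (fun t => s1 t + s2 t) I3 -> {ae P, forall w, I3 T w = I1 T w + I2 T w}.
Proof.
move=> w1 w2 w3.
have r1 := repr_one T0 bm w1; have r2 := repr_one T0 bm w2; have r3 := repr_one T0 bm w3.
have c1 : continuous (fun _ : R => 1 : R) by exact: cst_continuous.
have wsum1 s I (rp : repr P T W s (fun _ _ => 1) I (fun=> 1) 1 0) n w :
    wsum I (fun=> 1) n T w = I T w.
  rewrite /wsum; transitivity (\sum_(k < 2 ^ n) (I (tn T n k.+1) w - I (tn T n k) w)).
    by apply: eq_bigr => k _; rewrite mul1r !(min_idPl _)//; exact: tn_le.
  rewrite -(big_mkord xpredT (fun k => I (tn T n k.+1) w - I (tn T n k) w)) telescope_sumr//.
  by rewrite tn_end// tn0// (repr_J0 rp) subr0.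
pose X s I (rp : repr P T W s (fun _ _ => 1) I (fun=> 1) 1 0) n w := sp_integral W (wsp rp c1 n) T w.
have cX s I rp : E (fun w => (@X s I rp n w - I T w) ^+ 2) @[n --> \oo] --> (0 : R).
  apply: seq_eq (wsp_iso rp c1 TT) => n; apply: Eeq => w.
  by rewrite (wsum1 _ _ rp).
have LX s I rp n : L2 P (fun w => @X s I rp n w - I T w).
  by apply: L2_eq (wsp_L2 rp c1 n TT) => w; rewrite (wsum1 _ _ rp).
(* [wiener] describes an integral only through moments, so additivity is read off the simple
   integrals, which are linear in the integrand. *)
have Xadd n w : X _ _ r3 n w = X _ _ r1 n w + X _ _ r2 n w.
  rewrite /X /sp_integral -big_split/=; apply: eq_bigr => k _.
  by rewrite -dotvDl /gval -scalerDr !scale1r.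
have L3 : L2 P (fun w => I3 T w - (I1 T w + I2 T w)).
  by apply: L2B; [exact: (repr_L2J r3)|apply: L2D; [exact: (repr_L2J r1)|exact: (repr_L2J r2)]].
have le n : E (fun w => (I3 T w - (I1 T w + I2 T w)) ^+ 2) <=
    3 * (E (fun w => (X _ _ r1 n w - I1 T w) ^+ 2) + E (fun w => (X _ _ r2 n w - I2 T w) ^+ 2) +
    E (fun w => (X _ _ r3 n w - I3 T w) ^+ 2)).
  have [_ l1] := LX _ _ r1 n; have [_ l2] := LX _ _ r2 n; have [_ l3] := LX _ _ r3 n.
  rewrite -(ED l1 l2) -(ED (L1D l1 l2) l3) -(EZ 3 (L1D (L1D l1 l2) l3)).
  apply: Ele; [by case: L3|exact: L1Z (L1D (L1D l1 l2) l3)|move=> w].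
  rewrite Xadd; move: (X _ _ _ _ _) (X _ _ _ _ _) (I1 T w) (I2 T w) (I3 T w) => a b x y z.
  have -> : z - (x + y) = (b - x) + (a - y) - (b + a - z) by ring.
  move: (b - x) (a - y) (b + a - z) => p q r.
  have := sqr_ge0 (p - q); have := sqr_ge0 (p + r); have := sqr_ge0 (q + r); nra.
have z : E (fun w => (I3 T w - (I1 T w + I2 T w)) ^+ 2) <= 0.
  apply: (seq_geC le); rewrite -[X in _ --> X](mulr0 3); apply: seqZ.
  by rewrite -[X in _ --> X](addr0 (0 : R)) -{1}(addr0 (0 : R)); apply: seqD; [apply: seqD|]; exact: cX.
have [_ l3] := L3.
have := E0_ae (fun w => sqr_ge0 _) l3 z; apply: filterS => w /eqP.
by rewrite sqrf_eq0 subr_eq0 => /eqP.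
Qed.

End grid_limits.

Lemma sqr_sum_le (R : realType) (x : nat -> R) n :
  (\sum_(k < n) x k) ^+ 2 <= n%:R * \sum_(k < n) x k ^+ 2.
Proof.
elim: n => [|n IH]; first by rewrite !big_ord0 expr2 !mul0r.
rewrite !big_ord_recr/= -natr1; case: n IH => [|n] IH.
  by rewrite !big_ord0 !add0r mul1r.
move: (\sum_(k < n.+1) x k) (\sum_(k < n.+1) x k ^+ 2) (x n.+1) IH => S q y IH.
have n0 : 0 < n.+1%:R :> R by rewrite ltr0n.
move: n.+1%:R n0 IH => m m0 IH; rewrite -(ler_pM2l m0).
have h := sqr_ge0 (S - m * y).
have h2 : (m + 1) * S ^+ 2 <= (m + 1) * (m * q) by rewrite ler_wpM2l// addr_ge0 ?ltW.
have -> : m * (S + y) ^+ 2 = (m + 1) * S ^+ 2 + m * (m + 1) * y ^+ 2 - (S - m * y) ^+ 2 by ring.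
have -> : m * ((m + 1) * (q + y ^+ 2)) = (m + 1) * (m * q) + m * (m + 1) * y ^+ 2 by ring.
by move: (_ ^+ 2) ((m + 1) * _) ((m + 1) * _) (m * _ * _) h h2 => a b c e h h2; lra.
Qed.

Lemma continuous_sqr (R : realType) (f : R -> R) : continuous f -> continuous (fun r => f r ^+ 2).
Proof. by move=> cf r; exact: (cvgM (cf r) (cf r)). Qed.

(** * Ito integrals of deterministic and of exponential integrands *)

Section ito_existence.
Context (R : realType) (disp : measure_display) (Omega : measurableType disp)
  (P : probability Omega R) (d : nat) (T : R) (W : R -> Omega -> 'rV[R]_d).
Hypothesis T0 : 0 < T.
Hypothesis bm : brownian_motion P T W.
Local Notation F := (filtration P W).
Local Notation E f := (\int[P]_w f w).
Local Notation Fm := (Fm P W).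
Local Notation mu := (@lebesgue_measure R).
Local Notation Rint f a b := (\int[mu]_(x in `[a, b]) f x).
Let T0' : 0 <= T := ltW T0.
Local Notation RO := (measurableTypeR R * Omega)%type.
Local Notation tl := (tl T).
Local Notation jm := (jm T).
Local Notation Q := (@lebesgue_measure R \x P)%E.

Lemma Rint_sqr_le f (a b : R) : continuous f -> a <= b ->
  (Rint f a b) ^+ 2 <= (b - a) * Rint (fun r => f r ^+ 2) a b.
Proof.
move=> cf; rewrite le_eqVlt => /predU1P[<-|ab].
  by rewrite !Rint_point expr2 mul0r mulr0.
have ba : 0 < b - a by rewrite subr_gt0.
pose m := Rint f a b / (b - a).
have cf2 : continuous (fun r => f r ^+ 2) by exact: continuous_sqr.
have cmf : continuous (fun r => (2 * m) * f r) by move=> r; apply: cvgM; [exact: cvg_cst|exact: cf].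
have : 0 <= Rint (fun r => (f r ^+ 2 - (2 * m) * f r) + m ^+ 2) a b.
  apply: Rint_ge0 => r _.
  by rewrite (_ : _ + _ = (f r - m) ^+ 2) ?sqr_ge0//; ring.
rewrite RintD; [|by move=> r; apply: cvgB; [exact: cf2|exact: cmf]|exact: cst_continuous].
rewrite RintB// RintZ// (Rint_cst _ (ltW ab)) /m.
move: (Rint f a b) (Rint (fun r => f r ^+ 2) a b) => y z h.
rewrite -subr_ge0; have := mulr_ge0 (ltW ba) h; move: (b - a) ba h => k k0 _.
have -> : k * (z - 2 * (y / k) * y + (y / k) ^+ 2 * k) = k * z - y ^+ 2 by field; rewrite gt_eqF.
by [].
Qed.

Lemma E_Rint_le Y (a b c : R) : 0 <= a -> a <= b -> b <= T -> jm Y -> (forall w, continuous (Y ^~ w)) ->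
  (forall t w, 0 <= Y t w) -> 0 <= c ->
  (forall t, a <= t <= b -> L1 P (Y t) /\ E (Y t) <= c) ->
  L1 P (fun w => Rint (fun t => Y t w) a b) /\ E (fun w => Rint (fun t => Y t w) a b) <= c * (b - a).
Proof.
move=> a0 ab bT jY cY Y0 c0 h.
pose G (u : RO) := \1_(`[a, b]%classic) u.1 * tl Y u.
have mG : measurable_fun [set: RO] (fun u => (G u)%:E).
  apply/measurable_EFinP; apply: measurable_funM; last exact: jY.
  by apply: measurableT_comp => //; exact: measurable_indic.
have G0 u : (0 <= (G u)%:E)%E by rewrite lee_fin mulr_ge0 ?indicE ?ler0n//; apply: tl_ge0.
have inT t : a <= t <= b -> 0 <= t <= T by move=> /andP[h1 h2]; rewrite (le_trans a0 h1) (le_trans h2 bT).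
have Gin t w : a <= t <= b -> G (t, w) = Y t w.
  by move=> tab; rewrite /G indicE mem_set ?in_itv//= mul1r tl_in//; exact: inT.
have Gout t w : ~~ (a <= t <= b) -> G (t, w) = 0.
  by move=> tab; rewrite /G indicE memNset ?mul0r//= in_itv/=; exact/negP.
have GE w : (fubini_G mu (fun u => (G u)%:E) w = (Rint (fun t => Y t w) a b)%:E)%E.
  rewrite -RintE// /fubini_G [RHS]integral_mkcond; apply: eq_integral => t _; rewrite patchE.
  case: ifPn => tab; first by move: tab; rewrite inE/= in_itv/= => tab; rewrite Gin.
  by rewrite Gout//; apply: contra tab => tab; rewrite mem_set//= in_itv.
have mR : measurable_fun [set: Omega] (fun w => Rint (fun t => Y t w) a b).
  apply/measurable_EFinP; rewrite (_ : _ \o _ = fubini_G mu (fun u => (G u)%:E)).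
    exact: measurable_fun_fubini_tonelli_G.
  by apply/funext => w; rewrite GE.
have le : (\int[P]_w (Rint (fun t => Y t w) a b)%:E <= (c * (b - a))%:E)%E.
  rewrite (eq_integral (fubini_G mu (fun u => (G u)%:E))) => [|w _]; last by rewrite GE.
  rewrite -fubini_tonelli2// fubini_tonelli1//.
  have -> : (c * (b - a))%:E = (\int[mu]_t (c * \1_(`[a, b]%classic) t)%:E)%E.
    transitivity (\int[mu]_(t in `[a, b]) c%:E)%E.
      by rewrite (RintE _ _ (f := fun=> c)) ?Rint_cst//; exact: cst_continuous.
    rewrite integral_mkcond; apply: eq_integral => t _; rewrite patchE indicE.
    by case: (_ \in _); rewrite ?mulr1 ?mulr0.
  apply: ge0_le_integral => //.
  - by move=> t _; apply: integral_ge0.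
  - exact: measurable_fun_fubini_tonelli_F.
  - by apply/measurable_EFinP; apply: measurable_funM => //; exact: measurable_indic.
  move=> t _; rewrite /fubini_F indicE; have [tab|tab] := boolP (a <= t <= b).
    have [h1 h2] := h t tab; rewrite mem_set ?in_itv//= mulr1.
    rewrite (eq_integral (fun w => (Y t w)%:E)) => [|w _]; last by rewrite Gin.
    by rewrite E_EFin.
  rewrite (eq_integral (fun=> 0%E)) => [|w _]; last by rewrite Gout.
  by rewrite integral0 lee_fin mulr_ge0// ler0n.
have R0 w : 0 <= Rint (fun t => Y t w) a b by apply: Rint_ge0 => t _.
have LR : L1 P (fun w => Rint (fun t => Y t w) a b).
  by apply: L1_lty => //; apply: le_lt_trans le _; exact: ltry.
by split => //; rewrite -lee_fin -E_EFin.
Qed.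

(** The pathwise integral is a limit of Riemann sums over times up to [t]. *)
Lemma Fm_Rint X t : (forall s, 0 <= s <= T -> Fm s (X s)) -> (forall w, continuous (X ^~ w)) ->
  0 <= t <= T -> Fm t (fun w => Rint (X ^~ w) 0 t).
Proof.
move=> FX cX /andP[t0 t1].
apply: (Fm_lim bm (f_ := fun n w => \sum_(k < 2 ^ n) X (tn t n k) w *
   (cl 0 t (tn t n k.+1) - cl 0 t (tn t n k)))) => // [n|w].
  apply: (Fm_sum bm) => // k.
  have -> : (fun w => X (tn t n k) w * (cl 0 t (tn t n k.+1) - cl 0 t (tn t n k))) =
     (fun w => (cl 0 t (tn t n k.+1) - cl 0 t (tn t n k)) * X (tn t n k) w).
    by apply/funext => w; rewrite mulrC.
  apply: (FmZ bm) => //; apply: (Fm_mono (tn_le t n k)); apply: FX.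
  by rewrite tn_ge0// (le_trans (tn_le _ _ _) t1).
exact: riemann.
Qed.

Lemma progressive_eq (H H' : R -> Omega -> R) : (forall t w, 0 <= t <= T -> H t w = H' t w) ->
  progressive F T H -> progressive F T H'.
Proof.
move=> e h t B tT mB; have := h t B tT mB; congr (<<s _ >> _); apply/seteqP; split => u /= [u1 u2].
  by split => //; rewrite -e//; case/andP: u1 tT => -> u1 /andP[_ /(le_trans u1) ->].
by split => //; rewrite e//; case/andP: u1 tT => -> u1 /andP[_ /(le_trans u1) ->].
Qed.

Section from_repr.
Variables (sigma : R -> 'rV[R]_d) (U J : R -> Omega -> R) (u2 : R -> R) (C L : R).
Hypothesis rp : repr P T W sigma U J u2 C L.
Variables (D : R -> R) (H : R -> Omega -> 'rV[R]_d) (Jv : R -> Omega -> R).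
Hypothesis cD : continuous D.
Hypothesis HE : forall t w, 0 <= t <= T -> H t w = (D t * U t w) *: sigma t.
Hypothesis FJ : forall t, 0 <= t <= T -> Fm t (Jv t).
Hypothesis cJ : forall w, continuous (Jv ^~ w).
Hypothesis JL : forall n t, 0 <= t <= T -> L2 P (fun w => wsum T J D n t w - Jv t w).
Hypothesis Jc : forall t, 0 <= t <= T ->
  E (fun w => (wsum T J D n t w - Jv t w) ^+ 2) @[n --> \oo] --> (0 : R).

(** The simple processes [wsp] approximate [H] in M^2, and their integrals differ from [wsum] by a
    null sequence; what is left to each application is the limit of [wsum]. *)
Lemma ito_of_limit : ito_integral P T W H Jv.
Proof.
have cs : contv sigma := repr_contv rp.
have jU := @jm_U R disp Omega P d T W T0 bm _ _ _ _ _ _ rp.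
have HiE i t w : 0 <= t <= T -> D t * Usig sigma U i t w = H t w ord0 i.
  by move=> tT; rewrite HE// mxE /Usig mulrA.
split.
- split.
    move=> i; apply: (progressive_eq (HiE i)); apply: (progressive_cont bm).
      move=> t /[dup] tT /andP[_ t1]; apply: (FmZ bm) => //.
      have -> : Usig sigma U i t = (fun w => sigma t ord0 i * U t w) by apply/funext => w; exact: mulrC.
      by apply: (FmZ bm) => //; exact: (repr_Fm rp).
    move=> w t; apply: cvgM; first exact: cD.
    by apply: cvgM; [exact: (repr_cont rp)|exact: cs].
  have [B B0 hB] := @continuous_bounded _ _ 0 T cD.
  have h i : L2 Q (tl (fun t w => H t w ord0 i)).
    apply: (L2_eq (f := fun u : RO => D (clamp T u.1) * tl (Usig sigma U i) u)).
      move=> u; case: (boolP (0 <= u.1 <= T)) => c; last by rewrite !tl_out// mulr0.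
      by rewrite !tl_in// clampE// HiE.
    apply: (L2_bound (M := B)); last exact: (Usig_L2 T0 bm rp).
      have mD : measurable_fun [set: measurableTypeR R] (fun t => D (clamp T t)).
        apply: continuous_measurable_fun => t; apply: continuous_comp; last exact: cD.
        exact: continuous_clamp.
      exact: measurableT_comp mD _.
    by move=> u; apply: hB; exact: clamp_itv.
  by rewrite (M2_normsq_fin h) ltry.
- by move=> t B tT mB; exact: FJ.
- by apply: (aeW P) => w; apply: continuous_subspaceT; exact: cJ.
exists (wsp T0 bm rp cD); split.
  have ce : contv (fun t => D t *: sigma t).
    move=> i; have -> : (fun t => (D t *: sigma t) ord0 i) = (fun t => D t * sigma t ord0 i).
      by apply/funext => t; rewrite mxE.
    by move=> t; apply: cvgM; [exact: cD|exact: cs].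
  have := gsp_M2 T0 bm rp ce; apply: cvg_trans; apply: near_eq_cvg; apply: nearW => n.
  apply: M2_normsq_eq => t w tT; rewrite HE// scalerA [U t w * _]mulrC; congr (_ - _).
move=> t tT.
have Lw n := wsp_L2 T0 bm rp cD n tT.
have L' n : L2 P (fun w => sp_integral W (wsp T0 bm rp cD n) t w - Jv t w).
  by apply: L2_eq (L2D (Lw n) (JL n tT)) => w; rewrite addrA subrK.
apply: (@cvg_trans _ ((E (fun w => (sp_integral W (wsp T0 bm rp cD n) t w - Jv t w) ^+ 2))%:E @[n --> \oo])).
  by apply: near_eq_cvg; apply: nearW => n; rewrite E_EFin//; case: (L' n).
apply: cvg_EFin; first exact: nearW.
apply: (@seq_squeeze0 _ _ (fun n => 2 * E (fun w => (sp_integral W (wsp T0 bm rp cD n) t w - wsum T J D n t w) ^+ 2)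
   + 2 * E (fun w => (wsum T J D n t w - Jv t w) ^+ 2))) => [n|].
  apply/andP; split; first by apply: Ege0 => w; exact: sqr_ge0.
  have [_ l1] := Lw n; have [_ l2] := JL n tT; have [_ l3] := L' n.
  rewrite -(EZ 2 l1) -(EZ 2 l2) -(ED (L1Z 2 l1) (L1Z 2 l2)).
  apply: Ele => //; first exact: L1D (L1Z 2 l1) (L1Z 2 l2).
  move=> w; move: (sp_integral _ _ _ _) (wsum _ _ _ _ _ _) (Jv t w) => p q r.
  by have := sqrD_le (p - q) (q - r); rewrite addrA subrK.
rewrite -[X in _ --> X](addr0 (0 : R)) -{1 2}(mulr0 2); apply: seqD; apply: seqZ; last exact: Jc.
exact: (wsp_iso T0 bm rp cD tT).
Qed.

End from_repr.

Lemma ito_wiener sigma I H : wiener P T W sigma I ->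
  (forall t w, 0 <= t <= T -> H t w = sigma t) -> ito_integral P T W H I.
Proof.
move=> wI HE; have rp := repr_one T0 bm wI.
have c1 : continuous (fun _ : R => 1 : R) by exact: cst_continuous.
have wE n t w : 0 <= t <= T -> wsum T I (fun=> 1) n t w = I t w.
  move=> /andP[t0 tT]; rewrite /wsum.
  transitivity (\sum_(k < 2 ^ n) (I (Num.min (tn T n k.+1) t) w - I (Num.min (tn T n k) t) w)).
    by apply: eq_bigr => k _; rewrite mul1r.
  rewrite -(big_mkord xpredT (fun k => I (Num.min (tn T n k.+1) t) w - I (Num.min (tn T n k) t) w)).
  rewrite telescope_sumr// tn_end// tn0// (min_idPr tT) (min_idPl t0).
  by rewrite (repr_J0 rp) subr0.
apply: (ito_of_limit rp c1).
- by move=> t w tT; rewrite HE// mulr1 scale1r.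
- by move=> t tT; exact: (Fm_I wI).
- by case: wI.
- by move=> n t tT; apply: L2_eq (L2_0 P) => w; rewrite wE// subrr.
- move=> t tT; apply: (seq_eq (u := fun=> 0)) => [n|]; last exact: cvg_cst.
  by rewrite (@E_eq_cst _ _ _ P _ 0)// => w; rewrite wE// subrr expr0n.
Qed.

Section exponential.
Variables (sigma : R -> 'rV[R]_d) (I : R -> Omega -> R) (m : R -> R) (x : R).
Hypothesis wI : wiener P T W sigma I.
Hypothesis cm : continuous m.
Local Notation M := (Mexp T sigma I).

Definition Dexp t := x * expR (Prim T m t).
Definition Vexp t w := Dexp t * M t w.
(** [Vexp] minus its initial value and its drift, hence the candidate for int V sigma'dW. *)
Definition Jexp t w := Vexp t w - x - Prim T (fun s => m s * Vexp s w) t.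

Lemma Dexp_continuous : continuous Dexp.
Proof.
move=> t; apply: cvgM; first exact: cvg_cst.
by apply: continuous_comp; [exact: (Prim_continuous T0 cm)|exact: continuous_expR].
Qed.

Lemma mD_continuous : continuous (fun t => m t * Dexp t).
Proof. by move=> t; apply: cvgM; [exact: cm|exact: Dexp_continuous]. Qed.

Lemma Dexp_diff s t : 0 <= s -> s <= t -> t <= T -> Dexp t - Dexp s = Rint (fun r => m r * Dexp r) s t.
Proof.
move=> s0 st tT; rewrite /Dexp -mulrBr (Prim_ftc T0 cm)// -RintZ.
  by apply: Rint_eq => r _; rewrite mulrCA.
move=> r; apply: cvgM; first exact: cm.
by apply: continuous_comp; [exact: (Prim_continuous T0 cm)|exact: continuous_expR].
Qed.

Lemma M_continuous w : continuous (M ^~ w).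
Proof. exact: (@Mexp_continuous _ _ _ _ _ _ _ T0 _ _ wI w). Qed.

Lemma Vexp_continuous w : continuous (Vexp ^~ w).
Proof. by move=> t; apply: cvgM; [exact: Dexp_continuous|exact: M_continuous]. Qed.

Lemma mV_continuous w : continuous (fun s => m s * Vexp s w).
Proof. by move=> t; apply: cvgM; [exact: cm|exact: Vexp_continuous]. Qed.

Lemma Fm_Vexp t : 0 <= t <= T -> Fm t (Vexp t).
Proof. by move=> tT; apply: (FmZ bm); [case/andP: tT|exact: (Fm_Mexp bm wI)]. Qed.

Lemma Vexp0 w : Vexp 0 w = x.
Proof. by rewrite /Vexp /Dexp Prim0// expR0 (Mexp0 T0 wI) !mulr1. Qed.

Lemma Fm_mV t : 0 <= t <= T -> Fm t (fun w => m t * Vexp t w).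
Proof. by move=> tT; apply: (FmZ bm); [case/andP: tT|exact: Fm_Vexp]. Qed.

Lemma Fm_Jexp t : 0 <= t <= T -> Fm t (Jexp t).
Proof.
move=> tT; have [_ t1] := andP tT.
apply: (FmB bm) => //; first by apply: (FmB bm) => //; [exact: Fm_Vexp|exact: (Fm_cst bm)].
have -> : (fun w => Prim T (fun s => m s * Vexp s w) t) = (fun w => Rint ((fun s w => m s * Vexp s w) ^~ w) 0 t).
  by apply/funext => w; rewrite PrimE.
by apply: Fm_Rint => //; [exact: Fm_mV|exact: mV_continuous].
Qed.

Section remainder.
Variables (n : nat) (t : R).
Hypothesis tT : 0 <= t <= T.
Let t0 : 0 <= t. Proof. by case/andP: tT. Qed.
Let t1 : t <= T. Proof. by case/andP: tT. Qed.
Let p k := Num.min (tn T n k) t.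

(** The error on one cell in the product rule for D M, with M taken at the right endpoint and D at
    the left one. *)
Definition rho k w := Rint (fun r => m r * Dexp r * (M (p k.+1) w - M r w)) (p k) (p k.+1).

Lemma p_itv k : 0 <= p k <= T. Proof. by rewrite le_min tn_ge0// t0 ge_min tn_le. Qed.

Lemma p_homo k : p k <= p k.+1.
Proof. by rewrite le_min; apply/andP; split; rewrite ge_min ?(tnS n k T0') ?lexx ?orbT. Qed.

Lemma p_step k : p k.+1 - p k <= T / 2 ^+ n.
Proof.
apply: le_trans (tn_step n k T0'); have h := tnS n k T0'.
rewrite /p; move: (tn T n k) (tn T n k.+1) h => a b h.
have [at_|ta] := leP a t; have [bt|tb] := leP b t => //.
- by rewrite lerD2r ltW.
- by have := lt_le_trans ta (le_trans h bt); rewrite ltxx.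
- by rewrite subrr subr_ge0.
Qed.

Lemma rho_sub_continuous k w : continuous (fun r => M (p k.+1) w - M r w).
Proof. by move=> r; apply: cvgB; [exact: cvg_cst|exact: M_continuous]. Qed.

Lemma rhoE k w : rho k w = Vexp (p k.+1) w - Vexp (p k) w
  - Rint (fun s => m s * Vexp s w) (p k) (p k.+1) - Dexp (tn T n k) * (M (p k.+1) w - M (p k) w).
Proof.
have [p0 p1] := andP (p_itv k); have [_ p1'] := andP (p_itv k.+1); have pp := p_homo k.
(* The weight sits at the unclamped grid point. This differs from the clamped one on cells beyond
   [t], where the increment of M vanishes. *)
have -> : Dexp (tn T n k) * (M (p k.+1) w - M (p k) w) = Dexp (p k) * (M (p k.+1) w - M (p k) w).
  case: (boolP (tn T n k <= t)) => [kt|]; first by rewrite /p (min_idPl kt).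
  rewrite -ltNge => tk; have tk1 : t <= tn T n k.+1 by apply: (le_trans (ltW tk)); exact: tnS.
  have z : p k.+1 = p k by rewrite /p (min_idPr tk1) (min_idPr (ltW tk)).
  have h (a b : R) : a = b -> M a w - M b w = 0 by move=> ->; rewrite subrr.
  have h' (e1 e2 q : R) : q = 0 -> e1 * q = e2 * q by move=> ->; rewrite !mulr0.
  by apply: h'; exact: (h _ _ z).
have -> : rho k w = M (p k.+1) w * Rint (fun r => m r * Dexp r) (p k) (p k.+1)
   - Rint (fun s => m s * Vexp s w) (p k) (p k.+1).
  rewrite -RintZ; last exact: mD_continuous.
  rewrite -RintB; [|by move=> r; apply: cvgM; [exact: cvg_cst|exact: mD_continuous]|exact: mV_continuous].
  rewrite /rho; apply: Rint_eq => r _; rewrite /Vexp.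
  by move: (m r) (Dexp r) (M (p k.+1) w) (M r w) => a b e f; ring.
rewrite -Dexp_diff// /Vexp.
have h (a b e f g : R) : a * (e - f) - g = e * a - f * b - g - f * (a - b) by ring.
exact: h.
Qed.

Lemma rho_sum w : \sum_(k < 2 ^ n) rho k w =
  Jexp t w - wsum T (fun t w => M t w - 1) Dexp n t w.
Proof.
rewrite /wsum; under eq_bigr do rewrite rhoE.
rewrite sumrB sumrB.
have -> : \sum_(k < 2 ^ n) (Vexp (p k.+1) w - Vexp (p k) w) = Vexp t w - x.
  rewrite -(big_mkord xpredT (fun k => Vexp (p k.+1) w - Vexp (p k) w)) telescope_sumr//.
  by rewrite /p tn_end// tn0// (min_idPr t1) (min_idPl t0) Vexp0.
have e0 : p 0%N = 0 by rewrite /p tn0// (min_idPl t0).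
have eN : p (2 ^ n)%N = t by rewrite /p tn_end// (min_idPr t1).
have S : Rint (fun s => m s * Vexp s w) 0 t = \sum_(k < 2 ^ n) Rint (fun s => m s * Vexp s w) (p k) (p k.+1).
  rewrite -(Rint_sum (2 ^ n) (@mV_continuous w) p_homo).
  have h a a' b b' : a = a' -> b = b' ->
    Rint (fun s => m s * Vexp s w) a' b' = Rint (fun s => m s * Vexp s w) a b by move=> -> ->.
  exact: h.
rewrite /Jexp PrimE// S; congr (_ - _).
by apply: eq_bigr => k _; congr (_ * _); rewrite opprB addrA subrK.
Qed.

Lemma rho_meas k : measurable_fun [set: Omega] (rho k).
Proof.
have [_ p1] := andP (p_itv k); have [_ p2] := andP (p_itv k.+1).
have FR j : measurable_fun [set: Omega] (fun w => Rint (fun s => m s * Vexp s w) 0 (p j)).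
  exact: Fm_meas (Fm_Rint Fm_mV mV_continuous (p_itv j)).
have FV j : measurable_fun [set: Omega] (Vexp (p j)) := Fm_meas (Fm_Vexp (p_itv j)).
have FM j : measurable_fun [set: Omega] (M (p j)) := Fm_meas (Fm_Mexp bm wI (p_itv j)).
have -> : rho k = (fun w => Vexp (p k.+1) w - Vexp (p k) w
  - (Rint (fun s => m s * Vexp s w) 0 (p k.+1) - Rint (fun s => m s * Vexp s w) 0 (p k))
  - Dexp (tn T n k) * (M (p k.+1) w - M (p k) w)).
  apply/funext => w; rewrite rhoE; congr (_ - _ - _).
  have [p0 _] := andP (p_itv k).
  by rewrite (Rint_add (@mV_continuous w) p0 (p_homo k)) addrAC subrr add0r.
apply: measurable_funB; last by apply: measurable_funM => //; exact: measurable_funB.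
by apply: measurable_funB; exact: measurable_funB.
Qed.

(** A cell of width h contributes at most B L h^3 to the second moment, so even the crude factor 2^n
    of [sqr_sum_le] leaves a total of order h. *)
Lemma rho_bound B L : 0 <= B -> 0 <= L -> (forall r, 0 <= r <= T -> (m r * Dexp r) ^+ 2 <= B) ->
  (forall s t, 0 <= s -> s <= t -> t <= T -> E (fun w => (M t w - M s w) ^+ 2) <= L * (t - s)) ->
  L2 P (fun w => \sum_(k < 2 ^ n) rho k w) /\
  E (fun w => (\sum_(k < 2 ^ n) rho k w) ^+ 2) <= B * L * T ^+ 3 * (T / 2 ^+ n) / T.
Proof.
move=> B0 L0 hB hL; set h := T / 2 ^+ n.
have h0 : 0 <= h by rewrite divr_ge0// exprn_ge0.
have one k : L1 P (fun w => rho k w ^+ 2) /\ E (fun w => rho k w ^+ 2) <= B * L * h ^+ 3.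
  have [p0 p1] := andP (p_itv k); have [p0' p1'] := andP (p_itv k.+1); have pp := p_homo k.
  pose Y r w := (M (p k.+1) w - M r w) ^+ 2.
  have cY w : continuous (Y ^~ w) by apply: continuous_sqr; exact: rho_sub_continuous.
  have jY : jm Y.
    apply: (jm_eq (H := fun r w => (M (p k.+1) w - M r w) * (M (p k.+1) w - M r w))) => [r w _|].
      by rewrite -expr2.
    have jM : jm M by have [C' [L' rp]] := repr_exp T0 bm wI; exact: (@jm_U R disp Omega P d T W T0 bm _ _ _ _ _ _ rp).
    have j1 : jm (fun r w => M (p k.+1) w - M r w).
      by apply: jmB => //; apply: jm_rv; exact: Fm_meas (Fm_Mexp bm wI (p_itv k.+1)).
    exact: jmM.
  have [a1 a2] : L1 P (fun w => Rint (fun r => Y r w) (p k) (p k.+1)) /\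
      E (fun w => Rint (fun r => Y r w) (p k) (p k.+1)) <= (L * h) * (p k.+1 - p k).
    apply: E_Rint_le => //; [by move=> r w; exact: sqr_ge0|exact: mulr_ge0|].
    move=> r /andP[r1 r2]; have r0T : 0 <= r <= T by rewrite (le_trans p0 r1) (le_trans r2 p1').
    have [_ l] := L2B (Mexp_L2 T0 bm wI (p_itv k.+1)) (Mexp_L2 T0 bm wI r0T).
    split; first exact: l.
    apply: (le_trans (hL r (p k.+1) _ r2 p1')); first by case/andP: r0T.
    rewrite ler_wpM2l//; apply: le_trans (p_step k).
    by rewrite lerD2l lerN2.
  have le w : rho k w ^+ 2 <= (h * B) * Rint (fun r => Y r w) (p k) (p k.+1).
    have cr : continuous (fun r => m r * Dexp r * (M (p k.+1) w - M r w)).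
      by move=> r; apply: cvgM; [exact: mD_continuous|exact: rho_sub_continuous].
    apply: (le_trans (Rint_sqr_le cr pp)); rewrite -mulrA; apply: ler_pM.
    - by rewrite subr_ge0.
    - by apply: Rint_ge0 => r _; exact: sqr_ge0.
    - exact: p_step.
    rewrite -RintZ; last exact: cY.
    apply: Rint_le.
    - exact: continuous_sqr.
    - by move=> r; apply: cvgM; [exact: cvg_cst|exact: cY].
    move=> r /andP[r1 r2]; rewrite exprMn ler_wpM2r ?sqr_ge0// hB//.
    by rewrite (le_trans p0 r1) (le_trans r2 p1').
  have LL : L1 P (fun w => rho k w ^+ 2).
    apply: (L1_le _ _ (L1Z (h * B) a1)); first by apply: measurable_funX; exact: rho_meas.
    by move=> w; rewrite ger0_norm ?sqr_ge0.
  split => //; apply: (le_trans (Ele LL (L1Z (h * B) a1) le)); rewrite EZ//.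
  have -> : B * L * h ^+ 3 = h * B * (L * h * h) by ring.
  apply: ler_wpM2l; first exact: mulr_ge0.
  by apply: (le_trans a2); apply: ler_wpM2l; [exact: mulr_ge0|exact: p_step].
have L2r : L2 P (fun w => \sum_(k < 2 ^ n) rho k w).
  by apply: L2_sum => k; split; [exact: rho_meas|have [] := one k].
split => //.
have l1 : L1 P (fun w => \sum_(k < 2 ^ n) rho k w ^+ 2) by apply: L1_sum => k; have [] := one k.
apply: (le_trans (Ele L2r.2 (L1Z (2 ^ n)%:R l1) (fun w => sqr_sum_le (rho ^~ w) (2 ^ n)))).
rewrite EZ// Esum; last by move=> k; have [] := one k.
apply: (@le_trans _ _ ((2 ^ n)%:R * \sum_(k < 2 ^ n) B * L * h ^+ 3)).
  by rewrite ler_wpM2l ?ler0n//; apply: ler_sum => k _; have [] := one k.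
rewrite sumr_const card_ord -(mulr_natl (B * L * h ^+ 3)) natrX /h.
rewrite le_eqVlt; apply/orP; left; apply/eqP.
by field; rewrite expf_neq0//= gt_eqF.
Qed.

End remainder.

(** Takes the place of Ito's formula: [Jexp] differs from the weighted sums of increments of M by
    the sum of the [rho], which vanishes in L2. *)
Lemma ito_exp H : (forall t w, 0 <= t <= T -> H t w = Vexp t w *: sigma t) ->
  ito_integral P T W H Jexp.
Proof.
move=> HE; have [C [L rp]] := repr_exp T0 bm wI.
have cm2 : continuous (fun r => (m r * Dexp r) ^+ 2).
  by apply: continuous_sqr; exact: mD_continuous.
have [B B0 hB] := @continuous_bounded _ _ 0 T cm2.
have hB' r : 0 <= r <= T -> (m r * Dexp r) ^+ 2 <= B by move=> rT; apply: le_trans (ler_norm _) (hB r rT).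
have hL s t : 0 <= s -> s <= t -> t <= T -> E (fun w => (M t w - M s w) ^+ 2) <= `|L| * (t - s).
  move=> s0 st tT; apply: (le_trans (repr_lip rp s0 st tT)).
  by rewrite ler_wpM2r ?ler_norm// subr_ge0.
have rb n t (tT : 0 <= t <= T) := rho_bound n tT B0 (normr_ge0 L) hB' hL.
have eW n t w (tT : 0 <= t <= T) : - (\sum_(k < 2 ^ n) rho n t k w) =
    wsum T (fun t w => M t w - 1) Dexp n t w - Jexp t w.
  by rewrite rho_sum// opprB.
apply: (ito_of_limit rp Dexp_continuous).
- by move=> t w tT; rewrite HE.
- exact: Fm_Jexp.
- move=> w t; apply: cvgB; last exact: (Prim_continuous T0 (@mV_continuous w)).
  by apply: cvgB; [exact: Vexp_continuous|exact: cvg_cst].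
- move=> n t tT; have [b1 _] := rb n t tT.
  by apply: L2_eq (L2Z (-1) b1) => w; rewrite mulN1r eW.
- move=> t tT; apply: (@seq_squeeze0 _ _ (fun n => B * `|L| * T ^+ 3 * (T / 2 ^+ n) / T)) => [n|].
    apply/andP; split; first by apply: Ege0 => w; exact: sqr_ge0.
    have [_ b2] := rb n t tT; apply: le_trans b2; rewrite le_eqVlt; apply/orP; left; apply/eqP.
    by apply: Eeq => w; rewrite -eW// sqrrN.
  have c0 : T / 2 ^+ n @[n --> \oo] --> (0 : R).
    apply: squeeze0_near => [n|e e0]; first by rewrite divr_ge0// exprn_ge0.
    exact: grid_mesh.
  apply: (seq_eq (u := fun n => (B * `|L| * T ^+ 3 / T) * (T / 2 ^+ n))) => [n|]; first by rewrite mulrAC.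
  by rewrite -[X in _ --> X](mulr0 (B * `|L| * T ^+ 3 / T)); exact: seqZ.
Qed.

Lemma JexpE t w : 0 <= t <= T -> Vexp t w = x + Rint (fun s => m s * Vexp s w) 0 t + Jexp t w.
Proof. move=> tT; rewrite /Jexp PrimE//.
have h (a b c : R) : a = b + c + (a - b - c) by ring.
exact: h. Qed.

End exponential.
End ito_existence.

(** * The optimal investment *)

Section box_projection.
Variables (R : realType) (d : nat) (b eps K delta gamma : 'rV[R]_d).
Hypothesis eps0 : forall i, 0 < eps ord0 i.
Hypothesis K0 : forall i, 0 <= K ord0 i.
Hypothesis feas : feasible eps K delta gamma.
Hypothesis mini : forall delta' gamma', feasible eps K delta' gamma' ->
  normsq (b + gamma - delta) <= normsq (b + gamma' - delta').
Local Notation th i := (b ord0 i + gamma ord0 i - delta ord0 i).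

(** The feasible set is a product of intervals, so one coordinate of each vector may be changed
    alone. *)
Lemma coordinate_min i x y : `|x| <= eps ord0 i -> `|y| <= K ord0 i ->
  th i ^+ 2 <= (b ord0 i + y - x) ^+ 2.
Proof.
move=> hx hy.
pose delta' : 'rV[R]_d := \row_j if j == i then x else delta ord0 j.
pose gamma' : 'rV[R]_d := \row_j if j == i then y else gamma ord0 j.
have f' : feasible eps K delta' gamma'.
  by move=> j; rewrite !mxE; case: eqP => [->|_]; [split|exact: feas].
have := mini f'; rewrite /normsq /dotv (bigD1 i)//= [leRHS](bigD1 i)//=.
have -> : \sum_(j < d | j != i) (b + gamma' - delta') ord0 j * (b + gamma' - delta') ord0 j =
    \sum_(j < d | j != i) (b + gamma - delta) ord0 j * (b + gamma - delta) ord0 j.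
  by apply: eq_bigr => j ji; rewrite !mxE (negbTE ji).
by rewrite lerD2r !mxE eqxx.
Qed.

Lemma box_above i : K ord0 i + eps ord0 i < b ord0 i ->
  delta ord0 i = eps ord0 i /\ gamma ord0 i = - K ord0 i.
Proof.
move=> h; have [/ler_normlP[d1 d2] /ler_normlP[g1 g2]] := feas i.
have := coordinate_min (i := i) (x := eps ord0 i) (y := - K ord0 i).
rewrite normrN !ger0_norm ?K0 ?(ltW (eps0 i))// => /(_ (lexx _) (lexx _)).
move: (b ord0 i) (eps ord0 i) (K ord0 i) (delta ord0 i) (gamma ord0 i) h d1 d2 g1 g2.
move=> y e k u v h d1 d2 g1 g2 hs.
have p : 0 < y - k - e by lra.
have q : y - k - e <= y + v - u by lra.
have : y + v - u <= y - k - e.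
  rewrite leNgt; apply/negP => lt.
  have h1 : 0 < (y + v - u) - (y - k - e) by lra.
  have h2 : 0 < (y + v - u) + (y - k - e) by lra.
  by have := mulr_gt0 h1 h2; rewrite -subr_sqr subr_gt0 ltNge hs.
by split; lra.
Qed.

Lemma box_below i : b ord0 i < - (K ord0 i + eps ord0 i) ->
  delta ord0 i = - eps ord0 i /\ gamma ord0 i = K ord0 i.
Proof.
move=> h; have [/ler_normlP[d1 d2] /ler_normlP[g1 g2]] := feas i.
have := coordinate_min (i := i) (x := - eps ord0 i) (y := K ord0 i).
rewrite normrN !ger0_norm ?K0 ?(ltW (eps0 i))// => /(_ (lexx _) (lexx _)).
move: (b ord0 i) (eps ord0 i) (K ord0 i) (delta ord0 i) (gamma ord0 i) h d1 d2 g1 g2.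
move=> y e k u v h d1 d2 g1 g2 hs.
have : - (y + v - u) <= - (y + k + e).
  rewrite leNgt; apply/negP => lt.
  have h1 : 0 < - (y + v - u) - - (y + k - - e) by lra.
  have h2 : 0 < - (y + v - u) + - (y + k - - e) by lra.
  by have := mulr_gt0 h1 h2; rewrite -subr_sqr !sqrrN subr_gt0 ltNge hs.
by split; lra.
Qed.

Lemma box_inside i : `|b ord0 i| <= K ord0 i + eps ord0 i ->
  delta ord0 i - gamma ord0 i = b ord0 i.
Proof.
move=> h; have s0 : 0 < K ord0 i + eps ord0 i by rewrite ltr_wpDl.
(* Sharing b_i between the two bounds in proportion to their sizes gives a feasible point with
   residual 0. *)
pose r := b ord0 i / (K ord0 i + eps ord0 i).
have r1 : `|r| <= 1 by rewrite normrM normfV (gtr0_norm s0) ler_pdivrMr// mul1r.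
have hx : `|eps ord0 i * r| <= eps ord0 i by rewrite normrM (ger0_norm (ltW (eps0 i))) ler_piMr// ltW.
have hy : `|- (K ord0 i * r)| <= K ord0 i by rewrite normrN normrM (ger0_norm (K0 i)) ler_piMr.
have := coordinate_min hx hy.
have -> : b ord0 i + - (K ord0 i * r) - eps ord0 i * r = 0.
  by rewrite /r; field; rewrite gt_eqF.
rewrite expr0n/= => hs; have : th i ^+ 2 == 0 by rewrite eq_le hs sqr_ge0.
rewrite sqrf_eq0 => /eqP e; have : b ord0 i + gamma ord0 i = delta ord0 i by apply/eqP; rewrite -subr_eq0 e.
by move=> <-; rewrite addrK.
Qed.

(** The sign of the optimal residual tells at which corner the pair sits; this produces the absolute
    values in the next two lemmas. *)
Lemma box_cases i : [\/ [/\ delta ord0 i = eps ord0 i, gamma ord0 i = - K ord0 i & 0 < th i],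
  [/\ delta ord0 i = - eps ord0 i, gamma ord0 i = K ord0 i & th i < 0] | th i = 0].
Proof.
have [h|h] := leP (`|b ord0 i|) (K ord0 i + eps ord0 i).
  by constructor 3; rewrite -(box_inside h); move: (delta _ _) (gamma _ _) => u v; ring.
move: h; rewrite lter_normr => /orP[h|h].
  by have [e1 e2] := box_above h; constructor 1; split => //; rewrite e1 e2; lra.
have h' : b ord0 i < - (K ord0 i + eps ord0 i) by lra.
by have [e1 e2] := box_below h'; constructor 2; split => //; rewrite e1 e2; lra.
Qed.

Lemma box_delta : dotv delta (b + gamma - delta) = dotv eps (absv (b + gamma - delta)).
Proof.
apply: eq_bigr => i _; rewrite !mxE.
by case: (box_cases i) => [[-> _ h]|[-> _ h]|->]; rewrite ?(gtr0_norm h) ?(ltr0_norm h) ?normr0 ?mulr0 ?mulNr ?mulrN.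
Qed.

Lemma box_gamma : dotv gamma (b + gamma - delta) = - dotv K (absv (b + gamma - delta)).
Proof.
rewrite /dotv -sumrN; apply: eq_bigr => i _; rewrite !mxE.
by case: (box_cases i) => [[_ -> h]|[_ -> h]|->]; rewrite ?(gtr0_norm h) ?(ltr0_norm h) ?normr0 ?mulr0 ?oppr0 ?mulNr ?mulrN ?opprK.
Qed.

Lemma feasible_delta v : dotv delta v <= dotv eps (absv v).
Proof.
apply: ler_sum => i _; rewrite mxE; apply: le_trans (ler_norm _) _.
by rewrite normrM ler_wpM2r//; have [] := feas i.
Qed.

Lemma feasible_gamma v : - dotv K (absv v) <= dotv gamma v.
Proof.
rewrite -sumrN; apply: ler_sum => i _; rewrite mxE lerNl; apply: le_trans (ler_norm _) _.
by rewrite normrN normrM ler_wpM2r//; have [] := feas i.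
Qed.

End box_projection.

(** * Tangent lines of the power utility *)

Section powR_concavity.
Variables (R : realType) (alpha : R).
Hypotheses (a0 : 0 < alpha) (a1 : alpha < 1).

(** After division by e^(alpha v), the bound e^z >= 1 + z is applied to both exponentials on the
    right. The linear parts add up to exactly 1, and strictness for nonzero v settles the equality
    case. *)
Lemma exp_convex v : expR (alpha * v) <= 1 + alpha * (expR v - 1) ?= iff (v == 0).
Proof.
have e1 : expR v = expR (alpha * v) * expR (v - alpha * v) by rewrite -expRD addrC subrK.
have e2 : 1 = expR (alpha * v) * expR (- (alpha * v)) by rewrite expRxMexpNx_1.
have E0 := expR_gt0 (alpha * v).
have -> : 1 + alpha * (expR v - 1) = expR (alpha * v) *
   (alpha * expR (v - alpha * v) + (1 - alpha) * expR (- (alpha * v))).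
  have h (e A B : R) : e * (alpha * A + (1 - alpha) * B) = alpha * (e * A) + (1 - alpha) * (e * B) by ring.
  by rewrite h -e1 -e2; move: (expR v) => y; ring.
have h1 := expR_ge1Dx (v - alpha * v); have h2 := expR_ge1Dx (- (alpha * v)).
have b1 : 0 < 1 - alpha by rewrite subr_gt0.
have [->|v0] := eqVneq v 0.
  by rewrite mulr0 subr0 oppr0 expR0 !mulr1 mul1r addrC subrK; split; rewrite ?eqxx.
have av : - (alpha * v) != 0 by rewrite oppr_eq0 mulf_neq0// gt_eqF.
have h3 := expR_gt1Dx av.
have lt : 1 < alpha * expR (v - alpha * v) + (1 - alpha) * expR (- (alpha * v)).
  apply: (@le_lt_trans _ _ (alpha * (1 + (v - alpha * v)) + (1 - alpha) * (1 + - (alpha * v)))).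
    by rewrite le_eqVlt; apply/orP; left; apply/eqP; ring.
  by apply: ler_ltD; [rewrite ler_wpM2l// ltW|rewrite ltr_pM2l].
have l2 := lt; rewrite -(ltr_pM2l E0) mulr1 in l2.
by split; [exact: ltW|rewrite lt_eqF].
Qed.

(** The substitution y = z e^v reduces this to [exp_convex]; [y = 0] lies outside its range and is
    treated directly. *)
Lemma powR_tangent y z : 0 <= y -> 0 < z ->
  alpha^-1 * y `^ alpha <= alpha^-1 * z `^ alpha + z `^ (alpha - 1) * (y - z) ?= iff (y == z).
Proof.
move=> y0 z0; have zE : z `^ (alpha - 1) = z `^ alpha / z.
  by rewrite powRB ?powRr1 ?(ltW z0)//; apply/implyP => _; rewrite gt_eqF.
have za : 0 < z `^ alpha by rewrite powR_gt0.
have ai : 0 < alpha^-1 by rewrite invr_gt0.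
have -> : alpha^-1 * z `^ alpha + z `^ (alpha - 1) * (y - z) =
    alpha^-1 * (z `^ alpha * (1 + alpha * (y / z - 1))).
  by rewrite zE; field; rewrite !gt_eqF.
move: y0; rewrite le_eqVlt => /predU1P[<-|y0].
  have pw0 : 0 `^ alpha = 0 by rewrite powR0// gt_eqF.
  rewrite pw0 mulr0 mul0r sub0r mulrN1; have b1 : 0 < 1 - alpha by rewrite subr_gt0.
  have p : 0 < alpha^-1 * (z `^ alpha * (1 - alpha)) by rewrite !mulr_gt0.
  by split; [exact: ltW|rewrite !lt_eqF].
have -> : y `^ alpha = z `^ alpha * expR (alpha * ln (y / z)).
  have yE : y = z * expR (ln (y / z)) by rewrite lnK ?posrE ?divr_gt0// mulrC divfK// gt_eqF.
  by rewrite {1}yE powRM ?expR_ge0 ?(ltW z0)// -expRM mulrC [ln _ * _]mulrC mulrC.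
have := exp_convex (ln (y / z)); rewrite lnK ?posrE ?divr_gt0// => -[h1 h2].
split; first by rewrite ler_pM2l// ler_pM2l.
rewrite (inj_eq (mulfI (lt0r_neq0 ai))) (inj_eq (mulfI (lt0r_neq0 za))) h2.
rewrite ln_eq0 ?divr_gt0//; apply/eqP/eqP => [e|->]; last by rewrite divff// gt_eqF.
by rewrite -(divfK (lt0r_neq0 z0) y) e mul1r.
Qed.

End powR_concavity.

(** * Behaviour at time zero and drifts of a given integrand *)

Section brownian_facts.
Context (R : realType) (disp : measure_display) (Omega : measurableType disp)
  (P : probability Omega R) (d : nat) (T : R) (W : R -> Omega -> 'rV[R]_d).
Hypothesis T0 : 0 < T.
Hypothesis bm : brownian_motion P T W.
Local Notation F := (filtration P W).
Local Notation E f := (\int[P]_w f w).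
Local Notation Fm := (Fm P W).
Local Notation mu := (@lebesgue_measure R).
Let T0' : 0 <= T := ltW T0.
Local Notation RO := (measurableTypeR R * Omega)%type.
Local Notation tl := (tl T).
Local Notation Q := (@lebesgue_measure R \x P)%E.

(* Blumenthal's zero-one law, here immediate as the filtration is not made
   right-continuous. *)
Lemma zero_one A : F 0 A -> P A = 0%E \/ P A = 1%E.
Proof.
move=> [mA [B nB h]].
have PAB : P A = P B.
  by have := symdiff_null mA (nat_meas bm T0' nB) h measurableT; rewrite !setIT.
rewrite PAB; move: B nB {h PAB}; pose G := [set B : set Omega | measurable B /\ (P B = 0%E \/ P B = 1%E)].
suff : natural_filtration W 0 `<=` G by move=> s B /s[].
apply: smallest_sub.
  split.
  - by split; [exact: measurable0|left; rewrite measure0].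
  - move=> B [mB h]; split; first by rewrite setTD; exact: measurableC.
    rewrite setTD probability_setC//; case: h => ->; [right|left].
      by rewrite sube0.
    by rewrite subee.
  - move=> B hB; have mB k : measurable (B k) by case: (hB k).
    split; first exact: bigcupT_measurable.
    have [[k hk]|hno] := pselect (exists k, P (B k) = 1%E).
      right; apply/eqP; rewrite eq_le; apply/andP; split.
        by apply: probability_le1; exact: bigcupT_measurable.
      rewrite -[leLHS]hk; apply: le_measure; rewrite ?inE//; first exact: bigcupT_measurable.
      exact: bigcup_sup.
    left; apply/eqP; rewrite eq_le measure_ge0 andbT.
    apply: le_trans (measure_sigma_subadditive _ mB _ (@subset_refl _ _)) _.
      exact: bigcupT_measurable.
    rewrite eseries0// => k _ _; case: (hB k) => _ [//|h1].
    by exfalso; apply: hno; exists k.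
move=> _ [r [i [B [/andP[r0 r1] mB ->]]]].
have -> : r = 0 by apply/eqP; rewrite eq_le r1.
have m : measurable [set w | B (W 0 w ord0 i)].
  have := bm_meas bm i (t := 0); rewrite lexx => /(_ T0') mW.
  by rewrite -[X in measurable X]setTI; exact: mW.
split => //; have [_ W0 _ _] := bm; case: W0 => N [mN N0 sN].
have PN (A' : set Omega) : measurable A' -> A' `<=` N -> P A' = 0%E.
  by move=> mA' s; exact: (subset_measure0 mA' mN s N0).
have [B0|nB0] := pselect (B 0).
  right; have : P (~` [set w | B (W 0 w ord0 i)]) = 0%E.
    apply: PN; first exact: measurableC.
    by move=> w /= hB; apply: sN => /= e; apply: hB; rewrite e mxE.
  rewrite probability_setC// => h1; apply/eqP; rewrite eq_le probability_le1//=.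
  have fP := fin_num_measure P _ m; move: h1; rewrite -(fineK fP) -EFinB => -[h1].
  by rewrite lee_fin -subr_le0 h1.
left; apply: PN => // w /= hB; apply: sN => /= e; apply: nB0.
by move: hB; rewrite e mxE.
Qed.

(** Every simple integral vanishes at time 0, hence so does the L2 limit. *)
Lemma ito_at_zero H I : ito_integral P T W H I -> {ae P, forall w, I 0 w = 0}.
Proof.
move=> [_ aI _ [S [_ S2]]]; have T00 : (0 : R) <= 0 <= T by rewrite lexx T0'.
have mI : measurable_fun [set: Omega] (I 0).
  by apply: (@Fm_meas _ _ _ P d W 0) => B mB; exact: aI.
have s0 n w : sp_integral W (S n) 0 w = 0.
  rewrite /sp_integral big1// => k _; have kn := ltn_ord k.
  have /andP[h1 _] := sp_time_itv (ltnW kn); have /andP[h2 _] := sp_time_itv kn.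
  by rewrite (min_idPr h1) (min_idPr h2) subrr dotv0.
have z : (\int[P]_w ((I 0 w) ^+ 2)%:E = 0)%E.
  have c1 : (fun _ : nat => \int[P]_w ((I 0 w) ^+ 2)%:E)%E @ \oo --> 0%E.
    have := S2 0 T00; apply: cvg_trans; apply: near_eq_cvg; apply: nearW => n.
    by apply: eq_integral => w _; rewrite s0 sub0r sqrrN.
  exact: (cvg_unique (@ereal_hausdorff R) (cvg_cst _) c1).
have [L e] := L1_fin (measurable_funX 2 mI) (fun w => sqr_ge0 (I 0 w)) z.
have := E0_ae (fun w => sqr_ge0 (I 0 w)) L; rewrite e lexx => /(_ isT); apply: filterS => w /eqP.
by rewrite sqrf_eq0 => /eqP.
Qed.

Section drift_form.
Variables (H : R -> Omega -> 'rV[R]_d) (I : R -> Omega -> R) (g : R -> 'rV[R]_d) (k : 'rV[R]_d).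
Hypothesis itoH : ito_integral P T W H I.
Hypothesis cg : contv g.
(** Covers both drifts in use: [g] = b and [k] = -eps for the wealth, [g] = 0 and [k] = K for the
    utility. *)
Let a t w := dotv (g t) (H t w) + dotv k (absv (H t w)).

Lemma Fm_drift t : 0 <= t <= T -> Fm t (a t).
Proof.
move=> tT; have [_ t1] := andP tT; have [[pH _] _ _ _] := itoH.
have hi i : Fm t (fun w => H t w ord0 i) by exact: (progressive_section bm tT (pH i)).
apply: (FmD bm) => //; apply: (Fm_sum bm) => // i; first exact: (FmZ bm).
have -> : (fun w => k ord0 i * absv (H t w) ord0 i) = (fun w => k ord0 i * `|H t w ord0 i|).
  by apply/funext => w; rewrite mxE.
by apply: (FmZ bm) => //; apply: (Fm_comp (h := fun y : R => `|y|)) => //; exact: normr_measurable.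
Qed.

Lemma drift_L2 : L2 Q (tl a).
Proof.
have hL i := ito_L2H T0 itoH i.
have e (u : RO) : \sum_i (g (clamp T u.1) ord0 i * tl (fun t w => H t w ord0 i) u +
    k ord0 i * `|tl (fun t w => H t w ord0 i) u|) = tl a u.
  case: (boolP (0 <= u.1 <= T)) => c.
    rewrite tl_in// /a /dotv -big_split/=; apply: eq_bigr => i _.
    by rewrite !tl_in// clampE// mxE.
  by rewrite tl_out// big1// => i _; rewrite !tl_out// normr0 !mulr0 addr0.
apply: (L2_eq e); apply: L2_sum => i; apply: L2D.
  have cgi : continuous (fun t => g t ord0 i) by exact: cg.
  have [B B0 hB] := @continuous_bounded _ _ 0 T cgi.
  apply: (L2_bound (M := B)) => //; last by move=> u; apply: hB; exact: clamp_itv.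
  have mD : measurable_fun [set: measurableTypeR R] (fun t => g (clamp T t) ord0 i).
    apply: continuous_measurable_fun => t.
    by apply: (continuous_comp (f := clamp T) (g := fun t => g t ord0 i)); [exact: continuous_clamp|exact: cg].
  exact: measurableT_comp mD _.
apply: L2Z; have [m1 m2] := hL i; split; first exact: measurableT_comp.
by apply: L1_eq m2 => u; rewrite real_normK// num_real.
Qed.

End drift_form.
End brownian_facts.

Lemma absvZ (R : realType) (d : nat) (k : R) (v : 'rV[R]_d) : 0 <= k -> absv (k *: v) = k *: absv v.
Proof. by move=> k0; apply/rowP => i; rewrite !mxE normrM ger0_norm. Qed.

(** * Duality for the concave power *)

Section concave_duality.
Context (disp : measure_display) (Omega : measurableType disp) (R : realType)
  (P : probability Omega R) (alpha : R).
Hypotheses (a0 : 0 < alpha) (a1 : alpha < 1).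
Local Notation E f := (\int[P]_w f w).
Variables G z y : Omega -> R.
Hypotheses (mG : measurable_fun [set: Omega] G) (my : measurable_fun [set: Omega] y).
Hypotheses (G0 : forall w, 0 < G w) (z0 : forall w, 0 < z w) (y0 : forall w, 0 <= y w).
(** The weighted marginal utility at the candidate [z]; it acts as the pricing density in the budget
    constraint. *)
Let H w := G w * z w `^ (alpha - 1).
Hypotheses (Lz : L1 P (fun w => H w * z w)) (Ly : L1 P (fun w => H w * y w)).
Hypothesis budget : E (fun w => H w * y w) <= E (fun w => H w * z w).
Let V w := G w * (alpha^-1 * y w `^ alpha).
Let U w := alpha^-1 * (H w * z w) + (H w * y w - H w * z w).

Lemma concave_tangent w : V w <= U w ?= iff (y w == z w).
Proof.
have [h1 h2] := powR_tangent a0 a1 (y0 w) (z0 w).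
have e : U w = G w * (alpha^-1 * z w `^ alpha + z w `^ (alpha - 1) * (y w - z w)).
  have -> : z w `^ alpha = z w `^ (alpha - 1) * z w.
    by rewrite -{3}(powRr1 (ltW (z0 w))) -powRD ?subrK//; apply/implyP => _; rewrite gt_eqF.
  rewrite /U /H; move: (G w) (z w) (y w) (_ `^ _) alpha^-1 => g a b c e; ring.
by rewrite e; split; [rewrite ler_pM2l|rewrite -h2 (inj_eq (mulfI (lt0r_neq0 (G0 w))))].
Qed.

(** [V] lies between 0 and the tangent [U], whose integrability comes from the two budget
    products. *)
Lemma dual_L1 : L1 P V.
Proof.
have LU : L1 P U by apply: L1D; [exact: L1Z|exact: L1B].
apply: (L1_le _ _ LU).
  apply: measurable_funM => //; apply: measurable_funM => //.
  exact: measurableT_comp (measurable_powR alpha) my.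
move=> w; rewrite ger0_norm; first by case: (concave_tangent w).
by rewrite !mulr_ge0 ?powR_ge0 ?invr_ge0// ltW.
Qed.

Lemma dual_bound : E V <= alpha^-1 * E (fun w => H w * z w).
Proof.
have LU : L1 P U by apply: L1D; [exact: L1Z|exact: L1B].
apply: le_trans (Ele dual_L1 LU _) _ => [w|]; first by case: (concave_tangent w).
rewrite ED; [|exact: L1Z|exact: L1B].
by rewrite EZ// EB// gerDl subr_le0.
Qed.

(** If the bound is attained, [U - V] is nonnegative with mean at most 0. It vanishes almost
    everywhere, and the equality case of the tangent line identifies [y]. *)
Lemma dual_unique : alpha^-1 * E (fun w => H w * z w) <= E V -> {ae P, forall w, y w = z w}.
Proof.
move=> h; have LU : L1 P U by apply: L1D; [exact: L1Z|exact: L1B].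
have : {ae P, forall w, U w - V w = 0}.
  apply: E0_ae; first by move=> w; rewrite subr_ge0; case: (concave_tangent w).
    exact: L1B LU dual_L1.
  rewrite (EB LU dual_L1) subr_le0; apply: le_trans h.
  rewrite ED; [|exact: L1Z|exact: L1B].
  by rewrite EZ// EB// gerDl subr_le0.
apply: filterS => w /eqP; rewrite subr_eq0 eq_sym.
by case: (concave_tangent w) => _ -> /eqP.
Qed.

End concave_duality.

(** * The candidate, its optimality and its uniqueness *)

Section optimal_investment.
Context (R : realType) (disp : measure_display) (Omega : measurableType disp)
  (P : probability Omega R) (d : nat) (T : R) (W : R -> Omega -> 'rV[R]_d).
Hypothesis T0 : 0 < T.
Hypothesis bm : brownian_motion P T W.
Local Notation F := (filtration P W).
Local Notation E f := (\int[P]_w f w).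
Local Notation Fm := (Fm P W).
Local Notation mu := (@lebesgue_measure R).
Local Notation Rint f a b := (\int[mu]_(x in `[a, b]) f x).
Let T0' : 0 <= T := ltW T0.
Let TT : 0 <= T <= T. Proof. by rewrite T0' lexx. Qed.
Let T00 : (0 : R) <= 0 <= T. Proof. by rewrite lexx T0'. Qed.
Local Notation tl := (tl T).
Local Notation Q := (@lebesgue_measure R \x P)%E.

Variables (alpha : R) (x : R).
Hypotheses (a0 : 0 < alpha) (a1 : alpha < 1) (x0 : 0 < x).
Variables (b : R -> 'rV[R]_d) (eps K : 'rV[R]_d).
Hypothesis data : market_data T b eps K.
Variables delta gamma : R -> 'rV[R]_d.
Hypothesis mini : minimizer T b eps K delta gamma.

Lemma contv_clamp (f : R -> 'rV[R]_d) : continuous_on T f -> contv (fun t => f (clamp T t)).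
Proof.
move=> cf i t; apply: (continuous_comp (f := fun t => f (clamp T t)) (g := fun v : 'rV[R]_d => v ord0 i)).
  exact: (continuous_on_clamp T0' cf).
exact: coord_continuous.
Qed.

(** [nu], [gam] and [theta] are clamped in time, since the data are continuous on [0, T] only. *)
Definition nu t := b (clamp T t) - delta (clamp T t).
Definition gam t := gamma (clamp T t).
Definition theta t := nu t + gam t.

Lemma contv_gam : contv gam. Proof. by case: mini => _ cg _; exact: contv_clamp. Qed.

Lemma contv_b : contv (fun t => b (clamp T t)). Proof. by case: data => cb _ _ _; exact: contv_clamp. Qed.

Lemma contv_nu : contv nu.
Proof.
case: mini => cd _ _; apply: (contvD contv_b); apply: contvN; exact: contv_clamp.
Qed.

Lemma contv_theta : contv theta. Proof. exact: contvD contv_nu contv_gam. Qed.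

Lemma thetaE t : 0 <= t <= T -> theta t = b t + gamma t - delta t.
Proof. by move=> tT; rewrite /theta /nu /gam clampE// addrAC. Qed.

Lemma nu_theta t : 0 <= t <= T -> dotv (nu t) (theta t) = dotv (b t) (theta t) - dotv eps (absv (theta t)).
Proof.
move=> tT; case: data => _ _ K0 e0; case: mini => _ _ /(_ t tT) [fe mi].
by rewrite {1}/nu clampE// dotvBl; congr (_ - _); rewrite (thetaE tT); exact: (box_delta e0 K0 fe mi).
Qed.

Lemma gam_theta t : 0 <= t <= T -> dotv (gam t) (theta t) = - dotv K (absv (theta t)).
Proof.
move=> tT; case: data => _ _ K0 e0; case: mini => _ _ /(_ t tT) [fe mi].
by rewrite {1}/gam clampE// (thetaE tT); exact: (box_gamma e0 K0 fe mi).
Qed.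

Variables Inu Igam Ith : R -> Omega -> R.
Hypotheses (wnu : wiener P T W nu Inu) (wgam : wiener P T W gam Igam) (wth : wiener P T W theta Ith).

Local Notation A := (Rint (fun t => normsq (theta t)) 0 T).
Local Notation B := (Rint (fun t => dotv (nu t) (theta t)) 0 T).
Local Notation An := (Rint (fun t => normsq (nu t)) 0 T).
Local Notation Ag := (Rint (fun t => normsq (gam t)) 0 T).
Local Notation ib := ((1 - alpha)^-1).

Let ib0 : 0 < ib. Proof. by rewrite invr_gt0 subr_gt0. Qed.
Let ibE : ib - alpha * ib = 1.
Proof. by rewrite -{1}(mul1r ib) -mulrBl mulfV// subr_eq0 gt_eqF. Qed.

(** From gam = theta - nu. It eliminates |nu|^2 - |gam|^2 when exponents are compared. *)
Lemma energy_gap : An - Ag = 2 * B - A.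
Proof.
have c1 := contv_normsq contv_nu; have c2 := contv_normsq contv_gam.
have c3 := contv_normsq contv_theta; have c4 := contv_dotv contv_nu contv_theta.
have c5 : continuous (fun t => 2 * dotv (nu t) (theta t)).
  by move=> t; apply: cvgM; [exact: cvg_cst|exact: c4].
rewrite -(RintB _ _ c1 c2) -(RintZ 2 _ _ c4) -(RintB _ _ c5 c3); apply: Rint_eq => t _.
rewrite (_ : gam t = theta t - nu t); last by rewrite /theta addrC addKr.
rewrite normsqB (dotvC (theta t)).
by move: (normsq (theta t)) (normsq (nu t)) (dotv _ _) => p q r; ring.
Qed.

Lemma gam_thetaE : Rint (fun t => dotv (gam t) (theta t)) 0 T = A - B.
Proof.
have c3 := contv_normsq contv_theta; have c4 := contv_dotv contv_nu contv_theta.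
rewrite -(RintB _ _ c3 c4); apply: Rint_eq => t _.
by rewrite /normsq -dotvBl; congr dotv; rewrite /theta addrC addKr.
Qed.

Lemma split_ae : {ae P, forall w, Ith T w = Inu T w + Igam T w}.
Proof. exact: (wiener_linear T0 bm wnu wgam wth). Qed.

Lemma AvarZ (k : R) : Avar T (fun t => k *: theta t) T = k ^+ 2 * A.
Proof.
rewrite /Avar PrimE// -RintZ; last exact: contv_normsq contv_theta.
by apply: Rint_eq => t _; exact: normsqZ.
Qed.

Let sX t := ib *: theta t.
(** The relative drift of the wealth: by [nu_theta] it is (b'theta - eps'|theta|) / (1 - alpha). *)
Let mX t := ib * dotv (nu t) (theta t).
Let wX : wiener P T W sX (fun t w => ib * Ith t w). Proof. exact: (wienerZ bm ib wth). Qed.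
Let cmX : continuous mX.
Proof. by move=> t; apply: cvgM; [exact: cvg_cst|exact: (contv_dotv contv_nu contv_theta)]. Qed.

Definition X_opt := Vexp T sX (fun t w => ib * Ith t w) mX x.
Definition pi_opt t w := X_opt t w *: sX t.

Lemma X_opt_gt0 t w : 0 < X_opt t w.
Proof. by rewrite /X_opt /Vexp /Dexp MexpE !mulr_gt0 ?expR_gt0. Qed.

(** Written with the single integral [Ith], which suits the computations; [formulaE] compares it
    with the product of powers. *)
Definition Xi w := x * expR (ib * B - ib ^+ 2 * A / 2 + ib * Ith T w).

Lemma Xi_gt0 w : 0 < Xi w. Proof. by rewrite mulr_gt0 ?expR_gt0. Qed.

Lemma X_optT w : X_opt T w = Xi w.
Proof.
rewrite /X_opt /Vexp /Dexp MexpE AvarZ /Xi -mulrA -expRD PrimE// /mX RintZ; last exact: (contv_dotv contv_nu contv_theta).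
by congr (_ * expR _); move: A B (Ith T w) => p q r; ring.
Qed.

Lemma Xi_meas : measurable_fun [set: Omega] Xi.
Proof.
rewrite (_ : Xi = X_opt T); first exact: (Fm_meas (Fm_Vexp bm mX x wX TT)).
by apply/funext => w; rewrite X_optT.
Qed.

Lemma admissible_opt : admissible P T W b eps x pi_opt X_opt.
Proof.
have cX w := @Vexp_continuous _ _ _ _ _ _ _ T0 _ _ _ x wX cmX w.
split; last by apply: (aeW P) => w t _; exact: ltW (X_opt_gt0 t w).
split.
- by move=> t B tT mB; exact: (Fm_Vexp bm mX x wX tT).
- by apply: (aeW P) => w; apply: continuous_subspaceT; exact: cX.
exists (Jexp T sX (fun t w => ib * Ith t w) mX x); first exact: (ito_exp T0 bm wX cmX).
apply: (aeW P) => w t tT; rewrite {1}/X_opt (JexpE _ _ _ _ _ tT); congr (_ + _ + _).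
apply: Rint_eq => s /andP[s0 s1].
have sT : 0 <= s <= T by rewrite s0 (le_trans s1)//; case/andP: tT.
have X0 := ltW (X_opt_gt0 s w).
rewrite /pi_opt /sX !dotvZr absvZ// absvZ ?(ltW ib0)// !dotvZr /mX nu_theta// -/(X_opt s w).
by move: (X_opt s w) (dotv (b s) _) (dotv eps _) => p q r; ring.
Qed.

(** The Lagrange multiplier of the budget constraint, that is the constant for which [dual_relation]
    holds. *)
Definition kappa := x `^ (alpha - 1) * expR (alpha * ib * A / 2).
(** The optimal utility: E[G Xi^alpha / alpha] = kappa E[N Xi] / alpha, with E[N Xi] = x. *)
Let c := alpha^-1 * kappa * x.

Lemma kappa_gt0 : 0 < kappa. Proof. by rewrite mulr_gt0 ?expR_gt0 ?powR_gt0. Qed.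

Let c_gt0 : 0 < c. Proof. by do 2![apply: mulr_gt0 => //]; [rewrite invr_gt0|exact: kappa_gt0]. Qed.

Let sY t := (alpha * ib) *: theta t.
(** The generator K'|Z| divided by Y, rewritten through [gam_theta]. *)
Let mY t := (- (alpha * ib)) * dotv (gam t) (theta t).
Let wY : wiener P T W sY (fun t w => alpha * ib * Ith t w). Proof. exact: (wienerZ bm (alpha * ib) wth). Qed.
Let cmY : continuous mY.
Proof. by move=> t; apply: cvgM; [exact: cvg_cst|exact: (contv_dotv contv_gam contv_theta)]. Qed.

Definition Y_opt := Vexp T sY (fun t w => alpha * ib * Ith t w) mY c.
Definition Z_opt t w := Y_opt t w *: sY t.

Lemma Y_opt_gt0 t w : 0 < Y_opt t w.
Proof.
rewrite /Y_opt /Vexp /Dexp MexpE; apply: mulr_gt0; last exact: expR_gt0.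
by apply: mulr_gt0; [exact: c_gt0|exact: expR_gt0].
Qed.

Lemma Y_opt0 w : Y_opt 0 w = c. Proof. exact: (Vexp0 T0 mY c wY). Qed.

Lemma XiX (r : R) w : Xi w `^ r = x `^ r * expR (r * (ib * B - ib ^+ 2 * A / 2 + ib * Ith T w)).
Proof. by rewrite /Xi powRM ?expR_ge0 ?(ltW x0)// -expRM [r * _]mulrC. Qed.

Lemma x_powR : x `^ alpha = x `^ (alpha - 1) * x.
Proof. by rewrite -{3}(powRr1 (ltW x0)) -powRD ?subrK//; apply/implyP => _; rewrite gt_eqF. Qed.

Lemma Y_optT w : Y_opt T w = alpha^-1 * Xi w `^ alpha.
Proof.
rewrite /Y_opt /Vexp /Dexp MexpE AvarZ XiX PrimE// /mY RintZ; last exact: (contv_dotv contv_gam contv_theta).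
rewrite gam_thetaE /c /kappa x_powR.
(* The exponents agree because alpha ib = ib - 1. *)
have e : alpha * ib * A / 2 + (- (alpha * ib) * (A - B) + (alpha * ib * Ith T w - (alpha * ib) ^+ 2 * A / 2)) =
    alpha * (ib * B - ib ^+ 2 * A / 2 + ib * Ith T w).
  move: A B (Ith T w) ibE => p q r; move: ib => i hi.
  have ai : alpha * i = i - 1 by rewrite -hi; ring.
  have -> : alpha * (i * q - i ^+ 2 * p / 2 + i * r) = (alpha * i) * (q - i * p / 2 + r) by ring.
  by rewrite ai; field.
rewrite -e !expRD.
by move: (expR _) (expR _) (expR _) (_ `^ _) alpha^-1 => p q r s t; ring.
Qed.

Lemma utility_opt : recursive_utility P T W K alpha (X_opt T) Y_opt Z_opt.
Proof.
have cY w := @Vexp_continuous _ _ _ _ _ _ _ T0 _ _ _ c wY cmY w.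
split.
- by move=> t D tT mD; exact: (Fm_Vexp bm mY c wY tT).
- by apply: (aeW P) => w; apply: continuous_subspaceT; exact: cY.
exists (Jexp T sY (fun t w => alpha * ib * Ith t w) mY c); first exact: (ito_exp T0 bm wY cmY).
apply: (aeW P) => w t /[dup] tT /andP[t0 t1]; rewrite X_optT -Y_optT.
have cmV : continuous (fun s => mY s * Y_opt s w).
  by move=> s; apply: cvgM; [exact: cmY|exact: cY].
have -> : Rint (fun s => dotv K (absv (Z_opt s w))) t T = Rint (fun s => mY s * Y_opt s w) t T.
  apply: Rint_eq => s /andP[s0 s1]; have sT : 0 <= s <= T by rewrite s1 (le_trans t0).
  rewrite /Z_opt /sY absvZ ?(ltW (Y_opt_gt0 _ _))// absvZ ?mulr_ge0 ?(ltW ib0) ?(ltW a0)// !dotvZr.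
  rewrite /mY gam_theta//.
  by move: (Y_opt s w) (dotv K _) => p q; ring.
rewrite {1 2}/Y_opt (JexpE _ _ _ _ w tT) (JexpE _ _ _ _ w TT) (Rint_add cmV t0 t1) -/Y_opt.
by move: (Rint (fun s => mY s * Y_opt s w) 0 t) (Rint (fun s => mY s * Y_opt s w) t T) (Jexp _ _ _ _ _ T w) (Jexp _ _ _ _ _ t w) => p q r s; ring.
Qed.

Let sN t := (-1) *: nu t.
Let wN : wiener P T W sN (fun t w => -1 * Inu t w). Proof. exact: (wienerZ bm (-1) wnu). Qed.

Definition N_opt := Mexp T sN (fun t w => -1 * Inu t w) T.
Definition Gamma_opt := Mexp T gam Igam T.
Local Notation N := N_opt.
Local Notation Gm := Gamma_opt.

Lemma Gm_gt0 w : 0 < Gm w. Proof. by rewrite /Gamma_opt MexpE expR_gt0. Qed.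

Lemma Gm_meas : measurable_fun [set: Omega] Gm.
Proof. by have [] := Mexp_L2 T0 bm wgam TT. Qed.

(** The first-order condition. As (alpha - 1) ib = -1, the stochastic integrals reduce to -Inu, and
    [energy_gap] settles the deterministic part. *)
Lemma dual_relation : {ae P, forall w, kappa * N w = Gm w * Xi w `^ (alpha - 1)}.
Proof.
apply: filterS split_ae => w sp; rewrite XiX /kappa -[LHS]mulrA [RHS]mulrCA; congr (_ * _).
rewrite /N_opt /Gamma_opt !MexpE -!expRD; congr expR.
have -> : Avar T sN T = An.
  by rewrite /Avar PrimE//; apply: Rint_eq => t _; rewrite normsqZ sqrrN expr1n mul1r.
have -> : Avar T gam T = Ag by rewrite /Avar PrimE.
rewrite sp; move: A B An Ag (Inu T w) (Igam T w) energy_gap ibE => p q n g u v eg.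
move: ib => i hi.
have -> : (alpha - 1) * (i * q - i ^+ 2 * p / 2 + i * (u + v)) = - (i - alpha * i) * (q - i * p / 2 + (u + v)) by ring.
have ai : alpha * i = i - 1 by rewrite -hi; ring.
by rewrite hi ai (_ : n = 2 * q - p + g); [field|rewrite -eg subrK].
Qed.

(** N Xi is x times the terminal value of the exponential martingale with volatility ib theta - nu:
    the drift of Xi is exactly the mixed term of the squared volatility. *)
Lemma budget_opt : L1 P (fun w => N w * Xi w) /\ E (fun w => N w * Xi w) = x.
Proof.
have [I3 w3] := wiener_exists T0 bm (contvD (contvZ (k := -1) contv_nu) (contvZ (k := ib) contv_theta)).
have [l1 e1] := Mexp_pow T0 bm w3 1 TT.
have ae3 : {ae P, forall w, x * Mexp T (fun t => (-1) *: nu t + ib *: theta t) I3 T w ^+ 1 = N w * Xi w}.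
  apply: filterS (wiener_linear T0 bm wN wX w3) => w e3.
  rewrite /N_opt /Xi !MexpE e3 expr1 [RHS]mulrCA -expRD; congr (_ * expR _).
  have -> : Avar T sN T = An.
    by rewrite /Avar PrimE//; apply: Rint_eq => t _; rewrite normsqZ sqrrN expr1n mul1r.
  have -> : Avar T (fun t => (-1) *: nu t + ib *: theta t) T = An - (2 * ib) * B + ib ^+ 2 * A.
    have c1 := contv_normsq contv_nu; have c3 := contv_normsq contv_theta.
    have c4 := contv_dotv contv_nu contv_theta.
    have c5 : continuous (fun t => (2 * ib) * dotv (nu t) (theta t)).
      by move=> t; apply: cvgM; [exact: cvg_cst|exact: c4].
    have c6 : continuous (fun t => ib ^+ 2 * normsq (theta t)).
      by move=> t; apply: cvgM; [exact: cvg_cst|exact: c3].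
    have c7 : continuous (fun t => normsq (nu t) - (2 * ib) * dotv (nu t) (theta t)).
      by move=> t; apply: cvgB; [exact: c1|exact: c5].
    rewrite /Avar PrimE// -(RintZ _ _ _ c4) -(RintZ _ _ _ c3) -(RintB _ _ c1 c5) -(RintD _ _ c7 c6).
    apply: Rint_eq => t _; rewrite normsqD !normsqZ dotvZl dotvZr sqrrN expr1n mul1r.
    by move: (normsq _) (normsq _) (dotv _ _) => p q r; ring.
  by move: A B An (Ith T w) (Inu T w) => p q n r u; field; rewrite subr_eq0 gt_eqF.
have mNX : measurable_fun [set: Omega] (fun w => N w * Xi w).
  apply: measurable_funM; first by have [] := Mexp_L2 T0 bm wN TT.
  exact: Xi_meas.
have Lx := L1Z x l1; split; first exact: L1_ae mNX ae3 Lx.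
by rewrite -(Eeq_ae (L1_meas Lx) mNX ae3) EZ// e1 expr1n subrr !mul0r expR0 mulr1.
Qed.

Lemma budget pi' X' : admissible P T W b eps x pi' X' ->
  L1 P (fun w => N w * X' T w) /\ E (fun w => N w * X' T w) <= x.
Proof.
move=> [[aX _ [I itoI XE]] _].
pose a t w := dotv (b (clamp T t)) (pi' t w) + dotv (- eps) (absv (pi' t w)).
have aF t : 0 <= t <= T -> Fm t (a t) by move=> tT; exact: (Fm_drift bm (fun t => b (clamp T t)) (- eps) itoI tT).
have aL : L2 Q (tl a) by exact: (drift_L2 T0 (- eps) itoI contv_b).
have mXT : measurable_fun [set: Omega] (X' T) by apply: (@Fm_meas _ _ _ P d W T) => D mD; exact: aX.
have VE : {ae P, forall w, X' T w = x + Rint (fun s => a s w) 0 T + I T w}.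
  apply: filterS XE => w /(_ T TT) ->; congr (_ + _ + _); apply: Rint_eq => s sT.
  by rewrite /a clampE// dotvNl.
have [l ->] := verification T0 bm wN itoI aF aL mXT VE; split => //.
rewrite gerDl; apply: Ele0 => -[t w]; case: (boolP (0 <= t <= T)) => tT; last by rewrite tl_out.
rewrite tl_in//= mulr_ge0_le0 ?Mexp_ge0// /a /sN clampE// dotvZl mulN1r /nu clampE// dotvBl dotvNl.
case: mini => _ _ /(_ t tT) [fe _]; have := feasible_delta fe (pi' t w).
by move: (dotv (b t) _) (dotv _ _) (dotv eps _) => p q r h; lra.
Qed.

Let V (xi : Omega -> R) w := alpha^-1 * xi w `^ alpha.

Lemma V_meas (xi : Omega -> R) : measurable_fun [set: Omega] xi -> measurable_fun [set: Omega] (V xi).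
Proof. by move=> m; apply: measurable_funM => //; exact: measurableT_comp (measurable_powR alpha) m. Qed.

(** The initial value of Y' is random whereas [verification] starts from a constant, so it is
    subtracted and replaced by [y]. Its integrability under the weight is recovered in
    [utility_gap]. *)
Lemma utility_bound (xi : Omega -> R) Y' Z' (y : R) : measurable_fun [set: Omega] xi ->
  recursive_utility P T W K alpha xi Y' Z' ->
  L1 P (fun w => Gm w * (V xi w - Y' 0 w + y)) /\ y <= E (fun w => Gm w * (V xi w - Y' 0 w + y)).
Proof.
move=> mxi [aY _ [I itoI YE]]; have mV := V_meas mxi.
have mY0 : measurable_fun [set: Omega] (Y' 0) by apply: (@Fm_meas _ _ _ P d W 0) => D mD; exact: aY.
pose a t w := dotv (0 : 'rV[R]_d) (Z' t w) + dotv K (absv (Z' t w)).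
have aF t : 0 <= t <= T -> Fm t (a t) by move=> tT; exact: (Fm_drift bm (fun=> 0) K itoI tT).
have aL : L2 Q (tl a) by apply: (drift_L2 (g := fun=> 0) T0 K itoI); exact: contv_cst.
have mV'' : measurable_fun [set: Omega] (fun w => V xi w - Y' 0 w + y).
  by apply: measurable_funD => //; exact: measurable_funB.
have VE : {ae P, forall w, V xi w - Y' 0 w + y = y + Rint (fun s => a s w) 0 T + I T w}.
  apply: filterS2 (ito_at_zero T0 itoI) YE => w i0 /(_ 0 T00) ->; rewrite i0.
  have -> : Rint (fun s => a s w) 0 T = Rint (fun s => dotv K (absv (Z' s w))) 0 T.
    by apply: Rint_eq => s _; rewrite /a dot0v add0r.
  have h (p q r s : R) : p - (p - q - (r - 0)) + s = s + q + r by ring.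
  exact: h.
have [l ->] := verification T0 bm wgam itoI aF aL mV'' VE; split => //.
rewrite lerDl; apply: Ege0 => -[t w]; case: (boolP (0 <= t <= T)) => tT; last by rewrite tl_out.
rewrite tl_in//= mulr_ge0 ?Mexp_ge0// /a dot0v add0r /gam clampE//.
case: mini => _ _ /(_ t tT) [fe _]; have := feasible_gamma fe (Z' t w).
by rewrite lerNl -subr_ge0 opprK addrC.
Qed.

Lemma candidate pi' X' : admissible P T W b eps x pi' X' ->
  [/\ L1 P (fun w => Gm w * V (X' T) w), E (fun w => Gm w * V (X' T) w) <= c &
    c <= E (fun w => Gm w * V (X' T) w) -> {ae P, forall w, X' T w = Xi w}].
Proof.
move=> adm; have [lN eN] := budget adm; have [lXi eXi] := budget_opt.
have [[aX _ _] X0] := adm.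
have mXT : measurable_fun [set: Omega] (X' T) by apply: (@Fm_meas _ _ _ P d W T) => D mD; exact: aX.
(* The wealth is nonnegative almost surely only, while the duality bounds ask for it pointwise. *)
pose y w := Num.max 0 (X' T w).
have my : measurable_fun [set: Omega] y by apply: measurable_maxr => //; exact: measurable_cst.
have yX : {ae P, forall w, y w = X' T w}.
  by apply: filterS X0 => w /(_ T TT) h; rewrite /y max_r.
have y0 w : 0 <= y w by rewrite /y le_max lexx.
have mXi := Xi_meas.
have mH : measurable_fun [set: Omega] (fun w => Gm w * Xi w `^ (alpha - 1)).
  by apply: measurable_funM; [exact: Gm_meas|exact: measurableT_comp (measurable_powR _) mXi].
have hz : {ae P, forall w, kappa * (N w * Xi w) = Gm w * Xi w `^ (alpha - 1) * Xi w}.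
  by apply: filterS dual_relation => w <-; rewrite mulrA.
have hy : {ae P, forall w, kappa * (N w * X' T w) = Gm w * Xi w `^ (alpha - 1) * y w}.
  by apply: filterS2 dual_relation yX => w <- ->; rewrite mulrA.
have mz : measurable_fun [set: Omega] (fun w => Gm w * Xi w `^ (alpha - 1) * Xi w) by exact: measurable_funM.
have mHy : measurable_fun [set: Omega] (fun w => Gm w * Xi w `^ (alpha - 1) * y w) by exact: measurable_funM.
have kz := L1Z kappa lXi; have ky := L1Z kappa lN.
have Lz := L1_ae mz hz kz; have Ly := L1_ae mHy hy ky.
have Ez : E (fun w => Gm w * Xi w `^ (alpha - 1) * Xi w) = kappa * x.
  by rewrite -(Eeq_ae (L1_meas kz) mz hz) EZ// eXi.
have le : E (fun w => Gm w * Xi w `^ (alpha - 1) * y w) <= E (fun w => Gm w * Xi w `^ (alpha - 1) * Xi w).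
  by rewrite Ez -(Eeq_ae (L1_meas ky) mHy hy) EZ// ler_wpM2l// ltW// kappa_gt0.
have mV1 : measurable_fun [set: Omega] (fun w => Gm w * V y w) by apply: measurable_funM; [exact: Gm_meas|exact: V_meas].
have mV2 : measurable_fun [set: Omega] (fun w => Gm w * V (X' T) w) by apply: measurable_funM; [exact: Gm_meas|exact: V_meas].
have VV : {ae P, forall w, Gm w * V y w = Gm w * V (X' T) w} by apply: filterS yX => w e; rewrite /V e.
have l1 := dual_L1 a0 a1 Gm_meas my Gm_gt0 Xi_gt0 y0 Lz Ly.
have l2 := dual_bound a0 a1 Gm_meas my Gm_gt0 Xi_gt0 y0 Lz Ly le.
have l3 := dual_unique a0 a1 Gm_meas my Gm_gt0 Xi_gt0 y0 Lz Ly le.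
rewrite Ez mulrA -/c in l2 l3.
split; first exact: L1_ae mV2 VV l1.
  by rewrite -(Eeq_ae mV1 mV2 VV).
by rewrite -(Eeq_ae mV1 mV2 VV) => /l3; apply: filterS2 yX => w ->.
Qed.

Lemma utility_gap pi' X' Y' Z' : admissible P T W b eps x pi' X' ->
  recursive_utility P T W K alpha (X' T) Y' Z' ->
  L1 P (fun w => Gm w * (Y' 0 w - c)) /\
  E (fun w => Gm w * (Y' 0 w - c)) <= E (fun w => Gm w * V (X' T) w) - c.
Proof.
move=> adm ut; have [l1 _ _] := candidate adm; have [[aX _ _] _] := adm.
have mXT : measurable_fun [set: Omega] (X' T) by apply: (@Fm_meas _ _ _ P d W T) => D mD; exact: aX.
have [l2 e2] := utility_bound c mXT ut.
have e w : Gm w * V (X' T) w - Gm w * (V (X' T) w - Y' 0 w + c) = Gm w * (Y' 0 w - c).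
  by move: (Gm w) (V _ _) (Y' 0 w) => p q r; ring.
split; first exact: L1_eq e (L1B l1 l2).
by rewrite -(Eeq _ e) EB// lerD2l lerN2.
Qed.

(** The event that Y' exceeds [c] at time 0 has probability 0 or 1; in the second case an almost
    surely positive variable would have mean at most 0. *)
Lemma utility_le pi' X' Y' Z' : admissible P T W b eps x pi' X' ->
  recursive_utility P T W K alpha (X' T) Y' Z' -> {ae P, forall w, Y' 0 w <= c}.
Proof.
move=> adm ut; have [l e] := utility_gap adm ut; have [_ le _] := candidate adm.
have [aY _ _] := ut.
pose D := Y' 0 @^-1` `]c, +oo[%classic.
have FD : F 0 D by apply: aY.
have mD : measurable D by case: FD.
have DE w : D w = (c < Y' 0 w) :> Prop by rewrite /D /= in_itv/= andbT.
have [PD|PD] := zero_one T0 bm FD.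
  by exists D; split => // w /= h; rewrite DE ltNge; exact/negP.
exfalso; pose h w := Gm w * (Y' 0 w - c).
have hh : {ae P, forall w, `|h w| = h w}.
  exists (~` D); split; first exact: measurableC.
    by rewrite probability_setC// PD subee.
  move=> w /= nh; rewrite DE => lt; apply: nh; rewrite ger0_norm// mulr_ge0 ?(ltW (Gm_gt0 w))//.
  by rewrite subr_ge0 ltW.
have ln := L1_norm l.
have : {ae P, forall w, `|h w| = 0}.
  apply: E0_ae => //; rewrite (Eeq_ae (L1_meas ln) (L1_meas l) hh).
  by apply: le_trans e _; rewrite subr_le0.
move=> [B [mB PB sB]].
have : P D = 0%E.
  apply: (subset_measure0 mD mB _ PB) => w; rewrite DE => lt; apply: sB => /= /eqP.
  by rewrite normr_eq0 /h gt_eqF// mulr_gt0 ?Gm_gt0// subr_gt0.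
by rewrite PD => /eqP; rewrite onee_eq0.
Qed.

Lemma utility_unique pi' X' Y' Z' : admissible P T W b eps x pi' X' ->
  recursive_utility P T W K alpha (X' T) Y' Z' -> {ae P, forall w, c <= Y' 0 w} ->
  {ae P, forall w, X' T w = Xi w}.
Proof.
move=> adm ut cY; have [l e] := utility_gap adm ut; have [_ _] := candidate adm; apply.
rewrite -subr_ge0; apply: le_trans e.
have ln := L1_norm l.
rewrite -(Eeq_ae (L1_meas ln) (L1_meas l)); first by apply: Ege0 => w.
apply: filterS cY => w h; rewrite ger0_norm// mulr_ge0 ?(ltW (Gm_gt0 w))//.
by rewrite subr_ge0.
Qed.

(** Comparison with the candidate shows that an optimal initial utility is at least [c], and
    [utility_unique] then forces the terminal wealth. *)
Lemma optimalP (xi : Omega -> R) :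
  optimal_terminal_wealth P T W b eps K alpha x xi <-> {ae P, forall w, xi w = Xi w}.
Proof.
split=> [[p [X' [Y' [Z' [adm xiE ut opt]]]]]|xiE].
  have := opt _ _ _ _ admissible_opt utility_opt => cY.
  have cY' : {ae P, forall w, c <= Y' 0 w} by apply: filterS cY => w; rewrite Y_opt0.
  by apply: filterS2 xiE (utility_unique adm ut cY') => w ->.
exists pi_opt, X_opt, Y_opt, Z_opt; split.
- exact: admissible_opt.
- by apply: filterS xiE => w ->; rewrite X_optT.
- exact: utility_opt.
move=> p X' Y' Z' adm ut; apply: filterS (utility_le adm ut) => w; by rewrite Y_opt0.
Qed.

Lemma formulaE w : Ith T w = Inu T w + Igam T w ->
  x * expR (- (alpha / (2 * (1 - alpha) ^+ 2) * A)) *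
    expR (- (2^-1 * An) - Inu T w) `^ (alpha - 1)^-1 * expR (- (2^-1 * Ag) + Igam T w) `^ ib = Xi w.
Proof.
move=> sp; rewrite -!expRM -!(mulrA x) -!expRD /Xi; congr (_ * expR _).
have -> : (alpha - 1)^-1 = - ib by rewrite -invrN opprB.
have -> : alpha / (2 * (1 - alpha) ^+ 2) = (alpha * ib) * ib / 2.
  by field; rewrite subr_eq0 gt_eqF.
rewrite sp; move: A B An Ag (Inu T w) (Igam T w) energy_gap ibE => p q n g u v eg.
move: ib => i hi; have ai : alpha * i = i - 1 by rewrite -hi; ring.
rewrite ai; have -> : n = 2 * q - p + g by rewrite -eg subrK.
by field.
Qed.

Lemma wealth_formulaP (xi : Omega -> R) :
  wealth_formula P T W b alpha x delta gamma xi <-> {ae P, forall w, xi w = Xi w}.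
Proof.
have eA : Rint (fun r => normsq (b r + gamma r - delta r)) 0 T = A.
  by apply: Rint_eq => t tT; rewrite thetaE.
have nuE t : 0 <= t <= T -> b t - delta t = nu t by move=> tT; rewrite /nu clampE.
have gamE t : 0 <= t <= T -> gamma t = gam t by move=> tT; rewrite /gam clampE.
have eN : Rint (fun r => normsq (b r - delta r)) 0 T = An.
  by apply: Rint_eq => t tT; rewrite nuE.
have eG : Rint (fun r => normsq (gamma r)) 0 T = Ag.
  by apply: Rint_eq => t tT; rewrite gamE.
rewrite /wealth_formula eA; split=> [[n [g [[I1 i1 nE] [I2 i2 gE] xiE]]]|xiE].
  have u1 := ito_unique T0 bm wnu (fun t (w : Omega) tT => nuE t tT) i1.
  have u2 := ito_unique T0 bm wgam (fun t (w : Omega) tT => gamE t tT) i2.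
  apply: filterS2 (filterI xiE split_ae) (filterI (filterI nE u1) (filterI gE u2)).
  move=> w [-> sp] [[-> ->] [-> ->]]; rewrite eN eG; exact: formulaE.
exists (fun w => expR (- (2^-1 * An) - Inu T w)), (fun w => expR (- (2^-1 * Ag) + Igam T w)); split.
- exists Inu; last by apply: (aeW P) => w; rewrite eN.
  by apply: (ito_wiener T0 bm wnu) => t w tT; exact: nuE.
- exists Igam; last by apply: (aeW P) => w; rewrite eG.
  by apply: (ito_wiener T0 bm wgam) => t w tT; exact: gamE.
by apply: filterS2 xiE split_ae => w -> sp; rewrite formulaE.
Qed.

End optimal_investment.

Theorem proposition4p6 (R : realType) (disp : measure_display)
    (Omega : measurableType disp) (P : probability Omega R)
    (d : nat) (d_gt0 : (0 < d)%N) (T : R) (T_gt0 : 0 < T)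
    (W : R -> Omega -> 'rV[R]_d) (W_bm : brownian_motion P T W)
    (alpha : R) (alpha_gt0 : 0 < alpha) (alpha_lt1 : alpha < 1)
    (x : R) (x_gt0 : 0 < x)
    (b : R -> 'rV[R]_d) (eps K : 'rV[R]_d) (data : market_data T b eps K) :
  (* the minimizing pair may fail to be unique *)
  (exists (b0 : R -> 'rV[R]_d) (eps0 K0 : 'rV[R]_d)
      (delta1 gamma1 delta2 gamma2 : R -> 'rV[R]_d),
    [/\ market_data T b0 eps0 K0,
        minimizer T b0 eps0 K0 delta1 gamma1,
        minimizer T b0 eps0 K0 delta2 gamma2 &
        exists2 t : R, 0 <= t <= T & (delta1 t, gamma1 t) <> (delta2 t, gamma2 t)])
  /\
  (forall delta gamma : R -> 'rV[R]_d, minimizer T b eps K delta gamma ->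
    (* the formula defines the optimal terminal wealth *)
    ((exists xi : {RV P >-> R}, wealth_formula P T W b alpha x delta gamma xi) /\
     (forall xi : {RV P >-> R},
        wealth_formula P T W b alpha x delta gamma xi <->
        optimal_terminal_wealth P T W b eps K alpha x xi)) /\
    (* which does not depend on the minimizing pair *)
    (forall delta' gamma' : R -> 'rV[R]_d, minimizer T b eps K delta' gamma' ->
      forall xi xi' : {RV P >-> R},
        wealth_formula P T W b alpha x delta gamma xi ->
        wealth_formula P T W b alpha x delta' gamma' xi' ->
        {ae P, forall w, xi w = xi' w}) /\
    (forall (t : R) (i : 'I_d), 0 <= t <= T ->
      [/\ K ord0 i + eps ord0 i < b t ord0 i ->
            delta t ord0 i = eps ord0 i /\ gamma t ord0 i = - K ord0 i,
          b t ord0 i < - (K ord0 i + eps ord0 i) ->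
            delta t ord0 i = - eps ord0 i /\ gamma t ord0 i = K ord0 i &
          `|b t ord0 i| <= K ord0 i + eps ord0 i ->
            delta t ord0 i - gamma t ord0 i = b t ord0 i])).
Proof.
have T0' : 0 <= T := ltW T_gt0.
have xi_ae delta gamma : minimizer T b eps K delta gamma -> exists Xi : Omega -> R,
    [/\ measurable_fun [set: Omega] Xi,
        forall xi, wealth_formula P T W b alpha x delta gamma xi <-> {ae P, forall w, xi w = Xi w} &
        forall xi, optimal_terminal_wealth P T W b eps K alpha x xi <-> {ae P, forall w, xi w = Xi w}].
  move=> mini.
  have [Inu wnu] := wiener_exists T_gt0 W_bm (contv_nu T_gt0 data mini).
  have [Igam wgam] := wiener_exists T_gt0 W_bm (contv_gam T_gt0 mini).
  have [Ith wth] := wiener_exists T_gt0 W_bm (contv_theta T_gt0 data mini).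
  exists (Xi T alpha x b delta gamma Ith); split.
  - exact: (Xi_meas T_gt0 W_bm alpha x data mini wth).
  - move=> xi; exact: (wealth_formulaP T_gt0 W_bm x alpha_lt1 data mini wnu wgam wth).
  - move=> xi; exact: (optimalP T_gt0 W_bm alpha_gt0 alpha_lt1 x_gt0 data mini wnu wgam wth).
split; last first.
  move=> delta gamma mini; have [Z [mZ fZ oZ]] := xi_ae _ _ mini.
  split; [|split].
  - split; last by move=> xi; split => [/fZ/oZ|/oZ/fZ].
    by exists (mfun_Sub (mem_set mZ)); apply/fZ; apply: (aeW P) => w.
  - move=> delta' gamma' mini' xi xi' /fZ h; have [Z' [_ fZ' oZ']] := xi_ae _ _ mini'.
    by move=> /fZ'/oZ'/oZ; apply: filterS2 h => w -> ->.
  - move=> t i tT; have [_ _ K0 e0] := data; have [_ _ /(_ t tT) [fe mi]] := mini; split.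
    + exact: (box_above e0 K0 fe mi).
    + exact: (box_below e0 K0 fe mi).
    + exact: (box_inside e0 K0 fe mi).
(* With b = 0 and unit bounds, every constant feasible pair with delta = gamma has distance 0. The
   pairs of zeros and of ones differ because the dimension is positive. *)
pose one : 'rV[R]_d := const_mx 1.
have c0 (v : 'rV[R]_d) : continuous_on T (fun=> v) by apply: continuous_subspaceT => t; exact: cvg_cst.
have min0 (v : 'rV[R]_d) : (forall i, `|v ord0 i| <= 1) -> minimizer T (fun=> 0) one one (fun=> v) (fun=> v).
  move=> v1; split; [exact: c0|exact: c0|move=> t _; split].
    by move=> i; rewrite !mxE.
  by move=> d' g' _; rewrite add0r subrr normsq0 normsq_ge0.
exists (fun=> 0), one, one, (fun=> 0), (fun=> 0), (fun=> one), (fun=> one); split.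
- split; [exact: c0| |by move=> i; rewrite mxE|by move=> i; rewrite mxE].
  by exists 0 => t i _; rewrite mxE normr0.
- by apply: min0 => i; rewrite mxE normr0.
- by apply: min0 => i; rewrite mxE normr1.
exists 0; first by rewrite lexx T0'.
move=> [] /rowP /(_ (Ordinal d_gt0)); rewrite !mxE => /esym /eqP.
by rewrite oner_eq0.
Qed.
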